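(* There are constants $K_0<\infty$ and $C<\infty$ (depending only on $L$ and $\psi$) such that for all integers $K\ge K_0$ and $M\ge1$, with $N=KM$, and all $\zeta\in L^2(\mathbb T)$, $$\left|\nabla\bar H(P\zeta)-\nabla\mathcal H(\zeta)\right|_{L^2}\;\le\;C\left[\left(\frac1K+\frac1M\right)\big(|\zeta|_{L^2}+|\zeta|_{H^1}\big)+\frac1K\right].$$
   Context: Fix an integer $L\ge 0$. Let $\psi(z)=\tfrac12 z^2+az+\delta\psi(z)$ on $\mathbb R$, where $\delta\psi\in C^2(\mathbb R)$ with $\sup|\delta\psi|<\infty$ and $\sup|\delta\psi''|<\infty$, and $a\in\mathbb R$ is chosen such that $\int_{\mathbb R} z e^{-\psi(z)}dz=0$. Let $\psi^*(\sigma)=\ln\int_{\mathbb R}e^{\sigma z-\psi(z)}dz$ and $\varphi(m)=\sup_{\sigma\in\mathbb R}\{\sigma m-\psi^*(\sigma)\}$. Let $\mathbb T=\mathbb R/\mathbb Z$ and $N=KM$. Let $X_N=\mathbb R^N$, identified with the space of step functions on $\mathbb T$ constant on each $[\frac{j-1}{N},\frac jN)$, via $x(\theta)=x_j$ for $\theta\in[\frac{j-1}N,\frac jN)$. Let $H(x)=\sum_{n=1}^N\psi(x_n)$. Spline space: for $L\ge1$, $Y_M$ is the set of $y\in C^{L-1}(\mathbb T)$ whose restriction to each $(\frac{m-1}M,\frac mM)$, $m=1,\dots,M$, is a polynomial of degree $\le L$; for $L=0$, $Y_M$ is the set of $y\in L^2(\mathbb T)$ constant on each $(\frac{m-1}M,\frac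 mM)$. $Y_M$ carries the $L^2(\mathbb T)$ inner product and $P:L^2(\mathbb T)\to Y_M$ is the $L^2$-orthogonal projection; it is assumed that $K$ is large enough for $P|_{X_N}:X_N\to Y_M$ to be surjective. Coarse-grained Hamiltonian: $\bar H:Y_M\to\mathbb R$, $\bar H(y)=-\frac1N\ln\int_{\{x\in X_N:Px=y\}}e^{-H(x)}dx$ ($dx$ the Hausdorff measure on the affine fiber); $\nabla\bar H(y)\in Y_M\subset L^2(\mathbb T)$ is its gradient with respect to the $L^2$ inner product. Macroscopic free energy: $\mathcal H(\zeta)=\int_{\mathbb T}\varphi(\zeta(\theta))d\theta$ on $L^2(\mathbb T)$, with $L^2$-gradient $\nabla\mathcal H(\zeta)=\varphi'\circ\zeta$. $|\zeta|_{H^1}=|\zeta'|_{L^2}$ is the homogeneous $H^1$ norm, equal to $+\infty$ if $\zeta\notin H^1(\mathbb T)$. *)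

(* Defs.v *)
From HB Require Import structures.
From mathcomp Require Import all_boot all_order all_algebra.
From mathcomp Require Import all_classical all_reals all_analysis.

Set Implicit Arguments.
Unset Strict Implicit.
Unset Printing Implicit Defensive.
Import Order.TTheory GRing.Theory Num.Theory.
Import numFieldNormedType.Exports.
Local Open Scope classical_set_scope.
Local Open Scope ring_scope.

Definition Ck {R : realType} (k : nat) (f : R -> R) : Prop :=
  (forall j, (j < k)%N -> forall t, derivable (derive1n j f) t 1) /\
  continuous (derive1n k f).

Definition potential {R : realType} (a : R) (dpsi : R -> R) (z : R) : R :=
  z ^+ 2 / 2 + a * z + dpsi z.

Definition log_mgf {R : realType} (psi : R -> R) (s : R) : R :=
  ln (\int[lebesgue_measure]_z expR (s * z - psi z)).

Definition cramer {R : realType} (psi : R -> R) (m : R) : R :=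
  sup (range (fun s => s * m - log_mgf psi s)).

(* Functions on R/Z are 1-periodic functions on R; integration over R/Z is
   integration over the fundamental domain [0, 1[. *)
Definition circle_measure (R : realType) :
    {measure set (measurableTypeR R) -> \bar R} :=
  mrestr (@lebesgue_measure R) (measurable_itv `[0, 1[).

Definition L2circle {R : realType} : set (R -> R) :=
  [set f | periodic f 1 /\ f \in Lfun (circle_measure R) 2%:E].

Definition L2norm {R : realType} (f : R -> R) : \bar R :=
  'N[circle_measure R]_2%:E[EFin \o f]%E.

Definition L2dot {R : realType} (f g : R -> R) : R :=
  \int[circle_measure R]_t (f t * g t).

Definition weak_derivative {R : realType} (f g : R -> R) : Prop :=
  L2circle g /\
  forall eta : R -> R, periodic eta 1 -> (forall k, Ck k eta) ->
    L2dot f (derive1 eta) = - L2dot g eta.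

(* Weak derivatives agree almost everywhere, so this is |f'|_{L^2} when f has
   one in L^2; otherwise it is the infimum of the empty set, +oo. *)
Definition H1norm {R : realType} (f : R -> R) : \bar R :=
  ereal_inf [set L2norm g | g in weak_derivative f].

(* The step function with value x_j on [(j-1)/N, j/N) (here j starts at 0). *)
Definition step {R : realType} (N : nat) (x : 'rV[R]_N) (t : R) : R :=
  \sum_(j < N) x 0 j *
    \1_(`[j%:R / N%:R, j.+1%:R / N%:R[) (t - (Num.floor t)%:~R).

Definition spline {R : realType} (L M : nat) : set (R -> R) :=
  [set y | [/\ periodic y 1,
     forall m, (m < M)%N -> exists2 p : {poly R}, (size p <= L.+1)%N &
       forall t, t \in `]m%:R / M%:R, m.+1%:R / M%:R[ -> y t = p.[t] &
     if L is l.+1 then Ck l y else L2circle y]].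

(* Orthogonal projection onto the splines. It is determined up to equality
   almost everywhere (for L = 0 the values at the knots are arbitrary). *)
Definition spline_proj {R : realType} (L M : nat) (f : R -> R) : R -> R :=
  xget (cst 0) [set y | spline L M y /\
    forall v, spline L M v -> L2dot (f \- y) v = 0].

Definition spline_fiber {R : realType} (L M N : nat) (y : R -> R) :
    set 'rV[R]_N :=
  [set x | spline_proj L M (step x) = y %[ae circle_measure R]].

(* The norm of 'rV[R]_n in the library is the sup norm. *)
Definition euclidean_dist {R : realType} (n : nat) (x y : 'rV[R]_n) : R :=
  Num.sqrt (\sum_(i < n) (x 0 i - y 0 i) ^+ 2).

Definition diameter {R : realType} (n : nat) (A : set 'rV[R]_n) : \bar R :=
  ereal_sup [set (euclidean_dist p.1 p.2)%:E | p in A `*` A].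

Fixpoint unit_ball_volume (R : realType) (d : nat) : R :=
  match d with
  | 0 => 1
  | 1 => 2
  | (d'.+1).+1 => 2 * pi / d%:R * unit_ball_volume R d'
  end.

Lemma unit_ball_volume_ge0 (R : realType) (d : nat) :
  0 <= unit_ball_volume R d.
Proof.
suff : 0 <= unit_ball_volume R d /\ 0 <= unit_ball_volume R d.+1 by case.
elim: d => [|d [IH0 IH1]]; first by split; [exact: ler01 | exact: ler0n].
split=> //; rewrite [unit_ball_volume R d.+2]/=.
by rewrite mulr_ge0 // divr_ge0 // mulr_ge0 // pi_ge0.
Qed.

(* 'rV[R]_n with all subsets measurable, so that [mu_ext] allows arbitrary
   countable covers. *)
Definition discrete_rV (R : realType) (n : nat) : Type := 'rV[R]_n.
HB.instance Definition _ (R : realType) (n : nat) :=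
  Pointed.copy (discrete_rV R n) 'rV[R]_n.
HB.instance Definition _ (R : realType) (n : nat) :=
  @isMeasurable.Build default_measure_display (discrete_rV R n)
    discrete_measurable discrete_measurable0
    discrete_measurableC discrete_measurableU.

(* The infinite weight of sets of diameter > delta excludes them from the
   covers over which [mu_ext] takes the infimum. *)
Definition cover_weight {R : realType} (n d : nat) (delta : R)
    (A : set (discrete_rV R n)) : \bar R :=
  if `[< A = set0 >] then 0%E
  else if (diameter A <= delta%:E)%E
       then (unit_ball_volume R d * (fine (diameter A) / 2) ^+ d)%:E
       else +oo%E.

(* The d-dimensional Hausdorff outer measure, normalized to agree with the
   Lebesgue measure of R^d when n = d. *)
Definition hausdorff (R : realType) (n d : nat) (X : set 'rV[R]_n) : \bar R :=
  ereal_sup [set mu_ext (cover_weight d delta) (X : set (discrete_rV R n))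
            | delta in [set e | 0 < e]].

Lemma diameter_ge0 (R : realType) (n : nat) (A : set 'rV[R]_n) :
  A !=set0 -> (0 <= diameter A)%E.
Proof.
move=> [x Ax]; apply: le_trans (ereal_sup_ubound _); last first.
  by exists (x, x).
by rewrite lee_fin sqrtr_ge0.
Qed.

Lemma cover_weight_ge0 (R : realType) (n d : nat) (delta : R)
  (A : set (discrete_rV R n)) : (0 <= cover_weight d delta A)%E.
Proof.
rewrite /cover_weight; case: asboolP => // /eqP/set0P A0.
case: ifPn => // _; rewrite lee_fin mulr_ge0 ?unit_ball_volume_ge0 //.
by rewrite exprn_ge0 // divr_ge0 // fine_ge0 // diameter_ge0.
Qed.

Lemma cover_weight0 (R : realType) (n d : nat) (delta : R) :
  cover_weight d delta (set0 : set (discrete_rV R n)) = 0%E.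
Proof. by rewrite /cover_weight; case: asboolP. Qed.

Lemma hausdorff0 (R : realType) (n d : nat) : @hausdorff R n d set0 = 0%E.
Proof.
apply/eqP; rewrite eq_le; apply/andP; split.
  apply: ge_ereal_sup => _ [e _ <-].
  by rewrite mu_ext0 //; [exact: cover_weight0 | exact: cover_weight_ge0].
apply: le_trans (ereal_sup_ubound _); last by exists 1; [exact: ltr01|].
exact: mu_ext_ge0 (@cover_weight_ge0 R n d 1) _.
Qed.

Lemma hausdorff_ge0 (R : realType) (n d : nat) (X : set 'rV[R]_n) :
  (0 <= hausdorff d X)%E.
Proof.
apply: le_trans (ereal_sup_ubound _); last by exists 1; [exact: ltr01|].
exact: mu_ext_ge0 (@cover_weight_ge0 R n d 1) _.
Qed.

Lemma le_hausdorff (R : realType) (n d : nat) :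
  {homo @hausdorff R n d : A B / A `<=` B >-> (A <= B)%E}.
Proof.
move=> A B AB; apply: ge_ereal_sup => _ [e e0 <-].
apply: le_trans (ereal_sup_ubound _); last by exists e.
exact: (le_mu_ext (cover_weight d e) AB).
Qed.

Lemma hausdorff_sigma_subadditive (R : realType) (n d : nat) :
  sigma_subadditive (@hausdorff R n d).
Proof.
move=> F; apply: ge_ereal_sup => _ [e e0 <-].
apply: le_trans (mu_ext_sigma_subadditive _ _) _.
  exact: cover_weight_ge0.
apply: lee_nneseries => k _.
  by move=> _; exact: mu_ext_ge0 (@cover_weight_ge0 R n d e) _.
by apply: ereal_sup_ubound; exists e.
Qed.

HB.instance Definition _ (R : realType) (n d : nat) :=
  isOuterMeasure.Build R 'rV[R]_n (@hausdorff R n d) (@hausdorff0 R n d)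
    (@hausdorff_ge0 R n d) (@le_hausdorff R n d)
    (@hausdorff_sigma_subadditive R n d).

Definition hausdorff_outer (R : realType) (n d : nat) :
    {outer_measure set 'rV[R]_n -> \bar R} := @hausdorff R n d.

Definition hausdorff_measure (R : realType) (n d : nat) :
    {measure set (caratheodory_type (hausdorff_outer R n d)) -> \bar R} :=
  (hausdorff_outer R n d
    : set (caratheodory_type (hausdorff_outer R n d)) -> \bar R).

Definition hamiltonian {R : realType} (psi : R -> R) (N : nat)
    (x : 'rV[R]_N) : R := \sum_(n < N) psi (x 0 n).

(* The periodic splines of degree L with M knots form an M-dimensional space,
   so the fibers of a surjective projection have dimension N - M. *)
Definition coarse_hamiltonian {R : realType} (psi : R -> R) (L K M : nat)
    (y : R -> R) : R :=
  let N := (K * M)%N in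
  let A : set 'rV[R]_N := spline_fiber L M y in
  let Z := (\int[hausdorff_measure R N (N - M)]_(x in A)
              (expR (- hamiltonian psi x))%:E)%E in
  - (ln (fine Z) / N%:R).

(* Frechet gradient with respect to the L^2 inner product; only the values of
   [F] on splines matter. *)
Definition is_gradient {R : realType} (L M : nat) (F : (R -> R) -> R)
    (y g : R -> R) : Prop :=
  spline L M g /\
  forall e : R, 0 < e -> exists2 r : R, 0 < r &
    forall v, spline L M v -> (L2norm v <= r%:E)%E ->
      `|F (y \+ v) - F y - L2dot g v| <= e * fine (L2norm v).

(* L^2 gradient of the free energy zeta |-> \int cramer psi (zeta t) dt. *)
Definition macro_gradient {R : realType} (psi zeta : R -> R) : R -> R :=
  derive1 (cramer psi) \o zeta.

(* Main.v *)
Require Import Defs.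
From HB Require Import structures.
From mathcomp Require Import all_boot all_order all_algebra.
From mathcomp Require Import all_classical all_reals all_analysis.
From mathcomp Require Import measurable_realfun ring lra.
Set Implicit Arguments.
Unset Strict Implicit.
Unset Printing Implicit Defensive.
Import Order.TTheory GRing.Theory Num.Theory.
Import numFieldNormedType.Exports.
Local Open Scope classical_set_scope.
Local Open Scope ring_scope.

(* By duality, the gradient of the coarse-grained Hamiltonian at P zeta is the spline G whose
   inner products with splines are the conditional expectations of psi' over the fiber. Two
   local facts identify it up to O(1/K). First, conditioning on the B-spline averages of one
   block costs only a constant factor compared with the product of exponentially tilted one-site
   measures, by a midpoint inequality for the log-density (the one-block estimate). Second,
   Stein's equation turns the difference between a spin and the mean of its tilted law into
   psi' minus the tilt, so that mean(G) agrees with zeta against splines up to O(1/K); the fast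
   decay of the inverse of the B-spline Gram matrix keeps these errors local. Since the mean is a
   strictly monotone function of the tilt, with inverse phi', the difference G - phi'(zeta) is
   controlled by the distance of phi'(zeta) to splines, which is O(|zeta'|/M). *)

Local Notation measT := (measurable_fun setT).
Local Notation measT_comp := measurableT_comp.
Local Notation measTM := measurable_funM.
Local Notation measTD := measurable_funD.
Local Notation measTB := measurable_funB.
Local Notation emeasTM := emeasurable_funM.
Local Notation measT_EFin := measurable_EFinP.
Local Notation cts_measT := continuous_measurable_fun.

(** The site potential need not be convex, so the conditional measures are not log-concave in
    general and no spectral gap comes for free; moreover every constant must be uniform in both [K]
    and [M]. Inside a block only [L + 1] averages are constrained, so the price of conditioning does
    not depend on [K]. Across blocks, conditioning couples everything; the coupling is cut by
    weights that decay exponentially away from one block but change little from one block to the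
    next, so that they nearly commute with B-spline synthesis, while their total mass stays bounded
    in [M]. The factor [1 / K] arises because a unit vector of the spline span has squared entries
    [O(1 / K)], whereas the fluctuations of the spline part of the force are [O(1)] per block. Fiber
    integrals are handled through translation invariance and Tonelli's theorem, so that one
    disintegration lemma serves Hausdorff measures and iterated line integrals alike. Splines of
    degree 0 and weak derivatives are fixed only almost everywhere, hence the use of
    representatives: B-spline coefficients, and the primitive of the weak derivative. *)

Lemma le_of_eq d (T : porderType d) (x y : T) : x = y -> (x <= y)%O.
by move=> ->. Qed.

(** * Product sigma-algebra on row vectors *)

Definition rV_display : measure_display. exact: default_measure_display. Qed.

Section measurable_rV.
Context {R : realType} (n : nat).
Definition coor (i : 'I_n) (x : 'rV[R]_n) : measurableTypeR R := x 0 i.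

Let rV_set0 : g_sigma_preimage coor set0.
exact: sigma_algebra0. Qed.

Let rV_setC A : g_sigma_preimage coor A -> g_sigma_preimage coor (~` A).
exact: sigma_algebraC. Qed.

Let rV_bigcup (F : _^nat) : (forall i, g_sigma_preimage coor (F i)) ->
 g_sigma_preimage coor (\bigcup_i (F i)).
exact: sigma_algebra_bigcup. Qed.

HB.instance Definition _ := @isMeasurable.Build rV_display
 'rV[R]_n (g_sigma_preimage coor) rV_set0 rV_setC rV_bigcup.

Lemma meas_coor (i : 'I_n) : measurable_fun [set: 'rV[R]_n] (fun x : 'rV[R]_n => x 0 i).
move=> _ Y mY; rewrite setTI; apply: sub_sigma_algebra => /=.
rewrite -bigcup_seq/=; exists i => /=; first by rewrite mem_index_enum.
by exists Y => //; rewrite setTI.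
Qed.

Lemma meas_rVP d (T : measurableType d) (f : T -> 'rV[R]_n) :
 (forall i, measurable_fun [set: T] (fun t => f t 0 i)) ->
 measurable_fun [set: T] f.
move=> mf _ Y mY; rewrite setTI.
have : (g_sigma_preimage (fun i => coor i \o f)) `<=` measurable.
 apply: smallest_sub; first exact: sigma_algebra_measurable.
 rewrite -bigcup_seq; apply: bigcup_sub => i _.
 by move=> A [B mB <-]; exact: mf.
apply; rewrite g_sigma_preimage_comp; exists Y => //.
by rewrite setTI.
Qed.
End measurable_rV.

(** * Invariance of Lebesgue measure on the line *)

Section translation1.
Context {R : realType}.
Local Open Scope ereal_scope.
Notation mu := (@lebesgue_measure R).

Lemma lebesgue_measure_shift (s : R) (A : set R) : measurable A ->
 pushforward mu ((+%R s) : _ -> measurableTypeR R) A = mu A.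
have ms : measT ((+%R s) : measurableTypeR R -> measurableTypeR R).
 exact: measTD.
move=> mA; apply/esym/lebesgue_measure_unique => //= _ [[a b]] _ <-.
rewrite /pushforward.
rewrite (_ : _ @^-1` _ = [set` Interval (BRight (a - s)%R) (BRight (b - s)%R)])%classic; last first.
 apply/seteqP; split => x /=; rewrite !in_itv/= => /andP[h1 h2]; apply/andP; split; lra.
rewrite !lebesgue_measure_itv/=.
by rewrite !lte_fin ltrD2r; case: ifP => // _; rewrite -!EFinB; congr (_%:E); ring.
Qed.

Lemma ge0_int_shift (s : R) (f : R -> \bar R) : measT f ->
 (forall t, 0 <= f t) -> \int[mu]_t f (s + t)%R = \int[mu]_t f t.
move=> mf f0.
have mg : measT ((+%R s) : measurableTypeR R -> measurableTypeR R).
 exact: measTD.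
have := ge0_integral_pushforward mg mu measurableT mf (fun x _ => f0 x).
rewrite preimage_setT => <-.
by apply: eq_measure_integral => //= A mA AS; exact: lebesgue_measure_shift.
Qed.

Lemma ge0_int_opp (f : R -> \bar R) : measT f ->
 (forall t, 0 <= f t) -> \int[mu]_t f (- t)%R = \int[mu]_t f t.
move=> mf f0.
have mg : measT ((-%R) : measurableTypeR R -> measurableTypeR R).
 by [].
have := ge0_integral_pushforward mg mu measurableT mf (fun x _ => f0 x).
rewrite preimage_setT => <-.
by apply: eq_measure_integral => //= A mA AS; exact: lebesgue_measureN.
Qed.
End translation1.

Lemma meas_prode d (T : measurableType d) (R : realType) (I : Type) (r : seq I)
  (P : pred I) (f : I -> T -> \bar R) :
 (forall i, measT (f i)) ->
 measT (fun x => \prod_(i <- r | P i) f i x)%E.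
move=> mf; elim: r => [|i r IH]; first by under eq_fun do [rewrite big_nil]; exact: measurable_cst.
under eq_fun do rewrite big_cons.
by case: (P i) => //; exact: emeasTM.
Qed.

(** * Iterated line integrals and disintegration *)

Section dirint.
Context {R : realType} (n : nat).
Local Open Scope ereal_scope.
Notation mu := (@lebesgue_measure R).
Notation V := 'rV[R]_n.

(** For free directions this is Lebesgue measure on the affine span of [vs] through [x], up to a
    constant Jacobian. Keeping the base point as an argument makes the result a function on the
    whole space, which can be integrated again. *)
Fixpoint dirint (vs : seq V) (f : V -> \bar R) (x : V) : \bar R :=
 if vs is v :: vs' then \int[mu]_t dirint vs' f (x + t *: v)%R else f x.

Lemma dint_ge0 vs f x : (forall y, 0 <= f y) -> 0 <= dirint vs f x.
move=> f0; elim: vs x => [|v vs IH] x //=.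
by apply: integral_ge0 => t _; exact: IH.
Qed.

Lemma meas_line (v : V) :
 measT (fun p : V * R => p.1 + p.2 *: v)%R.
apply: meas_rVP => i.
under eq_fun do rewrite mxE [X in (_ + X)%R]mxE.
apply: measTD.
 exact: (measT_comp (meas_coor i)).
exact: measTM.
Qed.

Lemma meas_line1 (v x : V) :
 measT (fun t : R => x + t *: v)%R.
apply: meas_rVP => i.
under eq_fun do rewrite mxE [X in (_ + X)%R]mxE.
apply: measTD => //.
exact: measTM.
Qed.

(** The spare parameter space carries the induction through Tonelli's measurability theorem; it is
    also what allows an integral in a further variable to be exchanged with all the lines. *)
Lemma meas_dint_param d (T : measurableType d) vs (F : T * V -> \bar R) :
 measT F -> (forall p, 0 <= F p) ->
 measT (fun p => dirint vs (fun y => F (p.1, y)) p.2).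
move=> mF F0; elim: vs => [|v vs IH] /=.
 by under eq_fun do rewrite -surjective_pairing.
pose G (q : (T * V) * R) := dirint vs (fun y => F (q.1.1, y)) (q.1.2 + q.2 *: v)%R.
have mG : measT G.
 pose h (q : (T * V) * R) := (q.1.1, (q.1.2 + q.2 *: v)%R).
 have mh : measT h.
  apply: measurable_fun_pair.
   by apply: measT_comp => //; exact: measT_comp.
  apply: (measT_comp (meas_line v) (g := fun q : (T * V) * R => (q.1.2, q.2))).
  apply: measurable_fun_pair => //.
  by apply: measT_comp => //; exact: measT_comp.
 exact: (measT_comp IH mh).
have G0 q : 0 <= G q by exact: dint_ge0.
have := measurable_fun_fubini_tonelli_F (m2 := mu) G mG G0.
exact.
Qed.

Lemma meas_dint vs (f : V -> \bar R) :
 measT f -> (forall y, 0 <= f y) -> measT (dirint vs f).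
move=> mf f0.
have mF : measT (fun p : R * V => f p.2) by exact: measT_comp.
have := meas_dint_param vs mF (fun p => f0 p.2).
move=> /(fun h => measT_comp h (pair1_measurable (0%R : R))).
exact.
Qed.

Lemma meas_dint1 vs (f : V -> \bar R) x v :
 measT f -> (forall y, 0 <= f y) ->
 measT (fun t : R => dirint vs f (x + t *: v)%R).
move=> mf f0; apply: (measT_comp (meas_dint vs mf f0)).
exact: meas_line1.
Qed.

Lemma le_dint vs (f g : V -> \bar R) x : measT f ->
 measT g -> (forall y, 0 <= f y) -> (forall y, f y <= g y) ->
 dirint vs f x <= dirint vs g x.
move=> mf mg f0 fg; have g0 y : 0 <= g y by exact: le_trans (fg y).
elim: vs x => [|v vs IH] x //=.
apply: ge0_le_integral => //.
- by move=> t _; exact: dint_ge0.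
- exact: meas_dint1.
- exact: meas_dint1.
Qed.

Lemma eq_dint vs (f g : V -> \bar R) x :
 (forall y, f y = g y) -> dirint vs f x = dirint vs g x.
by move=> /funext ->. Qed.

Lemma dint_cat vs ws f x : dirint (vs ++ ws) f x = dirint vs (dirint ws f) x.
by elim: vs x => [|v vs IH] x //=; apply: eq_integral => t _; exact: IH. Qed.

Lemma dintZl vs (f : V -> \bar R) x (c : R) : (0 <= c)%R ->
 measT f -> (forall y, 0 <= f y) ->
 dirint vs (fun y => c%:E * f y) x = c%:E * dirint vs f x.
move=> c0 mf f0; elim: vs x => [|v vs IH] x //=.
under eq_integral do rewrite IH.
rewrite ge0_integralZl_EFin//; first by move=> t _; exact: dint_ge0.
exact: meas_dint1.
Qed.

Lemma dint0 vs x : dirint vs (fun=> 0) x = 0.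
elim: vs x => [|v vs IH] x //=.
by under eq_integral do rewrite IH; rewrite integral0.
Qed.

Lemma dintD vs (f g : V -> \bar R) x :
 measT f -> (forall y, 0 <= f y) ->
 measT g -> (forall y, 0 <= g y) ->
 dirint vs (fun y => f y + g y) x = dirint vs f x + dirint vs g x.
move=> mf f0 mg g0; elim: vs x => [|v vs IH] x //=.
under eq_integral do rewrite IH.
rewrite ge0_integralD//.
- by move=> t _; exact: dint_ge0.
- exact: meas_dint1.
- by move=> t _; exact: dint_ge0.
- exact: meas_dint1.
Qed.

Lemma dint_translate vs f x y :
 dirint vs (fun z => f (z + y)%R) x = dirint vs f (x + y)%R.
elim: vs x => [|v vs IH] x //=; apply: eq_integral => t _.
by rewrite IH addrAC.
Qed.

Lemma dirint_shift1 v vs (f : V -> \bar R) x (s : R) :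
 measT f -> (forall y, 0 <= f y) ->
 dirint (v :: vs) f (x + s *: v)%R = dirint (v :: vs) f x.
move=> mf f0 /=.
transitivity (\int[mu]_t dirint vs f (x + (s + t) *: v)%R).
 by apply: eq_integral => t _; rewrite scalerDl addrA.
apply: (ge0_int_shift s (f := fun t => dirint vs f (x + t *: v)%R)).
 exact: meas_dint1.
by move=> t; exact: dint_ge0.
Qed.

Lemma dirint_shift vs (f : V -> \bar R) x v (s : R) :
 measT f -> (forall y, 0 <= f y) -> v \in vs ->
 dirint vs f (x + s *: v)%R = dirint vs f x.
move=> mf f0; elim: vs x => [//|w vs IH] x.
rewrite inE => /predU1P[<-|vvs]; first exact: dirint_shift1.
by rewrite /=; apply: eq_integral => t _; rewrite addrAC IH.
Qed.

Lemma dirint_nneseries vs (F : nat -> V -> \bar R) x :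
 (forall k, measT (F k)) -> (forall k y, 0 <= F k y) ->
 dirint vs (fun y => \sum_(k <oo) F k y) x = \sum_(k <oo) dirint vs (F k) x.
move=> mF F0; elim: vs x => [|v vs IH] x //=.
under eq_integral do rewrite IH.
rewrite integral_nneseries//.
- by move=> k; exact: meas_dint1.
- by move=> k t _; exact: dint_ge0.
Qed.

Definition in_span (vs : seq V) (u : V) : Prop :=
 exists c : 'I_(size vs) -> R, (u = \sum_(i < size vs) c i *: tnth (in_tuple vs) i)%R.

(** Each direction is integrated over a whole line, and a shift along it passes through the other
    integrals. *)
Lemma dirint_span vs (f : V -> \bar R) x u :
 measT f -> (forall y, 0 <= f y) -> in_span vs u ->
 dirint vs f (x + u)%R = dirint vs f x.
move=> mf f0 [c ->]; elim/big_rec: _ => [|i w _ IH]; first by rewrite addr0.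
by rewrite addrCA addrC dirint_shift// mem_tnth.
Qed.

(** Besides invariance, commutation with one more Lebesgue integral is all that the disintegration
    asks of a functional. Integrals against sigma-finite measures and iterated line integrals both
    have it. *)
Definition tonelli_fun (J : (V -> \bar R) -> \bar R) :=
 forall F : V * R -> \bar R, measT F -> (forall p, 0 <= F p) ->
  J (fun x => \int[mu]_t F (x, t)) = \int[mu]_t J (fun x => F (x, t)).

Lemma dirint_tonelli vs x : tonelli_fun (fun f => dirint vs f x).
move=> F mF F0; elim: vs x => [//|v vs IH] x /=.
under eq_integral do rewrite IH.
pose G (p : R * R) := dirint vs (fun y => F (y, p.2)) (x + p.1 *: v)%R.
have G0 p : 0 <= G p by exact: dint_ge0.
suff mG : measT G by exact: (fubini_tonelli (m1 := mu) (m2 := mu) G mG G0).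
have mF' : measT (fun p : R * V => F (p.2, p.1)).
 exact: (measT_comp mF (measurable_swap (T1 := R) (T2 := V))).
have := meas_dint_param vs mF' (fun p => F0 (p.2, p.1)).
move=> mH; pose h (p : R * R) := (p.2, (x + p.1 *: v)%R).
have mh : measT h.
 apply: measurable_fun_pair => //.
 exact: (measT_comp (meas_line1 v x)).
exact: (measT_comp mH mh).
Qed.

Lemma integral_tonelli (m : {sigma_finite_measure set V -> \bar R}) :
 tonelli_fun (fun f => \int[m]_x f x).
by move=> F mF F0; exact: fubini_tonelli. Qed.

(** Cut-off to a fundamental domain: along a line on which [l] grows at unit speed it integrates to
    1. *)
Definition unit_ind (l : V -> R) (x : V) : \bar R := (\1_(`[0%R, 1%R[) (l x))%:E.

Lemma unit_ind_ge0 l x : 0 <= unit_ind l x.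
by rewrite /unit_ind lee_fin. Qed.

Lemma meas_unit_ind l : measT l ->
 measT (unit_ind l).
by move=> ml; apply/measT_EFin; apply: measT_comp.
Qed.

Lemma int_unit_shift (c : R) : \int[mu]_t (\1_(`[0%R, 1%R[) (c + t)%R)%:E = 1.
rewrite (ge0_int_shift c (f := fun t => (\1_(`[0%R, 1%R[) t)%:E))//.
 rewrite integral_indic// setIT; have := @lebesgue_measure_itv R `[0%R, 1%R[.
 by rewrite /= lte_fin ltr01 oppr0 adde0; exact.
by apply/measT_EFin; exact: measurable_indic.
Qed.

(* Insert [1 = \int 1_[0,1)(l x + t) dt], exchange the integrals and translate
 by [- t v]. *)
Lemma tonelli_disintegrate1 J v (l : V -> R) (f : V -> \bar R) :
 tonelli_fun J ->
 (forall g t, measT g -> (forall y, 0 <= g y) ->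
  J (fun x => g (x + t *: v)%R) = J g) ->
 measT l -> (forall x t, l (x + t *: v)%R = l x + t)%R ->
 measT f -> (forall y, 0 <= f y) ->
 J f = J (fun x => unit_ind l x * dirint [:: v] f x).
move=> JT Jinv ml lv mf f0.
have mT := meas_line v.
transitivity (J (fun x => \int[mu]_t (f x * unit_ind l (x + t *: v)%R))).
 congr J; apply: funext => x; rewrite ge0_integralZl//.
 - under eq_integral do rewrite /unit_ind lv.
  by rewrite int_unit_shift mule1.
 - by apply: (measT_comp (meas_unit_ind ml)); exact: meas_line1.
 - by move=> t _; exact: unit_ind_ge0.
rewrite (JT (fun p => f p.1 * unit_ind l (p.1 + p.2 *: v)%R)); last 2 first.
- apply: emeasTM; first exact: measT_comp.
 exact: (measT_comp (meas_unit_ind ml)).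
- by move=> p; rewrite mule_ge0// unit_ind_ge0.
transitivity (\int[mu]_t J (fun x => f (x + (- t) *: v)%R * unit_ind l x)).
 apply: eq_integral => t _ /=.
 rewrite -[RHS](Jinv _ t); first last.
 - by move=> y; rewrite mule_ge0// unit_ind_ge0.
 - apply: emeasTM; last exact: meas_unit_ind.
  apply: (measT_comp mf); apply: (measT_comp (meas_line v) (g := fun y => (y, - t)%R)).
  exact: pair2_measurable.
 by congr J; apply: funext => x; rewrite scaleNr addrK.
rewrite -(JT (fun p => f (p.1 + (- p.2) *: v)%R * unit_ind l p.1)); last 2 first.
- apply: emeasTM; last first.
  by apply: measT_comp; first exact: meas_unit_ind.
 apply: (measT_comp mf).
 apply: (measT_comp (meas_line v) (g := fun p : V * R => (p.1, - p.2)%R)).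
 apply: measurable_fun_pair => //.
 exact: measT_comp.
- by move=> p; rewrite mule_ge0// unit_ind_ge0.
congr J; apply: funext => x.
have mfx : measT (fun t : R => f (x + t *: v)%R).
 by apply: (measT_comp mf); exact: meas_line1.
rewrite /= ge0_integralZr//; last 2 first.
- exact: (measT_comp mfx).
- by rewrite unit_ind_ge0.
rewrite muleC; congr (_ * _).
by rewrite /= (ge0_int_opp (f := fun t => f (x + t *: v)%R)).
Qed.

Definition box_ind (ls : seq (V -> R)) (x : V) : \bar R := \prod_(l <- ls) unit_ind l x.

Lemma box_ind_ge0 ls x : 0 <= box_ind ls x.
by apply: prode_ge0 => l _; exact: unit_ind_ge0. Qed.

Lemma meas_box_ind ls : (forall l, l \in (ls : seq (V -> R)) -> measT l) ->
 measT (box_ind ls).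
elim: ls => [|l ls IH] H.
 by rewrite (_ : box_ind _ = cst 1)//; apply: funext => x; rewrite /box_ind big_nil.
rewrite (_ : box_ind _ = fun x => unit_ind l x * box_ind ls x); last first.
 by apply: funext => x; rewrite /box_ind big_cons.
apply: emeasTM.
 by apply: meas_unit_ind; apply: H; rewrite mem_head.
by apply: IH => k kls; apply: H; rewrite inE kls orbT.
Qed.

(** One direction at a time. The functionals [l] are dual to the directions, so the cut-offs of the
    other directions are constant along each line and leave the inner integral. *)
Lemma tonelli_disintegrate (I : eqType) (r : seq I) (v : I -> V) (l : I -> V -> R) J
  (f : V -> \bar R) :
 uniq r -> tonelli_fun J ->
 (forall i g t, measT g -> (forall y, 0 <= g y) ->
  J (fun x => g (x + t *: v i)%R) = J g) ->
 (forall i, measT (l i)) ->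
 (forall i j x t, l i (x + t *: v j)%R = l i x + t *+ (i == j))%R ->
 measT f -> (forall y, 0 <= f y) ->
 J f = J (fun x => box_ind (map l r) x * dirint (map v r) f x).
move=> ur JT Jinv ml lv mf f0.
have mb (s : seq I) : measT (box_ind (map l s)).
 by apply: meas_box_ind => k /mapP[i _ ->].
elim: r ur => [_|i r IH /= /andP[ir ur]].
 by congr J; apply: funext => x; rewrite /box_ind big_nil mul1e.
rewrite (IH ur) (tonelli_disintegrate1 (v := v i) (l := l i)) //; last 4 first.
- by move=> g t; exact: Jinv.
- by move=> x t; rewrite lv eqxx.
- by apply: emeasTM => //; exact: meas_dint.
- by move=> y; rewrite mule_ge0 ?box_ind_ge0 ?dint_ge0.
congr J; apply: funext => x /=.
under eq_integral => t _.
 rewrite (_ : box_ind _ _ = box_ind (map l r) x); first over.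
 rewrite /box_ind !big_map big_seq [RHS]big_seq; apply: eq_bigr => j jr.
 rewrite /unit_ind lv; case: eqP => [ji|_]; last by rewrite addr0.
 by rewrite -ji jr in ir.
rewrite ge0_integralZl//; last 3 first.
- exact: meas_dint1.
- by move=> t _; exact: dint_ge0.
- exact: box_ind_ge0.
by rewrite /box_ind big_cons muleA.
Qed.

Lemma dint_prod (I : eqType) (r : seq I) (v : I -> V) (l : I -> V -> R)
  (phi : I -> R -> \bar R) x :
 uniq r -> (forall i, measT (phi i)) -> (forall i t, 0 <= phi i t) ->
 (forall i, measT (l i)) ->
 (forall i j x t, l i (x + t *: v j)%R = l i x + t *+ (i == j))%R ->
 dirint (map v r) (fun y => \prod_(i <- r) phi i (l i y)) x =
 \prod_(i <- r) \int[mu]_t phi i t.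
move=> ur mphi phi0 ml lv.
(* Generalised to a part [s] of the directions: these are integrated out, and the remaining factors
   are evaluated at the base point. *)
suff H s y : {subset s <= r} -> uniq s -> dirint (map v s) (fun y => \prod_(i <- r) phi i (l i y)) y =
  \prod_(i <- s) (\int[mu]_t phi i t) * \prod_(i <- r | i \notin s) phi i (l i y).
 by rewrite H// [X in _ * X]big1_seq ?mule1// => i /andP[/negP].
have pos P z : 0 <= \prod_(i <- r | P i) phi i (l i z).
 by apply: prode_ge0 => i _; exact: phi0.
elim: s y => [|j s IH] y sr /= us.
 by rewrite [X in _ = X * _]big_nil mul1e; apply: eq_bigl => i.
case/andP: us => js us.
under eq_integral => t _.
 rewrite IH//; last by move=> i si; apply: sr; rewrite inE si orbT.
 over.
rewrite ge0_integralZl//; last 2 first.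
- apply: meas_prode => i; apply: (measT_comp (mphi i)).
 by apply: (measT_comp (ml i)); exact: meas_line1.
- by apply: prode_ge0 => i _; apply: integral_ge0 => t _; exact: phi0.
have jr : j \in r by apply: sr; rewrite mem_head.
rewrite big_cons [X in _ = X * _]muleC -muleA; congr (_ * _).
transitivity (\int[mu]_t (phi j (l j y + t)%R * \prod_(i <- r | i \notin j :: s) phi i (l i y))).
 apply: eq_integral => t _; rewrite big_mkcond (bigD1_seq j)//= js lv eqxx; congr (_ * _).
 rewrite -big_mkcondr; apply: eq_big => [i|i /andP[ij _]].
  by rewrite inE negb_or andbC.
 by rewrite lv (negbTE ij) addr0.
rewrite ge0_integralZr//; last first.
 by apply: (measT_comp (mphi j)); exact: measTD.
by rewrite (ge0_int_shift (l j y) (f := phi j)).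
Qed.
End dirint.

(** * Integration along the row space of a matrix *)

Section rows.
Context {R : realType} (d n : nat).
Implicit Type A : 'M[R]_(d, n).

Definition rows A : seq 'rV[R]_n := [seq row i A | i <- enum 'I_d].

Lemma rows_span A (c : 'rV[R]_d) : in_span (rows A) (c *m A).
have sz : size (rows A) = d by rewrite size_map size_enum_ord.
exists (fun i => c 0 (cast_ord sz i)).
rewrite mulmx_sum_row (reindex (cast_ord sz)) /=; last first.
 by exists (cast_ord (esym sz)) => i _; rewrite ?cast_ordK ?cast_ordKV.
apply: eq_bigr => i _; congr (_ *: _).
rewrite (tnth_nth 0) /= (nth_map (cast_ord sz i)) ?size_enum_ord -?[X in (_ < X)%N]sz//.
by congr (row _ _); apply: val_inj; rewrite /= nth_enum_ord // -[X in (_ < X)%N]sz.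
Qed.

Lemma dint_rows A (f : 'rV[R]_n -> \bar R) x c :
 measT f -> (forall y, 0 <= f y)%E ->
 dirint (rows A) f (x + c *m A) = dirint (rows A) f x.
by move=> mf f0; apply: dirint_span => //; exact: rows_span. Qed.

(** For a free [A] these are, on the row space, the coefficients in the rows; off it they are some
    linear extension, which is enough to cut off with. *)
Definition coords A (i : 'I_d) (x : 'rV[R]_n) : R := (x *m pinvmx A) 0 i.

Lemma meas_linear (B : 'M[R]_(n, d)) i :
 measT (fun x : 'rV[R]_n => (x *m B) 0 i).
under eq_fun do rewrite mxE.
apply: measurable_sum => j; apply: measTM => //.
exact: meas_coor.
Qed.

Lemma meas_coords A i : measT (coords A i).
exact: meas_linear. Qed.

Lemma coords_row A i j x t : row_free A ->
 coords A i (x + t *: row j A) = coords A i x + t *+ (i == j).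
move=> fA; rewrite /coords mulmxDl mxE -scalemxAl -row_mul mulmxVp//.
by rewrite [X in (_ + X)]mxE !mxE; rewrite eq_sym mulr_natr.
Qed.

Definition box A (x : 'rV[R]_n) : \bar R := box_ind [seq coords A i | i <- enum 'I_d] x.

(** Conditioning in disguise: the inner integral depends only on the coset of the row space, and
    [box A] gives every coset unit mass ([dint_box]). *)
Lemma disintegrate_rows A J f : row_free A -> tonelli_fun J ->
 (forall c g, measT g -> (forall y, 0 <= g y)%E ->
  J (fun x => g (x + c *m A)) = J g) ->
 measT f -> (forall y, 0 <= f y)%E ->
 J f = J (fun x => box A x * dirint (rows A) f x)%E.
move=> fA JT Jinv mf f0; apply: tonelli_disintegrate => //.
- exact: enum_uniq.
- move=> i g t mg g0; rewrite -(Jinv (t *: delta_mx 0 i) g mg g0).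
 by congr J; apply: funext => x; rewrite -scalemxAl rowE.
- exact: meas_coords.
- by move=> i j x t; exact: coords_row.
Qed.

Lemma dint_rows_prod A (phi : 'I_d -> R -> \bar R) x : row_free A ->
 (forall i, measT (phi i)) -> (forall i t, 0 <= phi i t)%E ->
 dirint (rows A) (fun y => \prod_(i < d) phi i (coords A i y))%E x =
 (\prod_(i < d) \int[lebesgue_measure]_t phi i t)%E.
move=> fA mphi phi0.
under eq_dint do rewrite -big_enum /=.
rewrite -big_enum /=.
apply: dint_prod => //; first exact: enum_uniq.
- exact: meas_coords.
- by move=> i j y t; exact: coords_row.
Qed.
End rows.

(** * Hausdorff measure as a metric outer measure *)

Section hausdorff_caratheodory.
Context {R : realType} (n d : nat).
Local Open Scope ereal_scope.
Notation V := 'rV[R]_n.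
Notation H := (@hausdorff R n d).

Lemma dist_coor (x y : V) k : (`|x 0 k - y 0 k| <= euclidean_dist x y)%R.
rewrite /euclidean_dist -sqrtr_sqr ler_sqrt; last first.
 by apply: sumr_ge0 => i _; exact: sqr_ge0.
rewrite (bigD1 k)//= lerDl; apply: sumr_ge0 => i _; exact: sqr_ge0.
Qed.

Lemma dist_diameter (A : set V) x y : A x -> A y ->
 (euclidean_dist x y)%:E <= diameter A.
by move=> Ax Ay; apply: ereal_sup_ubound; exists (x, y). Qed.

Lemma cover_weight_fin (delta : R) (A : set (discrete_rV R n)) x y :
 cover_weight d delta A < +oo -> A x -> A y -> (euclidean_dist x y <= delta)%R.
rewrite /cover_weight; case: asboolP => [->//|_]; case: ifPn => // Ad _ Ax Ay.
by rewrite -lee_fin; apply: le_trans Ad; exact: dist_diameter.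
Qed.

Lemma le_mu_ext_cover_weight (d1 d2 : R) (X : set V) : (d1 <= d2)%R ->
 mu_ext (cover_weight d d2) (X : set (discrete_rV R n)) <=
 mu_ext (cover_weight d d1) (X : set (discrete_rV R n)).
move=> d12; apply: le_ereal_inf_tmp => _ [F [mF XF] <-].
apply: le_trans (_ : \sum_(k <oo) cover_weight d d2 (F k) <= _).
 by apply: ereal_inf_lbound; exists F.
apply: lee_nneseries => // k _ //; first by move=> _; exact: cover_weight_ge0.
rewrite /cover_weight; case: asboolP => // _.
case: ifPn => [|h]; case: ifPn => // h2; rewrite ?leey//.
by move/negP: h => []; apply: (le_trans h2); rewrite lee_fin.
Qed.

Lemma mu_ext_le_hmeas (e : R) (X : set V) : (0 < e)%R ->
 mu_ext (cover_weight d e) (X : set (discrete_rV R n)) <= H X.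
by move=> e0; apply: ereal_sup_ubound; exists e. Qed.

(** A set of diameter at most [e] cannot meet both [A] and [B], so a cover of the union splits into
    a cover of each. *)
Lemma mu_ext_separated (e : R) (A B : set V) :
 (forall a b, A a -> B b -> (e < euclidean_dist a b)%R) ->
 mu_ext (cover_weight d e) (A : set (discrete_rV R n)) +
 mu_ext (cover_weight d e) (B : set (discrete_rV R n)) <=
 mu_ext (cover_weight d e) (A `|` B : set (discrete_rV R n)).
move=> sep; apply: le_ereal_inf_tmp => _ [F [mF ABF] <-].
have [[k Fk]|fin] := pselect (exists k, cover_weight d e (F k) = +oo).
 by rewrite (eseries_pinfty _ _ Fk)// ?leey// => i _; rewrite gt_eqF// (lt_le_trans _ (cover_weight_ge0 _ _ _)).
pose FA k := if `[< F k `&` A !=set0 >] then F k else set0.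
pose FB k := if `[< F k `&` A !=set0 >] then set0 else F k.
apply: (@le_trans _ _ (\sum_(k <oo) cover_weight d e (FA k) +
           \sum_(k <oo) cover_weight d e (FB k))).
 apply: leeD; apply: ereal_inf_lbound.
  exists FA => //; split => // x Ax; have [k _ Fkx] := ABF x (or_introl Ax).
  by exists k => //; rewrite /FA; case: asboolP => // -[]; exists x.
 exists FB => //; split => // x Bx; have [k _ Fkx] := ABF x (or_intror Bx).
 exists k => //; rewrite /FB; case: asboolP => // -[a [Fka Aa]].
 have := sep _ _ Aa Bx; rewrite ltNge => /negP; apply; apply: cover_weight_fin Fka Fkx.
 by rewrite ltey; apply: contra_notN fin => /eqP ?; exists k.
rewrite -nneseriesD; [|by move=> *; exact: cover_weight_ge0..].
apply: lee_nneseries => [k _ _|k _].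
 by rewrite adde_ge0// cover_weight_ge0.
by rewrite /FA /FB; case: asboolP => _; rewrite cover_weight0 ?addr0 ?adde0 ?add0e.
Qed.

Lemma hmeas_separated (e : R) (A B : set V) : (0 < e)%R ->
 (forall a b, A a -> B b -> (e < euclidean_dist a b)%R) ->
 H A + H B <= H (A `|` B).
move=> e0 sep.
have [->|Hfin] := eqVneq (H (A `|` B)) +oo; first by rewrite leey.
have fU : H (A `|` B) \is a fin_num by rewrite ge0_fin_numE ?hausdorff_ge0// ltey.
have fA : H A \is a fin_num.
 rewrite ge0_fin_numE ?hausdorff_ge0//; apply: le_lt_trans (_ : _ <= H (A `|` B)) _.
  by apply: le_hausdorff; exact: subsetUl.
 by rewrite ltey.
have fB : H B \is a fin_num.
 rewrite ge0_fin_numE ?hausdorff_ge0//; apply: le_lt_trans (_ : _ <= H (A `|` B)) _.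
  by apply: le_hausdorff; exact: subsetUr.
 by rewrite ltey.
rewrite -leeBrDr//; apply: ge_ereal_sup => _ [d1 /= d10 <-].
rewrite leeBrDr// addeC -leeBrDr; last first.
 rewrite ge0_fin_numE ?mu_ext_ge0//; last by move=> ?; exact: cover_weight_ge0.
 by apply: le_lt_trans (mu_ext_le_hmeas _ d10) _; rewrite -ge0_fin_numE ?hausdorff_ge0.
apply: ge_ereal_sup => _ [d2 /= d20 <-].
rewrite leeBrDr; last first.
 rewrite ge0_fin_numE ?mu_ext_ge0//; last by move=> ?; exact: cover_weight_ge0.
 by apply: le_lt_trans (mu_ext_le_hmeas _ d10) _; rewrite -ge0_fin_numE ?hausdorff_ge0.
rewrite addeC.
(* Refining the scale only increases the outer measures, so one scale below [e], [d1] and [d2]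
   serves both sets. *)
pose e' := Num.min e (Num.min d1 d2).
have e'0 : (0 < e')%R by rewrite /e' !lt_min e0 d10.
apply: le_trans (mu_ext_le_hmeas _ e'0).
apply: le_trans (mu_ext_separated (e := e') _); last first.
 by move=> a b Aa Bb; apply: le_lt_trans (sep _ _ Aa Bb); rewrite ge_min lexx.
by apply: leeD; apply: le_mu_ext_cover_weight; rewrite !ge_min lexx ?orbT.
Qed.

Lemma hausdorff_setU (A B : set V) : H (A `|` B) <= H A + H B.
exact: (outer_measureU2 (hausdorff_outer R n d)). Qed.

(* The slices [c + 1/(j+2) <= x_k < c + 1/(j+1)] of two indices apart are at
 positive distance, so the measures of all of them have a finite sum. *)
Lemma caratheodory_coor (k : 'I_n) (c : R) :
 (hausdorff_outer R n d).-caratheodory [set x : V | (x 0 k <= c)%R].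
apply: le_caratheodory_measurable => X /=.
rewrite -[X in X + _ <= _]/(H _) -[X in _ + X <= _]/(H _) -[X in _ <= X]/(H _).
set E := [set x : V | _].
have [->|Hfin] := eqVneq (H X) +oo; first by rewrite leey.
pose T j := X `&` [set x : V | (c + j.+1%:R^-1 <= x 0 k)%R].
pose S j := X `&` [set x : V | (c + j.+2%:R^-1 <= x 0 k < c + j.+1%:R^-1)%R].
have HfinX (Y : set V) : Y `<=` X -> H Y \is a fin_num.
 move=> YX; rewrite ge0_fin_numE ?hausdorff_ge0//.
 by apply: le_lt_trans (le_hausdorff _ YX) _; rewrite ltey.
have fT j : H (T j) \is a fin_num by apply: HfinX; exact: subIsetl.
have fS j : H (S j) \is a fin_num by apply: HfinX; exact: subIsetl.
have invlt (i j : nat) : (i < j)%N -> (j.+1%:R^-1 < i.+1%:R^-1 :> R)%R.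
 by move=> ij; rewrite ltf_pV2 ?posrE// ltr_nat.
have TS j : H (T j) + H (S j.+1) <= H (T j.+2).
 have : H (T j) + H (S j.+1) <= H (T j `|` S j.+1).
  apply: (@hmeas_separated ((j.+1%:R^-1 - j.+2%:R^-1) / 2)%R).
   by rewrite divr_gt0// subr_gt0 invlt.
  move=> a b [_ /= Ta] [_ /= /andP[_ Sb]].
  apply: lt_le_trans (dist_coor a b k); apply: lt_le_trans (ler_norm _).
  have := invlt j j.+1 (leqnn _).
  by move: (j.+2%:R^-1)%R (j.+1%:R^-1)%R Ta Sb => u v; lra.
 move/le_trans; apply; apply: le_hausdorff => x [[Xx /= h]|[Xx /= /andP[h _]]]; split => //=.
 by apply: le_trans h; rewrite lerD2l ltW// invlt.
have ET j : H (X `&` E) + H (T j) <= H X.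
 have : H (X `&` E) + H (T j) <= H ((X `&` E) `|` T j).
  apply: (@hmeas_separated (j.+1%:R^-1 / 2)%R).
   by rewrite divr_gt0.
  move=> a b [_ /= Ta] [_ /= Sb].
  apply: lt_le_trans (dist_coor a b k); rewrite distrC; apply: lt_le_trans (ler_norm _).
  have {}Ta : (a 0 k <= c)%R := Ta.
  have : (0 < j.+1%:R^-1 :> R)%R by [].
  by move: (j.+1%:R^-1)%R Sb => u; lra.
 by move/le_trans; apply; apply: le_hausdorff => x [[]|[]].
have sumS m : \sum_(0 <= j < m) H (S j.+1) <= H X + H X.
 have : \sum_(0 <= j < m) H (S j.+1) <= H (T m.+1) + H (T m).
  elim: m => [|m IH]; first by rewrite big_geq// adde_ge0 ?hausdorff_ge0.
  rewrite big_nat_recr//=; apply: (@le_trans _ _ (H (T m.+1) + H (T m) + H (S m.+1))).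
   by rewrite leeD2r.
  by rewrite -addeA addeC leeD2r.
 by move/le_trans; apply; apply: leeD; apply: le_hausdorff; exact: subIsetl.
have sumfin : \sum_(0 <= j <oo) H (S j) < +oo.
 rewrite (nneseries_split 0 1); last by move=> *; exact: hausdorff_ge0.
 rewrite add0n big_nat1.
 apply: lte_add_pinfty; first by rewrite -ge0_fin_numE// hausdorff_ge0.
 rewrite (_ : \sum_(1 <= k <oo) _ = \sum_(j <oo) H (S j.+1)); last first.
  rewrite -(nneseries_addn (f := fun j => H (S j)) 1).
   by apply: eq_eseriesr => j _; rewrite addn1.
  by move=> *; exact: hausdorff_ge0.
 apply: (@le_lt_trans _ _ (H X + H X)).
  apply: lime_le; first by apply: is_cvg_nneseries => *; exact: hausdorff_ge0.
  by apply: nearW => m; exact: sumS.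
 by rewrite lte_add_pinfty// ltey.
have tail j : H (X `&` ~` E) <= H (T j) + \sum_(j <= i <oo) H (S i).
 have XE : X `&` ~` E `<=` T j `|` \bigcup_i S (i + j)%N.
  move=> x [Xx /= /negP]; rewrite -ltNge => cx.
  have [h|h] := leP (c + j.+1%:R^-1)%R (x ord0 k); first by left.
  right.
  have : exists i, (c + i.+1%:R^-1 <= x 0 k)%R.
   have xc : (0 < x 0 k - c)%R by rewrite subr_gt0.
   have [i _ /=] := near_infty_natSinv_lt (PosNum xc).
   move=> /(_ i (leqnn _)) /= hi; exists i.
   by move: hi; rewrite ltrBrDl => /ltW.
  move=> /ex_minnP[[|i] hi mini].
   have := invlt 0%N j; case: (posnP j) => [j0|j0 /(_ isT)].
    by move: h; rewrite j0 => h; have := le_lt_trans hi h; rewrite ltxx.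
   by move: hi h; move: (j.+1%:R^-1)%R (1%:R^-1)%R => u v; lra.
  have ji : (j <= i)%N.
   rewrite leqNgt; apply/negP => ij.
   have : (j.+1%:R^-1 <= i.+2%:R^-1 :> R)%R by rewrite lef_pV2 ?posrE// ler_nat ltnS.
   by move: hi h; move: (j.+1%:R^-1)%R (i.+2%:R^-1)%R => u v; lra.
  exists (i - j)%N => //; rewrite subnK//; split => //=; rewrite hi/= ltNge.
  by apply/negP => /mini; rewrite ltnn.
 apply: (le_trans (le_hausdorff _ XE)); apply: (le_trans (hausdorff_setU _ _)).
 rewrite leeD2l//; apply: (le_trans (hausdorff_sigma_subadditive _ _)).
 rewrite (nneseries_addn (f := fun j => H (S j)) j)//.
 by move=> *; exact: hausdorff_ge0.
have := nneseries_tail_cvg (f := fun j => H (S j)) sumfin (fun _ _ => hausdorff_ge0 _ _).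
move=> cvg0.
have {}cvgt : (fun j => H X + \sum_(j <= i <oo) H (S i)) @ \oo --> H X + 0.
 apply: cvgeD => //; first by rewrite ge0_adde_def// inE ?hausdorff_ge0.
 exact: cvg_cst.
rewrite adde0 in cvgt; rewrite -(cvg_lim _ cvgt)//.
apply: lime_ge; first by apply/cvg_ex; exists (H X).
apply: nearW => j.
apply: (@le_trans _ _ (H (X `&` E) + (H (T j) + \sum_(j <= i <oo) H (S i)))).
 by rewrite leeD2l.
by rewrite addeA leeD2r.
Qed.
End hausdorff_caratheodory.

(** * Measurability and translation invariance of Hausdorff measure *)

Section hausdorff_measurable.
Context {R : realType} (n d : nat).
Local Open Scope ereal_scope.
Notation V := 'rV[R]_n.
Notation H := (@hausdorff R n d).
Notation HT := (caratheodory_type (hausdorff_outer R n d)).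

Lemma meas_fun_caratheodory : measurable_fun [set: HT] (id : HT -> V).
apply: meas_rVP => i.
apply: (measurability _ (RGenOInfty.measurableE R)) => //.
move=> _ [_ [a ->] <-]; rewrite setTI.
rewrite (_ : _ @^-1` _ = ~` [set x : V | (x ord0 i <= a)%R]).
 by apply: measurableC; exact: caratheodory_coor.
by apply/seteqP; split => x /=; rewrite in_itv/= andbT ltNge => /negP.
Qed.

Lemma measurable_caratheodory (A : set V) : measurable A ->
 measurable (A : set HT).
by move=> mA; have := meas_fun_caratheodory measurableT mA; rewrite setTI. Qed.

Lemma diameter_shift (v : V) (A : set V) :
 diameter [set (x + v)%R | x in A] = diameter A.
congr ereal_sup; apply/seteqP; split => z [[a b] /=].
 move=> [[x Ax <-] [y Ay <-]] <-; exists (x, y) => //=; congr EFin.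
 by rewrite /euclidean_dist; under [in RHS]eq_bigr do rewrite !mxE opprD addrACA subrr addr0.
move=> [Aa Ab] <-; exists ((a + v)%R, (b + v)%R) => /=; first by split; [exists a|exists b].
congr EFin; rewrite /euclidean_dist.
by under [in LHS]eq_bigr do rewrite !mxE opprD addrACA subrr addr0.
Qed.

Lemma hmeas_shift_le (v : V) (A : set V) : H [set (x + v)%R | x in A] <= H A.
apply: ge_ereal_sup => _ [e /= e0 <-].
apply: le_trans (mu_ext_le_hmeas _ _ e0).
apply: le_ereal_inf_tmp => _ [F [mF AF] <-].
apply: ereal_inf_lbound; exists (fun k => [set (x + v)%R | x in (F k : set V)]).
 split => // _ [x Ax <-]; have [k _ Fkx] := AF x Ax.
 by exists k => //; exists x.
apply: eq_eseriesr => k _; rewrite /cover_weight.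
have -> : ([set (x + v)%R | x in (F k : set V)] = set0) = (F k = set0).
 by rewrite propeqE; split => [/image_set0_set0//|->]; rewrite image_set0.
by rewrite !diameter_shift.
Qed.

Lemma hmeas_shift (v : V) (A : set V) : H [set (x + v)%R | x in A] = H A.
apply/eqP; rewrite eq_le hmeas_shift_le/=.
rewrite -[X in H X <= _](_ : [set (x - v)%R | x in [set (x + v)%R | x in A]] = A).
 exact: hmeas_shift_le.
apply/seteqP; split => [_ [_ [x Ax <-] <-]|x Ax]; first by rewrite addrK.
by exists (x + v)%R; [exists x|rewrite addrK].
Qed.
End hausdorff_measurable.

(** * Hausdorff measure of parallelepipeds *)

Section hausdorff_box.
Context {R : realType} (n d : nat).
Local Open Scope ereal_scope.
Notation V := 'rV[R]_n.
Notation H := (@hausdorff R n d).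
Implicit Type A : 'M[R]_(d, n).

Definition ubox A : set V :=
 [set x | exists2 c : 'rV[R]_d, x = (c *m A)%R & forall i, (0 <= c ord0 i < 1)%R].

Lemma euclidean_dist_mulmx A (c c' : 'rV[R]_d) (e : R) :
 (forall i, `|c ord0 i - c' ord0 i| <= e)%R -> (0 <= e)%R ->
 (euclidean_dist (c *m A) (c' *m A) <= e * (n%:R * \sum_i \sum_j `|A i j|))%R.
move=> ce e0; set a := (\sum_i _)%R.
have a0 : (0 <= a)%R by do 2 (apply: sumr_ge0 => ? _).
have Ha k : (`|(c *m A) ord0 k - (c' *m A) ord0 k| <= e * a)%R.
 rewrite !mxE -sumrB; apply: le_trans (ler_norm_sum _ _ _) _.
 rewrite /a mulr_sumr; apply: ler_sum => i _.
 rewrite -mulrBl normrM; apply: ler_pM => //.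
 by rewrite (bigD1 k)//= lerDl; apply: sumr_ge0.
rewrite -[leRHS]ger0_norm ?mulr_ge0// -sqrtr_sqr /euclidean_dist ler_wsqrtr//.
apply: (@le_trans _ _ (\sum_(i < n) (e * a) ^+ 2)%R).
 by apply: ler_sum => k _; rewrite -[leLHS]real_normK ?num_real// lerXn2r ?nnegrE// mulr_ge0.
have -> : (\sum_(i < n) (e * a) ^+ 2 = n%:R * (e * a) ^+ 2)%R.
 by rewrite sumr_const card_ord mulr_natl.
have -> : ((e * (n%:R * a)) ^+ 2 = n%:R ^+ 2 * (e * a) ^+ 2)%R by ring.
rewrite ler_wpM2r ?sqr_ge0//.
by rewrite -natrX ler_nat; case: (n) => // m; rewrite expnS leq_pmulr// expn_gt0.
Qed.

(** Cut into [m ^ d] cells of diameter at most [a / m], the parallelepiped has a cover of total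
    weight at most [unit_ball_volume * (a / 2) ^ d], whatever [m]. *)
Lemma hmeas_ubox_lty A : H (ubox A) < +oo.
set a := (n%:R * \sum_i \sum_j `|A i j|)%R.
have a0 : (0 <= a)%R by rewrite mulr_ge0//; do 2 (apply: sumr_ge0 => ? _).
apply: (@le_lt_trans _ _ (unit_ball_volume R d * (a / 2) ^+ d)%:E); last by rewrite ltry.
apply: ge_ereal_sup => _ [e /= e0 <-].
pose m := (Num.bound (a / e)).+1.
have m0 : (0 < m%:R :> R)%R by [].
have ame : (a / m%:R <= e)%R.
 rewrite ler_pdivrMr// -ler_pdivrMl// mulrC; apply: ltW.
 apply: lt_trans (archi_boundP _) _; first by rewrite divr_ge0// ltW.
 by rewrite ltr_nat.
pose Q (f : {ffun 'I_d -> 'I_m}) : set V := [set x | exists2 c : 'rV[R]_d, x = (c *m A)%R &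
 forall i, ((f i)%:R / m%:R <= c ord0 i < (f i).+1%:R / m%:R)%R].
pose G k : set (discrete_rV R n) :=
 if insub k is Some i then Q (enum_val (i : 'I_#|{ffun 'I_d -> 'I_m}|)) else set0.
apply: (@le_trans _ _ (\sum_(k <oo) cover_weight d e (G k))).
 apply: ereal_inf_lbound; exists G => //; split => // _ [c -> c01].
 pose f := [ffun i => (inord (Num.truncn (c ord0 i * m%:R)) : 'I_m)].
 exists (enum_rank f) => //=; rewrite /G (insubT (fun k => (k < _)%N) (ltn_ord (enum_rank f))).
 rewrite (_ : Sub _ _ = enum_rank f); last exact: val_inj.
 rewrite enum_rankK; exists c => // i; have /andP[ci0 ci1] := c01 i.
 have cm0 : (0 <= c ord0 i * m%:R)%R by rewrite mulr_ge0.
 have /andP[h1 h2] := truncn_itv cm0.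
 rewrite ffunE inordK; first by rewrite ler_pdivrMr// ltr_pdivlMr// h1 h2.
 by rewrite -(ltr_nat R); apply: le_lt_trans h1 _; rewrite gtr_pMl.
rewrite (nneseries_split 0 #|{ffun 'I_d -> 'I_m}|); last by move=> *; exact: cover_weight_ge0.
rewrite add0n eseries0 ?adde0; last first.
 move=> k hk _; rewrite /G insubF ?cover_weight0//.
 by apply/negbTE; rewrite -leqNgt.
apply: (@le_trans _ _ (\sum_(0 <= k < #|{ffun 'I_d -> 'I_m}|)
  (unit_ball_volume R d * (a / m%:R / 2) ^+ d)%:E)).
 apply: lee_sum => k _; have u0 := unit_ball_volume_ge0 R d.
 rewrite /cover_weight; case: asboolP => [_|]; first by rewrite lee_fin mulr_ge0// exprn_ge0// !divr_ge0.
 move=> /eqP/set0P Gk.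
 have dG : diameter (G k) <= (a / m%:R)%:E.
  rewrite /G; case: insubP => [i _ _|_]; last first.
   by apply: ge_ereal_sup => _ [p [[]]].
  apply: ge_ereal_sup => _ [[x y] /= [[c -> hc] [c' -> hc']] <-].
  rewrite lee_fin mulrC; apply: euclidean_dist_mulmx => // j.
  have /andP[h1 h2] := hc j; have /andP[h3 h4] := hc' j.
  move: h1 h2 h3 h4; rewrite -!natr1 !mulrDl mul1r => h1 h2 h3 h4.
  by rewrite ler_norml; apply/andP; split; lra.
 rewrite (le_trans dG) ?lee_fin// ler_wpM2l// lerXn2r// ?nnegrE ?divr_ge0//.
  by rewrite fine_ge0// diameter_ge0.
 rewrite ler_wpM2r// -lee_fin fineK// ge0_fin_numE ?diameter_ge0//.
 by apply: le_lt_trans dG _; rewrite ltry.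
rewrite sumEFin lee_fin sumr_const_nat subn0 card_ffun !card_ord.
rewrite -[leLHS]mulr_natl mulrCA ler_wpM2l ?unit_ball_volume_ge0// natrX -exprMn.
by rewrite mulrA [X in (X / 2)%R]mulrC mulfVK ?lt0r_neq0.
Qed.

Lemma unit_ball_volume_gt0 : (0 < unit_ball_volume R d)%R.
suff : (0 < unit_ball_volume R d /\ 0 < unit_ball_volume R d.+1)%R by case.
elim: d => [|k [IH0 IH1]]; first by split.
split=> //; rewrite [unit_ball_volume R k.+2]/=.
by rewrite mulr_gt0 // divr_gt0 // mulr_gt0 // pi_gt0.
Qed.

Lemma coords_mulmx A (c : 'rV[R]_d) i : row_free A -> coords A i (c *m A) = c ord0 i.
by move=> fA; rewrite /coords mulmxKp. Qed.

Lemma coords_lipschitz A : exists2 C : R, (0 < C)%R &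
 forall i x y, (`|coords A i x - coords A i y| <= C * euclidean_dist x y)%R.
exists (1 + \sum_i \sum_k `|pinvmx A k i|)%R.
 by rewrite ltr_wpDr//; do 2 (apply: sumr_ge0 => ? _).
move=> i x y; rewrite /coords !mxE -sumrB; apply: le_trans (ler_norm_sum _ _ _) _.
apply: (@le_trans _ _ (\sum_k (`|pinvmx A k i| * euclidean_dist x y))%R).
 apply: ler_sum => k _; rewrite -mulrBl normrM mulrC ler_wpM2l//.
 exact: dist_coor.
rewrite -mulr_suml ler_wpM2r ?sqrtr_ge0//.
by rewrite [X in (_ <= _ + X)%R](bigD1 i)//= ler_wpDl// lerDl; do 2 (apply: sumr_ge0 => ? _).
Qed.

Lemma box_prod A x : box A x = \prod_(i < d) (\1_(`[0%R, 1%R[) (coords A i x))%:E.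
by rewrite /box /box_ind big_map big_enum. Qed.

Lemma dint_box A x : row_free A -> dirint (rows A) (box A) x = 1.
move=> fA; under eq_dint do rewrite box_prod.
rewrite (dint_rows_prod (phi := fun i t => (\1_(`[0%R, 1%R[) t)%:E))//; last first.
 by move=> _; apply/measT_EFin; exact: measurable_indic.
rewrite big1// => i _.
by rewrite -[RHS](int_unit_shift 0%R); under [in RHS]eq_integral do rewrite add0r.
Qed.

(* Each set of a cover lies in a box whose volume is at most a constant times
 its weight. *)
Lemma hausdorff_ubox_gt0 A : row_free A -> (0 < d)%N -> 0 < H (ubox A).
move=> fA d0.
have [C C0 HC] := coords_lipschitz A.
(* A set of diameter [r] lies in a coordinate box of sides [2 C r], and [(2 C r) ^ d] is [kap] times
   its weight. *)
pose kap : R := ((4 * C) ^+ d / unit_ball_volume R d)%R.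
have kap0 : (0 < kap)%R by rewrite divr_gt0 ?exprn_gt0 ?mulr_gt0 ?unit_ball_volume_gt0.
apply: (@lt_le_trans _ _ (kap^-1)%:E); first by rewrite lte_fin invr_gt0.
apply: le_trans (mu_ext_le_hmeas d (ubox A) ltr01).
apply: le_ereal_inf_tmp => _ [F [mF cF] <-].
have [[k Fk]|fin] := pselect (exists k, cover_weight d 1%R (F k) = +oo).
 by rewrite (eseries_pinfty _ _ Fk)// ?leey// => i _; rewrite gt_eqF// (lt_le_trans _ (cover_weight_ge0 _ _ _)).
rewrite -(@lee_pmul2l _ kap%:E)// -EFinM divff ?lt0r_neq0//.
pose r k := fine (diameter (F k)).
pose I k i := `[(coords A i (xget (0%R : V) (F k)) - C * r k)%R, (coords A i (xget (0%R : V) (F k)) + C * r k)%R].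
pose S k y : \bar R := if `[< F k = set0 >] then 0 else
 \prod_(i < d) (\1_([set` I k i]) (coords A i y) : R)%:E.
have S0 k y : 0 <= S k y.
 by rewrite /S; case: asboolP => // _; apply: prode_ge0 => i _; rewrite lee_fin.
have mS k : measT (S k).
 rewrite /S; case: asboolP => // _; apply: meas_prode => i.
 apply/measT_EFin; apply: measT_comp; last exact: meas_coords.
 exact: measurable_indic.
rewrite -nneseriesZl//; last by move=> *; exact: cover_weight_ge0.
rewrite -(dint_box 0%R fA).
apply: (@le_trans _ _ (\sum_(k <oo) dirint (rows A) (S k) 0%R)).
 rewrite -dirint_nneseries//; apply: le_dint => //.
 - by apply: meas_box_ind => l /mapP[i _ ->]; exact: meas_coords.
 - by apply: ge0_emeasurable_sum.
 - by move=> y; exact: box_ind_ge0.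
 move=> y; rewrite box_prod.
 have [yQ|] := pselect (forall i, (0 <= coords A i y < 1)%R); last first.
  move=> /existsNP[i yi]; rewrite (bigD1 i)//= indicE (_ : _ \in _ = false) ?mul0e.
   by apply: nneseries_ge0.
  by apply/negP; rewrite inE/= in_itv.
 (* The retraction [y *m pinvmx A *m A] onto the row space keeps the coordinates of [y] and lands in
    [ubox A], hence in a set of the cover. *)
 have [k _ Fky] : (\bigcup_k F k) (y *m pinvmx A *m A)%R.
  by apply: cF; exists (y *m pinvmx A)%R.
 have wfin : cover_weight d 1%R (F k) < +oo.
  by rewrite ltey; apply: contra_notN fin => /eqP ?; exists k.
 have Fk0 : F k !=set0 by exists (y *m pinvmx A *m A)%R.
 have Sky : S k y = 1.
  rewrite /S; case: asboolP => [F0|_]; first by move: Fky; rewrite F0.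
  rewrite big1// => i _; rewrite indicE mem_set//= /I in_itv/= -ler_distl.
  have -> : coords A i y = coords A i (y *m pinvmx A *m A) by rewrite coords_mulmx.
  apply: le_trans (HC _ _ _) _; rewrite ler_wpM2l ?(ltW C0)// -lee_fin fineK.
   by apply: dist_diameter => //; exact: xgetPex.
  rewrite ge0_fin_numE ?diameter_ge0//.
  by move: wfin; rewrite /cover_weight; case: asboolP => [F0|_]; [move: Fky; rewrite F0|
   case: ifPn => // h _; apply: le_lt_trans h _; rewrite ltry].
 apply: (@le_trans _ _ 1).
  by rewrite big1// => i _; rewrite indicE mem_set//= in_itv/= yQ.
 rewrite -Sky; apply: le_trans (nneseries_lim_ge k.+1 _) => //.
 by rewrite big_nat_recr//= leeDr// sume_ge0.
apply: lee_nneseries => [k _ _|k _]; first exact: dint_ge0.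
rewrite /S /cover_weight; case: asboolP => [_|Fk0].
 by rewrite mule0 dint0.
have r0 : (0 <= r k)%R by rewrite fine_ge0// diameter_ge0//; apply/set0P/eqP.
case: ifPn => _; last by rewrite gt0_muley ?leey// lte_fin.
rewrite (dint_rows_prod (phi := fun i t => (\1_([set` I k i]) t : R)%:E))//; last first.
 by move=> i; apply/measT_EFin; exact: measurable_indic.
rewrite (eq_bigr (fun=> (2 * C * r k)%:E)); last first.
 move=> i _; rewrite integral_indic// setIT; have := @lebesgue_measure_itv R (I k i).
 rewrite /I /= => ->; case: ifPn => [_|]; first by rewrite -EFinB; congr EFin; ring.
 rewrite lte_fin -leNgt => h; congr EFin; apply/eqP; rewrite eq_le; apply/andP; split.
  by rewrite !mulr_ge0// ltW.
 by move: h; lra.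
rewrite prodEFin lee_fin prodr_const card_ord /kap.
rewrite mulrA mulfVK ?lt0r_neq0 ?unit_ball_volume_gt0// -exprMn.
by apply: le_of_eq; congr (_ ^+ _)%R; rewrite -/(r k); field.
Qed.
End hausdorff_box.

(** * The measure carried by a fiber *)

Section fiberm.
Context {R : realType} (n d : nat) (A : 'M[R]_(d, n)).
Local Open Scope ereal_scope.
Notation V := 'rV[R]_n.
Notation H := (@hausdorff R n d).
Notation HT := (caratheodory_type (hausdorff_outer R n d)).

Definition rowsp : set V := [set x | exists c : 'rV[R]_d, x = (c *m A)%R].

Lemma rowspE (x : V) : rowsp x <-> x = (x *m pinvmx A *m A)%R.
split=> [[c ->]|->]; last by exists (x *m pinvmx A)%R.
by rewrite mulmxKpV// submxMl.
Qed.

Lemma meas_rowsp : measurable rowsp.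
pose D (j : 'I_n) : set V := [set x | (x *m (1%:M - pinvmx A *m A)) ord0 j = 0%R].
rewrite (_ : rowsp = \big[setI/setT]_(j < n) D j); last first.
 apply/seteqP; split => x.
  move=> /rowspE xE; elim/big_ind : _ => // j _.
  by rewrite /D/= mulmxBr mulmx1 mulmxA -xE subrr mxE.
 move=> h; apply/rowspE/eqP; rewrite -subr_eq0; apply/eqP/rowP => j.
 have : D j x by move: h; rewrite (bigD1 j)//= => -[].
 by rewrite /D/= mulmxBr mulmx1 mulmxA mxE => ->; rewrite mxE.
apply: bigsetI_measurable => j _.
rewrite (_ : D j = (fun x : V => (x *m (1%:M - pinvmx A *m A)) ord0 j)%R @^-1` [set 0%R]).
 by rewrite -[X in measurable X]setTI; exact: meas_linear.
by [].
Qed.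

(** Restriction to the row space makes the measure sigma-finite, as Tonelli requires, while it still
    lives on the whole vector space. Affine fibers are reached by translation
    ([integral_hausdorff]). *)
Definition fiberm (S : set V) : \bar R := H (S `&` rowsp).

Let fiberm0 : fiberm set0 = 0.
by rewrite /fiberm set0I hausdorff0. Qed.

Let fiberm_ge0 S : 0 <= fiberm S.
exact: hausdorff_ge0. Qed.

Let fiberm_sigma_additive : semi_sigma_additive fiberm.
move=> F mF tF mUF; rewrite /fiberm setI_bigcupl.
have mFE k : measurable ((F k `&` rowsp : set V) : set HT).
 by apply: measurable_caratheodory; apply: measurableI => //; exact: meas_rowsp.
apply: (@measure_semi_sigma_additive _ _ _ (hausdorff_measure R n d) (fun k => F k `&` rowsp : set HT)) => //.
 by apply: trivIset_setIr.
exact: bigcup_measurable.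
Qed.

HB.instance Definition _ := isMeasure.Build _ _ _ fiberm
 fiberm0 fiberm_ge0 fiberm_sigma_additive.

Lemma fiberm_sigma_finite : sigma_finite setT fiberm.
exists (fun j : nat => [set x : V | forall i, (`|coords A i x| < j.+1%:R)%R]).
 apply/seteqP; split => // x _.
 exists (\sum_i Num.bound `|coords A i x|)%N => // i /=.
 apply: lt_le_trans (archi_boundP _) _ => //; rewrite ler_nat.
 by rewrite (bigD1 i)//=; apply: leqW; exact: leq_addr.
move=> j; split.
 rewrite (_ : [set x | _] = \big[setI/setT]_(i < d) [set x : V | (`|coords A i x| < j.+1%:R)%R]).
  apply: bigsetI_measurable => i _.
  rewrite -[X in measurable X]setTI; apply: measurable_fun_ltr => //.
  by apply: measT_comp => //; exact: meas_coords.
 apply/seteqP; split => x; first by move=> h; elim/big_ind: _ => // i _; exact: h.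
 by move=> h i; move: h; rewrite (bigD1 i)//= => -[].
(* Inside the row space, the points with coordinates below [j + 1] in modulus lie in a translate of
   the parallelepiped of [2 (j + 1) A]. *)
pose w := (- ((const_mx j.+1%:R : 'rV[R]_d) *m A))%R.
apply: (@le_lt_trans _ _ (H [set (x + w)%R | x in ubox ((2 * j.+1%:R) *: A)%R])).
 apply: le_hausdorff => x [/= xj /rowspE xE]; exists (x - w)%R; last by rewrite subrK.
 exists ((2 * j.+1%:R)^-1 *: (x *m pinvmx A + const_mx j.+1%:R))%R.
  by rewrite -scalemxAl -scalemxAr scalerA mulVf ?scale1r ?lt0r_neq0// opprK mulmxDl -xE.
 move=> i; have := xj i; rewrite /coords => ci.
 have -> : (((2 * j.+1%:R)^-1 *: (x *m pinvmx A + const_mx j.+1%:R)) ord0 i =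
   (2 * j.+1%:R)^-1 * ((x *m pinvmx A) ord0 i + j.+1%:R))%R.
  by rewrite mxE; congr (_ * _)%R; rewrite mxE; congr (_ + _)%R; rewrite mxE.
 move: ci; rewrite ltr_norml; move: ((x *m pinvmx A) _ _) => u /andP[h1 h2].
 rewrite mulr_ge0 ?invr_ge0 ?mulr_ge0//=; last by lra.
 by rewrite mulrC ltr_pdivrMr// mul1r; lra.
by rewrite hmeas_shift; exact: hmeas_ubox_lty.
Qed.

HB.instance Definition _ := Measure_isSigmaFinite.Build _ _ _ fiberm fiberm_sigma_finite.

Lemma int_fiberm_rowsp (f : V -> \bar R) :
 measT f -> (forall x, 0 <= f x) ->
 \int[fiberm]_x f x = \int[fiberm]_(x in rowsp) f x.
move=> mf f0; rewrite (@ge0_negligible_integral _ _ _ fiberm setT (~` rowsp))//.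
- by rewrite setTD setCK.
- by apply: measurableC; exact: meas_rowsp.
- by rewrite -[LHS]/(H (~` rowsp `&` rowsp)) setICl hausdorff0.
Qed.

Lemma eq_int_fiberm (f g : V -> \bar R) :
 measT f -> (forall x, 0 <= f x) ->
 measT g -> (forall x, 0 <= g x) ->
 (forall x, rowsp x -> f x = g x) -> \int[fiberm]_x f x = \int[fiberm]_x g x.
move=> mf f0 mg g0 fg; rewrite !int_fiberm_rowsp//.
by apply: eq_integral => x; rewrite inE => /fg.
Qed.

Lemma meas_transl (v : V) : measT (fun x : V => x + v)%R.
apply: meas_rVP => i; under eq_fun do rewrite mxE.
by apply: measTD => //; exact: meas_coor.
Qed.

Lemma meas_transll (v : V) : measT (fun x : V => v + x)%R.
apply: meas_rVP => i; under eq_fun do rewrite mxE.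
by apply: measTD => //; exact: meas_coor.
Qed.

Lemma integral_hausdorff (x0 : V) (f : V -> \bar R) :
 measT f -> (forall x, 0 <= f x) ->
 \int[hausdorff_measure R n d]_(x in [set y | rowsp (y - x0)%R]) f x =
 \int[fiberm]_x f (x0 + x)%R.
move=> mf f0.
have mphi : measT (fun x : HT => (x - x0)%R : V).
 exact: (measT_comp (meas_transl (- x0)%R) (meas_fun_caratheodory (n := n) (d := d))).
have mg : measT (fun y : V => f (x0 + y)%R).
 apply: measT_comp => //.
 exact: meas_transll.
rewrite int_fiberm_rowsp//.
transitivity (\int[pushforward (hausdorff_measure R n d) (fun x : HT => (x - x0)%R : V)]_(y in rowsp) f (x0 + y)%R).
 rewrite ge0_integral_pushforward//; last 2 first.
 - exact: meas_rowsp.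
 - exact: measurable_funTS.
 by apply: eq_integral => x _ /=; rewrite addrC subrK.
apply: eq_measure_integral => // S mS SE.
rewrite -[LHS]/(H ((fun x : V => x - x0)%R @^-1` S)) -[RHS]/(H (S `&` rowsp)).
rewrite (setIidl SE) -(hmeas_shift d (- x0)%R).
congr hausdorff; apply/seteqP; split => [_ [x Sx <-]//|x Sx].
by exists (x + x0)%R; rewrite /= addrK.
Qed.

Lemma fiberm_shift (c : 'rV[R]_d) (f : V -> \bar R) :
 measT f -> (forall x, 0 <= f x) ->
 \int[fiberm]_x f (x + c *m A)%R = \int[fiberm]_x f x.
move=> mf f0.
have mt := meas_transl (c *m A)%R.
have := ge0_integral_pushforward mt fiberm measurableT mf (fun x _ => f0 x).
rewrite preimage_setT => <-.
apply: eq_measure_integral => // S mS _.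
rewrite -[LHS]/(H (((fun x : V => x + c *m A)%R @^-1` S) `&` rowsp)) -[RHS]/(H (S `&` rowsp)).
rewrite -(hmeas_shift d (c *m A)%R); congr hausdorff.
apply/seteqP; split => [_ [x [Sx [e xe]] <-]|x [Sx [e xe]]].
 by split => //; exists (e + c)%R; rewrite mulmxDl xe.
exists (x - c *m A)%R; last by rewrite subrK.
by split; [rewrite /= subrK|exists (e - c)%R; rewrite mulmxBl xe].
Qed.

Lemma meas_box : measT (box A).
by apply: meas_box_ind => l /mapP[i _ ->]; exact: meas_coords.
Qed.

(** Uniqueness of Haar measure by hand: after disintegration the inner integral is constant on the
    row space, and the remaining integral of [box A] is the measure of [ubox A]. *)
Lemma int_fiberm (f : V -> \bar R) : row_free A ->
 measT f -> (forall x, 0 <= f x) ->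
 \int[fiberm]_x f x = H (ubox A) * dirint (rows A) f 0%R.
move=> fA mf f0; rewrite (disintegrate_rows (J := fun g => \int[fiberm]_x g x) fA _ _ mf f0); last 2 first.
- exact: integral_tonelli.
- by move=> c g mg g0; rewrite fiberm_shift.
have mb := meas_box.
have b0 x : 0 <= box A x by exact: box_ind_ge0.
rewrite (eq_int_fiberm (g := fun x => box A x * dirint (rows A) f 0%R)); last 5 first.
- by apply: emeasTM => //; exact: meas_dint.
- by move=> x; rewrite mule_ge0// dint_ge0.
- exact: emeasTM.
- by move=> x; rewrite mule_ge0// dint_ge0.
- by move=> x [c ->]; rewrite -[X in dirint _ _ X]add0r dint_rows.
rewrite ge0_integralZr ?dint_ge0//; congr (_ * _).
have mQ : measurable [set x : V | forall i, (0 <= coords A i x < 1)%R].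
 rewrite (_ : [set x | _] = \big[setI/setT]_(i < d) (coords A i @^-1` [set` `[0%R, 1%R[])).
  apply: bigsetI_measurable => i _; rewrite -[X in measurable X]setTI.
  exact: meas_coords.
 apply/seteqP; split => x.
  by move=> h; elim/big_ind: _ => // i _; rewrite /= in_itv/= h.
 by move=> h i; move: h; rewrite (bigD1 i)//= in_itv/= => -[].
transitivity (\int[fiberm]_x (\1_[set x : V | forall i, (0 <= coords A i x < 1)%R] x)%:E).
 apply: eq_integral => x _; rewrite box_prod indicE.
 case: (boolP (x \in _)); rewrite ?inE ?notin_setE /= => h.
  by rewrite big1// => i _; rewrite indicE mem_set//= in_itv/= h.
 move: h => /existsNP[i hi]; rewrite (bigD1 i)//= indicE (_ : _ \in _ = false) ?mul0e//.
 by apply/negP; rewrite inE/= in_itv.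
rewrite integral_indic// setIT /fiberm; congr hausdorff.
apply/seteqP; split => [x [/= h [c xc]]|_ [c -> hc]].
 by exists c => // i; have := h i; rewrite xc coords_mulmx.
by split; [move=> i /=; rewrite coords_mulmx|exists c].
Qed.
End fiberm.

(** * Integration by parts along a measure-preserving flow *)

Section flow.
Context d (T : measurableType d) (R : realType).
Variable m : {sigma_finite_measure set T -> \bar R}.
Notation mu := (@lebesgue_measure R).
Variable tau : R -> T -> T.
Hypothesis mtau : measT (fun p : T * R => tau p.2 p.1).
Hypothesis tau_inv : forall t (g : T -> \bar R), measT g ->
 (forall x, 0 <= g x)%E -> (\int[m]_x g (tau t x) = \int[m]_x g x)%E.

Lemma meas_flow t : measT (tau t).
have := measT_comp mtau (pair2_measurable (T1 := T) (t : measurableTypeR R)).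
exact.
Qed.

Lemma int_flow t (g : T -> \bar R) : measT g ->
 (\int[m]_x g (tau t x) = \int[m]_x g x)%E.
move=> mg; rewrite [LHS]integralE [RHS]integralE.
congr (_ - _)%E.
 rewrite -(tau_inv t (measurable_funepos mg) (fun x => funepos_ge0 g x)).
 by apply: eq_integral => x _; rewrite !funeposE.
rewrite -(tau_inv t (measurable_funeneg mg) (fun x => funeneg_ge0 g x)).
 by apply: eq_integral => x _; rewrite !funenegE.
Qed.

Variables Phi dPhi : T -> R.
Hypothesis tau0 : forall x, tau 0 x = x.
Hypothesis dPhiP : forall x (t : R), is_derive t 1 (fun s => Phi (tau s x)) (dPhi (tau t x)).
Hypothesis cdPhi : forall x, continuous (fun t => dPhi (tau t x)).
Hypothesis iPhi : m.-integrable setT (EFin \o Phi).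
Hypothesis idPhi : m.-integrable setT (EFin \o dPhi).

(* Integrate [Phi (tau 1 x) - Phi x] over the whole space in two ways. *)
Lemma int_flow_derivative : (\int[m]_x (dPhi x)%:E = 0)%E.
have mPhi := measurable_int _ iPhi; have mdPhi := measurable_int _ idPhi.
pose F (p : T * R) := ((dPhi (tau p.2 p.1))%:E * (\1_(`[0%R, 1%R] : set R) p.2)%:E)%E.
have mF : measT F.
 apply: emeasTM; first exact: (measT_comp mdPhi mtau).
 by apply/measT_EFin; apply: measT_comp => //; exact: measurable_indic.
have int1 (c : \bar R) : (0 <= c -> \int[mu]_t (c * (\1_(`[0%R, 1%R] : set R) t)%:E) = c)%E.
 move=> c0; rewrite ge0_integralZl//; last by apply/measT_EFin; exact: measurable_indic.
 rewrite integral_indic// setIT; have := @lebesgue_measure_itv R `[0%R, 1%R].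
 by rewrite /= lte_fin ltr01 oppr0 adde0 => ->; rewrite mule1.
have iF : (m \x mu)%E.-integrable setT F.
 apply: (proj2 (integrable21ltyP m mu mF)).
 have -> : (\int[mu]_y \int[m]_x `|F (x, y)| =
   \int[mu]_y ((\int[m]_x `|(dPhi x)%:E|) * (\1_(`[0%R, 1%R] : set R) y)%:E))%E.
  apply: eq_integral => t _; rewrite /F.
  transitivity (\int[m]_x (`|(dPhi (tau t x))%:E| * (\1_(`[0%R, 1%R] : set R) t)%:E))%E.
   by apply: eq_integral => x _; rewrite abseM [X in (_ * X)%E]gee0_abs ?lee_fin.
  rewrite ge0_integralZr//; last first.
   by apply: measT_comp => //; exact: (measT_comp mdPhi (meas_flow t)).
  congr (_ * _)%E.
  rewrite (tau_inv t (g := fun x => `|(dPhi x)%:E|%E))//.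
  exact: measT_comp.
 rewrite int1; last exact: integral_ge0.
 by have /integrableP[] := idPhi.
have := Fubini iF.
have -> : (\int[m]_x \int[mu]_y F (x, y) = \int[m]_x ((Phi (tau 1 x))%:E - (Phi x)%:E))%E.
 apply: eq_integral => x _.
 have FTC := @continuous_FTC2 R (fun t => dPhi (tau t x)) (fun t => Phi (tau t x)) 0 1.
 rewrite /= tau0 in FTC; rewrite -FTC.
 - rewrite [in RHS]integral_mkcond; apply: eq_integral => t _; rewrite /F /= patchE indicE.
  by case: ifP => _; rewrite ?mule1 ?mule0.
 - exact: ltr01.
 - exact/continuous_subspaceT/cdPhi.
 - have cP : continuous (fun t => Phi (tau t x)).
   by move=> t; apply/differentiable_continuous/derivable1_diffP; have [] := dPhiP x t.
  split; first by move=> t _; have [] := dPhiP x t.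
  + exact/cvg_at_right_filter/cP.
  + exact/cvg_at_left_filter/cP.
 - by move=> t _; rewrite derive1E; have [_] := dPhiP x t.
have -> : (\int[m]_x ((Phi (tau 1 x))%:E - (Phi x)%:E) = 0)%E.
 have iP1 : m.-integrable setT (fun x => (Phi (tau 1 x))%:E).
  apply/integrableP; split; first exact: (measT_comp mPhi (meas_flow 1)).
  rewrite (tau_inv 1 (g := fun x => `|(Phi x)%:E|%E))//.
   by have /integrableP[] := iPhi.
  exact: measT_comp.
 rewrite integralB//= (int_flow 1 (g := EFin \o Phi))// subee//.
 exact: integrable_fin_num.
move=> ->; rewrite /F.
transitivity (\int[mu]_y ((\int[m]_x (dPhi x)%:E) * (\1_(`[0%R, 1%R] : set R) y)%:E))%E; last first.
 apply: eq_integral => t _.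
 transitivity (\int[m]_x ((dPhi (tau t x))%:E * (\1_(`[0%R, 1%R] : set R) t)%:E))%E; last by [].
 rewrite integralZr//; last first.
  apply/integrableP; split; first exact: (measT_comp mdPhi (meas_flow t)).
  rewrite (tau_inv t (g := fun x => `|(dPhi x)%:E|%E))//.
   by have /integrableP[] := idPhi.
  exact: measT_comp.
 by rewrite (int_flow t (g := EFin \o dPhi)).
have fd : (\int[m]_x (dPhi x)%:E \is a fin_num)%E by exact: integrable_fin_num.
rewrite -(fineK fd) integralZl//; last first.
 have := @integrable_indic_itv R 0%R 1%R true false.
 exact.
rewrite integral_indic// setIT; have := @lebesgue_measure_itv R `[0%R, 1%R].
by rewrite /= lte_fin ltr01 oppr0 adde0 => ->; rewrite mule1.
Qed.
End flow.

(** The three bounds are merged into one number, so that the later constants are built from [slope],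
    [bnd] and the spline degree and are uniform in [K] and [M]. *)
Record perturbation (R : realType) := Perturbation {
 slope : R; bnd : R; pert : R -> R; pert1 : R -> R; pert2 : R -> R;
 is_derive_pert : forall z : R, is_derive z 1 pert (pert1 z);
 is_derive_pert1 : forall z : R, is_derive z 1 pert1 (pert2 z);
 continuous_pert2 : continuous pert2;
 bnd_ge0 : 0 <= bnd;
 pert_ub : forall z, `|pert z| <= bnd;
 pert1_ub : forall z, `|pert1 z| <= bnd;
 pert2_ub : forall z, `|pert2 z| <= bnd }.

#[local] Hint Extern 0 (is_true (0 <= bnd _)) => apply: bnd_ge0 : core.
#[local] Hint Extern 0 (is_true (`|pert _ _| <= _)) => apply: pert_ub : core.
#[local] Hint Extern 0 (is_true (`|pert1 _ _| <= _)) => apply: pert1_ub : core.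

Local Notation pot V := (potential (slope V) (pert V)).

(** * Tilted one-site measures and Stein's equation *)

Section onedim.
Context {R : realType} (V : perturbation R).
Notation mu := (@lebesgue_measure R).

Notation a := (slope V).
Notation B := (bnd V).
Notation f := (pert V).
Notation f1 := (pert1 V).
Notation f2 := (pert2 V).
Notation df := (is_derive_pert V).
Notation df1 := (is_derive_pert1 V).
Notation B0 := (bnd_ge0 V).
Notation fB := (pert_ub V).
Notation f1B := (pert1_ub V).

Definition psi1 (z : R) : R := z + a + f1 z.
Definition rho (s z : R) : R := expR (s * z - potential a f z).
(** Factor left by completing the square: [rho s] is this constant times a unit Gaussian centred at
    [s - a] times [expR (- f)]. *)
Definition rho_cst (s : R) : R := expR ((s - a) ^+ 2 / 2) / normal_peak 1.

Lemma derivable_cts (g : R -> R) : (forall z, derivable g z 1) -> continuous g.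
by move=> dg z; apply/differentiable_continuous/derivable1_diffP. Qed.

Lemma der_cts (g dg : R -> R) : (forall z : R, is_derive z 1 g (dg z)) -> continuous g.
by move=> h; apply: derivable_cts => z; have [] := h z. Qed.

Lemma cf : continuous f. exact: der_cts df. Qed.
Lemma cf1 : continuous f1. exact: der_cts df1. Qed.

Lemma normal_peak1_gt0 : 0 < normal_peak (1 : R).
by apply: normal_peak_gt0; exact: oner_neq0. Qed.

Lemma rho_cst_gt0 s : 0 < rho_cst s.
by rewrite divr_gt0 ?expR_gt0 ?normal_peak1_gt0. Qed.

Lemma rhoE s z : rho s z = rho_cst s * (normal_pdf (s - a) 1 z * expR (- f z)).
rewrite /normal_pdf (negbTE (oner_neq0 R)) /normal_fun /rho_cst /rho /potential.
rewrite mulrA (mulrA (_ / _)) mulfVK ?lt0r_neq0 ?normal_peak1_gt0//.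
by rewrite -!expRD; congr expR; rewrite expr1n; field.
Qed.

Lemma rho_gt0 s z : 0 < rho s z. exact: expR_gt0. Qed.
Lemma rho_ge0 s z : 0 <= rho s z. exact: expR_ge0. Qed.

Lemma der_psi (z : R) : is_derive z 1 (potential a f) (psi1 z).
rewrite /potential /psi1.
have := df z => dfz.
apply: is_derive_eq.
by rewrite /= /GRing.scale/=; field.
Qed.

Lemma der_psi1 (z : R) : is_derive z 1 psi1 (1 + f2 z).
rewrite /psi1; have := df1 z => dfz; apply: is_derive_eq.
by rewrite addr0.
Qed.

Lemma cpsi : continuous (potential a f). exact: der_cts der_psi. Qed.
Lemma cpsi1 : continuous psi1. exact: der_cts der_psi1. Qed.

Lemma der_rho s (z : R) : is_derive z 1 (rho s) (- (psi1 z - s) * rho s z).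
rewrite /rho; have := der_psi z => dz.
have -> : (fun z0 => expR (s * z0 - potential a f z0)) = expR \o (fun z0 => s * z0 - potential a f z0) by [].
apply: is_derive_eq; rewrite /GRing.scale/=; ring.
Qed.

Lemma is_derive_rho_s (s z : R) : is_derive s 1 (fun s => rho s z) (z * rho s z).
rewrite /rho.
have -> : (fun s0 => expR (s0 * z - potential a f z)) = expR \o (fun s0 => s0 * z - potential a f z) by [].
apply: is_derive_eq; rewrite /GRing.scale/=; ring.
Qed.

Lemma crho s : continuous (rho s). exact: der_cts (der_rho s). Qed.

(** Exponential growth gives a class that is closed under sums and products and integrable against
    every [rho s]; side conditions of this form can then be discharged by a hint. *)
Definition growth (g : R -> R) := measT g /\
 exists C (k : nat), 0 <= C /\ forall z, `|g z| <= C * expR (k%:R * `|z|).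

Lemma grD g h : growth g -> growth h -> growth (fun z => g z + h z).
move=> [mg [C [k [C0 gC]]]] [mh [D [l [D0 hD]]]]; split; first exact: measTD.
exists (C + D), (k + l)%N; split; first exact: addr_ge0.
move=> z; apply: le_trans (ler_normD _ _) _; rewrite mulrDl; apply: lerD.
 apply: le_trans (gC z) _; rewrite ler_wpM2l// ler_expR ler_wpM2r// ler_nat leq_addr//.
apply: le_trans (hD z) _; rewrite ler_wpM2l// ler_expR ler_wpM2r// ler_nat leq_addl//.
Qed.

Lemma grM g h : growth g -> growth h -> growth (fun z => g z * h z).
move=> [mg [C [k [C0 gC]]]] [mh [D [l [D0 hD]]]]; split; first exact: measTM.
exists (C * D), (k + l)%N; split; first exact: mulr_ge0.
move=> z; rewrite normrM natrD mulrDl expRD mulrACA.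
by apply: ler_pM.
Qed.

Lemma gr_cst c : growth (fun=> c).
split; first exact: measurable_cst.
by exists `|c|, 0%N; split=> // z; rewrite mul0r expR0 mulr1.
Qed.

Lemma grN g : growth g -> growth (fun z => - g z).
move=> gg; have := grM (gr_cst (-1)) gg.
by rewrite (_ : (fun z => -1 * g z) = (fun z => - g z))//; apply: funext => z; rewrite mulN1r.
Qed.

Lemma grB g h : growth g -> growth h -> growth (fun z => g z - h z).
by move=> gg gh; apply: grD => //; exact: grN. Qed.

Lemma gr_id : growth id.
split; first exact: measurable_id.
exists 1, 1%N; split=> // z; rewrite !mul1r.
by apply: le_trans (expR_ge1Dx _); rewrite lerDr.
Qed.

Lemma gr_bounded (g : R -> R) C : measT g -> (forall z, `|g z| <= C) -> growth g.
move=> mg gC; split=> //; exists C, 0%N; split; first exact: le_trans (gC 0).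
by move=> z; rewrite mul0r expR0 mulr1.
Qed.

Lemma gr_cts (g : R -> R) C : continuous g -> (forall z, `|g z| <= C) -> growth g.
by move=> cg; apply: gr_bounded; exact: cts_measT. Qed.

Lemma gr_f1 : growth f1. exact: gr_cts cf1 f1B. Qed.

Lemma growth_psi1 : growth psi1.
by apply: grD; [apply: grD; [exact: gr_id|exact: gr_cst]|exact: gr_f1]. Qed.

#[local] Hint Extern 0 (growth _) => solve [repeat first [assumption | exact: gr_id
 | exact: gr_cst | exact: gr_f1 | exact: growth_psi1 | apply: grB
 | apply: grN | apply: grD | apply: grM]] : core.

(** Half of the Gaussian exponent pays for the growth, through
    [k |z - c| <= k ^ 2 + (z - c) ^ 2 / 4]; the other half is a Gaussian of variance 2. *)
Lemma intble_rho g s : growth g -> mu.-integrable setT (EFin \o (fun z => g z * rho s z)).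
move=> [mg [C [k [C0 gC]]]]; set c := s - a.
pose sg := Num.sqrt (2 : R).
have sg0 : sg != 0 by rewrite sqrtr_eq0 -ltNge.
have sg2 : sg ^+ 2 = 2 by rewrite sqr_sqrtr.
have mr : measT (rho s) := cts_measT (@crho s).
pose D := C * expR (k%:R * `|c| + k%:R ^+ 2 + c ^+ 2 / 2 + B).
have : mu.-integrable setT (EFin \o (fun z => D * (normal_peak sg)^-1 * normal_pdf c sg z)).
 exact: (integrableZl measurableT _ (integrable_normal_pdf c sg)).
apply: le_integrable => //.
 exact/measT_EFin/measTM.
move=> z _ /=; rewrite lee_fin.
rewrite /normal_pdf (negbTE sg0) /normal_fun sg2 mulrA mulfVK ?lt0r_neq0 ?normal_peak_gt0//.
have D0 : 0 <= D by rewrite mulr_ge0// expR_ge0.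
rewrite [leRHS]ger0_norm ?mulr_ge0 ?expR_ge0// normrM (ger0_norm (rho_ge0 _ _)).
apply: le_trans (_ : C * expR (k%:R * `|z|) * rho s z <= _).
 by rewrite ler_wpM2r ?rho_ge0.
rewrite /D /rho -[leLHS]mulrA -[leRHS]mulrA ler_wpM2l// -!expRD ler_expR /potential.
have h1 : k%:R * `|z| <= k%:R * `|c| + k%:R * `|z - c|.
 rewrite -mulrDr ler_wpM2l//; apply: le_trans (ler_normD _ _).
 by rewrite addrC subrK.
have h2 : k%:R * `|z - c| <= k%:R ^+ 2 + (z - c) ^+ 2 / 4.
 rewrite -[in leRHS](@real_normK _ (z - c)) ?num_real//.
 rewrite -subr_ge0 (_ : _ - _ = (k%:R - `|z - c| / 2) ^+ 2); last by field.
 exact: sqr_ge0.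
have h3 : - f z <= B by have := fB z; rewrite ler_norml => /andP[+ _]; lra.
have h4 : s * z - (z ^+ 2 / 2 + a * z + f z) = c ^+ 2 / 2 - (z - c) ^+ 2 / 2 - f z.
 by rewrite /c; field.
have h5 : - (z - c) ^+ 2 / (2 *+ 2) = - ((z - c) ^+ 2 / 4) by rewrite -mulr_natr; field.
rewrite h4 h5; move: h1 h2 h3; move: (k%:R * `|z|) (k%:R * `|c|) (k%:R * `|z - c|) (k%:R ^+ 2) => u v w x.
by move: ((z - c) ^+ 2) (c ^+ 2) => y t; lra.
Qed.

Definition Mom (g : R -> R) (s : R) : R := \int[mu]_z (g z * rho s z).
Definition Zs (s : R) : R := Mom (fun=> 1) s.
Definition Ex (s : R) (g : R -> R) : R := Mom g s / Zs s.

Lemma MomD g h s : growth g -> growth h ->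
 Mom (fun z => g z + h z) s = Mom g s + Mom h s.
move=> gg gh; rewrite /Mom -RintegralD//; [|exact: intble_rho..].
by apply: eq_Rintegral => z _; rewrite mulrDl.
Qed.

Lemma MomZ c g s : growth g -> Mom (fun z => c * g z) s = c * Mom g s.
move=> gg; rewrite /Mom -RintegralZl//; last exact: intble_rho.
by apply: eq_Rintegral => z _; rewrite mulrA.
Qed.

Lemma le_Mom g h s : growth g -> growth h -> (forall z, g z <= h z) ->
 Mom g s <= Mom h s.
move=> gg gh gh'; apply: le_Rintegral => //; [exact: intble_rho..|].
by move=> z _; rewrite ler_wpM2r ?rho_ge0.
Qed.

Lemma Zs_lb s : rho_cst s * expR (- B) <= Zs s.
have ip : mu.-integrable setT (EFin \o normal_pdf (s - a) 1) by exact: integrable_normal_pdf.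
have -> : rho_cst s * expR (- B) = \int[mu]_z (rho_cst s * expR (- B) * normal_pdf (s - a) 1 z).
 by rewrite RintegralZl// /Rintegral integral_normal_pdf mulr1.
apply: le_Rintegral => //.
- exact: (integrableZl _ _ ip).
- exact: intble_rho.
move=> z _; rewrite mul1r rhoE -mulrA; apply: ler_wpM2l; first exact/ltW/rho_cst_gt0.
rewrite mulrC; apply: ler_wpM2l; first exact: normal_pdf_ge0.
rewrite ler_expR lerN2.
by have := fB z; rewrite ler_norml => /andP[].
Qed.

Lemma Zs_gt0 s : 0 < Zs s.
by apply: lt_le_trans (Zs_lb s); rewrite mulr_gt0 ?rho_cst_gt0 ?expR_gt0. Qed.

Lemma ExD s g h : growth g -> growth h -> Ex s (fun z => g z + h z) = Ex s g + Ex s h.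
by move=> gg gh; rewrite /Ex MomD// mulrDl. Qed.

Lemma ExZ s c g : growth g -> Ex s (fun z => c * g z) = c * Ex s g.
by move=> gg; rewrite /Ex MomZ// mulrA. Qed.

Lemma ExN s g : growth g -> Ex s (fun z => - g z) = - Ex s g.
move=> gg; rewrite -mulN1r -ExZ//; congr Ex; apply: funext => z; by rewrite mulN1r.
Qed.

Lemma ExB s g h : growth g -> growth h -> Ex s (fun z => g z - h z) = Ex s g - Ex s h.
by move=> gg gh; rewrite ExD ?ExN//; exact: grN. Qed.

Lemma Ex1 s : Ex s (fun=> 1) = 1.
by rewrite /Ex divff// lt0r_neq0// Zs_gt0. Qed.

Lemma Ex_cst s c : Ex s (fun=> c) = c.
rewrite -[RHS]mulr1 -(Ex1 s) -ExZ//.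
by congr Ex; apply: funext => z; rewrite mulr1.
Qed.

Lemma le_Ex s g h : growth g -> growth h -> (forall z, g z <= h z) -> Ex s g <= Ex s h.
by move=> gg gh gh'; rewrite /Ex ler_wpM2r ?invr_ge0 ?(ltW (Zs_gt0 _))// le_Mom. Qed.

Lemma Ex_ub s g C : growth g -> (forall z, `|g z| <= C) -> `|Ex s g| <= C.
move=> gg gC; rewrite ler_norml; apply/andP; split.
 rewrite -(Ex_cst s (- C)); apply: le_Ex => // z.
 by have := gC z; rewrite ler_norml => /andP[].
rewrite -(Ex_cst s C); apply: le_Ex => // z.
by have := gC z; rewrite ler_norml => /andP[].
Qed.

Lemma is_derive_addl (z t : R) : is_derive t 1 (fun s => z + s) 1.
rewrite (_ : (fun s => z + s) = shift z); first exact: is_derive_shift.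
by apply: funext => s; rewrite /shift /= addrC.
Qed.

(** The total derivative of [g * rho s] integrates to zero: the flow lemma for translations of the
    line. *)
Lemma int_rho_derivative s (g dg : R -> R) :
 (forall z : R, is_derive z 1 g (dg z)) -> continuous dg -> growth g -> growth dg ->
 Ex s (fun z => dg z - g z * (psi1 z - s)) = 0.
move=> Dg cdg gg gdg.
pose Phi z := g z * rho s z; pose dPhi z := (dg z - g z * (psi1 z - s)) * rho s z.
have gd : growth (fun z => dg z - g z * (psi1 z - s)).
 by [].
suff h : (\int[mu]_z (dPhi z)%:E = 0)%E.
 by rewrite /Ex /Mom /Rintegral h/= mul0r.
have cg : continuous g by exact: der_cts Dg.
have cdPhi : continuous dPhi.
 move=> z; apply: cvgM; last exact: crho.
 apply: cvgB; first exact: cdg.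
 apply: cvgM; first exact: cg.
 by apply: cvgB; [exact: cpsi1|exact: cvg_cst].
apply: (@int_flow_derivative _ (measurableTypeR R) R mu (fun t x => x + t) _ _ Phi dPhi).
- exact: measTD.
- move=> t h mh h0; rewrite -(ge0_int_shift t mh h0).
 by apply: eq_integral => z _; rewrite addrC.
- by move=> z; rewrite addr0.
- move=> z t.
 have DP (y : R) : is_derive y 1 Phi (dPhi y).
  have := Dg y => Dgy; have := der_rho s y => Dry.
  apply: is_derive_eq; rewrite /dPhi /GRing.scale/=; ring.
 have := DP (z + t) => DPt.
 have Dz := is_derive_addl z t.
 by have := @is_derive1_comp _ Phi (fun s => z + s) t _ _ DPt Dz; rewrite mulr1.
- move=> z t; apply: (continuous_comp (f := fun t => z + t)); last exact: cdPhi.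
 by apply: cvgD; [exact: cvg_cst|exact: cvg_id].
- exact: intble_rho.
- exact: intble_rho.
Qed.

Lemma Ex_psi1 s : Ex s psi1 = s.
have := @int_rho_derivative s (fun=> 1) (fun=> 0).
move=> /(_ _ _ (gr_cst 1) (gr_cst 0)) => h.
have gp : growth (fun z => psi1 z - s) by [].
have : Ex s (fun z => - (psi1 z - s)) = 0.
 rewrite -h//; last by move=> z; exact: cvg_cst.
 by congr Ex; apply: funext => z; rewrite mul1r sub0r.
rewrite ExN// ExB//.
by rewrite Ex_cst; lra.
Qed.

Definition mean s := Ex s id.

Lemma meanE s : mean s = s - a - Ex s f1.
have := Ex_psi1 s; rewrite /psi1 ExD//.
rewrite ExD//.
by rewrite Ex_cst -/(mean s); lra.
Qed.

(** The centred force of the perturbation. As [psi1 - s] is the centred spin plus [hs] ([psi1E]), it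
    measures the defect from the Gaussian case. *)
Definition hs s z := f1 z - Ex s f1.

Lemma gr_hs s : growth (hs s).
by []. Qed.

Lemma hs_ub s z : `|hs s z| <= 2 * B.
apply: le_trans (ler_normB _ _) _; rewrite mulrDl mul1r lerD//.
by apply: Ex_ub => //; exact: gr_f1.
Qed.

Lemma psi1E s z : psi1 z - s = (z - mean s) + hs s z.
by rewrite meanE /psi1 /hs; ring. Qed.

Definition Var s := Ex s (fun z => (z - mean s) ^+ 2).

Lemma gr_center s : growth (fun z => z - mean s).
by []. Qed.

Lemma gr_center2 s : growth (fun z => (z - mean s) ^+ 2).
exact: grM (gr_center s) (gr_center s). Qed.
#[local] Hint Resolve gr_center2 : core.

Lemma Var_identity s : Var s + Ex s (fun z => (z - mean s) * hs s z) = 1.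
have gc := gr_center s; have gh := gr_hs s.
have := @int_rho_derivative s (fun z => z - mean s) (fun=> 1).
move=> /(_ _ _ gc (gr_cst 1)) => h.
rewrite /Var -ExD//.
have : Ex s (fun z => 1 - (z - mean s) * (psi1 z - s)) = 0.
 apply: h; last by move=> z; exact: cvg_cst.
 by move=> z; apply: is_derive_eq; rewrite subr0.
rewrite ExB; [|exact: gr_cst|]; last first.
 by [].
rewrite Ex1 => /eqP; rewrite subr_eq0 => /eqP ->.
by congr Ex; apply: funext => z; rewrite psi1E; ring.
Qed.

(** Young's inequality in [Var_identity] with [|hs| <= 2 B], half of the variance being absorbed on
    the left. *)
Lemma Var_ub s : Var s <= 2 + 4 * B ^+ 2.
have gc := gr_center s; have gh := gr_hs s.
have := Var_identity s.
have : Ex s (fun z => - ((z - mean s) * hs s z)) <=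
  Ex s (fun z => 2^-1 * (z - mean s) ^+ 2 + 2 * B ^+ 2).
 apply: le_Ex; first by apply: grN; exact: grM.
  by [].
 move=> z; have hz : hs s z ^+ 2 <= (2 * B) ^+ 2.
  by rewrite -[leLHS]real_normK ?num_real// lerXn2r ?nnegrE ?mulr_ge0 ?hs_ub.
 rewrite -subr_ge0; have := sqr_ge0 ((z - mean s) + hs s z); move: hz; move: (hs s z) (z - mean s) => u v.
 by rewrite sqrrD exprMn; lra.
rewrite ExN// ExD// (ExZ _ 2^-1)//.
by rewrite Ex_cst -/(Var s); lra.
Qed.

(** In [Var_identity] the cross term is at most [(l / 2) Var + 1 / 2] for [l = 1 + 4 B ^ 2], which
    leaves [1 <= (2 + l) Var]. *)
Lemma Var_lb s : (3 + 4 * B ^+ 2)^-1 <= Var s.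
have gc := gr_center s; have gh := gr_hs s.
pose l := 1 + 4 * B ^+ 2.
have l0 : 0 < l by rewrite ltr_pwDl// mulr_ge0// sqr_ge0.
have := Var_identity s.
have : Ex s (fun z => (z - mean s) * hs s z) <=
  Ex s (fun z => (l / 2) * (z - mean s) ^+ 2 + 2^-1).
 apply: le_Ex; first exact: grM.
  by [].
 move=> z; have hz : hs s z ^+ 2 <= l.
  apply: le_trans (_ : (2 * B) ^+ 2 <= _).
   by rewrite -[leLHS]real_normK ?num_real// lerXn2r ?nnegrE ?mulr_ge0 ?hs_ub.
  by rewrite /l exprMn; lra.
 have [h0|h0] := leP ((z - mean s) * hs s z) 0.
  apply: le_trans h0 _; rewrite addr_ge0// mulr_ge0 ?sqr_ge0// divr_ge0// ltW//.
 rewrite -(ler_pM2l l0) -subr_ge0.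
 have := sqr_ge0 (l * (z - mean s) - hs s z); move: hz; move: (hs s z) (z - mean s) => u v hz.
 move=> sq.
 have -> : l * (l / 2 * v ^+ 2 + 2^-1) - l * (v * u) =
  ((l * v - u) ^+ 2 + (l - u ^+ 2)) / 2 by field.
 by rewrite divr_ge0// addr_ge0// subr_ge0.
rewrite ExD// (ExZ _ (l / 2))// Ex_cst -/(Var s) => h1 h2.
have h3 : 1 <= Var s * (2 + l) by move: h1 h2; lra.
rewrite (_ : 3 + _ = 2 + l); last by rewrite /l; ring.
by rewrite -div1r ler_pdivrMr// addr_gt0.
Qed.

Lemma der_Mom g (s : R) : growth g -> is_derive s 1 (Mom g) (Mom (fun z => z * g z) s).
move=> gg; have [mg _] := gg.
have gzg : growth (fun z => z * g z) by [].
pose F (x z : R) := g z * rho x z.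
have dF (x z : R) : is_derive x 1 (F ^~ z) (z * g z * rho x z).
 have := is_derive_rho_s x z => h; apply: is_derive_eq.
 by rewrite /GRing.scale/=; ring.
have d1F x z : partial1of2 F x z = z * g z * rho x z.
 by rewrite partial1of2E; have [_] := dF x z.
have sI : `]s - 1, s + 1[%classic s by rewrite /= in_itv/=; apply/andP; split; lra.
have iF x : `]s - 1, s + 1[%classic x -> mu.-integrable setT (EFin \o F x).
 by move=> _; exact: intble_rho.
have derF x y : `]s - 1, s + 1[%classic x -> setT y -> derivable (F ^~ y) x 1.
 by move=> _ _; have [] := dF x y.
(* For [|x - s| < 1] the exponential tilt lies below the one at [s + 1] or at [s - 1], according to
   the sign of [z]. *)
pose G z := `|z * g z| * (rho (s + 1) z + rho (s - 1) z).
have G0 z : 0 <= G z by rewrite mulr_ge0// addr_ge0// rho_ge0.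
have iG : mu.-integrable setT (EFin \o G).
 have ig x : mu.-integrable setT (fun z => (`|z * g z| * rho x z)%:E).
  apply: (@intble_rho (fun z => `|z * g z|)).
  split; first by apply: measT_comp => //; have [] := gzg.
  have [_ [C [k [C0 H]]]] := gzg; exists C, k; split=> // z; by rewrite normr_id.
 rewrite (_ : EFin \o G = (fun z => (`|z * g z| * rho (s + 1) z)%:E + (`|z * g z| * rho (s - 1) z)%:E)%E).
  exact: integrableD.
 by apply: funext => z; rewrite /G /= mulrDr EFinD.
have dG x y : `]s - 1, s + 1[%classic x -> setT y -> `|partial1of2 F x y| <= G y.
 rewrite /= in_itv/= => /andP[x1 x2] _; rewrite d1F normrM (ger0_norm (rho_ge0 _ _)).
 rewrite /G ler_wpM2l//.
 have [y0|y0] := leP 0 y.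
  apply: ler_wpDr; first exact: rho_ge0.
  by rewrite /rho ler_expR lerD2r; apply: ler_wpM2r => //; exact: ltW.
 apply: ler_wpDl; first exact: rho_ge0.
 by rewrite /rho ler_expR lerD2r; apply: ler_wnM2r; [exact: ltW|lra].
have h1 := differentiation_under_integral measurableT sI iF derF G0 iG dG.
have h2 := derivable_under_integral measurableT sI iF derF G0 iG dG.
apply: DeriveDef; first exact: h2.
rewrite -derive1E h1; apply: eq_Rintegral => z _; exact: d1F.
Qed.

(** The derivative in the tilt is a covariance. For the spin itself it is the variance, whose
    two-sided bounds make [mean] bi-Lipschitz. *)
Lemma der_Ex g (s : R) : growth g ->
 is_derive s 1 (Ex ^~ g) (Ex s (fun z => g z * (z - mean s))).
move=> gg; have dM := der_Mom s gg; have dZ := der_Mom s (gr_cst 1).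
have Z0 : Mom (fun=> 1) s != 0 by rewrite lt0r_neq0// Zs_gt0.
have gzg : growth (fun z => z * g z) by [].
have -> : Ex ^~ g = (fun x => Mom g x * (Mom (fun=> 1) x)^-1) by [].
have dV := is_deriveV (f := Mom (fun=> 1)) (x := s) (v := 1) Z0.
apply: is_derive_eq.
rewrite (_ : (fun z => g z * (z - mean s)) = (fun z => z * g z - mean s * g z)); last first.
 by apply: funext => z; ring.
rewrite ExB// ExZ// /mean /Ex /Zs.
rewrite (_ : Mom (fun z => z * 1) s = Mom id s); last by congr Mom; apply: funext => z; rewrite mulr1.
by rewrite /GRing.scale/=; field.
Qed.

Lemma der_mean (s : R) : is_derive s 1 mean (Var s).
have := der_Ex s gr_id; rewrite (_ : Ex s _ = Var s)//.
have gc := gr_center s.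
rewrite (_ : (fun z => id z * (z - mean s)) = (fun z => (z - mean s) ^+ 2 + mean s * (z - mean s))); last first.
 by apply: funext => z /=; ring.
rewrite ExD ?ExZ//.
by rewrite ExB ?Ex_cst; [rewrite -/(mean s) subrr mulr0 addr0|exact: gr_id|exact: gr_cst].
Qed.

Lemma mean_mono (s t : R) :
 (3 + 4 * B ^+ 2)^-1 * (s - t) ^+ 2 <= (s - t) * (mean s - mean t).
wlog st : s t / t <= s.
 move=> h; have [/h //|/ltW/h] := leP t s.
 by rewrite -(opprB s t) -(opprB (mean s)) sqrrN mulrNN.
have [c _ ->] := MVT_segment st (fun x _ => der_mean x)
 (continuous_subspaceT (der_cts der_mean)).
have -> : (s - t) * (Var c * (s - t)) = Var c * (s - t) ^+ 2 by ring.
by rewrite ler_wpM2r ?sqr_ge0//; exact: Var_lb.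
Qed.

Lemma mean_lip (s t : R) : `|mean s - mean t| <= (2 + 4 * B ^+ 2) * `|s - t|.
wlog st : s t / t <= s.
 by move=> h; case/orP: (le_total t s) => ts; [exact: h|rewrite (distrC (mean s)) (distrC s); exact: h].
have [c _ ->] := MVT_segment st (fun x _ => der_mean x)
 (continuous_subspaceT (der_cts der_mean)).
rewrite normrM ler_wpM2r// ger0_norm ?Var_ub//.
by apply: le_trans (Var_lb c); rewrite invr_ge0 addr_ge0// mulr_ge0 ?sqr_ge0.
Qed.

(** The covariance of the spin with a function bounded by [C] is at most [C (Var + 1)], because
    [|u| <= u ^ 2 + 1]. *)
Lemma Ex_lipschitz (g : R -> R) (C s t : R) : measT g -> (forall z, `|g z| <= C) ->
 `|Ex s g - Ex t g| <= C * (3 + 4 * B ^+ 2) * `|s - t|.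
move=> mg gC; have gg := gr_bounded mg gC.
have C0 : 0 <= C by exact: le_trans (gC 0).
wlog st : s t / t <= s.
 by move=> h; case/orP: (le_total t s) => ts; [exact: h|rewrite (distrC (Ex s g)) (distrC s); exact: h].
have dE (x : R) : is_derive x 1 (Ex ^~ g) (Ex x (fun z => g z * (z - mean x))) by exact: der_Ex.
have [c _ ->] := MVT_segment st (fun x _ => dE x)
 (continuous_subspaceT (der_cts dE)).
rewrite normrM ler_wpM2r//.
have gc := gr_center c; have gc2 := gr_center2 c.
have g1 := grD gc2 (gr_cst 1).
have bnd z : `|g z * (z - mean c)| <= C * ((z - mean c) ^+ 2 + 1).
 rewrite normrM; apply: ler_pM => //.
 have := sqr_ge0 (`|z - mean c| - 1); rewrite sqrrB real_normK ?num_real// mulr1 expr1n.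
 have := normr_ge0 (z - mean c); rewrite -mulr_natr; lra.
have : Ex c (fun z => C * ((z - mean c) ^+ 2 + 1)) <= C * (3 + 4 * B ^+ 2).
 rewrite ExZ// ler_wpM2l// ExD//.
 by rewrite Ex_cst -/(Var c); have := Var_ub c; lra.
move=> /(le_trans _); apply; rewrite ler_norml; apply/andP; split.
 rewrite lerNl -ExN//.
 apply: le_Ex => //.
 by move=> z; have := bnd z; rewrite ler_norml => /andP[+ _]; rewrite lerNl.
apply: le_Ex => //.
by move=> z; have := bnd z; rewrite ler_norml => /andP[].
Qed.

Definition tail_cst : R := expR (2 * B) * (1 + (normal_peak 1)^-1).

Lemma tail_cst_ge0 : 0 <= tail_cst.
by rewrite mulr_ge0 ?expR_ge0// addr_ge0// invr_ge0 ltW ?normal_peak1_gt0. Qed.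

(** The Gaussian part is expanded exactly around [z]; the perturbation costs the factor
    [expR (2 * B)]. *)
Lemma rho_ratio s z t : rho s (z + t) <=
 rho s z * (expR (2 * B) * expR (- ((z - (s - a)) * t) - t ^+ 2 / 2)).
rewrite /rho -!expRD ler_expR /potential.
have := fB z; have := fB (z + t); rewrite !ler_norml => /andP[h1 h2] /andP[h3 h4].
have -> : s * (z + t) - ((z + t) ^+ 2 / 2 + a * (z + t) + f (z + t)) =
 s * z - (z ^+ 2 / 2 + a * z + f z) + (- ((z - (s - a)) * t) - t ^+ 2 / 2) + (f z - f (z + t)) by field.
lra.
Qed.

Lemma meas_rho s : measT (rho s).
exact: (cts_measT (@crho s)). Qed.

(* [\int_0^oo e^(- u t - t^2/2) dt <= min (1/u, \int e^(-t^2/2))] *)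
Lemma tail_bound s z (sg : R) : sg ^+ 2 = 1 -> 0 <= sg * (z - (s - a)) ->
 (\int[mu]_t (\1_(`[0%R, +oo[ : set R) t * rho s (z + sg * t))%:E <=
  (rho s z * tail_cst / (1 + sg * (z - (s - a))))%:E)%E.
move=> sg1; set u := sg * _ => u0.
have u1 : 0 < 1 + u by rewrite ltr_pwDl.
(* Uses [(1 + u) e^(- u t - t^2 / 2) <= e^(- t^2 / 2) + u e^(- u t)], a Gaussian plus an exponential
   density, the latter being dropped at [u = 0]. *)
pose F t : \bar R := ((rho s z * expR (2 * B) / (1 + u))%:E *
 ((normal_peak 1)^-1%:E * (normal_pdf 0 1 t)%:E + (if u == 0 then 0 else exponential_pdf u t)%:E))%E.
have c0 : 0 <= rho s z * expR (2 * B) / (1 + u).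
 apply: divr_ge0; last exact: ltW.
 by apply: mulr_ge0; [exact: rho_ge0|exact: expR_ge0].
have me : measT (fun t => (if u == 0 then 0 else exponential_pdf u t)%:E).
 by case: (u == 0); [exact: measurable_cst|apply/measT_EFin; exact: measurable_exponential_pdf].
have e0 t : (0 <= (if u == 0 then 0 else exponential_pdf u t)%:E)%E.
 by case: ifP => // _; rewrite lee_fin exponential_pdf_ge0.
have mn : measT (fun t : R => (normal_pdf 0 1 t)%:E).
 by apply/measT_EFin; exact: measurable_normal_pdf.
have p0 : 0 <= (normal_peak (1 : R))^-1 by rewrite invr_ge0 ltW// normal_peak1_gt0.
apply: (@le_trans _ _ (\int[mu]_t F t)%E).
 apply: ge0_le_integral => //.
 - by move=> t _; rewrite lee_fin mulr_ge0// rho_ge0.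
 - apply/measT_EFin/measTM; first exact: measurable_indic.
  apply: (measT_comp (meas_rho s)).
  by apply: measTD => //; exact: measTM.
 - apply: emeasTM => //; apply: emeasurable_funD => //.
  exact: emeasTM.
 have EE (c p n e : R) : (c%:E * (p%:E * n%:E + e%:E))%E = (c * (p * n + e))%:E by [].
 move=> t _; rewrite /F EE lee_fin.
 have [t0|t0] := leP 0 t; last first.
  rewrite indicE memNset ?mul0r; last by rewrite /= in_itv/= andbT => /(lt_le_trans t0); rewrite ltxx.
  rewrite mulr_ge0// addr_ge0//; first by rewrite mulr_ge0// normal_pdf_ge0.
  by have := e0 t; rewrite lee_fin.
 rewrite indicE mem_set ?mul1r; last by rewrite /= in_itv/= t0.
 apply: le_trans (rho_ratio s z (sg * t)) _.
 have -> : - ((z - (s - a)) * (sg * t)) - (sg * t) ^+ 2 / 2 = - (u * t) - t ^+ 2 / 2.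
  by rewrite /u exprMn sg1; ring.
 set q := expR (- (u * t) - _).
 rewrite [leLHS]mulrA -[leRHS]mulrA ler_wpM2l//.
  by apply: mulr_ge0; [exact: rho_ge0|exact: expR_ge0].
 rewrite ler_pdivlMl// /q.
 rewrite /normal_pdf (negbTE (oner_neq0 R)) mulKf ?lt0r_neq0 ?normal_peak1_gt0//.
 rewrite mulrDl mul1r; apply: lerD.
  by rewrite /normal_fun ler_expR subr0 expr1n -mulr_natr; have := mulr_ge0 u0 t0; lra.
 case: eqP => [->|/eqP un0]; first by rewrite mul0r.
 rewrite exponential_pdfE// ler_wpM2l// ler_expR.
 by have := sqr_ge0 t; lra.
rewrite ge0_integralZl//; last 2 first.
- by apply: emeasurable_funD => //; exact: emeasTM.
- by move=> t _; rewrite adde_ge0// mule_ge0// ?lee_fin ?normal_pdf_ge0.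
rewrite ge0_integralD//; last 2 first.
- by move=> t _; rewrite mule_ge0// ?lee_fin ?normal_pdf_ge0.
- exact: emeasTM.
rewrite ge0_integralZl//; last by move=> t _; rewrite lee_fin normal_pdf_ge0.
rewrite integral_normal_pdf mule1 /tail_cst.
have -> : rho s z * (expR (2 * B) * (1 + (normal_peak 1)^-1)) / (1 + u) =
 rho s z * expR (2 * B) / (1 + u) * (1 + (normal_peak 1)^-1) by ring.
rewrite [X in (_ <= X)%E]EFinM lee_wpmul2l ?lee_fin//; last first.
 rewrite [X in (_ <= X)%E]EFinD [X in (_ <= X)%E]addeC leeD2l//.
 have [u00|un0] := eqVneq u 0; first by rewrite integral0 lee_fin.
 by rewrite integral_exponential_pdf// lt_def un0.
Qed.

Lemma Ex_hs s : Ex s (hs s) = 0.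
by rewrite /hs ExB ?Ex_cst ?subrr//.
Qed.

(** Variation of constants: the quotient [stein] solves [stein' - stein * (psi1 - s) = hs], and it
    stays bounded at both ends because [hs] has mean zero under the tilted law. *)
Definition stein_num s z : R := \int[mu]_(t in `]-oo, z]) (hs s t * rho s t).
Definition stein s z : R := stein_num s z / rho s z.

Lemma chs s : continuous (hs s).
by move=> z; apply: cvgB; [exact: cf1|exact: cvg_cst]. Qed.

Lemma is_derive_stein_num s (z : R) : is_derive z 1 (stein_num s) (hs s z * rho s z).
have zz : z < z + 1 by rewrite ltrDl.
have ci : {for z, continuous (fun t => hs s t * rho s t)}.
 by apply: cvgM; [exact: chs|exact: crho].
have i0 : mu.-integrable setT (EFin \o (fun t => hs s t * rho s t)).
 exact: intble_rho (gr_hs s).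
have iu : mu.-integrable [set` Interval -oo%O (BRight (z + 1))] (EFin \o (fun t => hs s t * rho s t)).
 exact: (integrableS measurableT).
have [h1 h2] := continuous_FTC1 zz iu (ltNyr _) ci.
apply: DeriveDef; first exact: h1.
by rewrite -derive1E h2.
Qed.

Lemma der_stein s (z : R) :
 is_derive z 1 (stein s) (hs s z + stein s z * (psi1 z - s)).
have dI := is_derive_stein_num s z; have dr := der_rho s z.
have r0 : rho s z != 0 by rewrite lt0r_neq0// rho_gt0.
have dV := is_deriveV (f := rho s) (x := z) (v := 1) r0.
rewrite /stein; apply: is_derive_eq.
by rewrite /GRing.scale/=; field.
Qed.

(** The integral may be taken over the tail beyond [z] on its own side of the centre, since the full
    integral vanishes. The Mills-ratio decay of that tail keeps [stein * (psi1 - s)], and with it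
    the derivative of [stein], bounded. *)
Lemma stein_bound s z : `|stein s z| * (1 + `|z - (s - a)|) <= 2 * B * tail_cst.
have i0 : mu.-integrable setT (EFin \o (fun t => hs s t * rho s t)).
 exact: intble_rho (gr_hs s).
have ir : mu.-integrable setT (EFin \o (fun t => 1 * rho s t)) by exact: intble_rho (gr_cst 1).
have B2 : 0 <= 2 * B by rewrite mulr_ge0.
have bound (D : set R) : measurable D -> (\int[mu]_(t in D) (`|hs s t * rho s t|)%:E <=
  (2 * B)%:E * \int[mu]_t (\1_D t * rho s t)%:E)%E.
 move=> mD; have mr := meas_rho s.
 rewrite -ge0_integralZl//; last 2 first.
 - by apply/measT_EFin/measTM => //; exact: measurable_indic.
 - by move=> t _; rewrite lee_fin mulr_ge0// rho_ge0.
 rewrite [leLHS]integral_mkcond; apply: ge0_le_integral => //.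
 - by move=> t _; rewrite patchE; case: ifP.
 - apply/(measurable_restrictT _ mD); apply: measurable_funTS; apply/measT_EFin.
  by apply: measT_comp => //; apply: measTM => //; have [] := gr_hs s.
 - apply: emeasTM => //.
  by apply/measT_EFin/measTM => //; exact: measurable_indic.
 move=> t _; rewrite patchE indicE; case: (t \in D); rewrite -?EFinM lee_fin ?mul0r ?mulr0// mul1r.
 by rewrite normrM (ger0_norm (rho_ge0 _ _)) ler_wpM2r ?rho_ge0 ?hs_ub.
have key (u : R) (S : \bar R) : 0 <= u -> (S <= (rho s z * tail_cst / (1 + u))%:E)%E ->
  (`|stein_num s z|%:E <= (2 * B)%:E * S)%E -> `|stein s z| * (1 + u) <= 2 * B * tail_cst.
 move=> u0 hS hI; have u1 : 0 < 1 + u by rewrite ltr_pwDl.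
 have : (`|stein_num s z|%:E <= ((2 * B) * (rho s z * tail_cst / (1 + u)))%:E)%E.
  by apply: (le_trans hI); rewrite (EFinM (2 * B)) lee_wpmul2l// lee_fin.
 rewrite lee_fin => h; rewrite /stein normrM normfV (ger0_norm (rho_ge0 _ _)).
 rewrite -ler_pdivlMr// ler_pdivrMr ?rho_gt0//.
 by apply: le_trans h _; apply: le_of_eq; field; exact: lt0r_neq0.
have [zc|zc] := leP 0 (z - (s - a)).
 have zc1 : 0 <= 1 * (z - (s - a)) by rewrite mul1r.
 rewrite (ger0_norm zc) -[z - _]mul1r; apply: (key _ _ zc1 (tail_bound (expr1n _ _) zc1)).
 have -> : stein_num s z = - \int[mu]_(t in `]z, +oo[) (hs s t * rho s t).
  have : \int[mu]_t (hs s t * rho s t) = 0.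
   have := Ex_hs s; rewrite /Ex /Mom => /eqP.
   by rewrite mulf_eq0 invr_eq0 (gt_eqF (Zs_gt0 s)) orbF => /eqP.
  rewrite -(setUv (`]-oo, z]%classic : set R)) Rintegral_setU//; last 3 first.
  - exact: measurableC.
  - by rewrite setUv.
  - exact/disj_setPCl.
  by rewrite setCitvl => /eqP; rewrite addr_eq0 => /eqP.
 rewrite normrN.
 have mD : measurable (`]z, +oo[%classic : set R) by [].
 have iD : mu.-integrable (`]z, +oo[%classic : set R) (EFin \o (fun t => hs s t * rho s t)).
  exact: (integrableS measurableT).
 rewrite EFin_normr_Rintegral//.
 apply: le_trans; first by apply: le_abse_integral => //; exact: measurable_int iD.
 apply: le_trans (bound _ mD) _; rewrite lee_wpmul2l ?lee_fin//.
 rewrite -(ge0_int_shift z); last 2 first.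
 - apply/measT_EFin/measTM; first exact: measurable_indic.
  exact: meas_rho.
 - by move=> t; rewrite lee_fin mulr_ge0// rho_ge0.
 apply: ge0_le_integral => //.
 - by move=> t _; rewrite lee_fin mulr_ge0// rho_ge0.
 - apply/measT_EFin/measTM.
   apply: measT_comp; first exact: measurable_indic.
   exact: measTD.
  by apply: (measT_comp (meas_rho s)); exact: measTD.
 - apply/measT_EFin/measTM; first exact: measurable_indic.
  apply: (measT_comp (meas_rho s)).
  by apply: measTD => //; exact: measTM.
 move=> t _; rewrite lee_fin mul1r ler_wpM2r ?rho_ge0// !indicE ler_nat.
 have [|//] := boolP (z + t \in _); rewrite inE/= in_itv/= andbT ltrDl => t0.
 by rewrite mem_set//= in_itv/= andbT ltW.
have zc' : 0 <= -1 * (z - (s - a)) by rewrite mulN1r oppr_ge0 ltW.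
rewrite (ltr0_norm zc) -mulN1r; apply: (key _ _ zc' (tail_bound (sg := -1) _ zc')).
 by rewrite sqrrN expr1n.
have mD : measurable (`]-oo, z]%classic : set R) by [].
 have iD : mu.-integrable (`]-oo, z]%classic : set R) (EFin \o (fun t => hs s t * rho s t)).
  exact: (integrableS measurableT).
rewrite EFin_normr_Rintegral//.
apply: le_trans; first by apply: le_abse_integral => //; exact: measurable_int iD.
apply: le_trans (bound _ mD) _; rewrite lee_wpmul2l ?lee_fin//.
have mf : measT (fun t : R => (\1_(`]-oo, z]) t * rho s t)%:E).
 apply/measT_EFin/measTM; first exact: measurable_indic.
 exact: meas_rho.
rewrite -(ge0_int_shift z mf); last by move=> t; rewrite lee_fin mulr_ge0// rho_ge0.
rewrite -(ge0_int_opp (f := fun t => (\1_(`]-oo, z]) (z + t) * rho s (z + t))%:E)); last 2 first.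
- by apply: (measT_comp mf); exact: measTD.
- by move=> t; rewrite lee_fin mulr_ge0// rho_ge0.
apply: le_of_eq; apply: eq_integral => t _.
congr (_%:E); rewrite mulN1r; congr (_ * _); rewrite !indicE; congr (_%:R); congr nat_of_bool.
apply/idP/idP; rewrite !inE/= !in_itv/= andbT gerDl oppr_le0//.
Qed.

Definition stein_cst : R := 2 * B + 2 * B * tail_cst * (1 + B).

Lemma stein_cst_ge : 2 * B * tail_cst <= stein_cst.
have T0 : 0 <= 2 * B * tail_cst by apply: mulr_ge0; [exact: mulr_ge0|exact: tail_cst_ge0].
by have := mulr_ge0 T0 B0; move: T0; rewrite /stein_cst mulrDr mulr1; move: (2 * B * tail_cst) B0 => T h1 h2 h3; lra.
Qed.

Lemma stein_ub s z : `|stein s z| <= stein_cst.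
apply: le_trans stein_cst_ge; apply: le_trans (stein_bound s z).
by rewrite ler_peMr// lerDl.
Qed.

Lemma dstein_ub s z : `|hs s z + stein s z * (psi1 z - s)| <= stein_cst.
apply: le_trans (ler_normD _ _) _; apply: lerD; first exact: hs_ub.
rewrite normrM.
have T0 : 0 <= 2 * B * tail_cst by apply: mulr_ge0; [exact: mulr_ge0|exact: tail_cst_ge0].
have h : `|psi1 z - s| <= (1 + `|z - (s - a)|) * (1 + B).
 rewrite /psi1 (_ : z + a + f1 z - s = (z - (s - a)) + f1 z); last by ring.
 apply: le_trans (ler_normD _ _) _; have := f1B z; move: `|f1 z| `|z - (s - a)| (normr_ge0 (z - (s - a))) => u v v0 uB.
 by rewrite mulrDl mul1r mulrDr mulr1; have := mulr_ge0 v0 B0; lra.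
apply: le_trans (_ : `|stein s z| * ((1 + `|z - (s - a)|) * (1 + B)) <= _).
 by rewrite ler_wpM2l.
by rewrite mulrA ler_wpM2r ?stein_bound// addr_ge0.
Qed.

Lemma stein_equation s z :
 (hs s z + stein s z * (psi1 z - s)) - stein s z * (psi1 z - s) = hs s z.
by rewrite addrK. Qed.
End onedim.

(** * Logarithmic moment generating function *)

Section macroscopic.
Context {R : realType} (V : perturbation R).
Notation a := (slope V).
Notation B := (bnd V).
Notation f := (pert V).
Notation Zs := (Zs V).
Notation Ex := (Ex V).
Notation mean := (mean V).
Notation hs := (hs V).
Notation stein := (stein V).
Notation psi1 := (psi1 V).

Lemma cts_dstein s : continuous (fun z => hs s z + stein s z * (psi1 z - s)).
have cs : continuous (stein s).
 exact: der_cts (der_stein V s).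
move=> z; apply: cvgD; first exact: chs.
apply: cvgM; first exact: cs.
by apply: cvgB; [exact: cpsi1|exact: cvg_cst].
Qed.

Notation psi := (potential a f).

Lemma log_mgfE s : log_mgf psi s = ln (Zs s).
rewrite /log_mgf /(Zs _) /Mom; congr ln; apply: eq_Rintegral => z _.
by rewrite mul1r.
Qed.

Lemma der_log_mgf (s : R) : is_derive s 1 (log_mgf psi) (mean s).
rewrite (_ : log_mgf psi = @ln R \o Zs); last by apply: funext => t; exact: log_mgfE.
have Z0 := Zs_gt0 V s.
have dZ := der_Mom V s (gr_cst (1 : R)).
have dl := is_derive1_ln Z0.
have -> : mean s = (Zs s)^-1 * Mom V (fun z => z * 1) s.
 by rewrite /(mean _) /(Ex _ _) mulrC; congr (_ * _); congr Mom; apply: funext => z; rewrite mulr1.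
exact: is_derive1_comp.
Qed.

(** Quadratic growth, the perturbation and the Gaussian normaliser being in the constant; this makes
    the dual problem for the tilt coercive. *)
Lemma log_mgf_lb s : (s - a) ^+ 2 / 2 - (B + ln (normal_peak 1)) <= log_mgf psi s.
rewrite log_mgfE; have h := Zs_lb V s.
have p0 : 0 < expR (- B) * (rho_cst V s) by rewrite mulr_gt0 ?expR_gt0 ?rho_cst_gt0.
apply: le_trans (_ : ln (rho_cst V s * expR (- B)) <= _); last first.
 by rewrite ler_ln ?posrE ?Zs_gt0// mulrC.
rewrite lnM ?posrE ?expR_gt0 ?rho_cst_gt0// expRK /rho_cst ln_div ?posrE ?expR_gt0 ?normal_peak1_gt0// expRK.
by apply: le_of_eq; ring.
Qed.

Definition tilted (s z : R) : R := rho V s z / Zs s.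

Lemma tilted_ge0 s z : 0 <= tilted s z.
by rewrite divr_ge0 ?rho_ge0// ltW// Zs_gt0. Qed.

Lemma meas_tilted s : measT (tilted s).
by apply: measTM => //; exact: meas_rho. Qed.

Lemma int_tilted (g : R -> R) s : growth g -> (forall z, 0 <= g z) ->
 (\int[lebesgue_measure]_z (g z * tilted s z)%:E = (Ex s g)%:E)%E.
move=> gg g0; have ir := intble_rho V s gg.
rewrite /(Ex _ _) /Mom mulrC EFinM /Rintegral fineK; last exact: (integrable_fin_num measurableT ir).
rewrite -ge0_integralZl//.
- by apply: eq_integral => z _; rewrite -EFinM /tilted mulrA mulrC.
- exact: measurable_int ir.
- by move=> z _; rewrite lee_fin mulr_ge0// rho_ge0.
- by rewrite lee_fin invr_ge0 ltW// Zs_gt0.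
Qed.
End macroscopic.

#[local] Opaque Mom Ex mean Zs.

(** * Legendre duality and the derivative of the free energy *)

Section fenchel.
Context {R : realType} (V : perturbation R).
Notation a := (slope V).
Notation B := (bnd V).
Notation f := (pert V).
Notation f1 := (pert1 V).
Notation B0 := (bnd_ge0 V).
Notation Ex := (Ex V).
Notation mean := (mean V).
Notation psi := (potential a f).

Lemma mean_close (s : R) : `|mean s - (s - a)| <= B.
rewrite meanE (_ : _ - _ = - Ex s f1); last by ring.
by rewrite normrN; apply: Ex_ub (pert1_ub V); exact: gr_f1.
Qed.

Lemma cts_mean : continuous mean.
exact: der_cts (der_mean V). Qed.

Lemma mean_surj (m : R) : exists s, mean s = m.
have c := @continuous_subspaceT _ _ `[m + a - B, m + a + B] mean cts_mean.
have [] := @IVT _ mean (m + a - B) (m + a + B) m _ c.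
- by have := B0; lra.
- have := mean_close (m + a - B); have := mean_close (m + a + B); rewrite !ler_norml.
 move: (mean (m + a - B)) (mean (m + a + B)) => u v.
 move: (slope V) (bnd V) => a' b' /andP[h1 h2] /andP[h3 h4]; rewrite ge_min le_max.
 by apply/andP; split; apply/orP; [left|right]; lra.
by move=> s _ <-; exists s.
Qed.

(** Convexity in tangent form, from the monotonicity of the derivative [mean]. *)
Lemma log_mgf_fenchel (s t : R) : log_mgf psi s + mean s * (t - s) <= log_mgf psi t.
have c : continuous (log_mgf psi) := der_cts (der_log_mgf V).
have m0 (u v : R) : 0 <= (u - v) * (mean u - mean v).
 apply: le_trans (mean_mono V u v); apply: mulr_ge0; last exact: sqr_ge0.
 by rewrite invr_ge0 addr_ge0// mulr_ge0 ?sqr_ge0.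
have [st|/ltW ts] := leP s t.
 have [x] := MVT_segment st (fun x _ => (der_log_mgf V) x) (continuous_subspaceT c).
 rewrite in_itv/= => /andP[sx xt] e.
 rewrite -subr_ge0 opprD addrA e -mulrBl.
 have [->|xs] := eqVneq x s; first by rewrite subrr mul0r.
 have xs0 : 0 < x - s by rewrite subr_gt0 lt_def xs.
 by rewrite mulr_ge0 ?subr_ge0// -subr_ge0 -(pmulr_rge0 _ xs0).
have [x] := MVT_segment ts (fun x _ => (der_log_mgf V) x) (continuous_subspaceT c).
rewrite in_itv/= => /andP[sx xt] e.
rewrite -subr_ge0 (_ : _ - _ = (mean s - mean x) * (s - t)); last first.
 move: (mean s) (mean x) (log_mgf psi s) (log_mgf psi t) e => u y v w e.
 by rewrite mulrBl -e; ring.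
have [->|xs] := eqVneq x s; first by rewrite subrr mul0r.
have xs0 : 0 < s - x by rewrite subr_gt0 lt_def eq_sym xs.
by rewrite mulr_ge0 ?subr_ge0// -subr_ge0 -(pmulr_rge0 _ xs0).
Qed.

Lemma cramer_mean (s : R) : cramer psi (mean s) = s * mean s - log_mgf psi s.
apply/eqP; rewrite eq_le; apply/andP; split.
 apply: ge_sup; first by exists (s * mean s - log_mgf psi s), s.
 move=> _ [t _ <-]; have := log_mgf_fenchel s t.
 by move: (mean s) (log_mgf psi s) (log_mgf psi t) => u v w; lra.
apply: ub_le_sup; last by exists s.
exists (s * mean s - log_mgf psi s) => _ [t _ <-].
have := log_mgf_fenchel s t.
by move: (mean s) (log_mgf psi s) (log_mgf psi t) => u v w; lra.
Qed.

(** The tangent inequalities at [s] and [t] squeeze the increment of the Legendre transform: for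
    [h = mean t - mean s] it lies between [s h] and [t h], and [t - s = O(h)] by strong
    monotonicity. Hence the derivative of [cramer] inverts [mean]. *)
Lemma derive1_cramer (s : R) : derive1 (cramer psi) (mean s) = s.
pose k := (3 + 4 * B ^+ 2).
have k0 : 0 < k by rewrite ltr_pwDl// mulr_ge0 ?sqr_ge0.
have key (h : R) : `|cramer psi (mean s + h) - cramer psi (mean s) - s * h| <= k * h ^+ 2.
 have [t tE] := mean_surj (mean s + h).
 have hE : h = mean t - mean s by rewrite tE addrC addKr.
 rewrite -tE hE !cramer_mean; clear tE hE.
 have := log_mgf_fenchel s t; have := log_mgf_fenchel t s.
 have := mean_mono V t s; rewrite -/k.
 move: (log_mgf psi s) (log_mgf psi t) (mean s) (mean t) => u v x y m1 h1 h2.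
 rewrite ger0_norm; last by lra.
 have : (t - s) * (y - x) <= k * (y - x) ^+ 2.
  move: (t - s) (y - x) m1 => d e m1.
  have q : 0 <= k^-1 * (d - k * e) ^+ 2 by rewrite mulr_ge0 ?invr_ge0 ?sqr_ge0// ltW.
  have : k^-1 * (d - k * e) ^+ 2 = k^-1 * d ^+ 2 - 2 * (d * e) + k * e ^+ 2.
   by field; exact: lt0r_neq0.
  by lra.
 by lra.
rewrite derive1E; apply: cvg_lim => //.
apply/cvgrPdist_le => /= e e0.
near=> h.
have h0 : h != 0 by near: h; exact: nbhs_dnbhs_neq.
have hs : `|h| <= e / k.
 near: h; apply: dnbhs0_le; exact: divr_gt0.
rewrite /GRing.scale/= mulr1 (addrC h).
rewrite (_ : s - _ = - h^-1 * (cramer psi (mean s + h) - cramer psi (mean s) - s * h)); last by field.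
rewrite normrM normrN normfV ler_pdivrMl ?normr_gt0//.
apply: le_trans (key h) _; rewrite -(real_normK (num_real h)) expr2 mulrCA ler_wpM2l//.
by rewrite mulrC -ler_pdivlMr.
Unshelve. all: by end_near. Qed.
End fenchel.

(** Interpolation: on [[z, z + 1]] the mean value theorem finds a point where the first derivative
    is at most twice the bound of [g], and the second derivative controls the way back to [z]. *)
Lemma Ck2_bounds (R : realType) (g : R -> R) :
 Ck 2 g -> bounded_fun g -> bounded_fun (derive1n 2 g) ->
 exists B : R, [/\ 0 <= B, (forall z, `|g z| <= B), (forall z, `|derive1 g z| <= B) &
  forall z, `|derive1n 2 g z| <= B].
move=> [dg _] [M [Mr gM]] [M' [Mr' gM']].
have bg z : `|g z| <= `|M| + 1 by apply: gM => //; rewrite (le_lt_trans (ler_norm M))// ltrDl.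
have bg2 z : `|derive1n 2 g z| <= `|M'| + 1.
 by apply: gM' => //; rewrite (le_lt_trans (ler_norm M'))// ltrDl.
have D0 (z : R) : is_derive z 1 g (derive1 g z).
 by apply: DeriveDef; [exact: (dg 0%N)|rewrite derive1E].
have D1 (z : R) : is_derive z 1 (derive1 g) (derive1n 2 g z).
 apply: DeriveDef; first by have := dg 1%N isT z; rewrite derive1n1.
 by rewrite [RHS]derive1E -derive1n1.
exists (2 * (`|M| + 1) + (`|M'| + 1)).
have M0 := normr_ge0 M; have M0' := normr_ge0 M'.
split; first by lra.
- by move=> z; apply: le_trans (bg z) _; lra.
- move=> z.
 have zz : z <= z + 1 by rewrite lerDl.
 have [c] := MVT_segment zz (fun x _ => D0 x) (continuous_subspaceT (der_cts D0)).
 rewrite in_itv/= => /andP[zc cz]; rewrite (addrC z) addrK mulr1 => e.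
 have [d _ e'] := MVT_segment zc (fun x _ => D1 x) (continuous_subspaceT (der_cts D1)).
 rewrite (_ : derive1 g z = derive1 g c - (derive1 g c - derive1 g z)); last by ring.
 rewrite e' -e; apply: le_trans (ler_normB _ _) _; apply: lerD.
  by apply: le_trans (ler_normB _ _) _; rewrite mulrDl mul1r; apply: lerD; exact: bg.
 rewrite normrM -[leRHS]mulr1; apply: ler_pM => //.
 by rewrite ger0_norm; lra.
- by move=> z; apply: le_trans (bg2 z) _; lra.
Qed.

(** * Euclidean structure on row vectors *)

Section dot.
Context {R : realType}.
Definition dot n (x y : 'rV[R]_n) : R := \sum_i x 0 i * y 0 i.
Definition sqn n (x : 'rV[R]_n) : R := dot x x.

Lemma dotC n (x y : 'rV_n) : dot x y = dot y x.
by apply: eq_bigr => i _; rewrite mulrC. Qed.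

Lemma dotDl n (x y z : 'rV_n) : dot (x + y) z = dot x z + dot y z.
by rewrite -big_split; apply: eq_bigr => i _; rewrite mxE mulrDl. Qed.

Lemma dotZl n c (x y : 'rV_n) : dot (c *: x) y = c * dot x y.
by rewrite mulr_sumr; apply: eq_bigr => i _; rewrite mxE mulrA. Qed.

Lemma dotNl n (x y : 'rV_n) : dot (- x) y = - dot x y.
by rewrite -scaleN1r dotZl mulN1r. Qed.

Lemma dotBl n (x y z : 'rV_n) : dot (x - y) z = dot x z - dot y z.
by rewrite dotDl dotNl. Qed.

Lemma dotDr n (x y z : 'rV_n) : dot x (y + z) = dot x y + dot x z.
by rewrite dotC dotDl !(dotC x). Qed.

Lemma dotZr n c (x y : 'rV_n) : dot x (c *: y) = c * dot x y.
by rewrite dotC dotZl dotC. Qed.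

Lemma dotNr n (x y : 'rV_n) : dot x (- y) = - dot x y.
by rewrite dotC dotNl dotC. Qed.

Lemma dotBr n (x y z : 'rV_n) : dot x (y - z) = dot x y - dot x z.
by rewrite dotDr dotNr. Qed.

Lemma dot0l n (x : 'rV_n) : dot 0 x = 0.
by rewrite -(scale0r x) dotZl mul0r. Qed.

Lemma dot_mul n m (x : 'rV_n) (A : 'M[R]_(n, m)) (y : 'rV_m) : dot (x *m A) y = dot x (y *m A^T).
rewrite /dot; under eq_bigr do rewrite mxE mulr_suml.
rewrite exchange_big; apply: eq_bigr => i _ /=.
by rewrite mxE mulr_sumr; apply: eq_bigr => j _; rewrite mxE; ring.
Qed.

Lemma dot_delta n (x : 'rV_n) i : dot x (delta_mx 0 i) = x 0 i.
rewrite /dot (bigD1 i)//= mxE !eqxx mulr1 big1 ?addr0// => j ji.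
by rewrite mxE (negbTE ji) andbF mulr0.
Qed.

Lemma sqn_ge0 n (x : 'rV_n) : 0 <= sqn x.
by apply: sumr_ge0 => i _; rewrite -expr2 sqr_ge0. Qed.

Lemma sqnE n (x : 'rV_n) : sqn x = \sum_i x 0 i ^+ 2.
by apply: eq_bigr => i _; rewrite expr2. Qed.

Lemma sqn_eq0 n (x : 'rV_n) : (sqn x == 0) = (x == 0).
apply/eqP/eqP => [|->]; last by rewrite /sqn dot0l.
rewrite sqnE => /eqP; rewrite psumr_eq0 => [/allP H|i _]; last exact: sqr_ge0.
apply/rowP => i; rewrite mxE; have := H i (mem_index_enum i).
by rewrite /= sqrf_eq0 => /eqP.
Qed.

Lemma sqnZ n c (x : 'rV_n) : sqn (c *: x) = c ^+ 2 * sqn x.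
by rewrite /sqn dotZl dotZr mulrA -expr2. Qed.

Lemma sqnN n (x : 'rV_n) : sqn (- x) = sqn x.
by rewrite /sqn dotNl dotNr opprK. Qed.

Lemma sqnB n (x y : 'rV_n) : sqn (x - y) = sqn x - 2 * dot x y + sqn y.
by rewrite /sqn dotBl !dotBr (dotC y x); ring. Qed.

Lemma sqnDE n (x y : 'rV_n) : sqn (x + y) = sqn x + 2 * dot x y + sqn y.
by rewrite /sqn dotDl !dotDr (dotC y x); ring. Qed.

Lemma dot_young n (x y : 'rV_n) : 2 * dot x y <= sqn x + sqn y.
by have := sqn_ge0 (x - y); rewrite sqnB; move: (dot x y) (sqn x) (sqn y) => *; lra. Qed.

Lemma sqnD n (x y : 'rV_n) : sqn (x + y) <= 2 * sqn x + 2 * sqn y.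
rewrite sqnDE; have := dot_young x y.
by move: (dot x y) (sqn x) (sqn y) => *; lra.
Qed.

Lemma dot_cs n (x y : 'rV_n) : dot x y ^+ 2 <= sqn x * sqn y.
have [y0|yn0] := eqVneq (sqn y) 0.
 move/eqP: y0; rewrite sqn_eq0 => /eqP ->.
 by rewrite dotC dot0l expr0n mulr_ge0 ?sqn_ge0.
have y0 : 0 < sqn y by rewrite lt_def yn0 sqn_ge0.
have := sqn_ge0 (sqn y *: x - dot x y *: y).
rewrite sqnB !sqnZ dotZl dotZr (_ : _ + _ = sqn y * (sqn x * sqn y - dot x y ^+ 2)); last by ring.
by rewrite pmulr_rge0// subr_ge0.
Qed.

Lemma measurable_dot n (y : 'rV_n) : measT (fun x : 'rV[R]_n => dot x y).
apply: measurable_sum => i; apply: measTM => //; exact: meas_coor.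
Qed.
End dot.

(** * Comparison of iterated integrals on a coset *)

Section dirint_extra.
Context {R : realType} (n : nat).
Notation V := 'rV[R]_n.

(** [P] stands for the coset of the span of [vs] through [x]: the integrands have to be compared on
    the fiber only. *)
Lemma le_dint_on (P : set V) vs (f g : V -> \bar R) x : measT f ->
 measT g -> (forall y, 0 <= f y)%E -> (forall y, 0 <= g y)%E ->
 (forall y v t, v \in vs -> P y -> P (y + t *: v)) ->
 (forall y, P y -> f y <= g y)%E -> P x -> (dirint vs f x <= dirint vs g x)%E.
move=> mf mg f0 g0; elim: vs x => [|v vs IH] x Pv fg Px /=; first exact: fg.
apply: ge0_le_integral => //.
- by move=> t _; exact: dint_ge0.
- exact: meas_dint1.
- exact: meas_dint1.
move=> t _; apply: IH => //.
 by move=> y w s wvs; apply: Pv; rewrite inE wvs orbT.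
by apply: Pv; rewrite ?mem_head.
Qed.

Lemma eq_dint_on (P : set V) vs (f g : V -> \bar R) x : measT f ->
 measT g -> (forall y, 0 <= f y)%E -> (forall y, 0 <= g y)%E ->
 (forall y v t, v \in vs -> P y -> P (y + t *: v)) ->
 (forall y, P y -> f y = g y)%E -> P x -> dirint vs f x = dirint vs g x.
move=> mf mg f0 g0 Pv fg Px; apply/eqP; rewrite eq_le; apply/andP; split.
 by apply: (le_dint_on (P := P)) => // y /fg ->.
by apply: (le_dint_on (P := P)) => // y /fg ->.
Qed.

Lemma dirint_sum (I : Type) (s : seq I) vs (F : I -> V -> \bar R) x :
 (forall i, measT (F i)) -> (forall i y, 0 <= F i y)%E ->
 dirint vs (fun y => \sum_(i <- s) F i y)%E x = (\sum_(i <- s) dirint vs (F i) x)%E.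
move=> mF F0; elim: s => [|i s IH].
 by under eq_dint do rewrite big_nil; rewrite dint0 big_nil.
under eq_dint do rewrite big_cons.
rewrite dintD//; first by rewrite IH big_cons.
- exact: emeasurable_sum.
- by move=> y; exact: sume_ge0.
Qed.

Lemma dintZe vs (f : V -> \bar R) x c : (0 <= c)%E ->
 measT f -> (forall y, 0 <= f y)%E ->
 dirint vs (fun y => c * f y)%E x = (c * dirint vs f x)%E.
move=> c0 mf f0; elim: vs x => [|v vs IH] x //=.
under eq_integral do rewrite IH.
rewrite ge0_integralZl//; last by move=> t _; exact: dint_ge0.
exact: meas_dint1.
Qed.

Lemma dirint_reflect vs (f : V -> \bar R) x :
 measT f -> (forall y, 0 <= f y)%E ->
 dirint vs (fun y => f (- y)) (- x) = dirint vs f x.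
move=> mf f0; elim: vs x => [|v vs IH] x /=; first by rewrite opprK.
rewrite -(ge0_int_opp (f := fun t => dirint vs f (x + t *: v))).
- apply: eq_integral => t _; rewrite -IH; congr dirint.
 by rewrite opprD scaleNr opprK.
- exact: meas_dint1.
- by move=> t; exact: dint_ge0.
Qed.
End dirint_extra.

(** * Product of tilted one-site laws *)

Section product_density.
Context {R : realType} (V : perturbation R) (n : nat).
Notation mu := (@lebesgue_measure R).
Implicit Types (x y lam : 'rV[R]_n).

Definition pdensity lam x : R := \prod_i tilted V (lam 0 i) (x 0 i).

Definition lebint (F : 'rV[R]_n -> \bar R) : \bar R := dirint (rows 1%:M) F 0.

Lemma pdensity_ge0 lam x : 0 <= pdensity lam x.
by apply: prodr_ge0 => i _; exact: tilted_ge0. Qed.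

Lemma meas_pdensity lam : measT (pdensity lam).
apply: measurable_prod => i _.
by apply: (measT_comp (meas_tilted V _)); exact: meas_coor.
Qed.

Lemma Ex_square s (g : R -> R) (c d w : R) : growth g -> Ex V s g = 0 ->
 Ex V s (fun z => (c * g z + d) ^+ 2 + w) = d ^+ 2 + (c ^+ 2 * Ex V s (fun z => g z ^+ 2) + w).
move=> gg g0; have gg2 : growth (fun z => g z ^+ 2) by exact: grM.
rewrite (_ : (fun z => _) = (fun z => c ^+ 2 * g z ^+ 2 + (2 * c * d * g z + (d ^+ 2 + w)))); last first.
 by apply: funext => z; ring.
have gc k : growth (fun=> k : R) := gr_cst k.
rewrite ExD; [|exact: grM|by apply: grD => //; exact: grM].
rewrite ExD//; [|exact: grM].
by rewrite !ExZ// g0 Ex_cst; ring.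
Qed.

(** Under the product law the sites are independent and the [g i] centred, so the cross terms
    vanish. *)
Lemma second_moment lam (b : 'rV[R]_n) (g : 'I_n -> R -> R) :
 (forall i, growth (g i)) -> (forall i, Ex V (lam 0 i) (g i) = 0) ->
 lebint (fun x => ((\sum_i b 0 i * g i (x 0 i)) ^+ 2 * pdensity lam x)%:E) =
 (\sum_i b 0 i ^+ 2 * Ex V (lam 0 i) (fun z => g i z ^+ 2))%:E.
move=> gg g0.
pose e (i : 'I_n) : 'rV[R]_n := delta_mx 0 i.
have ->: lebint = (fun F => dirint (map e (enum 'I_n)) F 0).
 apply: funext => F; rewrite /lebint /rows; congr dirint.
 by apply: eq_map => i; rewrite row1.
(* The sites in [s] are integrated out and their variances accumulate outside the square; the other
   sites stay frozen inside it. *)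
suff H (s : seq 'I_n) y : uniq s -> dirint (map e s)
  (fun x => ((\sum_i b 0 i * g i (x 0 i)) ^+ 2 * pdensity lam x)%:E) y =
  (((\sum_(i | i \notin s) b 0 i * g i (y 0 i)) ^+ 2 +
   \sum_(i | i \in s) b 0 i ^+ 2 * Ex V (lam 0 i) (fun z => g i z ^+ 2)) *
  \prod_(i | i \notin s) tilted V (lam 0 i) (y 0 i))%:E.
 rewrite H ?enum_uniq//; congr (_%:E).
 rewrite big1 ?expr0n ?add0r; last by move=> i; rewrite mem_enum.
 rewrite [X in _ * X]big1 ?mulr1; last by move=> i; rewrite mem_enum.
 by apply: eq_bigl => i; rewrite mem_enum.
elim: s y => [|j s IH] y.
 by move=> _ /=; rewrite [X in (_ + X) * _]big_pred0 ?addr0.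
move=> /= /andP[js us].
under eq_integral => t _ do rewrite IH//.
set W := \sum_(i | i \in s) _.
pose d := \sum_(i | i \notin j :: s) b 0 i * g i (y 0 i).
pose Q := \prod_(i | i \notin j :: s) tilted V (lam 0 i) (y 0 i).
have W0 : 0 <= W.
 apply: sumr_ge0 => i _; rewrite mulr_ge0 ?sqr_ge0//.
 rewrite -(Ex_cst V (lam 0 i) 0); apply: le_Ex; [exact: gr_cst|exact: grM|].
 by move=> z; rewrite sqr_ge0.
have Q0 : 0 <= Q by apply: prodr_ge0 => i _; exact: tilted_ge0.
have ej i t : (y + t *: e j) 0 i = y 0 i + t * (i == j)%:R by rewrite !mxE eqxx.
have split_p (i : 'I_n) : (i \notin s) && (i != j) = (i \notin j :: s).
 by rewrite inE negb_or andbC.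
have neq (i : 'I_n) : i \notin j :: s -> (i == j) = false.
 by rewrite inE negb_or => /andP[/negbTE].
transitivity (\int[mu]_t (((b 0 j * g j (y 0 j + t) + d) ^+ 2 + W) * tilted V (lam 0 j) (y 0 j + t) * Q)%:E)%E.
 apply: eq_integral => t _; congr (_%:E).
 rewrite (bigD1 j)//= [X in _ * X = _](bigD1 j)//= !ej eqxx mulr1 -mulrA.
 congr ((_ + _) * (_ * _)).
  congr ((_ + _) ^+ 2); rewrite /d; apply: eq_big => i; first by rewrite split_p.
  by rewrite split_p => /neq ij; rewrite ej ij mulr0 addr0.
 apply: eq_big => i; first by rewrite split_p.
 by rewrite split_p => /neq ij; rewrite ej ij mulr0 addr0.
have gq : growth (fun z => (b 0 j * g j z + d) ^+ 2 + W).
 have h : growth (fun z => b 0 j * g j z + d).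
  by apply: grD; [apply: grM => //; exact: gr_cst|exact: gr_cst].
 by apply: grD; [exact: grM|exact: gr_cst].
have mq : measT (fun z => ((b 0 j * g j z + d) ^+ 2 + W) * tilted V (lam 0 j) z).
 by apply: measTM; [case: gq|exact: meas_tilted].
have q0 z : 0 <= (b 0 j * g j z + d) ^+ 2 + W by rewrite addr_ge0 ?sqr_ge0.
rewrite (ge0_int_shift (y 0 j) (f := fun t => (((b 0 j * g j t + d) ^+ 2 + W) * tilted V (lam 0 j) t * Q)%:E)); last 2 first.
- by apply/measT_EFin/measTM.
- by move=> t; rewrite lee_fin; apply: mulr_ge0 => //; apply: mulr_ge0 => //; exact: tilted_ge0.
under eq_integral do rewrite EFinM.
rewrite ge0_integralZr//; last 2 first.
- exact/measT_EFin.
- by move=> t _; rewrite lee_fin mulr_ge0 ?tilted_ge0.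
rewrite int_tilted// -EFinM Ex_square//; congr ((_ * _)%:E).
congr (_ + _); rewrite [RHS](bigD1 j) ?mem_head//=; congr (_ + _).
apply: eq_bigl => i; rewrite inE; case: eqP => [->|_] /=; last by rewrite andbT.
by rewrite (negbTE js).
Qed.

Lemma lebint_pdensity lam : lebint (fun x => (pdensity lam x)%:E) = 1%E.
have := @dint_rows_prod R n n 1%:M (fun i z => (tilted V (lam 0 i) z)%:E) 0.
have fr : row_free (1%:M : 'M[R]_n) by rewrite row_free_unit unitmx1.
move=> /(_ fr) => H.
rewrite (_ : (fun x => _) = (fun x => \prod_(i < n) (tilted V (lam 0 i) (coords 1%:M i x))%:E)%E); last first.
 apply: funext => x; rewrite /pdensity -prodEFin; apply: eq_bigr => i _.
 by rewrite /coords -[in X in _ = X](mulmx1 x) mulmxKp.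
rewrite /lebint H//.
- rewrite big1// => i _.
 have := int_tilted V (g := fun=> 1) (lam 0 i) (gr_cst 1) (fun=> ler01).
 by under eq_integral do rewrite mul1r; rewrite Ex1.
- by move=> i; apply/measT_EFin; exact: meas_tilted.
- by move=> i t; rewrite lee_fin tilted_ge0.
Qed.
End product_density.

(** * Mean value and Taylor estimates *)

Lemma MVT_any (R : realType) (g dg : R -> R) (x y : R) :
 (forall z : R, is_derive z 1 g (dg z)) ->
 exists2 c, `|c - x| <= `|y - x| & g y - g x = dg c * (y - x).
move=> Dg; have cg := der_cts Dg.
have [xy|/ltW yx] := leP x y.
 have [c] := MVT_segment xy (fun z _ => Dg z) (continuous_subspaceT cg).
 rewrite in_itv/= => /andP[xc cy] e; exists c => //.
 by rewrite !ger0_norm ?subr_ge0// lerD2r.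
have [c] := MVT_segment yx (fun z _ => Dg z) (continuous_subspaceT cg).
rewrite in_itv/= => /andP[yc cx] e; exists c; last by rewrite -(opprB x y) mulrN -e opprB.
by rewrite !(distrC _ x) !ger0_norm ?subr_ge0// lerD2l lerN2.
Qed.

Lemma meas_mulmx d (T : measurableType d) (R : realType) n m (u : T -> 'rV[R]_n)
  (A : 'M[R]_(n, m)) j :
 (forall i, measT (fun x => u x 0 i)) ->
 measT (fun x => (u x *m A) 0 j).
move=> mu; under eq_fun do rewrite mxE.
by apply: measurable_sum => i; apply: measTM.
Qed.

Lemma meas_sqn d (T : measurableType d) (R : realType) n (u : T -> 'rV[R]_n) :
 (forall i, measT (fun x => u x 0 i)) ->
 measT (fun x => sqn (u x)).
by move=> mu; apply: measurable_sum => i; apply: measTM. Qed.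

Section taylor.
Context {R : realType} (V : perturbation R).
Notation psi := (pot V).

Definition curv : R := 2^-1 + bnd V.

Lemma curv_ge0 : 0 <= curv. by rewrite addr_ge0// invr_ge0. Qed.

Lemma pert1_lipschitz (x y : R) : `|pert1 V y - pert1 V x| <= bnd V * `|y - x|.
have [c _ ->] := MVT_any x y (is_derive_pert1 V).
by rewrite normrM ler_wpM2r// pert2_ub.
Qed.

Lemma psi_taylor (z h : R) : `|psi (z + h) - psi z - psi1 V z * h| <= curv * h ^+ 2.
have [c] := MVT_any z (z + h) (is_derive_pert V).
rewrite [z + h - z]addrAC subrr add0r => ch e.
rewrite (_ : _ - _ = h ^+ 2 / 2 + (pert1 V c - pert1 V z) * h); last first.
 rewrite mulrBl -e /potential /psi1.
 by move: (pert V _) (pert V _) (pert1 V _) (slope V) => *; field.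
apply: le_trans (ler_normD _ _) _; rewrite /curv [leRHS]mulrDl; apply: lerD.
 by rewrite ger0_norm ?divr_ge0 ?sqr_ge0// mulrC.
rewrite normrM -(real_normK (num_real h)) expr2 mulrA ler_wpM2r//.
by apply: le_trans (pert1_lipschitz z c) _; rewrite ler_wpM2l.
Qed.
End taylor.

(** * The one-block estimate *)

Section one_block.
Context {R : realType} (V : perturbation R) (r n : nat) (C1 C2 : R).
Notation B := (bnd V).
Notation k := (curv V).
Notation psi := (pot V).
Variable Bm : 'M[R]_(r, n).
Hypothesis C1_gt0 : 0 < C1.
Hypothesis C2_ge0 : 0 <= C2.
Hypothesis Bm_ub : forall s : 'rV_r, sqn (s *m Bm) <= C1 * sqn s.
Hypothesis Bm_lb : forall s : 'rV_r, sqn s <= C2 * sqn (s *m Bm).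
Implicit Types (x y z w lam : 'rV[R]_n) (s : 'rV[R]_r).

Lemma Bm_gram_unit : Bm *m Bm^T \in unitmx.
rewrite -row_free_unit -kermx_eq0; apply/eqP/row_matrixP => i.
set u := row i _; rewrite row0; apply/eqP; rewrite -sqn_eq0.
have u0 : u *m (Bm *m Bm^T) = 0 by rewrite /u -row_mul mulmx_ker row0.
have : sqn (u *m Bm) = 0 by rewrite /sqn dot_mul -mulmxA u0 dotC dot0l.
by move=> e; rewrite eq_le sqn_ge0 andbT; have := Bm_lb u; rewrite e mulr0.
Qed.

(** Moore-Penrose right inverse: [Bm_inv *m Bm] is the orthogonal projection onto the row space of
    [Bm]. The rows of [Us] span the orthogonal complement, along which the averages [x *m Bm^T] do
    not change. *)
Definition Bm_inv : 'M[R]_(n, r) := Bm^T *m invmx (Bm *m Bm^T).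

Lemma mul_Bm_inv : Bm *m Bm_inv = 1%:M.
by rewrite /Bm_inv mulmxA mulmxV// Bm_gram_unit. Qed.

Definition Us := row_base (kermx Bm^T).

Lemma Us_free : row_free Us. exact: row_base_free. Qed.

Lemma Us_orth : Us *m Bm^T = 0.
by apply/sub_kermxP; rewrite eq_row_base. Qed.

Lemma Us_full z : z *m Bm^T = 0 -> exists u, z = u *m Us.
by move=> z0; apply/submxP; rewrite eq_row_base; apply/sub_kermxP. Qed.

Lemma Bm_trans_ub z : sqn (z *m Bm^T) <= C1 * sqn z.
set u := z *m Bm^T.
have e : sqn u = dot z (u *m Bm) by rewrite /sqn {1}/u dot_mul trmxK.
have := dot_young (C1 *: z) (u *m Bm); rewrite dotZl -e sqnZ.
move=> /le_trans /(_ (lerD (lexx _) (Bm_ub u))) h.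
have : C1 * sqn u <= C1 * (C1 * sqn z) by move: h; move: (sqn u) (sqn z) => p q h; lra.
by rewrite ler_pM2l.
Qed.

Lemma Bm_inv_ub z : sqn (z *m Bm_inv) <= C2 ^+ 2 * sqn (z *m Bm^T).
set s := z *m Bm_inv; set t := z *m Bm^T.
have e : sqn (s *m Bm) = dot s t.
 by rewrite /sqn dot_mul -mulmxA /s /Bm_inv !mulmxA -[_ *m Bm *m _]mulmxA mulmxKV ?Bm_gram_unit.
have := Bm_lb s; rewrite e -dotZr => h1.
have := dot_young s (C2 *: t); rewrite sqnZ; move: (sqn s) (sqn t) (dot s _) h1 => p q d h1 h2.
by lra.
Qed.

Lemma sqn_row_Bm j : sqn (row j Bm) <= C1.
have := Bm_ub (delta_mx 0 j); rewrite -rowE /sqn [X in _ * X](dot_delta) mxE !eqxx mulr1.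
exact.
Qed.

Variable lam : 'rV[R]_n.

Definition mvec lam : 'rV[R]_n := \row_i mean V (lam 0 i).
Definition hvec lam x : 'rV[R]_n := \row_i hs V (lam 0 i) (x 0 i).
Definition dH x : 'rV[R]_n := \row_i psi1 V (x 0 i).

Lemma dHE x : dH x - lam = (x - mvec lam) + hvec lam x.
by apply/rowP => i; rewrite !mxE psi1E. Qed.

Notation q := (pdensity V lam).
(** [Fq] and [Dq] measure the averages of the force defect and of the centred spins, [r] numbers
    each; the lower bound on the fiber sees nothing else. *)
Definition Fq x := sqn (hvec lam x *m Bm^T).
Definition Dq x := sqn ((x - mvec lam) *m Bm^T).

Lemma measurable_hvec i : measT (fun x => hvec lam x 0 i).
under eq_fun do rewrite mxE.
apply: (measT_comp (f := hs V (lam 0 i))); last exact: meas_coor.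
by have [] := gr_hs V (lam 0 i).
Qed.

Lemma meas_Fq : measT Fq.
by apply: meas_sqn => j; apply: meas_mulmx => i; exact: measurable_hvec. Qed.

Lemma meas_Dq : measT Dq.
apply: meas_sqn => j; apply: meas_mulmx => i.
under eq_fun do rewrite !mxE.
by apply: measTD => //; exact: meas_coor.
Qed.

Lemma pdensityE : exists2 Z : R, 0 < Z &
 forall x, q x = Z * expR (dot lam x - hamiltonian psi x).
exists (\prod_i (Zs V (lam 0 i))^-1).
 by apply: prodr_gt0 => i _; rewrite invr_gt0 Zs_gt0.
move=> x; rewrite /pdensity /hamiltonian /dot -sumrB expR_sum -big_split/=.
by apply: eq_bigr => i _; rewrite mulrC.
Qed.

Lemma sum_taylor x w : `|hamiltonian psi (x + w) - hamiltonian psi x - dot (dH x) w| <= k * sqn w.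
rewrite /hamiltonian /dot -!sumrB sqnE mulr_sumr.
apply: le_trans (ler_norm_sum _ _ _) _; apply: ler_sum => i _.
by rewrite !mxE; exact: psi_taylor.
Qed.

(** The first-order terms at [w] and [- w] cancel, so the log-density at [x] exceeds the mean of its
    two neighbours by at most [k * sqn w]; the arithmetic-geometric inequality passes to the
    densities. *)
Lemma pdensity_midpoint x w : q x <= expR (k * sqn w) * (q (x + w) + q (x - w)) / 2.
have [Z Z0 qE] := pdensityE; rewrite !qE.
rewrite -mulrDr mulrCA -mulrA -mulrA ler_wpM2l ?(ltW Z0)//.
set u := dot lam (x + w) - _; set v := dot lam (x - w) - _; set m := dot lam x - _.
have h : m <= k * sqn w + (u + v) / 2.
 have := sum_taylor x w; have := sum_taylor x (- w).
 rewrite dotNr sqnN !ler_norml /u /v /m dotDr dotBr => /andP[_ h1] /andP[_ h2].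
 by move: (dot _ _) (dot _ _) (hamiltonian _ _) (hamiltonian _ _) (hamiltonian _ _) h1 h2 => *; lra.
apply: (@le_trans _ _ (expR (k * sqn w + (u + v) / 2))); first by rewrite ler_expR.
rewrite expRD ler_wpM2l ?expR_ge0//.
have -> : (u + v) / 2 = u / 2 + v / 2 by rewrite mulrDl.
have eu (t : R) : expR t = expR (t / 2) ^+ 2 by rewrite expr2 -expRD -splitr.
rewrite (eu u) (eu v) expRD.
move: (expR (u / 2)) (expR (v / 2)) => p p'.
by have := sqr_ge0 (p - p'); rewrite sqrrB -mulr_natr; lra.
Qed.

Variables (f : 'I_n -> R -> R) (D : R).
Hypothesis D_ge0 : 0 <= D.
Hypothesis f_measurable : forall i, measT (f i).
Hypothesis f_ub : forall i t, `|f i t| <= D.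
Hypothesis f_lipschitz : forall i t u, `|f i t - f i u| <= D * `|t - u|.
Hypothesis f_center : forall i, Ex V (lam 0 i) (f i) = 0.

Definition fvec x : 'rV[R]_n := \row_i f i (x 0 i).
Definition Ff x := sqn (fvec x *m Bm^T).

Lemma Ff_ge0 x : 0 <= Ff x. exact: sqn_ge0. Qed.

Lemma meas_Ff : measT Ff.
apply: meas_sqn => j; apply: meas_mulmx => i.
under eq_fun do rewrite mxE.
by apply: (measT_comp (f_measurable i)); exact: meas_coor.
Qed.

Lemma Ff_shift x w : Ff x <= 2 * Ff (x + w) + 2 * (C1 * D ^+ 2 * sqn w).
have -> : Ff x = sqn (fvec (x + w) *m Bm^T + (fvec x - fvec (x + w)) *m Bm^T).
 by rewrite /Ff -mulmxDl addrCA subrr addr0.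
apply: le_trans (sqnD _ _) _; rewrite lerD2l ler_wpM2l//.
apply: le_trans (Bm_trans_ub _) _; rewrite -mulrA ler_wpM2l ?(ltW C1_gt0)//.
rewrite !sqnE mulr_sumr; apply: ler_sum => i _.
rewrite !mxE -(real_normK (num_real _)) -[in leRHS](real_normK (num_real (w 0 i))) -exprMn.
rewrite lerXn2r ?nnegrE ?mulr_ge0//.
apply: le_trans (f_lipschitz _ _ _) _.
by rewrite opprD addrA subrr sub0r normrN.
Qed.

(** [k * C1] pays for the midpoint defect [k * sqn (s *m Bm)]; the extra 1 leaves a factor
    [expR (- sqn s)] that absorbs the growth of [Ff] under the shift by [s *m Bm]. *)
Definition cwt : R := k * C1 + 1.
Definition Kwt : R := C1 ^+ 2 * D ^+ 2.

Lemma cwt_gt0 : 0 < cwt.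
by rewrite ltr_wpDl// mulr_ge0 ?curv_ge0// ltW. Qed.

Lemma xexpNx_le1 (t : R) : 0 <= t -> t * expR (- t) <= 1.
move=> t0; rewrite expRN ler_pdivrMr ?expR_gt0// mul1r.
by apply: le_trans (expR_ge1Dx _); rewrite lerDr.
Qed.

(** A point of the fiber is bounded by its two mirror points off the fiber, with a Gaussian weight
    in the transverse variable [s]. Integration in [s] then thickens the fiber to the whole space,
    where the law is a product. *)
Lemma upper_pointwise x s : Ff x * q x * expR (- (cwt * sqn s)) <=
 (Ff (x + s *m Bm) + Kwt) * q (x + s *m Bm) + (Ff (x - s *m Bm) + Kwt) * q (x - s *m Bm).
set w := s *m Bm.
have ws : sqn w <= C1 * sqn s by exact: Bm_ub.
have s0 := sqn_ge0 s; have F0 y : 0 <= Ff y by exact: sqn_ge0.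
have E1 : expR (k * sqn w) * expR (- (cwt * sqn s)) <= expR (- sqn s).
 rewrite -expRD ler_expR /cwt; have := ler_wpM2l (curv_ge0 V) ws.
 by move: (sqn w) (sqn s) k => a b c; lra.
have E2 : expR (- sqn s) <= 1 by rewrite -expR0 ler_expR oppr_le0.
have E3 := xexpNx_le1 s0.
have side w' : sqn w' = sqn w -> Ff x * expR (- sqn s) <= 2 * (Ff (x + w') + Kwt).
 move=> ww; apply: (@le_trans _ _ ((2 * Ff (x + w') + 2 * (Kwt * sqn s)) * expR (- sqn s))).
  rewrite ler_wpM2r ?expR_ge0//; apply: le_trans (Ff_shift x w') _.
  rewrite lerD2l ler_wpM2l// ww /Kwt.
  have : C1 * D ^+ 2 * sqn w <= C1 * D ^+ 2 * (C1 * sqn s).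
   by rewrite ler_wpM2l// mulr_ge0 ?sqr_ge0// ltW.
  by move=> /le_trans; apply; apply: le_of_eq; ring.
 have K0 : 0 <= Kwt by rewrite mulr_ge0 ?sqr_ge0.
 rewrite mulrDl mulrDr; apply: lerD.
  by rewrite ler_piMr// mulr_ge0.
 by rewrite mulrA -[leLHS]mulrA -[leRHS]mulr1 ler_wpM2l// mulr_ge0.
have q0 y : 0 <= q y by exact: pdensity_ge0.
apply: (@le_trans _ _ (Ff x * (expR (- sqn s) * (q (x + w) + q (x - w)) / 2))).
 rewrite -mulrA ler_wpM2l//.
 apply: (@le_trans _ _ (expR (k * sqn w) * (q (x + w) + q (x - w)) / 2 * expR (- (cwt * sqn s)))).
  by rewrite ler_wpM2r ?expR_ge0// pdensity_midpoint.
 rewrite (_ : expR (k * sqn w) * _ / 2 * _ = expR (k * sqn w) * expR (- (cwt * sqn s)) * ((q (x + w) + q (x - w)) / 2)); last by ring.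
 by rewrite -[leRHS]mulrA ler_wpM2r// divr_ge0// addr_ge0.
have := side w erefl; have := side (- w) (sqnN w).
move=> /(ler_wpM2r (q0 (x - w))) h1 /(ler_wpM2r (q0 (x + w))) h2.
by move: h1 h2; move: (Ff x) (expR _) (q (x + w)) (q (x - w)) (Ff (x + w)) (Ff (x - w)) Kwt => *; lra.
Qed.

(** The 1 comes from the linear term of [lower_pointwise], the rest from its terms in [sqn s], since
    [sqn s <= C2 ^ 2 * Dq] at a point with transverse coordinate [s]. *)
Definition Cq : R := 1 + (2^-1 + k * C1 + cwt) * C2 ^+ 2.
Definition Qq z := Cq * Dq z + Fq z.

Lemma Cq_ge0 : 0 <= Cq.
rewrite addr_ge0// mulr_ge0 ?sqr_ge0// addr_ge0 ?(ltW cwt_gt0)// addr_ge0//.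
by rewrite mulr_ge0 ?curv_ge0// ltW.
Qed.

(** Comparison of a point [y = x + s *m Bm] off the fiber with its foot [x]. The first-order term
    [dot (dH y - lam) (s *m Bm)] sees only averages at [y], those measured by [Dq] and [Fq]; as [x0]
    has the averages of the means, [Dq] controls [s] as well. *)
Lemma lower_pointwise x0 x s : x0 *m Bm^T = mvec lam *m Bm^T -> x *m Bm^T = x0 *m Bm^T ->
 q (x + s *m Bm) * expR (- Qq (x + s *m Bm)) <= q x * expR (- (cwt * sqn s)).
move=> x0m xx0; set w := s *m Bm; set y := x + w.
have sy : s = (y - x0) *m Bm_inv.
 rewrite /y addrAC mulmxDl -mulmxA mul_Bm_inv mulmx1 /Bm_inv mulmxA mulmxBl xx0 subrr mul0mx add0r.
 by [].
have sD : sqn s <= C2 ^+ 2 * Dq y.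
 by rewrite {1}sy; apply: le_trans (Bm_inv_ub _) _; rewrite /Dq !mulmxBl x0m.
have ws : sqn w <= C1 * sqn s by exact: Bm_ub.
have dw : - (Dq y + Fq y) - 2^-1 * sqn s <= dot (dH y - lam) w.
 rewrite dHE /w dotC dot_mul dotC.
 have := dot_young (- ((y - mvec lam + hvec lam y) *m Bm^T)) s.
 rewrite dotNl sqnN mulmxDl.
 have := sqnD ((y - mvec lam) *m Bm^T) (hvec lam y *m Bm^T); rewrite -/(Dq y) -/(Fq y).
 by move: (sqn _) (dot _ _) (Dq y) (Fq y) (sqn s) => *; lra.
have [Z Z0 qE] := pdensityE; rewrite !qE -!mulrA ler_wpM2l ?(ltW Z0)// -!expRD ler_expR.
have := sum_taylor y (- w); rewrite dotNr sqnN /y addrK -/y ler_norml => /andP[_].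
have h1 : k * sqn w <= k * C1 * sqn s by rewrite -mulrA ler_wpM2l ?curv_ge0.
have h2 : (2^-1 + k * C1 + cwt) * sqn s <= (Cq - 1) * Dq y.
 rewrite /Cq [1 + _]addrC addrK -mulrA ler_wpM2l//.
  apply: addr_ge0; last exact: ltW cwt_gt0.
  by rewrite addr_ge0// mulr_ge0 ?curv_ge0// ltW.
move: dw; rewrite dotBl /Qq [in dot lam y]/y dotDr.
move: h1 h2; move: (dot _ _) (dot _ _) (dot lam x) (hamiltonian _ _) (hamiltonian _ _) => d1 d2 d3 p p'.
move: (k * C1) (Dq y) (Fq y) (sqn w) (sqn s) k cwt Cq => *; lra.
Qed.

Let mq := meas_pdensity V lam.
Let q0 := pdensity_ge0 V lam.

Let mtr (c : 'rV[R]_n) : measT (fun x : 'rV[R]_n => x + c).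
by apply: meas_rVP => i; under eq_fun do rewrite mxE; apply: measTD => //; exact: meas_coor.
Qed.

(** Lebesgue measure in coordinates transverse and parallel to the fiber. Its constant relative to
    [lebint] is left undetermined: it occurs in the upper and in the lower bound and cancels. *)
Definition fullint x0 (F : 'rV[R]_n -> \bar R) : \bar R :=
 dirint (rows Bm) (dirint (rows Us) F) x0.

Lemma fullint_shift x0 c g : measT g -> (forall y, 0 <= g y)%E ->
 fullint x0 (fun x => g (x + c)) = fullint x0 g.
move=> mg g0; rewrite /fullint.
have [u [s ->]] : exists u s, c = u *m Us + s *m Bm.
 have [u cE] : exists u, c - (c *m Bm_inv) *m Bm = u *m Us.
  apply: Us_full; rewrite mulmxBl /Bm_inv !mulmxA -[_ *m Bm *m _]mulmxA mulmxKV ?Bm_gram_unit//.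
  by rewrite subrr.
 by exists u, (c *m Bm_inv); rewrite -cE subrK.
have -> : dirint (rows Us) (fun x => g (x + (u *m Us + s *m Bm))) =
  fun y => dirint (rows Us) g (y + s *m Bm).
 by apply: funext => y; rewrite dint_translate addrCA addrC dint_rows.
rewrite dint_translate dint_rows//; first exact: meas_dint.
by move=> y; exact: dint_ge0.
Qed.

Lemma fullint_tonelli x0 : tonelli_fun (fullint x0).
move=> F mF F0; rewrite /fullint -dint_cat dirint_tonelli//.
by apply: eq_integral => t _; rewrite -dint_cat.
Qed.

(** A translation-invariant functional is a multiple of Lebesgue measure, the multiple being its
    value on the unit box. *)
Lemma fullint_lebint x0 F (a : R) : measT F -> (forall y, 0 <= F y)%E ->
 lebint F = a%:E -> fullint x0 F = (a%:E * fullint x0 (box 1%:M))%E.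
move=> mF F0 aE.
have fr : row_free (1%:M : 'M[R]_n) by rewrite row_free_unit unitmx1.
have a0 : 0 <= a by rewrite -lee_fin -aE; exact: dint_ge0.
have b0 y : (0 <= box (1%:M : 'M[R]_n) y)%E by exact: box_ind_ge0.
have mb : measT (box (1%:M : 'M[R]_n)).
 by apply: meas_box_ind => l /mapP[i _ ->]; exact: meas_coords.
rewrite (disintegrate_rows fr (@fullint_tonelli x0) _ mF F0); last first.
 by move=> c g mg g0; exact: fullint_shift.
rewrite (_ : (fun x => _) = (fun x => a%:E * box 1%:M x)%E); last first.
 apply: funext => x; rewrite muleC; congr (_ * _)%E.
 by rewrite -aE /lebint -[in RHS](dint_rows _ _ x)// mulmx1 add0r.
rewrite /fullint -!dint_cat dintZl//.
Qed.

Notation v := (2 + 4 * B ^+ 2).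

(** Each of the [r] averages is a sum of independent centred terms whose coefficients have square
    sum at most [C1], whence a bound free of [n]. *)
Lemma lebint_sqn (g : 'I_n -> R -> R) (c : R) : 0 <= c -> (forall i, growth (g i)) ->
 (forall i, Ex V (lam 0 i) (g i) = 0) ->
 (forall i, Ex V (lam 0 i) (fun t => g i t ^+ 2) <= c) ->
 (lebint (fun x : 'rV[R]_n => (sqn ((\row_i g i (x ord0 i)) *m Bm^T) * q x)%:E) <= (r%:R * (c * C1))%:E)%E.
move=> c0 gg g0 gc.
have mg j : measT (fun x : 'rV[R]_n => ((\sum_i row j Bm 0 i * g i (x 0 i)) ^+ 2 * q x)%:E).
 apply/measT_EFin/measTM; last exact: meas_pdensity.
 apply: measurable_funX; apply: measurable_sum => i; apply: measTM => //.
 by apply: (measT_comp (f := g i)); [case: (gg i)|exact: meas_coor].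
have pg j (x : 'rV[R]_n) : (0 <= ((\sum_i row j Bm 0 i * g i (x 0 i)) ^+ 2 * q x)%:E)%E.
 by rewrite lee_fin mulr_ge0 ?sqr_ge0 ?pdensity_ge0.
have -> : (fun x : 'rV[R]_n => (sqn ((\row_i g i (x 0 i)) *m Bm^T) * q x)%:E) =
  (fun x => \sum_(j < r) ((\sum_i row j Bm 0 i * g i (x 0 i)) ^+ 2 * q x)%:E)%E.
 apply: funext => x; rewrite sumEFin sqnE -mulr_suml; congr ((_ * _)%:E).
 apply: eq_bigr => j _; congr (_ ^+ 2); rewrite mxE; apply: eq_bigr => i _.
 by rewrite !mxE mulrC.
rewrite /lebint dirint_sum//; apply: (@le_trans _ _ (\sum_(j < r) (c * C1)%:E)%E); last first.
 by rewrite sumEFin lee_fin sumr_const card_ord mulr_natl.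
apply: lee_sum => j _; rewrite -/(lebint _) second_moment// lee_fin.
apply: (@le_trans _ _ (\sum_i c * row j Bm 0 i ^+ 2)).
 by apply: ler_sum => i _; rewrite mulrC ler_wpM2r ?sqr_ge0.
by rewrite -mulr_sumr -sqnE ler_wpM2l// sqn_row_Bm.
Qed.

Definition fbound : R := r%:R * (D ^+ 2 * C1).
Definition Fbound : R := r%:R * ((2 * B) ^+ 2 * C1).
Definition Dbound : R := r%:R * ((2 + 4 * B ^+ 2) * C1).

Lemma lebint_Ff : (lebint (fun x => (Ff x * q x)%:E) <= fbound%:E)%E.
have gf i : growth (f i) by exact: gr_bounded (f_measurable i) (f_ub i).
apply: (lebint_sqn (g := f)) => [|i|i|i]; [exact: sqr_ge0|exact: gf|exact: f_center|].
rewrite -(Ex_cst V (lam 0 i) (D ^+ 2)); apply: le_Ex.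
- exact: grM.
- exact: gr_cst.
- by move=> t; rewrite -(real_normK (num_real (f _ _))) lerXn2r ?nnegrE.
Qed.

Lemma lebint_Fq : (lebint (fun x => (Fq x * q x)%:E) <= Fbound%:E)%E.
apply: (lebint_sqn (g := fun i => hs V (lam 0 i))) => [|i|i|i]; [exact: sqr_ge0|exact: gr_hs|exact: Ex_hs|].
rewrite -(Ex_cst V (lam 0 i) ((2 * B) ^+ 2)); apply: le_Ex.
- by apply: grM; exact: gr_hs.
- exact: gr_cst.
- move=> z; rewrite -(real_normK (num_real (hs _ _ _))) lerXn2r ?nnegrE ?hs_ub//.
 by rewrite mulr_ge0.
Qed.

Lemma lebint_Dq : (lebint (fun x => (Dq x * q x)%:E) <= Dbound%:E)%E.
have -> : (fun x => (Dq x * q x)%:E) =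
 (fun x => (sqn ((\row_i (x 0 i - mean V (lam 0 i))) *m Bm^T) * q x)%:E).
 apply: funext => x; rewrite /Dq; congr ((sqn (_ *m _) * _)%:E).
 by apply/rowP => i; rewrite !mxE.
apply: (lebint_sqn (g := fun i t => t - mean V (lam 0 i))) => [|i|i|i].
- by rewrite addr_ge0// mulr_ge0 ?sqr_ge0.
- exact: gr_center.
- by rewrite ExB ?Ex_cst ?subrr//; [exact: gr_id|exact: gr_cst].
- exact: Var_ub.
Qed.

Definition Qbound : R := Cq * Dbound + Fbound.
Definition Tq z := q z * expR (- Qq z).

Lemma Fq_ge0 x : 0 <= Fq x. exact: sqn_ge0. Qed.
Lemma Dq_ge0 x : 0 <= Dq x. exact: sqn_ge0. Qed.

Lemma Qq_ge0 x : 0 <= Qq x.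
by rewrite addr_ge0 ?Fq_ge0// mulr_ge0 ?Dq_ge0// Cq_ge0. Qed.

Lemma meas_Qq : measT Qq.
by apply: measTD; [apply: measTM => //; exact: meas_Dq|exact: meas_Fq].
Qed.

Lemma Tq_ge0 x : 0 <= Tq x. by rewrite mulr_ge0 ?pdensity_ge0 ?expR_ge0. Qed.

Lemma measurable_Tq : measT Tq.
apply: measTM; first exact: meas_pdensity.
by apply: measT_comp => //; apply: measT_comp => //; exact: meas_Qq.
Qed.

Lemma lebint_Qq : (lebint (fun x => (Qq x * q x)%:E) <= Qbound%:E)%E.
have mD := measTM meas_Dq mq; have mF := measTM meas_Fq mq.
have -> : (fun x => (Qq x * q x)%:E) = (fun x => Cq%:E * (Dq x * q x)%:E + (Fq x * q x)%:E)%E.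
 by apply: funext => x; rewrite /Qq mulrDl EFinD -mulrA.
rewrite /lebint dintD ?dintZl//.
- by rewrite /Qbound (EFinD (Cq * _)) (EFinM Cq) leeD ?lebint_Fq// lee_wpmul2l ?lee_fin ?Cq_ge0// lebint_Dq.
- exact: Cq_ge0.
- exact/measT_EFin.
- by move=> y; rewrite lee_fin mulr_ge0 ?Dq_ge0.
- by apply: emeasTM => //; exact/measT_EFin.
- by move=> y; rewrite mule_ge0 ?lee_fin ?Cq_ge0// mulr_ge0 ?Dq_ge0.
- exact/measT_EFin.
- by move=> y; rewrite lee_fin mulr_ge0 ?Fq_ge0.
Qed.

Notation TE := (fun x => (Tq x)%:E).
Notation PE := (fun x => ((Ff x + Kwt) * q x)%:E).

Let mT : measT TE.
by apply/measT_EFin; exact: measurable_Tq. Qed.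

Let T0 x : (0 <= (Tq x)%:E)%E. by rewrite lee_fin Tq_ge0. Qed.

Let K0 : 0 <= Kwt. by rewrite mulr_ge0 ?sqr_ge0. Qed.

Let mP : measT PE.
by apply/measT_EFin/measTM => //; apply: measTD => //; exact: meas_Ff.
Qed.

Let P0 x : (0 <= ((Ff x + Kwt) * q x)%:E)%E.
by rewrite lee_fin mulr_ge0 ?addr_ge0 ?Ff_ge0. Qed.

(* Jensen, in the form [e^-t >= e^-A (1 + A - t)]. *)
Lemma lebint_Tq : ((expR (- Qbound))%:E <= lebint TE)%E.
set A := Qbound.
have A0 : 0 <= A.
 by rewrite -lee_fin; apply: le_trans lebint_Qq; apply: dint_ge0 => y; rewrite lee_fin mulr_ge0 ?Qq_ge0.
have pw x : expR (- A) * (1 + A) * q x <= Tq x + expR (- A) * (Qq x * q x).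
 rewrite /Tq -subr_ge0 (_ : _ - _ = q x * (expR (- Qq x) - expR (- A) * (1 + (A - Qq x)))); last by ring.
 rewrite mulr_ge0// subr_ge0 [X in _ <= expR X](_ : - Qq x = - A + (A - Qq x)); last by ring.
 by rewrite expRD ler_wpM2l ?expR_ge0// expR_ge1Dx.
have E0 : 0 <= expR (- A) * (1 + A) by rewrite mulr_ge0 ?expR_ge0// addr_ge0.
have mQ : measT (fun x => (Qq x * q x)%:E).
 by apply/measT_EFin/measTM => //; exact: meas_Qq.
have Q0 x : (0 <= (Qq x * q x)%:E)%E by rewrite lee_fin mulr_ge0 ?Qq_ge0.
have h : ((expR (- A) * (1 + A))%:E <= lebint TE + (expR (- A))%:E * A%:E)%E.
 apply: (@le_trans _ _ (lebint TE + (expR (- A))%:E * lebint (fun x => (Qq x * q x)%:E))%E); last first.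
  by rewrite leeD2l// lee_wpmul2l ?lee_fin ?expR_ge0// lebint_Qq.
 rewrite /lebint -dintZl ?expR_ge0// -dintD//; last 2 first.
 - exact: emeasTM.
 - by move=> y; apply: mule_ge0 => //; rewrite lee_fin expR_ge0.
 rewrite -[leLHS]mule1 -(lebint_pdensity V lam) /lebint -dintZl//; last exact/measT_EFin.
 apply: le_dint => //.
 - by apply: emeasTM => //; exact/measT_EFin.
 - by apply: emeasurable_funD => //; exact: emeasTM.
 - by move=> y; rewrite mule_ge0 ?lee_fin.
have : (0 <= lebint TE)%E by exact: dint_ge0.
move: (lebint _) h => [t h _|_ _|//]; last exact: leey.
by move: h; rewrite -EFinM -EFinD !lee_fin; move: (expR _) => e; lra.
Qed.

(** Gaussian weight in the transverse coordinates relative to the fiber through [x0]. *)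
Definition gwt x0 y : R := expR (- (cwt * sqn ((y - x0) *m Bm_inv))).

Lemma meas_gwt x0 : measT (fun y => (gwt x0 y)%:E).
apply/measT_EFin; apply: measT_comp => //; apply: measT_comp => //.
apply: measTM => //; apply: meas_sqn => j; apply: meas_mulmx => i.
under eq_fun do rewrite !mxE.
by apply: measTD => //; exact: meas_coor.
Qed.

Lemma gwt_ge0 x0 y : (0 <= (gwt x0 y)%:E)%E. by rewrite lee_fin expR_ge0. Qed.

Lemma int_gauss (c : R) : 0 < c ->
 exists2 G : R, 0 < G & (\int[lebesgue_measure]_t (expR (- (c * t ^+ 2)))%:E = G%:E)%E.
move=> c0; pose sg := Num.sqrt ((2 * c)^-1).
have sg0 : sg != 0 by rewrite sqrtr_eq0 -ltNge invr_gt0 mulr_gt0.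
have sg2 : sg ^+ 2 = (2 * c)^-1 by rewrite sqr_sqrtr// invr_ge0 mulr_ge0// ltW.
have p0 := normal_peak_gt0 sg0.
exists (normal_peak sg)^-1; first by rewrite invr_gt0.
rewrite -[RHS]mule1 -(integral_normal_pdf 0 sg) -ge0_integralZl//; last 3 first.
- by apply/measT_EFin; exact: measurable_normal_pdf.
- by move=> t _; rewrite lee_fin normal_pdf_ge0.
- by rewrite lee_fin invr_ge0 ltW.
apply: eq_integral => t _; rewrite -EFinM; congr (_%:E).
rewrite /normal_pdf (negbTE sg0) mulKf ?lt0r_neq0// /normal_fun subr0 sg2; congr expR.
by rewrite -mulr_natr; field; exact: lt0r_neq0.
Qed.

Lemma dirint_gwt x0 : exists2 G : R, 0 < G & dirint (rows Bm) (fun y => (gwt x0 y)%:E) x0 = G%:E.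
have [G G0 GE] := int_gauss cwt_gt0.
exists (\prod_(i <- enum 'I_r) G); first by apply: prodr_gt0.
pose l (i : 'I_r) y := ((y - x0) *m Bm_inv) 0 i.
have := @dint_prod R n 'I_r (enum 'I_r) (fun i => row i Bm) l (fun _ t => (expR (- (cwt * t ^+ 2)))%:E) x0.
move=> H; rewrite -prodEFin -GE -H.
- rewrite /rows; congr dirint; apply: funext => y.
 rewrite /gwt sqnE big_enum/= prodEFin -expR_sum mulr_sumr -sumrN.
 by [].
- exact: enum_uniq.
- move=> i; apply/measT_EFin; apply: measT_comp => //; apply: measT_comp => //.
 by apply: measTM => //; exact: measurable_funX.
- by move=> i t; rewrite lee_fin expR_ge0.
- move=> i; apply: meas_mulmx => j; under eq_fun do rewrite !mxE.
 by apply: measTD => //; exact: meas_coor.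
- move=> i j x t; rewrite /l addrAC mulmxDl -scalemxAl -row_mul mul_Bm_inv mxE.
 by congr (_ + _); rewrite !mxE mulr_natr eq_sym.
Qed.

Lemma Bm_decomp x0 y : exists u, y = x0 + (y - x0) *m Bm_inv *m Bm + u *m Us.
have [u uE] : exists u, (y - x0) - (y - x0) *m Bm_inv *m Bm = u *m Us.
 apply: Us_full; rewrite mulmxBl /Bm_inv !mulmxA -[_ *m Bm *m _]mulmxA mulmxKV ?Bm_gram_unit//.
 by rewrite subrr.
by exists u; rewrite -uE -addrA [_ *m Bm + _]addrC subrK addrC subrK.
Qed.

(** [upper_pointwise] integrated along the fiber and in [s]. Reflection in [x0] exchanges the two
    mirror terms, hence the factor 2. *)
Lemma upper_bound x0 : (dirint (rows Us) (fun x => (Ff x * q x)%:E) x0 *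
  dirint (rows Bm) (fun y => (gwt x0 y)%:E) x0 <=
 2%:E * fullint x0 PE)%E.
have mF := measTM meas_Ff mq.
have F0 x : (0 <= (Ff x * q x)%:E)%E by rewrite lee_fin mulr_ge0 ?Ff_ge0.
set Psi := fun x => ((Ff x + Kwt) * q x)%:E; have PG x : (0 <= Psi x)%E := P0 x.
pose h := dirint (rows Us) Psi.
have mh : measT h by exact: meas_dint.
have h0 y : (0 <= h y)%E by exact: dint_ge0.
have mre : measT (fun x : 'rV[R]_n => - x).
 by apply: meas_rVP => i; under eq_fun do rewrite mxE; apply: measT_comp => //; exact: meas_coor.
have mh2 : measT (fun y => h (- y + (x0 + x0))).
 by apply: (measT_comp mh); apply: (measT_comp (mtr _)).
rewrite -dintZe//; last 3 first.
- exact: dint_ge0.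
- exact: meas_gwt.
- exact: gwt_ge0.
apply: (@le_trans _ _ (dirint (rows Bm) (fun y => h y + h (- y + (x0 + x0))%R)%E x0)).
 apply: le_dint.
 - by apply: emeasTM => //; exact: meas_gwt.
 - exact: emeasurable_funD.
 - by move=> y; rewrite mule_ge0 ?gwt_ge0// dint_ge0.
 move=> y; set s := (y - x0) *m Bm_inv.
 have [u yE] := Bm_decomp x0 y; rewrite -/s in yE.
 have -> : h y = dirint (rows Us) (fun x => Psi (x + s *m Bm)) x0.
  by rewrite dint_translate yE /h dint_rows.
 have -> : h (- y + (x0 + x0)) = dirint (rows Us) (fun x => Psi (x - s *m Bm)) x0.
  rewrite (_ : - y + (x0 + x0) = (x0 - s *m Bm) + (- u) *m Us).
   by rewrite /h dint_rows// dint_translate.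
  by rewrite yE mulNmx !opprD; apply/rowP => i; rewrite !mxE; ring.
 rewrite -dintD//; last 2 first.
 - by apply: (measT_comp mP); exact: mtr.
 - by apply: (measT_comp mP); exact: mtr.
 rewrite muleC -dintZl ?expR_ge0//; last exact/measT_EFin.
 apply: le_dint => //.
 - by apply: emeasTM => //; exact/measT_EFin.
 - by apply: emeasurable_funD; apply: (measT_comp mP); exact: mtr.
 - by move=> z; rewrite mule_ge0// lee_fin expR_ge0.
 - by move=> z; rewrite /Psi -EFinM -EFinD lee_fin mulrC; exact: upper_pointwise.
rewrite dintD// (_ : dirint (rows Bm) (fun y => h (- y + _)) x0 = dirint (rows Bm) h x0).
 have -> : 2%:E = (1 + 1)%E :> \bar R by rewrite -EFinD.
 by rewrite ge0_muleDl ?mul1e.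
have mk : measT (fun y => h (y + (x0 + x0))) by exact: (measT_comp mh (mtr _)).
have := @dirint_reflect R n (rows Bm) (fun y => h (y + (x0 + x0))) (- x0) mk (fun y => h0 _).
by rewrite opprK => ->; rewrite dint_translate addrA addNr add0r.
Qed.

Lemma lower_bound x0 : x0 *m Bm^T = mvec lam *m Bm^T ->
 (fullint x0 TE <= dirint (rows Us) (fun x => (q x)%:E) x0 *
  dirint (rows Bm) (fun y => (gwt x0 y)%:E) x0)%E.
move=> x0m; rewrite -dintZe//; last 3 first.
- by apply: dint_ge0 => y; rewrite lee_fin.
- exact: meas_gwt.
- exact: gwt_ge0.
have Dq0 : (0 <= dirint (rows Us) (fun x => (q x)%:E) x0)%E.
 by apply: dint_ge0 => y; rewrite lee_fin.
apply: le_dint.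
- exact: meas_dint.
- by apply: emeasTM => //; exact: meas_gwt.
- by move=> y; exact: dint_ge0.
move=> y; set s := (y - x0) *m Bm_inv.
have [u yE] := Bm_decomp x0 y; rewrite -/s in yE.
have -> : dirint (rows Us) TE y = dirint (rows Us) (fun x => (Tq (x + s *m Bm))%:E) x0.
 by rewrite (dint_translate _ TE) yE dint_rows.
rewrite muleC -dintZl ?expR_ge0//; [|exact/measT_EFin].
apply: (le_dint_on (P := fun x => x *m Bm^T = x0 *m Bm^T)).
- by apply: (measT_comp mT); exact: mtr.
- by apply: emeasTM => //; exact/measT_EFin.
- by move=> z; exact: T0.
- by move=> z; rewrite mule_ge0 ?lee_fin ?expR_ge0.
- move=> z v t /mapP[i _ ->] zx0.
 by rewrite mulmxDl -scalemxAl -row_mul Us_orth row0 scaler0 addr0.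
- move=> z zx0; rewrite -EFinM lee_fin mulrC; exact: lower_pointwise zx0.
- by [].
Qed.

(** Quotient of the upper bound by the lower one; the block length [n] does not occur in it. *)
Definition block_cst : R := 2 * (fbound + Kwt) * expR Qbound.

(** The Gaussian mass [G] and the unknown factor [fullint x0 (box 1)] are common to both bounds. *)
Lemma one_block_density x0 : x0 *m Bm^T = mvec lam *m Bm^T ->
 (dirint (rows Us) (fun x => (Ff x * q x)%:E) x0 <=
  block_cst%:E * dirint (rows Us) (fun x => (q x)%:E) x0)%E.
move=> x0m; have [G G0 GE] := dirint_gwt x0.
have up := upper_bound x0; have low := lower_bound x0m; rewrite GE in up low.
have b0 : (0 <= fullint x0 (box (1%:M : 'M[R]_n)))%E.
 by apply: dint_ge0 => y; apply: dint_ge0 => z; exact: box_ind_ge0.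
have lebP : (lebint PE <= (fbound + Kwt)%:E)%E.
 have -> : PE = (fun x => (Ff x * q x)%:E + Kwt%:E * (q x)%:E)%E.
  by apply: funext => x; rewrite mulrDl EFinD.
 rewrite /lebint dintD//.
 - rewrite dintZl//; [|exact/measT_EFin].
  rewrite -/(lebint (fun x => (q x)%:E)) lebint_pdensity mule1 EFinD leeD2r//.
  exact: lebint_Ff.
 - by apply/measT_EFin/measTM => //; exact: meas_Ff.
 - by move=> y; rewrite lee_fin mulr_ge0 ?Ff_ge0.
 - by apply: emeasTM => //; exact/measT_EFin.
 - by move=> y; rewrite mule_ge0 ?lee_fin.
have lebT1 : (lebint TE <= 1)%E.
 rewrite -(lebint_pdensity V lam); apply: le_dint => //; first exact/measT_EFin.
 move=> y; rewrite lee_fin /Tq ler_piMr// -expR0 ler_expR oppr_le0; exact: Qq_ge0.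
have lebP0 : (0 <= lebint PE)%E by exact: dint_ge0.
have lebT0 : (0 <= lebint TE)%E by exact: dint_ge0.
have [p pE] : exists p, lebint PE = p%:E.
 by move: lebP lebP0; case: (lebint _) => [p _ _| |]//; exists p.
have [t tE] : exists t, lebint TE = t%:E.
 by move: lebT1 lebT0; case: (lebint _) => [t _ _| |]//; exists t.
rewrite (fullint_lebint _ mP P0 pE) in up; rewrite (fullint_lebint _ mT T0 tE) in low.
have pA : p <= fbound + Kwt by rewrite -lee_fin -pE.
have tA : expR (- Qbound) <= t by rewrite -lee_fin -tE; exact: lebint_Tq.
rewrite -(@lee_pmul2r _ G%:E) ?lte_fin//.
apply: (le_trans up); rewrite -muleA.
apply: (@le_trans _ _ (block_cst%:E * (t%:E * fullint x0 (box 1%:M)))%E); last first.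
 rewrite lee_wpmul2l// lee_fin mulr_ge0 ?expR_ge0// mulr_ge0// addr_ge0//.
 by rewrite mulr_ge0// mulr_ge0 ?sqr_ge0// ltW.
have F0 : 0 <= fbound by rewrite mulr_ge0// mulr_ge0 ?sqr_ge0// ltW.
rewrite !muleA lee_wpmul2r// -!EFinM lee_fin /block_cst.
apply: (@le_trans _ _ (2 * (fbound + Kwt))); first by rewrite ler_wpM2l.
rewrite -[leLHS]mulr1 -[leRHS]mulrA ler_wpM2l ?mulr_ge0 ?addr_ge0//.
by rewrite mulrC -ler_pdivrMr ?expR_gt0// div1r -expRN.
Qed.

(** A tilt in the row space of [Bm] is constant on the fiber, so there the tilted and untilted
    densities differ by a constant factor. *)
Lemma one_block x0 : (lam <= Bm)%MS -> x0 *m Bm^T = mvec lam *m Bm^T ->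
 (dirint (rows Us) (fun x => (Ff x * expR (- hamiltonian psi x))%:E) x0 <=
  block_cst%:E * dirint (rows Us) (fun x => (expR (- hamiltonian psi x))%:E) x0)%E.
move=> /submxP[sig lamE] x0m; have := one_block_density x0m.
have [Z Z0 qE] := pdensityE.
pose z := Z * expR (dot lam x0); have z0 : 0 < z by rewrite mulr_gt0 ?expR_gt0.
have mH : measT (fun x : 'rV[R]_n => expR (- hamiltonian psi x)).
 apply: measT_comp => //; apply: measT_comp => //; apply: measurable_sum => i.
 apply: (measT_comp (f := psi)); last exact: meas_coor.
 exact: cts_measT (@cpsi R V).
have key (G : 'rV[R]_n -> R) : measT G -> (forall x, 0 <= G x) ->
  dirint (rows Us) (fun x => (G x * q x)%:E) x0 =
  (z%:E * dirint (rows Us) (fun x => (G x * expR (- hamiltonian psi x))%:E) x0)%E.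
 move=> mG G0; rewrite -dintZl ?(ltW z0)//; last 2 first.
 - exact/measT_EFin/measTM.
 - by move=> y; rewrite lee_fin mulr_ge0 ?expR_ge0.
 apply: (eq_dint_on (P := fun x => x *m Bm^T = x0 *m Bm^T)).
 - by apply/measT_EFin/measTM => //; exact: meas_pdensity.
 - by apply: emeasTM => //; exact/measT_EFin/measTM.
 - by move=> y; rewrite lee_fin mulr_ge0 ?pdensity_ge0.
 - by move=> y; rewrite mule_ge0 ?lee_fin ?(ltW z0)// mulr_ge0 ?expR_ge0.
 - move=> y v t /mapP[i _ ->] zx0.
  by rewrite mulmxDl -scalemxAl -row_mul Us_orth row0 scaler0 addr0.
 - move=> y yx0; rewrite -EFinM qE /z; congr (_%:E).
  have -> : dot lam x0 = dot lam y by rewrite lamE !dot_mul yx0.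
  by rewrite expRD; ring.
 - by [].
rewrite key; [|exact: meas_Ff|exact: Ff_ge0].
have -> : (fun x => (q x)%:E) = (fun x => (1 * q x)%:E) by apply: funext => x; rewrite mul1r.
rewrite key//.
have -> : (fun x => (1 * expR (- hamiltonian psi x))%:E) = (fun x => (expR (- hamiltonian psi x))%:E).
 by apply: funext => x; rewrite mul1r.
by rewrite muleCA lee_pmul2l ?lte_fin// fin_numE.
Qed.
End one_block.

Lemma cts_sum (R : realType) (T : topologicalType) (I : Type) (r : seq I)
  (F : I -> T -> R) : (forall i, continuous (F i)) ->
 continuous (fun x => \sum_(i <- r) F i x).
move=> cF; elim: r => [|i r IH].
 rewrite (_ : (fun x => _) = cst 0); first by move=> x; exact: cvg_cst.
 by apply: funext => x; rewrite big_nil.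
rewrite (_ : (fun x => _) = fun x => F i x + \sum_(j <- r) F j x).
 by move=> x; apply: cvgD; [exact: cF|exact: IH].
by apply: funext => x; rewrite big_cons.
Qed.

(** * Measurability of Lipschitz functions *)

Section lip_meas.
Context {R : realType} (p : nat).
Let cell (k : nat) (c : 'rV[R]_p) : 'rV[int]_p := \row_i Num.floor (c 0 i * k.+1%:R).

Let measurable_cell k (z : 'rV[int]_p) : measurable [set c | cell k c = z].
have -> : [set c | cell k c = z] = \bigcap_(i in [set: 'I_p])
  ((fun c : 'rV[R]_p => c 0 i * k.+1%:R) @^-1` `[(z 0 i)%:~R, (z 0 i + 1)%:~R[%classic).
 apply/seteqP; split => c /=.
  by move=> <- i _ /=; rewrite in_itv/= mxE floor_itv.
 move=> H; apply/rowP => i; rewrite mxE; have := H i I; rewrite /= in_itv/=.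
 by move/floor_def.
apply: fin_bigcap_measurable => // i _; rewrite -[X in measurable X]setTI.
by apply: measTM => //; exact: meas_coor.
Qed.

(* A Lipschitz function is the limit of functions that are constant on the
 cells of finer and finer grids. *)
Lemma lip_meas (g : 'rV[R]_p -> R) (C : R) :
 (forall c d, (g c - g d) ^+ 2 <= C * sqn (c - d)) -> measT g.
move=> gC.
pose h k (c : 'rV[R]_p) := g (\row_i ((cell k c 0 i)%:~R / k.+1%:R)).
apply: (@measurable_fun_cvg _ _ _ _ h).
 move=> k _ Y mY; rewrite setTI.
 have -> : h k @^-1` Y = \bigcup_(z : 'rV[int]_p)
   (if `[< Y (g (\row_i ((z 0 i)%:~R / k.+1%:R))) >] then [set c | cell k c = z] else set0).
  apply/seteqP; split => c /=.
   by move=> Yc; exists (cell k c) => //; case: asboolP.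
  by move=> [z _]; case: asboolP => // Yz /= cz; rewrite /h cz.
 apply: countable_bigcupT_measurable; first exact: countableP.
 by move=> z; case: asboolP => _; [exact: measurable_cell|exact: measurable0].
move=> c _; apply/cvgrPdist_le => e e0 /=.
pose D := (C * p%:R) / e ^+ 2.
have C0 : 0 <= C * p%:R.
 have := gC 0 (const_mx 1); rewrite sqnE; under eq_bigr do rewrite !mxE sub0r sqrrN expr1n.
 by rewrite sumr_const card_ord; apply: le_trans; rewrite sqr_ge0.
near=> k.
have kD : D <= k.+1%:R.
 apply: (@le_trans _ _ k%:R); last by rewrite ler_nat.
 by near: k; exact: nbhs_infty_ger.
rewrite -ler_sqr ?nnegrE ?(ltW e0)// real_normK ?num_real//.
apply: le_trans (gC _ _) _.
have k0 : (0 : R) < k.+1%:R by rewrite ltr0n.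
apply: (@le_trans _ _ (C * p%:R / k.+1%:R)); last first.
 by rewrite ler_pdivrMr// [leRHS]mulrC -ler_pdivrMr ?exprn_gt0.
set d := _ - _.
have dp : sqn d <= p%:R / k.+1%:R.
 rewrite sqnE -[p in leRHS]card_ord -sumr_const mulr_suml; apply: ler_sum => i _.
 rewrite mul1r !mxE; set a := c 0 i.
 have /andP[h1 h2] := floor_itv (a * k.+1%:R).
 have e1 : 0 <= a - (Num.floor (a * k.+1%:R))%:~R / k.+1%:R by rewrite subr_ge0 ler_pdivrMr.
 have e2 : a - (Num.floor (a * k.+1%:R))%:~R / k.+1%:R <= k.+1%:R^-1.
  rewrite lerBlDr -[X in X + _]mul1r -mulrDl ler_pdivlMr// ltW//.
  by move: h2; rewrite intrD addrC.
 rewrite expr2; apply: le_trans (ler_pM e1 e1 e2 e2) _.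
 by rewrite ler_piMr ?invr_ge0// invf_le1// ler1n.
have [Cp|Cn] := leP 0 C; first by rewrite -mulrA ler_wpM2l.
apply: (@le_trans _ _ 0); first by rewrite nmulr_rle0// sqn_ge0.
by rewrite divr_ge0.
Unshelve. all: by end_near. Qed.
End lip_meas.

(** * Existence and Lipschitz dependence of the tilt *)

Section tilt_existence.
Context {R : realType} (V : perturbation R) (p n : nat) (A : 'M[R]_(p, n)) (C2 : R).
Notation psi := (pot V).
Notation B := (bnd V).
Hypothesis C2_gt0 : 0 < C2.
Hypothesis A_lb : forall s : 'rV_p, sqn s <= C2 * sqn (s *m A).

(** Dual functional of the moment problem: convex in [c], its critical points are the tilts whose
    mean vector has the same averages as [y]. *)
Definition tilt_energy (y : 'rV[R]_n) (c : 'rV[R]_p) : R :=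
 \sum_k log_mgf psi ((c *m A) 0 k) - dot (c *m A) y.

Lemma tilt_energy_continuous y : continuous (tilt_energy y).
have cl k : continuous (fun c : 'rV[R]_p => (c *m A) 0 k).
 rewrite (_ : (fun c => _) = fun c : 'rV[R]_p => \sum_j c 0 j * A j k); last first.
  by apply: funext => c; rewrite mxE.
 apply: (cts_sum (F := fun j (c : 'rV[R]_p) => c 0 j * A j k)) => j c.
 apply: (continuous_comp (f := fun c : 'rV[R]_p => c 0 j) (g := fun t : R => t * A j k)).
  by have := @coord_continuous R 1 p 0 j c; exact.
 by apply: cvgM; [exact: cvg_id|exact: cvg_cst].
have c1 : continuous (fun c : 'rV[R]_p => \sum_k log_mgf psi ((c *m A) 0 k)).
 apply: (cts_sum (F := fun k (c : 'rV[R]_p) => log_mgf psi ((c *m A) 0 k))) => k d.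
 apply: (continuous_comp (cl k d)).
 exact: (der_cts (der_log_mgf V)).
move=> c; apply: (continuousB (c1 c)); move: c.
apply: (cts_sum (F := fun k (c : 'rV[R]_p) => (c *m A) 0 k * y 0 k)) => k d.
apply: (continuous_comp (g := fun t : R => t * y 0 k) (cl k d)).
by apply: cvgM; [exact: cvg_id|exact: cvg_cst].
Qed.

Lemma tilt_energy_lb y : exists D, forall c, sqn c / (4 * C2) - D <= tilt_energy y c.
exists (\sum_k (((slope V) + y 0 k) ^+ 2 + (B + ln (normal_peak 1)))) => c.
have h : sqn c / (4 * C2) <= sqn (c *m A) / 4.
 rewrite ler_pdivrMr ?mulr_gt0// mulrA mulrVK ?unitfE// mulrC.
 by rewrite mulrC; apply: le_trans (A_lb c) _; rewrite mulrC.
set D := \sum_k _; apply: (@le_trans _ _ (sqn (c *m A) / 4 - D)); first by rewrite lerD2r.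
rewrite {}/D /tilt_energy sqnE mulr_suml -!sumrB; apply: ler_sum => k _.
apply: le_trans (_ : ((c *m A) 0 k - slope V) ^+ 2 / 2 - (B + ln (normal_peak 1)) - (c *m A) 0 k * y 0 k <= _).
 rewrite -subr_ge0; move: ((c *m A) 0 k) (slope V) (y 0 k) (B + _) => l a' y' b'.
 rewrite (_ : _ - _ = (l / 2 - (a' + y')) ^+ 2 + a' ^+ 2 / 2); last by field.
 by rewrite addr_ge0 ?sqr_ge0// divr_ge0 ?sqr_ge0.
by rewrite lerD2r; exact: log_mgf_lb.
Qed.

(** A minimiser over a large cube is global by coercivity, and stationarity is read off a quadratic
    upper bound along each coordinate. *)
Lemma tilt_exists (y : 'rV[R]_n) : exists c : 'rV[R]_p, mvec V (c *m A) *m A^T = y *m A^T.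
have [D PD] := tilt_energy_lb y.
(* Outside the cube of half-width [rad] the lower bound [sqn c / (4 * C2) - D] is at least the
   energy at 0, since [rad <= rad ^ 2]. *)
pose rad := 1 + 4 * C2 * (`|tilt_energy y 0| + `|D|).
have rad1 : 1 <= rad by rewrite lerDl mulr_ge0 ?addr_ge0// mulr_ge0// ltW.
pose K := [set v : 'rV[R]_p | forall i, `[- rad, rad]%classic (v ord0 i)].
have cK : compact K by exact: (@rV_compact R p (fun=> `[- rad, rad]%classic) (fun=> @segment_compact _ _ _)).
have K0 : K 0 by move=> i; rewrite /= mxE in_itv/= oppr_le0 andbb (le_trans ler01).
have [|c cK' cmin] := EVT_min_rV (ex_intro _ _ K0) cK (f := tilt_energy y).
 exact/continuous_subspaceT/tilt_energy_continuous.
have glob d : tilt_energy y c <= tilt_energy y d.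
 have [dK|dK] := pselect (K d); first by apply: cmin; rewrite inE.
 have c0 : tilt_energy y c <= tilt_energy y 0 by apply: cmin; rewrite inE.
 apply: (le_trans c0); apply: le_trans (PD d).
 have [i di] : exists i, rad < `|d 0 i|.
  apply/not_existsP => H; apply: dK => i; rewrite /= in_itv/=.
  by have /negP := H i; rewrite -leNgt ler_norml.
 have : rad ^+ 2 <= sqn d.
  rewrite sqnE (bigD1 i)//= -[X in _ <= X + _]real_normK ?num_real//.
  apply: le_trans (_ : `|d 0 i| ^+ 2 <= _).
   by rewrite lerXn2r ?nnegrE ?(ltW di)// (le_trans ler01).
  by rewrite lerDl sumr_ge0// => j _; rewrite sqr_ge0.
 move=> h; rewrite lerBrDr ler_pdivlMr ?mulr_gt0//; apply: le_trans h.
 apply: le_trans (_ : rad <= _); last first.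
  by rewrite expr2 ler_peMr// (le_trans ler01).
 rewrite /rad mulrC; apply: ler_wpDl => //; rewrite ler_wpM2l ?mulr_ge0 ?(ltW C2_gt0)//.
 by rewrite lerD ?ler_norm.
exists c; apply/rowP => i.
set lam := c *m A.
pose g := \sum_k (mean V (lam 0 k) - y 0 k) * A i k.
suff g0 : g = 0.
 move/eqP: g0; rewrite /g; under eq_bigr do rewrite mulrBl.
 rewrite sumrB subr_eq0 => /eqP e; rewrite !mxE; transitivity (\sum_k mean V (lam 0 k) * A i k).
  by apply: eq_bigr => k _; rewrite !mxE.
 by rewrite e; apply: eq_bigr => k _; rewrite !mxE.
pose Lc := 2 + 4 * B ^+ 2; pose Q := Lc * \sum_k A i k ^+ 2.
have Q0 : 0 <= Q by rewrite mulr_ge0 ?addr_ge0 ?mulr_ge0 ?sqr_ge0// sumr_ge0// => k _; rewrite sqr_ge0.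
have key s : 0 <= s * g + Q * s ^+ 2.
 have := glob (c + s *: delta_mx 0 i); rewrite /tilt_energy mulmxDl -scalemxAl -rowE -/lam.
 rewrite -subr_ge0 => /le_trans; apply.
 rewrite dotDl dotZl.
 have alg (X Y d e : R) : X - (d + e) - (Y - d) = X - Y - e by ring.
 rewrite alg -sumrB /dot mulr_sumr -sumrB /g /Q mulr_sumr -mulrA mulr_suml mulr_sumr -big_split/=.
 apply: ler_sum => k _.
 rewrite mxE [X in log_mgf _ (_ + X)]mxE [row i A 0 k]mxE.
 have := log_mgf_fenchel V (lam 0 k + s * A i k) (lam 0 k).
 rewrite opprD addrA subrr sub0r.
 have := mean_lip V (lam 0 k + s * A i k) (lam 0 k).
 rewrite [lam 0 k + _ - _]addrAC subrr add0r -/Lc.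
 set L1 := log_mgf _ _; set L2 := log_mgf _ _; set m1 := mean _ _; set m2 := mean _ _; set sa := s * A i k.
 move=> h1 h2; have h3 : (m1 - m2) * sa <= Lc * sa ^+ 2.
  apply: le_trans (ler_norm _) _; rewrite normrM -[in leRHS](real_normK (num_real sa)) expr2 mulrA.
  by rewrite ler_wpM2r.
 have -> : s * (A i k * y 0 k) = sa * y 0 k by rewrite /sa; ring.
 have -> : s * ((m2 - y 0 k) * A i k) + Lc * (A i k ^+ 2 * s ^+ 2) = m2 * sa - sa * y 0 k + Lc * sa ^+ 2.
  by rewrite /sa; ring.
 clearbody L1 L2 m1 m2 sa; move: h2 h3; move: (sa * y 0 k) (Lc * sa ^+ 2) => u w.
 by rewrite mulrN mulrBl; move: (m1 * sa) (m2 * sa) => *; lra.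
(* At this [s] the quadratic equals [- g ^ 2 / (Q + 1) ^ 2], which forces [g = 0]. *)
have := key (- g / (Q + 1)).
rewrite (_ : _ + _ = - (g ^+ 2 / (Q + 1) ^+ 2)); last first.
 by field; rewrite gt_eqF// ltr_wpDl.
rewrite oppr_ge0 pmulr_lle0 ?invr_gt0 ?exprn_gt0 ?ltr_wpDl// => g2.
by apply/eqP; rewrite -sqrf_eq0 eq_le g2 sqr_ge0.
Qed.

(** Chosen from a set that depends on [y] only through [y *m A^T], so that the choice is constant on
    fibers ([tiltc_eq]). *)
Definition tiltc (y : 'rV[R]_n) : 'rV[R]_p :=
 xget 0 [set c | mvec V (c *m A) *m A^T = y *m A^T].

Lemma tiltcP y : mvec V (tiltc y *m A) *m A^T = y *m A^T.
by rewrite /tiltc; case: xgetP => [c -> //|] /(_ _) H; have [c cP] := tilt_exists y; case: (H c). Qed.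

Lemma tiltc_eq y z : y *m A^T = z *m A^T -> tiltc y = tiltc z.
by rewrite /tiltc => ->. Qed.

Lemma mvec_mono (u v : 'rV[R]_n) :
 sqn (u - v) <= (3 + 4 * B ^+ 2) * dot (u - v) (mvec V u - mvec V v).
have k0 : 0 < 3 + 4 * B ^+ 2 by rewrite ltr_pwDl// mulr_ge0 ?sqr_ge0.
rewrite sqnE /dot mulr_sumr; apply: ler_sum => k _; rewrite !mxE.
by have := mean_mono V (u 0 k) (v 0 k); rewrite ler_pdivrMl.
Qed.

Lemma mvec_lipschitz (u v : 'rV[R]_n) :
 sqn (mvec V u - mvec V v) <= (2 + 4 * B ^+ 2) ^+ 2 * sqn (u - v).
rewrite !sqnE mulr_sumr; apply: ler_sum => k _; rewrite !mxE.
rewrite -(real_normK (num_real (mean _ _ - _))) -(real_normK (num_real (u 0 k - _))) -exprMn.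
have L0 : 0 <= 2 + 4 * B ^+ 2 by rewrite addr_ge0// mulr_ge0 ?sqr_ge0.
by rewrite lerXn2r ?nnegrE ?mean_lip// mulr_ge0.
Qed.

(** Strong monotonicity of [mvec] tested with [c - d], together with the lower frame bound. *)
Lemma tilt_lipschitz (c d : 'rV[R]_p) (y z : 'rV[R]_n) :
 mvec V (c *m A) *m A^T = y *m A^T -> mvec V (d *m A) *m A^T = z *m A^T ->
 sqn (c - d) <= (C2 * (3 + 4 * B ^+ 2)) ^+ 2 * sqn ((y - z) *m A^T).
move=> cy dz; set k := C2 * (3 + 4 * B ^+ 2).
have k0 : 0 <= k by rewrite mulr_ge0 ?(ltW C2_gt0)// addr_ge0// mulr_ge0 ?sqr_ge0.
have h : sqn (c - d) <= k * dot (c - d) ((y - z) *m A^T).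
 apply: le_trans (A_lb _) _; rewrite /k -mulrA ler_wpM2l ?(ltW C2_gt0)//.
 rewrite mulmxBl; apply: le_trans (mvec_mono _ _) _.
 have e : (mvec V (c *m A) - mvec V (d *m A)) *m A^T = (y - z) *m A^T.
  by rewrite mulmxBl [RHS]mulmxBl; exact: (f_equal2 (fun u v => u - v) cy dz).
 by rewrite -(mulmxBl c d A) dot_mul e.
have := dot_young (c - d) (k *: ((y - z) *m A^T)); rewrite dotZr sqnZ.
by move: (sqn (c - d)) (k * dot _ _) (k ^+ 2 * _) h => *; lra.
Qed.

Lemma tiltc_lipschitz y z : sqn (tiltc y - tiltc z) <= (C2 * (3 + 4 * B ^+ 2)) ^+ 2 * sqn ((y - z) *m A^T).
exact: tilt_lipschitz (tiltcP y) (tiltcP z). Qed.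
End tilt_existence.

Lemma mulmx_ub (R : realType) (n m : nat) (M : 'M[R]_(n, m)) :
 exists2 C, 0 < C & forall x : 'rV[R]_n, sqn (x *m M) <= C * sqn x.
exists (1 + \sum_j \sum_i M i j ^+ 2).
 by rewrite ltr_pwDl// sumr_ge0// => j _; apply: sumr_ge0 => i _; exact: sqr_ge0.
move=> x; rewrite mulrDl mul1r; apply: ler_wpDl; first exact: sqn_ge0.
rewrite sqnE mulr_suml; apply: ler_sum => j _.
have -> : (x *m M) 0 j = dot x (\row_i M i j).
 by rewrite mxE; apply: eq_bigr => i _; rewrite mxE.
apply: le_trans (dot_cs _ _) _; rewrite mulrC ler_wpM2r ?sqn_ge0//.
by rewrite sqnE le_eqVlt; apply/orP; left; apply/eqP; apply: eq_bigr => i _; rewrite mxE.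
Qed.

Lemma integral_gt0 d (T : measurableType d) (R : realType) (m : {measure set T -> \bar R})
  (f : T -> \bar R) : measT f -> (forall x, 0 < f x)%E -> (0 < m setT)%E ->
 (0 < \int[m]_x f x)%E.
move=> mf f0 m0; rewrite lt_def integral_ge0 ?andbT; last by move=> x _; exact: ltW.
apply/eqP => If; move: m0; rewrite lt_neqAle => /andP[/eqP m0 _]; apply: m0.
have : (\int[m]_x `|f x| = 0)%E.
 by rewrite -[RHS]If; apply: eq_integral => x _; rewrite gee0_abs// ltW.
move/(ae_eq_integral_abs m measurableT mf) => [N [mN N0 sN]].
apply/esym/eqP; rewrite eq_le measure_ge0 andbT -N0 le_measure ?inE//.
by move=> x _; apply: sN => /= /(_ I) fx; have := f0 x; rewrite fx ltxx.
Qed.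

Lemma is_derive_affine (R : realType) (g dg : R -> R) (b c t : R) :
 (forall z : R, is_derive z 1 g (dg z)) -> is_derive t 1 (fun s => g (b + s * c)) (dg (b + t * c) * c).
move=> Dg.
have Da : is_derive t 1 (fun s => b + s * c) c.
 by apply: is_derive_eq; rewrite /GRing.scale/=; ring.
exact: (@is_derive1_comp _ g (fun s => b + s * c) t _ _ (Dg _) Da).
Qed.

(** * Functions of linear and quadratic growth *)

Section growth_classes.
Context {R : realType} (n : nat).
Implicit Types F G : 'rV[R]_n -> R.

Definition qgr F := measT F /\
 exists2 C, 0 <= C & forall x, `|F x| <= C * (1 + sqn x).
(** Stated through squares to match [sqn]. Products of two such functions lie in [qgr], the class on
    which conditional expectations are shown to be linear. *)
Definition lgr F := measT F /\
 exists2 C, 0 <= C & forall x, F x ^+ 2 <= C * (1 + sqn x).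

Lemma sqn1_ge1 (x : 'rV[R]_n) : 1 <= 1 + sqn x.
by rewrite lerDl sqn_ge0. Qed.

Lemma qgr_cst c : qgr (fun=> c).
split; first exact: measurable_cst.
by exists `|c| => // x; rewrite -[leLHS]mulr1 ler_wpM2l// sqn1_ge1.
Qed.

Lemma qgrD F G : qgr F -> qgr G -> qgr (fun x => F x + G x).
move=> [mF [C C0 FC]] [mG [D D0 GD]]; split; first exact: measTD.
exists (C + D); first exact: addr_ge0.
by move=> x; apply: le_trans (ler_normD _ _) _; rewrite mulrDl lerD.
Qed.

Lemma qgrZ c F : qgr F -> qgr (fun x => c * F x).
move=> [mF [C C0 FC]]; split; first exact: measTM.
exists (`|c| * C); first exact: mulr_ge0.
by move=> x; rewrite normrM -mulrA ler_wpM2l.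
Qed.

Lemma qgrN F : qgr F -> qgr (fun x => - F x).
by move=> /(qgrZ (-1)); under eq_fun do rewrite mulN1r. Qed.

Lemma qgrB F G : qgr F -> qgr G -> qgr (fun x => F x - G x).
by move=> qF qG; apply: qgrD => //; exact: qgrN. Qed.

Lemma qgr_sum (I : Type) (s : seq I) (F : I -> 'rV[R]_n -> R) :
 (forall i, qgr (F i)) -> qgr (fun x => \sum_(i <- s) F i x).
move=> qF; elim: s => [|i s IH].
 by under eq_fun do rewrite big_nil; exact: qgr_cst.
by under eq_fun do rewrite big_cons; exact: qgrD.
Qed.

Lemma lgr_cst c : lgr (fun=> c).
split; first exact: measurable_cst.
by exists (c ^+ 2) => [|x]; [exact: sqr_ge0|rewrite -[leLHS]mulr1 ler_wpM2l ?sqr_ge0// sqn1_ge1].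
Qed.

Lemma lgrD F G : lgr F -> lgr G -> lgr (fun x => F x + G x).
move=> [mF [C C0 FC]] [mG [D D0 GD]]; split; first exact: measTD.
exists (2 * C + 2 * D); first by rewrite addr_ge0// mulr_ge0.
move=> x; apply: (@le_trans _ _ (2 * F x ^+ 2 + 2 * G x ^+ 2)).
 rewrite -subr_ge0 (_ : _ - _ = (F x - G x) ^+ 2); first exact: sqr_ge0.
 by ring.
by rewrite [leRHS]mulrDl -[X in _ <= X + _]mulrA -[X in _ <= _ + X]mulrA lerD// ler_wpM2l.
Qed.

Lemma lgrZ c F : lgr F -> lgr (fun x => c * F x).
move=> [mF [C C0 FC]]; split; first exact: measTM.
exists (c ^+ 2 * C); first by rewrite mulr_ge0 ?sqr_ge0.
by move=> x; rewrite exprMn -[leRHS]mulrA ler_wpM2l ?sqr_ge0.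
Qed.

Lemma lgrowthN F : lgr F -> lgr (fun x => - F x).
by move=> /(lgrZ (-1)); under eq_fun do rewrite mulN1r. Qed.

Lemma lgrB F G : lgr F -> lgr G -> lgr (fun x => F x - G x).
by move=> qF qG; apply: lgrD => //; exact: lgrowthN. Qed.

Lemma lgr_sum (I : Type) (s : seq I) (F : I -> 'rV[R]_n -> R) :
 (forall i, lgr (F i)) -> lgr (fun x => \sum_(i <- s) F i x).
move=> qF; elim: s => [|i s IH].
 by under eq_fun do rewrite big_nil; exact: lgr_cst.
by under eq_fun do rewrite big_cons; exact: lgrD.
Qed.

Lemma lgrM F G : lgr F -> lgr G -> qgr (fun x => F x * G x).
move=> [mF [C C0 FC]] [mG [D D0 GD]]; split; first exact: measTM.
exists (C + D); first exact: addr_ge0.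
move=> x; have h1 := sqr_ge0 (F x - G x); have h2 := sqr_ge0 (F x + G x).
apply: (@le_trans _ _ (F x ^+ 2 + G x ^+ 2)); last by rewrite mulrDl lerD.
have e1 : (F x - G x) ^+ 2 = F x ^+ 2 - 2 * (F x * G x) + G x ^+ 2 by ring.
have e2 : (F x + G x) ^+ 2 = F x ^+ 2 + 2 * (F x * G x) + G x ^+ 2 by ring.
have h3 := sqr_ge0 (F x); have h4 := sqr_ge0 (G x).
rewrite e1 in h1; rewrite e2 in h2; rewrite ler_norml.
move: (F x ^+ 2) (G x ^+ 2) (F x * G x) h1 h2 h3 h4 => f g fg *.
by apply/andP; split; lra.
Qed.

Lemma lgrowth_coor i : lgr (fun x => x 0 i).
split; first exact: meas_coor.
exists 1 => // x; rewrite mul1r sqnE (bigD1 i)//=.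
rewrite addrCA lerDl addr_ge0// sumr_ge0// => j _; exact: sqr_ge0.
Qed.

Lemma lgr_bounded F C : measT F -> (forall x, `|F x| <= C) -> lgr F.
move=> mF FC; split=> //; exists (C ^+ 2); first exact: sqr_ge0.
move=> x; apply: (@le_trans _ _ (C ^+ 2)); last first.
 by rewrite -[leLHS]mulr1 ler_wpM2l ?sqr_ge0// sqn1_ge1.
rewrite -(real_normK (num_real (F x))) lerXn2r ?nnegrE//.
exact: le_trans (FC x).
Qed.

Lemma lgr_dot (u : 'rV[R]_n -> 'rV[R]_n) (v : 'rV[R]_n) :
 (forall i, lgr (fun x => u x 0 i)) -> lgr (fun x => dot (u x) v).
move=> lu; apply: (@lgr_sum _ _ (fun i x => u x 0 i * v 0 i)) => i.
by have := lgrZ (v 0 i) (lu i); under eq_fun do rewrite mulrC.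
Qed.

Lemma lgr_mul p q (u : 'rV[R]_n -> 'rV[R]_p) (M : 'M[R]_(p, q)) j :
 (forall i, lgr (fun x => u x 0 i)) -> lgr (fun x => (u x *m M) 0 j).
move=> lu; under eq_fun do rewrite mxE.
apply: (@lgr_sum _ _ (fun i x => u x 0 i * M i j)) => i.
by have := lgrZ (M i j) (lu i); under eq_fun do rewrite mulrC.
Qed.

Lemma qgr_sqn p (u : 'rV[R]_n -> 'rV[R]_p) :
 (forall i, lgr (fun x => u x 0 i)) -> qgr (fun x => sqn (u x)).
by move=> lu; apply: (@qgr_sum _ _ (fun i x => u x 0 i * u x 0 i)) => i; exact: lgrM.
Qed.
End growth_classes.

(** * Conditional Gibbs expectations on a fiber *)

Section gibbs.
Context {R : realType} (V : perturbation R) (n d : nat) (A : 'M[R]_(d, n)).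
Hypothesis A_free : row_free A.
Hypothesis d_gt0 : (0 < d)%N.
Variable x0 : 'rV[R]_n.
Notation psi := (pot V).
Notation B := (bnd V).
Notation m := (fiberm A).
Implicit Types (x y v : 'rV[R]_n) (F G : 'rV[R]_n -> R).

Definition weight x : R := expR (- hamiltonian psi x).

Lemma weight_gt0 x : 0 < weight x. exact: expR_gt0. Qed.

Lemma meas_weight : measT weight.
apply: measT_comp => //; apply: measT_comp => //; apply: measurable_sum => i.
apply: (measT_comp (f := psi)); last exact: meas_coor.
exact: cts_measT (@cpsi R V).
Qed.

Lemma hamiltonian_lb x : sqn x / 4 - n%:R * (slope V ^+ 2 + B) <= hamiltonian psi x.
have -> : n%:R * (slope V ^+ 2 + B) = \sum_(i < n) (slope V ^+ 2 + B).
 by rewrite sumr_const card_ord mulr_natl.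
rewrite sqnE mulr_suml -sumrB.
apply: ler_sum => i _; rewrite /potential.
have := pert_ub V (x 0 i); rewrite ler_norml => /andP[+ _].
have := sqr_ge0 (x 0 i / 2 + slope V).
have -> : (x 0 i / 2 + slope V) ^+ 2 = x 0 i ^+ 2 / 4 + slope V * x 0 i + slope V ^+ 2 by field.
by move: (x 0 i ^+ 2) (slope V * x 0 i) (slope V ^+ 2) (pert V _) B => *; lra.
Qed.

Lemma gibbs_integrable : (\int[m]_x ((1 + sqn (x0 + x)) * weight (x0 + x))%:E < +oo)%E.
have [Ca Ca0 CaP] := mulmx_ub (pinvmx A).
pose D := n%:R * (slope V ^+ 2 + B).
(* From [1 + s <= 8 expR (s / 8)], [hamiltonian_lb] and [sqn x <= 2 sqn (x0 + x) + 2 sqn x0], the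
   exponent that remains is [- sqn x / 16]; [e] turns it into a Gaussian in the coordinates along
   the fiber. *)
pose K := 8 * expR (D + sqn x0 / 8).
pose e := (16 * Ca)^-1.
have e0 : 0 < e by rewrite invr_gt0 mulr_gt0.
pose phi (i : 'I_d) (t : R) := (expR (- (e * t ^+ 2)))%:E.
have mphi i : measT (phi i).
 apply/measT_EFin; apply: measT_comp => //; apply: measT_comp => //.
 by apply: measTM => //; exact: measurable_funX.
have phi0 i t : (0 <= phi i t)%E by rewrite lee_fin expR_ge0.
have mprod : measT (fun x : 'rV[R]_n => \prod_(i < d) phi i (coords A i x))%E.
 by apply: meas_prode => i; apply: (measT_comp (mphi i)); exact: meas_coords.
have prod0 x : (0 <= \prod_(i < d) phi i (coords A i x))%E by apply: prode_ge0 => i _; exact: phi0.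
have K0 : 0 <= K by rewrite mulr_ge0// expR_ge0.
apply: (@le_lt_trans _ _ (\int[m]_x (K%:E * \prod_(i < d) phi i (coords A i x)))%E).
 have ms : measT (fun x => ((1 + sqn (x0 + x)) * weight (x0 + x))%:E).
  apply/measT_EFin; apply: measTM.
   apply: measTD => //; apply: meas_sqn => i; under eq_fun do rewrite mxE.
   by apply: measTD => //; exact: meas_coor.
  by apply: (measT_comp meas_weight); exact: meas_transll.
 apply: ge0_le_integral => //.
 - by move=> x _; rewrite lee_fin mulr_ge0 ?(ltW (weight_gt0 _))// addr_ge0 ?sqn_ge0.
 - exact: emeasTM.
 move=> x _; rewrite prodEFin -expR_sum -EFinM lee_fin.
 set y := x0 + x.
 have h1 : 1 + sqn y <= 8 * expR (sqn y / 8).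
  by have := expR_ge1Dx (sqn y / 8); have := sqn_ge0 y; move: (sqn y) (expR _) => *; lra.
 apply: (@le_trans _ _ (8 * expR (sqn y / 8) * weight y)).
  by rewrite ler_wpM2r// ltW// weight_gt0.
 rewrite /weight /K -!mulrA ler_wpM2l// -!expRD ler_expR.
 have := hamiltonian_lb y; rewrite -/D.
 rewrite sumrN -mulr_sumr.
 have -> : \sum_(i < d) coords A i x ^+ 2 = sqn (x *m pinvmx A) by rewrite sqnE.
 have h2 : e * sqn (x *m pinvmx A) <= sqn x / 16.
  by rewrite [leRHS]mulrC /e invfM -mulrA ler_wpM2l ?invr_ge0// ler_pdivrMl.
 have h3 : sqn x <= 2 * sqn y + 2 * sqn x0.
  rewrite (_ : x = y + - x0); last by rewrite /y addrAC subrr add0r.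
  by apply: le_trans (sqnD _ _) _; rewrite sqnN.
 by move: h2 h3; move: (e * _) (sqn x) (sqn y) (sqn x0) (hamiltonian _ _) => *; lra.
rewrite ge0_integralZl// (int_fiberm A_free mprod prod0) dint_rows_prod//.
have [G G0 GE] := int_gauss e0.
rewrite (eq_bigr (fun=> G%:E)) ?prodEFin => [|i _]; last by rewrite -GE.
have := hmeas_ubox_lty A; have := hausdorff_ge0 d (ubox A).
by case: (hausdorff _ _) => [h _ _||]//; rewrite -!EFinM ltry.
Qed.

Lemma fiberm_gt0 : (0 < m setT)%E.
have h : (0 < \int[m]_x box A x)%E.
 rewrite int_fiberm//; last 2 first.
 - exact: meas_box.
 - by move=> x; exact: box_ind_ge0.
 by rewrite dint_box// mule1 hausdorff_ubox_gt0.
apply: (lt_le_trans h); apply: (@le_trans _ _ (\int[m]_x (cst 1) x)%E).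
 apply: ge0_le_integral => //.
 - by move=> x _; exact: box_ind_ge0.
 - exact: meas_box.
 move=> x _; rewrite box_prod prodEFin lee_fin.
 by apply: prodr_ile1 => i _; rewrite indicE; case: (_ \in _); rewrite ?ler01 ?lexx.
by rewrite integral_cst// mul1e.
Qed.

Definition gibbs_int F : R := \int[m]_x (F (x0 + x) * weight (x0 + x)).
Definition Zf : R := gibbs_int (fun=> 1).
Definition Ef F : R := gibbs_int F / Zf.

Lemma meas_gibbs F : measT F ->
 measT (fun x => (F (x0 + x) * weight (x0 + x))%:E).
move=> mF; apply/measT_EFin; apply: measTM.
 by apply: (measT_comp mF); exact: meas_transll.
by apply: (measT_comp meas_weight); exact: meas_transll.
Qed.

Lemma intble_gibbs F : qgr F ->
 m.-integrable setT (EFin \o (fun x => F (x0 + x) * weight (x0 + x))).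
move=> [mF [C C0 FC]]; apply/integrableP; split; first exact: meas_gibbs.
have mQ : measT (fun x : 'rV[R]_n => 1 + sqn x).
 by apply: measTD => //; apply: meas_sqn => i; exact: meas_coor.
have Q0 x : (0 <= ((1 + sqn (x0 + x)) * weight (x0 + x))%:E)%E.
 by rewrite lee_fin mulr_ge0 ?(ltW (weight_gt0 _))// addr_ge0 ?sqn_ge0.
apply: (@le_lt_trans _ _ (\int[m]_x (C%:E * ((1 + sqn (x0 + x)) * weight (x0 + x))%:E))%E).
 apply: ge0_le_integral => //.
 - by apply: measT_comp => //; exact: meas_gibbs.
 - by apply: emeasTM => //; exact: meas_gibbs mQ.
 move=> x _; rewrite -EFinM lee_fin normrM (ger0_norm (ltW (weight_gt0 _))) mulrA.
 by rewrite ler_wpM2r// ltW// weight_gt0.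
rewrite ge0_integralZl//; try exact: (meas_gibbs mQ).
have h := gibbs_integrable; have h0 : (0 <= \int[m]_x ((1 + sqn (x0 + x)) * weight (x0 + x))%:E)%E.
 by apply: integral_ge0 => x _.
by move: h h0; case: (\int[m]_x _)%E => [r _ _||]//; rewrite -EFinM ltry.
Qed.

Lemma int_weightE : (\int[m]_x (weight (x0 + x))%:E)%E = Zf%:E.
rewrite /Zf /gibbs_int /Rintegral fineK.
 by apply: eq_integral => x _; rewrite mul1r.
exact: (integrable_fin_num measurableT (intble_gibbs (qgr_cst _ 1))).
Qed.

Lemma Zf_gt0 : 0 < Zf.
rewrite -lte_fin -int_weightE; apply: integral_gt0.
- by have := meas_gibbs (measurable_cst (1 : R)); under eq_fun do rewrite mul1r.
- by move=> x; rewrite lte_fin weight_gt0.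
- exact: fiberm_gt0.
Qed.

Lemma EfD F G : qgr F -> qgr G -> Ef (fun x => F x + G x) = Ef F + Ef G.
move=> qF qG; rewrite /Ef -mulrDl; congr (_ / _); rewrite /gibbs_int -RintegralD//; [|exact: intble_gibbs..].
by apply: eq_Rintegral => x _; rewrite mulrDl.
Qed.

Lemma EfZ c F : qgr F -> Ef (fun x => c * F x) = c * Ef F.
move=> qF; rewrite /Ef mulrA; congr (_ / _); rewrite /gibbs_int -RintegralZl//; last exact: intble_gibbs.
by apply: eq_Rintegral => x _; rewrite mulrA.
Qed.

Lemma EfN F : qgr F -> Ef (fun x => - F x) = - Ef F.
by move=> qF; rewrite -mulN1r -EfZ//; congr Ef; apply: funext => x; rewrite mulN1r. Qed.

Lemma EfB F G : qgr F -> qgr G -> Ef (fun x => F x - G x) = Ef F - Ef G.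
by move=> qF qG; rewrite EfD ?EfN//; exact: qgrN. Qed.

Lemma Ef_cst c : Ef (fun=> c) = c.
rewrite -[RHS]mulr1 (_ : (fun=> c) = (fun x : 'rV[R]_n => c * 1)); last first.
 by apply: funext => x; rewrite mulr1.
rewrite EfZ; last exact: qgr_cst.
by rewrite /Ef divff// lt0r_neq0// Zf_gt0.
Qed.

Lemma Ef_sum (I : Type) (s : seq I) (F : I -> 'rV[R]_n -> R) : (forall i, qgr (F i)) ->
 Ef (fun x => \sum_(i <- s) F i x) = \sum_(i <- s) Ef (F i).
move=> qF; elim: s => [|i s IH].
 by under eq_fun do rewrite big_nil; rewrite Ef_cst big_nil.
under eq_fun do rewrite big_cons.
by rewrite EfD// ?IH ?big_cons//; exact: qgr_sum.
Qed.

Lemma le_Ef F G : qgr F -> qgr G -> (forall x, F x <= G x) -> Ef F <= Ef G.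
move=> qF qG FG; rewrite /Ef ler_wpM2r ?invr_ge0 ?(ltW Zf_gt0)//.
apply: le_Rintegral => //; [exact: intble_gibbs..|].
by move=> x _; rewrite ler_wpM2r// ltW// weight_gt0.
Qed.

(** The expectation is written on the ambient space; a correction supported off the fiber restores
    the inequality everywhere and has expectation zero. *)
Lemma le_Ef_fiber F G : qgr F -> qgr G ->
 (forall x, rowsp A (x - x0) -> F x <= G x) -> Ef F <= Ef G.
move=> qF qG FG; have [mF [C C0 FC]] := qF; have [mG [D D0 GD]] := qG.
pose off x : R := \1_(~` rowsp A) (x - x0).
have moff : measT off.
 apply: (measT_comp (f := (\1_(~` rowsp A) : 'rV[R]_n -> R))).
  by apply: measurable_indic; apply: measurableC; exact: meas_rowsp.
 exact: meas_transl.
pose K x := off x * (`|F x| + `|G x|).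
have mK : measT K.
 by apply: measTM => //; apply: measTD; exact: measT_comp.
have off01 x : 0 <= off x <= 1 by rewrite /off indicE; case: (_ \in _); rewrite ?ler01 ?lexx.
have qK : qgr K.
 split=> //; exists (C + D); first exact: addr_ge0.
 move=> x; have /andP[ho0 ho1] := off01 x.
 rewrite ger0_norm ?mulr_ge0 ?addr_ge0// mulrDl -[leRHS]mul1r.
 by apply: ler_pM => //; exact: lerD.
apply: (@le_trans _ _ (Ef (fun x => G x + K x))).
 apply: le_Ef => //; first exact: qgrD.
 move=> x; rewrite /K /off indicE; have [xA|xA] := pselect (rowsp A (x - x0)).
  by rewrite memNset ?mul0r ?addr0; [exact: FG|exact].
 rewrite mem_set// mul1r; apply: le_trans (ler_norm _) _.
 by rewrite addrCA lerDl -[X in _ <= X + _]opprK addrC subr_ge0 lerNl; have := ler_norm (- G x); rewrite normrN lerNl.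
have mKw := meas_gibbs mK.
have K0 x : 0 <= K x by have /andP[ho0 _] := off01 x; rewrite mulr_ge0// addr_ge0.
rewrite EfD// [X in _ + X](_ : _ = 0) ?addr0//.
rewrite /Ef /gibbs_int /Rintegral (@eq_int_fiberm _ _ _ A _ (fun=> 0%E))//.
- by rewrite integral0/= mul0r.
- by move=> x; rewrite lee_fin mulr_ge0// ltW// weight_gt0.
- move=> x xA; rewrite /K /off indicE memNset ?mul0r//.
 by move=> H; apply: H; rewrite addrAC subrr add0r.
Qed.

Notation dH := (dH V).

Lemma lgr_psi1vec i : lgr (fun x => dH x 0 i).
under eq_fun do rewrite mxE.
apply: lgrD; first by apply: lgrD; [exact: lgrowth_coor|exact: lgr_cst].
apply: (lgr_bounded (C := B)) => [|x]; last exact: pert1_ub.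
apply: (measT_comp (f := pert1 V)); last exact: meas_coor.
exact: cts_measT (@cf1 R V).
Qed.

Lemma der_coor_line (g dg : R -> R) x v i (t : R) :
 (forall z : R, is_derive z 1 g (dg z)) ->
 is_derive t 1 (fun s => g ((x + s *: v) 0 i)) (dg ((x + t *: v) 0 i) * v 0 i).
move=> Dg; have := is_derive_affine (x 0 i) (v 0 i) t Dg.
rewrite !mxE; rewrite (_ : (fun s => g (x 0 i + s * v 0 i)) = (fun s => g ((x + s *: v) 0 i)))//.
by apply: funext => s; rewrite !mxE.
Qed.

Lemma der_sum_fun (I : Type) (s : seq I) (h : I -> R -> R) (dh : I -> R) (t : R) :
 (forall i, is_derive t 1 (h i) (dh i)) ->
 is_derive t 1 (fun u => \sum_(i <- s) h i u) (\sum_(i <- s) dh i).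
move=> Dh; elim: s => [|i s IH].
 rewrite big_nil (_ : (fun u => _) = cst 0); last by apply: funext => u; rewrite big_nil.
 exact: is_derive_cst.
rewrite big_cons (_ : (fun u => _) = h i + (fun u => \sum_(j <- s) h j u)); last first.
 by apply: funext => u; rewrite big_cons.
exact: is_deriveD.
Qed.

Lemma der_weight x v (t : R) :
 is_derive t 1 (fun s => weight (x + s *: v)) (- dot (dH (x + t *: v)) v * weight (x + t *: v)).
have Dh : is_derive t 1 (fun s => hamiltonian psi (x + s *: v)) (dot (dH (x + t *: v)) v).
 rewrite /dot (eq_bigr (fun i => psi1 V ((x + t *: v) 0 i) * v 0 i)); last by move=> i _; rewrite mxE.
 apply: (@der_sum_fun _ _ (fun i s => psi ((x + s *: v) 0 i))) => i.
 by apply: der_coor_line; exact: der_psi.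
rewrite /weight (_ : (fun s => _) = expR \o (fun s => - hamiltonian psi (x + s *: v)))//.
apply: is_derive_eq; rewrite /GRing.scale/=; ring.
Qed.

(** Translation along a vector of the row space preserves the fiber measure, so the flow lemma
    applies to [G * weight]. *)
Lemma fiber_ibp (c : 'rV[R]_d) G dG : let v := c *m A in
 lgr G -> qgr dG ->
 (forall x (t : R), is_derive t 1 (fun s => G (x + s *: v)) (dG (x + t *: v))) ->
 (forall x, continuous (fun t : R => dG (x + t *: v))) ->
 Ef dG = Ef (fun x => G x * dot (dH x) v).
move=> v lG qdG DG cdG.
have qGp : qgr (fun x => G x * dot (dH x) v).
 by apply: lgrM => //; apply: lgr_dot; exact: lgr_psi1vec.
have qG : qgr G.
 by have := lgrM lG (lgr_cst _ 1); under eq_fun do rewrite mulr1.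
apply/eqP; rewrite -subr_eq0 -EfB//; apply/eqP.
pose Phi x := G (x0 + x) * weight (x0 + x).
pose dPhi x := (dG (x0 + x) - G (x0 + x) * dot (dH (x0 + x)) v) * weight (x0 + x).
suff h : (\int[m]_x (dPhi x)%:E = 0)%E by rewrite /Ef /gibbs_int /Rintegral h/= mul0r.
have line x t : x0 + (x + t *: v) = (x0 + x) + t *: v by rewrite addrA.
have cline (g : R -> R) x i : continuous g -> continuous (fun t : R => g ((x + t *: v) 0 i)).
 move=> cg; rewrite (_ : (fun t => _) = fun t => g (x 0 i + t * v 0 i)); last first.
  by apply: funext => t; rewrite !mxE.
 move=> t; apply: (continuous_comp (f := fun t : R => x 0 i + t * v 0 i) (g := g)); last exact: cg.
 by apply: cvgD; [exact: cvg_cst|apply: cvgM; [exact: cvg_id|exact: cvg_cst]].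
have DPhi x (t : R) : is_derive t 1 (fun s => Phi (x + s *: v)) (dPhi (x + t *: v)).
 rewrite /Phi /dPhi line (_ : (fun s => _) = fun s => G ((x0 + x) + s *: v) * weight ((x0 + x) + s *: v)); last first.
  by apply: funext => s; rewrite line.
 have D1 := DG (x0 + x) t; have D2 := der_weight (x0 + x) v t.
 apply: is_derive_eq; rewrite /GRing.scale/=; ring.
have cdPhi x : continuous (fun t : R => dPhi (x + t *: v)).
 rewrite /dPhi (_ : (fun t => _) = fun t => (dG ((x0 + x) + t *: v) -
  G ((x0 + x) + t *: v) * dot (dH ((x0 + x) + t *: v)) v) * weight ((x0 + x) + t *: v)); last first.
  by apply: funext => s; rewrite line.
 have c1 : continuous (fun t : R => G ((x0 + x) + t *: v)).
  exact: der_cts (DG (x0 + x)).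
 have c2 : continuous (fun t : R => weight ((x0 + x) + t *: v)).
  exact: der_cts (der_weight (x0 + x) v).
 have c3 : continuous (fun t : R => dot (dH ((x0 + x) + t *: v)) v).
  apply: (cts_sum (F := fun i (t : R) => dH (x0 + x + t *: v) 0 i * v 0 i)) => i t.
  apply: cvgM; last exact: cvg_cst.
  rewrite (_ : (fun t => _) = fun t => psi1 V ((x0 + x + t *: v) 0 i)); last first.
   by apply: funext => s; rewrite mxE.
  by have := cline (psi1 V) (x0 + x) i (@cpsi1 R V) t; rewrite [dH _ 0 i]mxE.
 move=> t; apply: cvgM; last exact: c2.
 by apply: cvgB; [exact: cdG|apply: cvgM; [exact: c1|exact: c3]].
apply: (@int_flow_derivative _ _ R m (fun t x => x + t *: v) _ _ Phi dPhi).
- exact: meas_line.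
- by move=> t h mh h0; rewrite -(fiberm_shift A (t *: c) mh h0); apply: eq_integral => x _; rewrite scalemxAl.
- by move=> x; rewrite scale0r addr0.
- exact: cdPhi.
- exact: intble_gibbs.
- exact: (intble_gibbs (qgrB qdG qGp)).
Qed.

Lemma Ef_psi1 (c : 'rV[R]_d) : Ef (fun x => dot (dH x) (c *m A)) = 0.
have := @fiber_ibp c (fun=> 1) (fun=> 0) (lgr_cst _ 1) (qgr_cst _ 0).
rewrite Ef_cst => ->.
- by congr Ef; apply: funext => x; rewrite mul1r.
- by move=> x t; exact: cvg_cst.
Qed.

(** Integration by parts turns the square of the force along [v] into the Hessian form of the
    Hamiltonian at [v], which is at most [(1 + B) * sqn v]. *)
Lemma Ef_psi1_sqr (c : 'rV[R]_d) :
 Ef (fun x => dot (dH x) (c *m A) ^+ 2) <= (1 + B) * sqn (c *m A).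
set v := c *m A.
pose dG x := \sum_i (1 + pert2 V (x 0 i)) * v 0 i ^+ 2.
have mp2 i : measT (fun x : 'rV[R]_n => pert2 V (x 0 i)).
 apply: (measT_comp (f := pert2 V)); last exact: meas_coor.
 exact: cts_measT (@continuous_pert2 R V).
have dGub x : dG x <= (1 + B) * sqn v.
 rewrite sqnE mulr_sumr; apply: ler_sum => i _; rewrite ler_wpM2r ?sqr_ge0//.
 by rewrite lerD2l; apply: le_trans (ler_norm _) (pert2_ub _ _).
have qdG : qgr dG.
 apply: (@qgr_sum _ _ _ _ (fun i x => (1 + pert2 V (x 0 i)) * v 0 i ^+ 2)) => i.
 apply: lgrM; last exact: lgr_cst.
 apply: lgrD; first exact: lgr_cst.
 by apply: (lgr_bounded (C := B)) => // x; exact: pert2_ub.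
have lp : lgr (fun x => dot (dH x) v) by apply: lgr_dot; exact: lgr_psi1vec.
have -> : Ef (fun x => dot (dH x) v ^+ 2) = Ef dG.
 apply/esym; apply: (@fiber_ibp c (fun x => dot (dH x) v) dG lp qdG).
 - move=> x t; rewrite /dG /dot.
  rewrite (eq_bigr (fun i => (1 + pert2 V ((x + t *: v) 0 i)) * v 0 i * v 0 i)); last by move=> i _; rewrite expr2 mulrA.
  apply: (@der_sum_fun _ _ (fun i s => dH (x + s *: v) 0 i * v 0 i)) => i.
  rewrite (_ : (fun s => _) = (fun s => psi1 V ((x + s *: v) 0 i) * v 0 i)); last first.
   by apply: funext => s; rewrite mxE.
  have D1 := der_coor_line x v i t (der_psi1 V).
  by apply: is_derive_eq; rewrite /GRing.scale/=; ring.
 - move=> x; apply: (cts_sum (F := fun i (t : R) => (1 + pert2 V ((x + t *: v) 0 i)) * v 0 i ^+ 2)) => i t.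
  rewrite (_ : (fun t => _) = fun t => (1 + pert2 V (x 0 i + t * v 0 i)) * v 0 i ^+ 2); last first.
   by apply: funext => s; rewrite !mxE.
  apply: (continuous_comp (f := fun t : R => x 0 i + t * v 0 i) (g := fun z => (1 + pert2 V z) * v 0 i ^+ 2)).
   by apply: cvgD; [exact: cvg_cst|apply: cvgM; [exact: cvg_id|exact: cvg_cst]].
  apply: cvgM; last exact: cvg_cst.
  by apply: cvgD; [exact: cvg_cst|exact: continuous_pert2].
rewrite -[leRHS]Ef_cst; apply: le_Ef => //; exact: qgr_cst.
Qed.

(** Tower property: the fiber is foliated by affine spaces parallel to [U], and a ratio bound valid
    on each of them passes to the whole. Estimates on one block given all the others thereby become
    estimates under [Ef]. *)
Lemma block_Ef q (U : 'M[R]_(q, n)) F (C : R) : row_free U -> (U <= A)%MS -> 0 <= C ->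
 qgr F -> (forall x, 0 <= F x) ->
 (forall x, dirint (rows U) (fun y => (F y * weight y)%:E) x <=
  C%:E * dirint (rows U) (fun y => (weight y)%:E) x)%E ->
 Ef F <= C.
move=> fU /submxP[D UE] C0 qF F0 H; have [mF _] := qF.
pose J (f : 'rV[R]_n -> \bar R) := (\int[m]_x f (x0 + x)%R)%E.
have mx0 := @meas_transll R n x0.
have JT : tonelli_fun J.
 move=> f mf f0; rewrite /J.
 apply: (@fubini_tonelli _ _ _ _ _ m lebesgue_measure (fun p : 'rV[R]_n * R => f (x0 + p.1, p.2))) => //.
 apply: (measT_comp mf); apply: measurable_fun_pair => //.
 by apply: (measT_comp mx0).
have Jinv c g : measT g -> (forall y, 0 <= g y)%E -> J (fun x => g (x + c *m U)) = J g.
 move=> mg g0; have mg' := measT_comp mg mx0.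
 rewrite /J -[RHS](fiberm_shift A (c *m D) mg' (fun y => g0 (x0 + y))).
 by apply: eq_integral => x _; rewrite /= UE mulmxA addrA.
have mw : measT (fun y => (weight y)%:E) by apply/measT_EFin; exact: meas_weight.
have w0 y : (0 <= (weight y)%:E)%E by rewrite lee_fin ltW// weight_gt0.
have mFw : measT (fun y => (F y * weight y)%:E).
 by apply/measT_EFin/measTM => //; exact: meas_weight.
have Fw0 y : (0 <= (F y * weight y)%:E)%E by rewrite lee_fin mulr_ge0// ltW// weight_gt0.
have mb : measT (box U) by exact: meas_box.
have b0 x : (0 <= box U x)%E by exact: box_ind_ge0.
have key : (J (fun y => (F y * weight y)%:E) <= C%:E * J (fun y => (weight y)%:E))%E.
 rewrite (disintegrate_rows fU JT Jinv mFw Fw0) (disintegrate_rows fU JT Jinv mw w0).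
 have m1 f : measT f -> (forall y, 0 <= f y)%E ->
   measT (fun x => box U (x0 + x) * dirint (rows U) f (x0 + x))%E.
  move=> mf f0; apply: emeasTM; first exact: (measT_comp mb mx0).
  by apply: (measT_comp _ mx0); exact: meas_dint.
 rewrite /J -ge0_integralZl//; last 2 first.
 - exact: m1.
 - by move=> x _; rewrite mule_ge0// dint_ge0.
 apply: ge0_le_integral => //.
 - by move=> x _; rewrite mule_ge0// dint_ge0.
 - exact: m1.
 - by apply: emeasTM => //; exact: m1.
 - by move=> x _; rewrite muleCA lee_wpmul2l.
rewrite /Ef ler_pdivrMr ?Zf_gt0// -lee_fin EFinM -int_weightE.
apply: le_trans key; rewrite /J /gibbs_int /Rintegral fineK//.
exact: (integrable_fin_num measurableT (intble_gibbs qF)).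
Qed.
End gibbs.

(** * Scalar inequalities for the weighted test *)

Section scalar.
Context {R : realType}.
Implicit Types c l q k u d : R.

Lemma small_le1 c l q : 0 < c -> c <= 1 -> 2 <= l -> q <= (c / (2 * l)) ^+ 2 -> q <= 1.
move=> c0 c1 l2 qh; have l0 : 0 < l by exact: lt_le_trans l2.
have w0 : 0 <= c / (2 * l) by rewrite divr_ge0 ?mulr_ge0 ?(ltW c0) ?(ltW l0).
have w1 : c / (2 * l) <= 1 by rewrite ler_pdivrMr ?mulr_gt0// mul1r; lra.
by apply: (le_trans qh); rewrite expr2; exact: mulr_ile1.
Qed.

Lemma ler_of_sqr (x y : R) : 0 <= y -> x ^+ 2 <= y ^+ 2 -> x <= y.
move=> y0 xy; apply: le_trans (ler_norm x) _.
by rewrite -ler_sqr ?nnegrE// real_normK// num_real.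
Qed.

(** On one block, [u] is the squared distance of two tilts, [D] their monotone pairing and [E] the
    squared commutator error of the weight [k]; the smallness of [q] lets half of [c * u]
    survive. *)
Lemma test_lower c l q k u E S D W : 0 < c -> 0 < l -> 0 < k -> 0 <= u -> 0 <= E -> 0 <= q ->
 q <= (c / (2 * l)) ^+ 2 -> S <= l ^+ 2 * u -> E <= q * k ^+ 2 * u -> c * u <= D ->
 W ^+ 2 <= E * S -> k * (c / 2) * u <= k * D + W.
move=> c0 l0 k0 u0 E0 q0 qh Sh Eh Dh Wh.
have h : - W <= k * (c / 2) * u.
 apply: ler_of_sqr; first by rewrite !mulr_ge0// ?divr_ge0// ltW.
 rewrite sqrrN; apply: (le_trans Wh); apply: (@le_trans _ _ (E * (l ^+ 2 * u))).
  by rewrite ler_wpM2l.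
 have lu : 0 <= l ^+ 2 * u by rewrite mulr_ge0 ?sqr_ge0.
 apply: le_trans (ler_wpM2r lu Eh) _.
 have -> : q * k ^+ 2 * u * (l ^+ 2 * u) = q * (k * u * l) ^+ 2 by ring.
 apply: le_trans (ler_wpM2r (sqr_ge0 _) qh) _.
 apply: le_of_eq; field; exact: lt0r_neq0.
have := ler_wpM2l (ltW k0) Dh.
have -> : k * (c * u) = k * (c / 2) * u + k * (c / 2) * u by field.
by move: (k * (c / 2) * u) (k * D) h => *; lra.
Qed.

(** Cauchy-Schwarz, then Young with the split chosen so that [c / 4] of [u] appears and can be
    absorbed by [test_lower]. *)
Lemma test_upper c l k u d F S W : 0 < c -> 0 < k -> 0 <= u -> 0 <= d -> 0 <= F -> 0 <= S ->
 F <= 4 * k ^+ 2 * u -> S <= l ^+ 2 * d -> W ^+ 2 <= F * S ->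
 W <= k * (c / 4) * u + k * (4 * l ^+ 2 / c) * d.
move=> c0 k0 u0 d0 F0 S0 Fh Sh Wh.
have X0 : 0 <= k * (c / 4) * u by rewrite !mulr_ge0// ?divr_ge0// ltW.
have Y0 : 0 <= k * (4 * l ^+ 2 / c) * d.
 by rewrite mulr_ge0// mulr_ge0 ?(ltW k0)// divr_ge0 ?(ltW c0)// mulr_ge0 ?sqr_ge0.
apply: ler_of_sqr; first exact: addr_ge0.
apply: (le_trans Wh); apply: le_trans (ler_pM F0 S0 Fh Sh) _.
have -> : 4 * k ^+ 2 * u * (l ^+ 2 * d) = 4 * ((k * (c / 4) * u) * (k * (4 * l ^+ 2 / c) * d)).
 by field; exact: lt0r_neq0.
move: (k * (c / 4) * u) (k * (4 * l ^+ 2 / c) * d) => x y.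
by rewrite -subr_ge0 (_ : _ - _ = (x - y) ^+ 2) ?sqr_ge0//; ring.
Qed.

Lemma twice_le (x y : R) : y <= x -> 2 * x + 2 * y <= 4 * x.
by lra. Qed.

Lemma absorb_half (s t d : R) : s + s <= d -> d <= s + t -> s <= t.
by lra. Qed.

Lemma weight_cancel (c l s t : R) : 0 < c ->
 c / 4 * s <= 4 * l ^+ 2 / c * t -> s <= (4 * l / c) ^+ 2 * t.
move=> c0; rewrite -ler_pdivlMl ?divr_gt0// => h; apply: (le_trans h).
by apply: le_of_eq; field; exact: lt0r_neq0.
Qed.
End scalar.

(** * Block decomposition and discretised B-splines *)

Section blocks.
Context {R : realType} (K M : nat).
Notation N := (K * M)%N.

Lemma idx_subproof (m : 'I_M) (k : 'I_K) : (m * K + k < N)%N.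
apply: (@leq_trans (m.+1 * K)); first by rewrite mulSn addnC ltn_add2r.
by rewrite mulnC leq_mul2l ltn_ord orbT.
Qed.

Definition idx (m : 'I_M) (k : 'I_K) : 'I_N := Ordinal (idx_subproof m k).

Lemma idx_inj (m m' : 'I_M) (k k' : 'I_K) : idx m k = idx m' k' -> m = m' /\ k = k'.
have K0 : (0 < K)%N by case: (K) k => [[]|].
move=> /(congr1 val) /= e; split; apply: val_inj => /=.
 have := congr1 (fun j => j %/ K)%N e; rewrite !divnMDl//.
 by rewrite !divn_small// !addn0.
have := congr1 (fun j => j %% K)%N e; rewrite !modnMDl.
by rewrite !modn_small.
Qed.

Lemma sum_idx (F : 'I_N -> R) : \sum_j F j = \sum_m \sum_k F (idx m k).
rewrite pair_bigA/= (reindex (fun p : 'I_M * 'I_K => idx p.1 p.2))//=.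
apply: onW_bij; apply: inj_card_bij.
 by move=> [m k] [m' k'] /= /idx_inj [-> ->].
by rewrite card_prod !card_ord mulnC.
Qed.

Definition Pm (m : 'I_M) : 'M[R]_(K, N) := \matrix_(k, j) (j == idx m k)%:R.
Definition blk (m : 'I_M) (x : 'rV[R]_N) : 'rV[R]_K := x *m (Pm m)^T.

Lemma blkE m x k : blk m x 0 k = x 0 (idx m k).
rewrite mxE (bigD1 (idx m k))//= !mxE eqxx mulr1 big1 ?addr0// => j jk.
by rewrite !mxE (negbTE jk) mulr0.
Qed.

Lemma embE m (u : 'rV[R]_K) m' k : (u *m Pm m) 0 (idx m' k) = u 0 k * (m == m')%:R.
rewrite mxE; have [<-|mm'] := eqVneq m m'.
 rewrite (bigD1 k)//= !mxE eqxx mulr1 big1 ?addr0 ?mulr1// => j jk.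
 rewrite !mxE; case: eqP => [/idx_inj[_ kj]|_]; last by rewrite mulr0.
 by rewrite kj eqxx in jk.
rewrite mulr0 big1// => j _; rewrite !mxE; case: eqP => [/idx_inj[e _]|_]; last by rewrite mulr0.
by rewrite e eqxx in mm'.
Qed.

Lemma blk_emb m m' (u : 'rV[R]_K) : blk m (u *m Pm m') = (m == m')%:R *: u.
by apply/rowP => k; rewrite blkE embE mxE mulrC eq_sym. Qed.

Lemma idx_surj (j : 'I_N) : exists m k, j = idx m k.
have inj : injective (fun p : 'I_M * 'I_K => idx p.1 p.2).
 by move=> [m k] [m' k'] /= /idx_inj [-> ->].
have [|g _ gK] := inj_card_bij inj; first by rewrite card_prod !card_ord mulnC.
by exists (g j).1, (g j).2; rewrite gK.
Qed.

Lemma blkD m x y : blk m (x + y) = blk m x + blk m y.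
by rewrite /blk mulmxDl. Qed.

Lemma blkB m x y : blk m (x - y) = blk m x - blk m y.
by rewrite /blk mulmxBl. Qed.

Lemma blk_sum m (F : 'I_M -> 'rV[R]_N) : blk m (\sum_i F i) = \sum_i blk m (F i).
by rewrite /blk mulmx_suml. Qed.

Lemma dot_blk x y : dot x y = \sum_m dot (blk m x) (blk m y).
rewrite /dot sum_idx; apply: eq_bigr => m _; apply: eq_bigr => k _.
by rewrite !blkE.
Qed.

Lemma sqn_blk x : sqn x = \sum_m sqn (blk m x).
exact: dot_blk. Qed.

Lemma sqn_emb m (u : 'rV[R]_K) : sqn (u *m Pm m) = sqn u.
rewrite sqn_blk (bigD1 m)//= blk_emb eqxx scale1r big1 ?addr0// => i im.
by rewrite blk_emb (negbTE im) scale0r /sqn dot0l.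
Qed.

Lemma hamiltonian_blk psi x : hamiltonian psi x = \sum_m hamiltonian psi (blk m x).
rewrite /hamiltonian sum_idx; apply: eq_bigr => m _; apply: eq_bigr => k _.
by rewrite blkE.
Qed.

Lemma mvec_blk V m x : blk m (mvec V x) = mvec V (blk m x).
by apply/rowP => k; rewrite blkE !mxE -blkE mxE. Qed.

Lemma mvecB_blk V m (x y : 'rV[R]_N) :
 blk m (mvec V x - mvec V y) = mvec V (blk m x) - mvec V (blk m y).
by rewrite blkB !mvec_blk. Qed.

Variables (r : nat) (beta : 'M[R]_(r, K)) (sigma : 'I_M -> 'I_r -> 'I_M).

(** Gathers the [r] coefficients active on block [m]. All blocks share the shape [beta], and the
    rows of [bsp] are the discretised B-splines. *)
Definition Sm (m : 'I_M) : 'M[R]_(M, r) := \matrix_(j, i) (j == sigma m i)%:R.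
Definition bsp : 'M[R]_(M, N) := \sum_m Sm m *m beta *m Pm m.

Lemma mul_Sm (z : 'rV[R]_M) m i : (z *m Sm m) 0 i = z 0 (sigma m i).
rewrite mxE (bigD1 (sigma m i))//= !mxE eqxx mulr1 big1 ?addr0// => j ji.
by rewrite !mxE (negbTE ji) mulr0.
Qed.

Lemma blk_bsp m z : blk m (z *m bsp) = z *m Sm m *m beta.
rewrite /bsp mulmx_sumr blk_sum (bigD1 m)//= !mulmxA blk_emb eqxx scale1r.
by rewrite big1 ?addr0// => i im; rewrite !mulmxA blk_emb eq_sym (negbTE im) scale0r.
Qed.

Lemma mul_bspT x : x *m bsp^T = \sum_m blk m x *m beta^T *m (Sm m)^T.
rewrite /bsp raddf_sum/= mulmx_sumr; apply: eq_bigr => m _.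
by rewrite !trmx_mul !mulmxA.
Qed.

Lemma Pm_bspT m : Pm m *m bsp^T = beta^T *m (Sm m)^T.
rewrite -[RHS]trmxK trmx_mul !trmxK -[LHS]trmxK trmx_mul trmxK; congr trmx.
apply/row_matrixP => i; rewrite !rowE; have := blk_bsp m (delta_mx 0 i).
by rewrite /blk -!mulmxA.
Qed.

Variables C1 C2 : R.
Hypothesis C1_gt0 : 0 < C1.
Hypothesis C2_gt0 : 0 < C2.
Hypothesis beta_ub : forall s : 'rV_r, sqn (s *m beta) <= C1 * sqn s.
Hypothesis beta_lb : forall s : 'rV_r, sqn s <= C2 * sqn (s *m beta).
Hypothesis r_gt0 : (0 < r)%N.
Hypothesis sigma_inj : forall i, injective (sigma ^~ i).

Lemma sum_sqn_Sm (z : 'rV[R]_M) : \sum_m sqn (z *m Sm m) = r%:R * sqn z.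
under eq_bigr do rewrite sqnE; rewrite exchange_big/=.
rewrite -[r in RHS]card_ord mulr_natl -sumr_const; apply: eq_bigr => i _.
under eq_bigr do rewrite mul_Sm.
by rewrite sqnE [RHS](reindex_inj (@sigma_inj i)).
Qed.

(** Counted with multiplicity, every coefficient is active on [r] blocks, because each map
    [sigma ^~ i] is injective; hence the gain [1 / r]. *)
Lemma bsp_lb z : sqn z <= (C2 / r%:R) * sqn (z *m bsp).
rewrite mulrAC ler_pdivlMr ?ltr0n// mulrC -sum_sqn_Sm sqn_blk mulr_sumr.
by apply: ler_sum => m _; rewrite blk_bsp.
Qed.

Lemma span_beta_lb (s : 'rV[R]_r) : sqn (s *m beta) <= C2 * sqn (s *m beta *m beta^T).
set v := s *m beta; set t := v *m beta^T.
have e : sqn v = dot s t by rewrite /sqn {1}/v dot_mul.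
have := dot_young s (C2 *: t); rewrite dotZr -e sqnZ.
move=> /le_trans /(_ (lerD (beta_lb s) (lexx _))); rewrite -/v => h.
have : C2 * sqn v <= C2 * (C2 * sqn t) by move: h; move: (sqn v) (sqn t) => p q h; lra.
by rewrite ler_pM2l.
Qed.

Lemma dot_bsp_eq (z : 'rV[R]_M) (p a b : 'rV[R]_N) : a *m bsp^T = b *m bsp^T ->
 dot (z *m bsp) (p - a) = dot (z *m bsp) (p - b).
by move=> ab; rewrite dot_mul [RHS]dot_mul mulmxBl [in RHS]mulmxBl ab. Qed.

Section weighted_inversion.
Variable V : perturbation R.
Notation B := (bnd V).

(** Lipschitz and strong monotonicity constants of [mean], from [Var_ub] and [Var_lb]. *)
Definition lip : R := 2 + 4 * B ^+ 2.
Definition mono : R := (3 + 4 * B ^+ 2)^-1.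

Lemma lip_ge2 : 2 <= lip. by rewrite lerDl mulr_ge0 ?sqr_ge0. Qed.
Lemma mono_gt0 : 0 < mono.
by rewrite invr_gt0 ltr_pwDl// mulr_ge0 ?sqr_ge0. Qed.
Lemma mono_le1 : mono <= 1.
rewrite /mono invf_le1; last by rewrite -invr_gt0 mono_gt0.
by have := mulr_ge0 (ler0n R 4) (sqr_ge0 B); lra.
Qed.

Lemma mono_mvec n (a b : 'rV[R]_n) : mono * sqn (a - b) <= dot (a - b) (mvec V a - mvec V b).
by rewrite /mono ler_pdivrMl ?mvec_mono// -invr_gt0 mono_gt0. Qed.

Lemma lip_mvec n (a b : 'rV[R]_n) : sqn (mvec V a - mvec V b) <= lip ^+ 2 * sqn (a - b).
exact: mvec_lipschitz. Qed.

#[local] Opaque lip mono.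
Variables (kap : 'I_M -> R) (eta : R).
Hypothesis kap_gt0 : forall m, 0 < kap m.
Hypothesis kap_slow : forall m i, `|kap (sigma m i) - kap m| <= eta * kap m.
Hypothesis eta_small : C1 * C2 * eta ^+ 2 <= (mono / (2 * lip)) ^+ 2.

(** Commutator of the weight with B-spline synthesis: a block has a single weight, while its active
    coefficients carry the weights of their own indices. *)
Definition kap_err (ze : 'rV[R]_M) m : 'rV[R]_r :=
 \row_i ((kap (sigma m i) - kap m) * ze 0 (sigma m i)).

Lemma blk_kap (ze : 'rV[R]_M) m : blk m ((\row_j (kap j * ze 0 j)) *m bsp) =
 kap m *: blk m (ze *m bsp) + kap_err ze m *m beta.
rewrite !blk_bsp scalemxAl -mulmxDl; congr (_ *m _); apply/rowP => i.
by rewrite mul_Sm [RHS]mxE [X in _ = X + _]mxE mul_Sm !mxE; ring.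
Qed.

Lemma kap_err_ub (ze : 'rV[R]_M) m : sqn (kap_err ze m *m beta) <=
 C1 * C2 * eta ^+ 2 * kap m ^+ 2 * sqn (blk m (ze *m bsp)).
apply: le_trans (beta_ub _) _.
have -> : C1 * C2 * eta ^+ 2 * kap m ^+ 2 * sqn (blk m (ze *m bsp)) =
 C1 * (eta ^+ 2 * kap m ^+ 2 * (C2 * sqn (blk m (ze *m bsp)))) by ring.
apply: ler_wpM2l; first exact: ltW C1_gt0.
apply: (@le_trans _ _ (eta ^+ 2 * kap m ^+ 2 * sqn (ze *m Sm m))); last first.
 apply: ler_wpM2l; first by apply: mulr_ge0; exact: sqr_ge0.
 by rewrite blk_bsp; exact: beta_lb.
rewrite !sqnE mulr_sumr; apply: ler_sum => i _.
rewrite mul_Sm mxE exprMn; apply: ler_wpM2r; first exact: sqr_ge0.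
rewrite -exprMn -(real_normK (num_real (kap (sigma m i) - kap m))).
by apply: lerXn2r; rewrite ?nnegrE ?kap_slow// (le_trans _ (kap_slow m i)).
Qed.

(** Locality of the nonlinear inversion, in the manner of Combes and Thomas. The moment condition is
    tested against the spline with coefficients [kap * (z - y)]: monotonicity of the mean gives
    weighted coercivity block by block, and the commutator, of relative size [eta], is absorbed. The
    constant does not involve the number of blocks. *)
Lemma weighted_inversion (y z : 'rV[R]_M) (L' : 'rV[R]_N) :
 mvec V L' *m bsp^T = mvec V (y *m bsp) *m bsp^T ->
 \sum_m kap m * sqn (blk m (z *m bsp - y *m bsp)) <=
  (4 * lip / mono) ^+ 2 * \sum_m kap m * sqn (blk m (z *m bsp - L')).
move=> L'E; set L := z *m bsp; set l := y *m bsp.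
pose ze := z - y; pose kz : 'rV[R]_M := \row_j (kap j * ze 0 j).
have uE : L - l = ze *m bsp by rewrite mulmxBl.
have tst : dot (kz *m bsp) (mvec V L - mvec V l) = dot (kz *m bsp) (mvec V L - mvec V L').
 exact/dot_bsp_eq/esym.
have c0 := mono_gt0; have c1 := mono_le1; have L2 := lip_ge2.
have l0 : 0 < lip by apply: lt_le_trans L2.
pose q := C1 * C2 * eta ^+ 2.
have q0 : 0 <= q by apply: mulr_ge0; [apply: mulr_ge0; exact: ltW|exact: sqr_ge0].
have q1 : q <= 1 := small_le1 c0 c1 L2 eta_small.
have FE m : blk m (kz *m bsp) = kap m *: blk m (L - l) + kap_err ze m *m beta.
 by rewrite uE blk_kap.
have eub m : sqn (kap_err ze m *m beta) <= q * kap m ^+ 2 * sqn (blk m (L - l)).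
 by rewrite uE kap_err_ub.
pose u m := sqn (blk m (L - l)); pose d m := sqn (blk m (L - L')).
have lhs m : kap m * (mono / 2) * u m <= dot (blk m (kz *m bsp)) (blk m (mvec V L - mvec V l)).
 rewrite FE dotDl dotZl mvecB_blk (blkB m L l).
 set a := blk m L; set b := blk m l.
 have h1 : mono * u m <= dot (a - b) (mvec V a - mvec V b) by rewrite /u blkB; exact: mono_mvec.
 have h2 : sqn (mvec V a - mvec V b) <= lip ^+ 2 * u m by rewrite /u blkB; exact: lip_mvec.
 exact: (test_lower c0 l0 (kap_gt0 m) (sqn_ge0 _) (sqn_ge0 _) q0 eta_small h2 (eub m) h1 (dot_cs _ _)).
have rhs m : dot (blk m (kz *m bsp)) (blk m (mvec V L - mvec V L')) <=
  kap m * (mono / 4) * u m + kap m * (4 * lip ^+ 2 / mono) * d m.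
 rewrite FE mvecB_blk.
 set a := blk m L; set b := blk m L'.
 have h2 : sqn (mvec V a - mvec V b) <= lip ^+ 2 * d m by rewrite /d blkB; exact: lip_mvec.
 set F := kap m *: _ + _.
 have h1 : sqn F <= 4 * kap m ^+ 2 * u m.
  apply: le_trans (sqnD _ _) _; rewrite sqnZ -/(u m).
  have w0 : 0 <= kap m ^+ 2 * u m := mulr_ge0 (sqr_ge0 _) (sqn_ge0 _).
  have := le_trans (eub m) (_ : _ <= kap m ^+ 2 * u m).
  rewrite -mulrA -[X in _ <= X -> _]mul1r => /(_ (ler_wpM2r w0 q1)).
  by rewrite -[4 * _ * _]mulrA; exact: twice_le.
 exact: (test_upper c0 (kap_gt0 m) (sqn_ge0 _) (sqn_ge0 _) (sqn_ge0 _) (sqn_ge0 _) h1 h2 (dot_cs _ _)).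
have sums : \sum_m kap m * (mono / 4) * u m <= \sum_m kap m * (4 * lip ^+ 2 / mono) * d m.
 have h2 : \sum_m kap m * (mono / 2) * u m <= dot (kz *m bsp) (mvec V L - mvec V l).
  by rewrite dot_blk; apply: ler_sum => m _; exact: lhs.
 have h1 : dot (kz *m bsp) (mvec V L - mvec V l) <=
   \sum_m kap m * (mono / 4) * u m + \sum_m kap m * (4 * lip ^+ 2 / mono) * d m.
  by rewrite tst dot_blk -big_split; apply: ler_sum => m _; exact: rhs.
 have : \sum_m kap m * (mono / 2) * u m = \sum_m kap m * (mono / 4) * u m + \sum_m kap m * (mono / 4) * u m.
  by rewrite -big_split/=; apply: eq_bigr => m _; field.
 move=> e2; move: h2; rewrite e2 => h2; exact: absorb_half h2 h1.
move: sums; rewrite (eq_bigr (fun m => (mono / 4) * (kap m * u m))); last by move=> m _; ring.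
rewrite -mulr_sumr [X in _ <= X](eq_bigr (fun m => (4 * lip ^+ 2 / mono) * (kap m * d m))); last by move=> m _; ring.
rewrite -mulr_sumr; exact: weight_cancel c0.
Qed.
End weighted_inversion.
End blocks.

(** What the main estimate uses of B-splines: frame bounds on a block, columns of square sum
    [O(1 / K)], and for each block a slowly varying weight that is at least 1 there and has total
    mass at most [Ck]. *)
Record frame {R : realType} (V : perturbation R) (K M r : nat) (beta : 'M[R]_(r, K))
  (sigma : 'I_M -> 'I_r -> 'I_M) (C1 C2 C3 Ck eta : R) : Prop := Frame {
 frame_C1 : 0 < C1;
 frame_C2 : 0 < C2;
 frame_C3 : 0 <= C3;
 frame_Ck : 0 <= Ck;
 frame_ub : forall s : 'rV_r, sqn (s *m beta) <= C1 * sqn s;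
 frame_lb : forall s : 'rV_r, sqn s <= C2 * sqn (s *m beta);
 frame_col : forall k, \sum_i beta i k ^+ 2 <= C3 / K%:R;
 frame_r : (0 < r)%N;
 frame_inj : forall i, injective (sigma ^~ i);
 frame_eta : C1 * C2 * eta ^+ 2 <= (mono V / (2 * lip V)) ^+ 2;
 frame_kap : forall m0 : 'I_M, exists kap : 'I_M -> R,
  [/\ forall m, 0 < kap m, forall m i, `|kap (sigma m i) - kap m| <= eta * kap m,
    1 <= kap m0 & \sum_m kap m <= Ck];
 frame_K : (0 < K)%N;
 frame_rank : (0 < \rank (kermx (bsp beta sigma)^T))%N }.

(** Lines in embedded directions are lines of the small space, the rest of [x] being a frozen
    environment. *)
Lemma dirint_embed (R : realType) p n (P : 'M[R]_(p, n)) (us : seq 'rV[R]_p)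
  (F : 'rV[R]_n -> \bar R) x z :
 dirint [seq u *m P | u <- us] F x = dirint us (fun y => F (x + (y - z) *m P)) z.
elim: us x z => [|u us IH] x z /=; first by rewrite subrr mul0mx addr0.
apply: eq_integral => t _; rewrite (IH _ (z + t *: u)); congr dirint; apply: funext => y.
by congr F; rewrite opprD addrA mulmxBl -scalemxAl -addrA [t *: _ + _]addrC subrK.
Qed.

Lemma lipschitz_lgrowth (R : realType) n (g : 'rV[R]_n -> R) (C : R) : 0 <= C ->
 (forall c d, (g c - g d) ^+ 2 <= C * sqn (c - d)) -> lgr g.
move=> C0 gC; split; first exact: lip_meas gC.
exists (2 * C + 2 * g 0 ^+ 2); first by rewrite addr_ge0// mulr_ge0// sqr_ge0.
move=> x; apply: (@le_trans _ _ (2 * (g x - g 0) ^+ 2 + 2 * g 0 ^+ 2)).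
 rewrite -subr_ge0 (_ : _ - _ = (g x - 2 * g 0) ^+ 2) ?sqr_ge0//; ring.
have := gC x 0; rewrite subr0 => h.
have h1 : 0 <= g 0 ^+ 2 * sqn x by rewrite mulr_ge0 ?sqr_ge0 ?sqn_ge0.
rewrite (_ : _ * (1 + _) = 2 * (C * sqn x) + 2 * C + 2 * g 0 ^+ 2 + 2 * (g 0 ^+ 2 * sqn x)); last by ring.
by move: ((g x - _) ^+ 2) (g 0 ^+ 2) (C * sqn x) (g 0 ^+ 2 * sqn x) h h1 C0 => *; lra.
Qed.

(** The choice [t = |X| / (a + e)] is legitimate even when [a] vanishes; [e] then tends to 0. *)
Lemma optimize (R : realType) (X a b : R) : 0 <= a -> 0 <= b ->
 (forall t, 0 < t -> `|2 * X| <= t * a + t^-1 * b) -> X ^+ 2 <= a * b.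
move=> a0 b0 H; have [->|X0] := eqVneq X 0; first by rewrite expr0n mulr_ge0.
have y0 : 0 < `|X| by rewrite normr_gt0.
have key e : 0 < e -> X ^+ 2 <= b * (a + e).
 move=> e0; have ae : 0 < a + e by rewrite ltr_wpDl.
 have := H _ (divr_gt0 y0 ae); rewrite normrM (ger0_norm (ler0n _ 2)) invfM invrK => h.
 rewrite -(real_normK (num_real X)) expr2 -ler_pdivlMr//.
 have h1 : `|X| / (a + e) * a <= `|X|.
  by rewrite -mulrA ler_piMr// mulrC ler_pdivrMr// mul1r lerDl ltW.
 have -> : b * (a + e) / `|X| = `|X|^-1 * (a + e) * b by ring.
 by move: (_ * a) (_ * b) h h1 => *; lra.
apply/ler_addgt0Pr => e e0.
have b1 : 0 < b + 1 by rewrite ltr_wpDl.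
apply: le_trans (key _ (divr_gt0 e0 b1)) _.
rewrite mulrDr mulrC lerD2l mulrCA ler_piMr ?(ltW e0)//.
by rewrite ler_pdivrMr// mul1r lerDl.
Qed.

Lemma dot_young_scaled (R : realType) n (x y : 'rV[R]_n) t : 0 < t ->
 `|2 * dot x y| <= t * sqn x + t^-1 * sqn y.
move=> t0; have tn : t != 0 by rewrite gt_eqF.
have h c : c ^+ 2 = 1 -> c * (2 * dot x y) <= t * sqn x + t^-1 * sqn y.
 move=> c1; rewrite -subr_ge0.
 have -> : t * sqn x + t^-1 * sqn y - c * (2 * dot x y) = t^-1 * sqn (t *: x - c *: y).
  rewrite sqnB !sqnZ c1 mul1r dotZl dotZr.
  by move: (sqn x) (sqn y) (dot x y) => X Y D; field.
 by rewrite mulr_ge0 ?sqn_ge0// invr_ge0 ltW.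
rewrite ler_norml; have := h 1 (expr1n _ 2); have := h (-1) (sqrr_sign _ 1).
by rewrite mulN1r mul1r; move: (2 * _) (_ + _) => u v; lra.
Qed.

Section block_cst.
Context {R : realType} (V : perturbation R) (r : nat) (C1 C2 : R).
Lemma block_cst_ge0 D : 0 <= C1 -> 0 <= block_cst V r C1 C2 D.
move=> C10; rewrite /block_cst mulr_ge0 ?expR_ge0// mulr_ge0// addr_ge0//.
 by rewrite /fbound mulr_ge0// mulr_ge0 ?sqr_ge0.
by rewrite /Kwt mulr_ge0 ?sqr_ge0.
Qed.

Lemma block_cst_scale t D : block_cst V r C1 C2 (t * D) = t ^+ 2 * block_cst V r C1 C2 D.
rewrite /block_cst /fbound /Kwt; move: (expR _) => e; ring.
Qed.
End block_cst.

#[local] Opaque block_cst stein_cst lip mono.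

(** * Bias of the expected force *)

Section main.
Context {R : realType} (V : perturbation R) (K M r : nat) (beta : 'M[R]_(r, K)).
Variables (sigma : 'I_M -> 'I_r -> 'I_M) (C1 C2 C3 Ck eta : R).
Hypothesis fr : frame V beta sigma C1 C2 C3 Ck eta.
Notation N := (K * M)%N.
Variable x0 : 'rV[R]_N.
Notation B := (bnd V).
Notation Bs := (bsp beta sigma).
Notation A := (Us (bsp beta sigma)).
Notation E := (Ef V A x0).
Notation dH := (dH V).
Implicit Types (x y : 'rV[R]_N).

Let A_free : row_free A := Us_free Bs.
Let d0 := frame_rank fr.
Notation EfZ := (EfZ V A_free x0).
Notation EfD := (EfD V A_free x0).
Notation EfB := (EfB V A_free x0).

Lemma frame_bsp_lb z : sqn z <= C2 / r%:R * sqn (z *m Bs).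
exact: (bsp_lb (frame_lb fr) (frame_r fr) (frame_inj fr)). Qed.

Lemma C2r_gt0 : 0 < C2 / r%:R.
by rewrite divr_gt0 ?(frame_C2 fr)// ltr0n (frame_r fr). Qed.

(** Orthogonal projection onto the span of the discretised B-splines; its kernel is the direction
    space of the fibers. *)
Definition proj x : 'rV[R]_N := x *m Bm_inv Bs *m Bs.

Lemma proj_sub x : exists u, x - proj x = u *m A.
apply: Us_full; rewrite mulmxBl /proj /Bm_inv !mulmxA -[_ *m Bs *m _]mulmxA.
by rewrite mulmxKV ?subrr// (Bm_gram_unit frame_bsp_lb).
Qed.

Lemma span_orth (z : 'rV[R]_M) u : dot (z *m Bs) (u *m A) = 0.
by rewrite dot_mul -mulmxA Us_orth mulmx0 dotC dot0l. Qed.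

Lemma dot_proj x y : dot (proj x) y = dot (proj x) (proj y).
have [u uE] := proj_sub y; rewrite -[in LHS](subrK (proj y) y) uE dotDr.
by rewrite {1}/proj span_orth add0r.
Qed.

Lemma proj_sym x y : dot (proj x) y = dot x (proj y).
by rewrite dot_proj dotC -dot_proj dotC. Qed.

Lemma proj_contr x : sqn (x - proj x) <= sqn x.
rewrite sqnB {2}/sqn -dot_proj [dot (proj x) x]dotC.
have : 0 <= dot x (proj x) by rewrite dotC dot_proj sqn_ge0.
by move: (dot x (proj x)) (sqn x) => p s; lra.
Qed.

Lemma sqn_blk_le m x : sqn (blk m x) <= sqn x.
by rewrite (sqn_blk x) (bigD1 m)//= lerDl sumr_ge0// => i _; exact: sqn_ge0. Qed.

(** An element of the block span is spread over its [K] sites: no squared entry exceeds this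
    fraction of its squared norm. The factor [1 / K] of the main estimate comes from here. *)
Definition supc : R := C2 * C3 / K%:R.

Lemma supc_ge0 : 0 <= supc.
by rewrite divr_ge0// mulr_ge0 ?(frame_C3 fr)// ltW// (frame_C2 fr). Qed.

Lemma span_sup (c : 'rV[R]_r) k : (c *m beta) 0 k ^+ 2 <= supc * sqn (c *m beta).
have -> : (c *m beta) 0 k = dot c (\row_i beta i k).
 by rewrite mxE; apply: eq_bigr => i _; rewrite mxE.
apply: le_trans (dot_cs _ _) _.
have h1 : sqn (\row_i beta i k) <= C3 / K%:R.
 by rewrite sqnE; under eq_bigr do rewrite mxE; exact: (frame_col fr).
have h2 := frame_lb fr c.
apply: le_trans (ler_pM (sqn_ge0 _) (sqn_ge0 _) h2 h1) _.
by apply: le_of_eq; rewrite /supc; ring.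
Qed.

Lemma bsp_sup (z : 'rV[R]_M) m k : blk m (z *m Bs) 0 k ^+ 2 <= supc * sqn (blk m (z *m Bs)).
by rewrite blk_bsp span_sup. Qed.

(** The diagonal entry is the squared norm [s] of the projected unit vector, and the sup bound gives
    [s ^ 2 <= supc * s]. *)
Lemma proj_diag j : 0 <= proj (delta_mx 0 j) 0 j <= supc.
have [m [k jE]] := idx_surj j.
have e : proj (delta_mx 0 j) 0 j = sqn (proj (delta_mx 0 j)).
 by rewrite /sqn -dot_proj dot_delta.
rewrite e sqn_ge0/=; set s := sqn _.
have s0 : 0 <= s by exact: sqn_ge0.
have h : s ^+ 2 <= supc * s.
 rewrite {1}/s -[in leLHS]e.
 have -> : proj (delta_mx 0 j) 0 j = blk m (proj (delta_mx 0 j)) 0 k by rewrite blkE -jE.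
 apply: le_trans (bsp_sup _ _ _) _.
 by apply: ler_wpM2l; [exact: supc_ge0|rewrite /s; exact: sqn_blk_le].
have [->|sn] := eqVneq s 0; first exact: supc_ge0.
have sp : 0 < s by rewrite lt_def sn.
by rewrite -(ler_pM2r sp) -expr2.
Qed.

(** The local tilt: a random element of the block span whose means reproduce the averages of [x] on
    block [m]. *)
Definition lamJ m x : 'rV[R]_K := tiltc V beta (blk m x) *m beta.

Lemma lamJ_eq m x : blk m x *m beta^T = mvec V (lamJ m x) *m beta^T.
by rewrite /lamJ (tiltcP V (frame_C2 fr) (frame_lb fr)). Qed.

Lemma lgr_lamJ m k : lgr (fun x => lamJ m x 0 k).
apply: lgr_mul => i.
apply: (@lipschitz_lgrowth _ _ _ ((C2 * (3 + 4 * B ^+ 2)) ^+ 2 * C1)).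
 by apply: mulr_ge0; [exact: sqr_ge0|exact: ltW (frame_C1 fr)].
move=> x y; have h := tiltc_lipschitz V (frame_C2 fr) (frame_lb fr) (blk m x) (blk m y).
set c := tiltc _ _ _; set d := tiltc _ _ _.
apply: (@le_trans _ _ (sqn (c - d))).
 by rewrite sqnE (bigD1 i)//= !mxE lerDl sumr_ge0// => l _; exact: sqr_ge0.
apply: (le_trans h); rewrite -blkB -mulrA; apply: ler_wpM2l; first exact: sqr_ge0.
apply: le_trans (Bm_trans_ub (frame_C1 fr) (frame_ub fr) _) _.
by apply: ler_wpM2l; [exact: ltW (frame_C1 fr)|exact: sqn_blk_le].
Qed.

Lemma lgr_blk m k (u : 'rV[R]_N -> 'rV[R]_N) : (forall i, lgr (fun x => u x 0 i)) ->
 lgr (fun x => blk m (u x) 0 k).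
by move=> lu; under eq_fun do rewrite blkE; exact: lu. Qed.

Lemma lgr_vecB p (u v : 'rV[R]_N -> 'rV[R]_p) : (forall i, lgr (fun x => u x 0 i)) ->
 (forall i, lgr (fun x => v x 0 i)) -> forall i, lgr (fun x => (u x - v x) 0 i).
move=> lu lv i; rewrite (_ : (fun x => _) = fun x => u x 0 i - v x 0 i); first exact: lgrB.
by apply: funext => x; rewrite !mxE.
Qed.

(** Given all other blocks and the averages on block [m], the local tilt [lamJ m] is constant, so
    the one-block estimate applies to the family at this frozen tilt; [block_Ef] removes the extra
    conditioning. *)
Lemma block_expect (m : 'I_M) (fam : 'rV[R]_K -> 'I_K -> R -> R) (D : R) : 0 <= D ->
 (forall (l : 'rV[R]_K) (k : 'I_K), measT (fam l k)) ->
 (forall (l : 'rV[R]_K) (k : 'I_K) (t : R), `|fam l k t| <= D) ->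
 (forall (l : 'rV[R]_K) (k : 'I_K) (t u : R), `|fam l k t - fam l k u| <= D * `|t - u|) ->
 (forall (l : 'rV[R]_K) (k : 'I_K), Ex V (l 0 k) (fam l k) = 0) ->
 (forall k : 'I_K, measT (fun x => fam (lamJ m x) k (blk m x 0 k))) ->
 E (fun x => sqn ((\row_k fam (lamJ m x) k (blk m x 0 k)) *m beta^T)) <= block_cst V r C1 C2 D.
move=> D0 mf fD fL f0 mfl.
pose U := Us beta *m Pm K m.
have PP : Pm K m *m (Pm K m)^T = 1%:M :> 'M[R]_K.
 apply/row_matrixP => i; rewrite row_mul rowE -/(blk m _) blk_emb eqxx scale1r.
 by rewrite rowE mulmx1.
have fU : row_free U.
 rewrite /row_free eqn_leq rank_leq_row/=.
 apply: leq_trans (mxrankM_maxl U (Pm K m)^T).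
 by rewrite /U -mulmxA PP mulmx1 (eqP (Us_free beta)).
(* A block vector orthogonal to the block span is orthogonal to all discretised B-splines, so the
   finer fibers lie inside the given one. *)
have UA : (U <= A)%MS.
 by rewrite eq_row_base; apply/sub_kermxP; rewrite -mulmxA Pm_bspT mulmxA Us_orth mul0mx.
set F := fun x => _.
have mF : forall k, lgr (fun x => (\row_k fam (lamJ m x) k (blk m x 0 k)) 0 k).
 move=> k; under eq_fun do rewrite mxE.
 by apply: (lgr_bounded (C := D)).
have qF : qgr F by apply: qgr_sqn => i; apply: lgr_mul.
have F0 x : 0 <= F x by exact: sqn_ge0.
have bc0 : 0 <= block_cst V r C1 C2 D by apply: block_cst_ge0; exact: ltW (frame_C1 fr).
apply: (block_Ef A_free d0 x0 fU UA bc0 qF F0) => x.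
set xJ := blk m x; set l := lamJ m x.
have rowsU : rows U = [seq u *m Pm K m | u <- rows (Us beta)].
 by rewrite /rows; elim: (enum _) => //= i s ->; rewrite row_mul.
rewrite rowsU !(dirint_embed _ _ _ _ xJ).
pose c := expR (- \sum_(i | i != m) hamiltonian (pot V) (blk i x)).
have blk_in (y : 'rV[R]_K) : blk m (x + (y - xJ) *m Pm K m) = y.
 by rewrite blkD blk_emb eqxx scale1r addrC subrK.
have wE (y : 'rV[R]_K) : weight V (x + (y - xJ) *m Pm K m) = c * weight V y.
 rewrite /weight hamiltonian_blk (bigD1 m)//= blk_in opprD addrC expRD; congr (expR (- _) * _).
 apply: eq_bigr => i im; congr hamiltonian.
 by rewrite blkD blk_emb (negbTE im) scale0r addr0.
have mw := meas_weight V (n := K).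
have mwN := meas_weight V (n := N).
have w0 n (y : 'rV[R]_n) : 0 <= weight V y := ltW (weight_gt0 V y).
have mtr : measT (fun y : 'rV[R]_K => x + (y - xJ) *m Pm K m).
 apply: meas_rVP => i; under eq_fun do rewrite mxE.
 apply: measTD => //; apply: meas_mulmx => j.
 by under eq_fun do rewrite !mxE; apply: measTD => //; exact: meas_coor.
have mFf : measT (Ff beta (fam l)).
 by apply: meas_Ff => k; exact: mf.
have Pstep (y v : 'rV[R]_K) (t : R) : v \in rows (Us beta) -> y *m beta^T = xJ *m beta^T ->
  (y + t *: v) *m beta^T = xJ *m beta^T.
 by move=> /mapP[i _ ->] yx; rewrite mulmxDl -scalemxAl -row_mul Us_orth row0 scaler0 addr0.
rewrite (eq_dint_on (g := fun y : 'rV[R]_K => (c%:E * (Ff beta (fam l) y * weight V y)%:E)%E)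
 (P := fun y : 'rV[R]_K => y *m beta^T = xJ *m beta^T)); first last.
- by [].
- move=> y yx; rewrite /F wE -EFinM; congr (_%:E).
 rewrite blk_in /lamJ blk_in (tiltc_eq V yx) -/(lamJ m x) -/l.
 by rewrite mulrCA /Ff /fvec.
- exact: Pstep.
- by move=> y; rewrite mule_ge0 ?lee_fin ?expR_ge0// mulr_ge0 ?Ff_ge0.
- by move=> y; rewrite lee_fin mulr_ge0.
- by apply: emeasTM => //; apply/measT_EFin/measTM.
- apply/measT_EFin/measTM; last exact: measT_comp.
 by apply: (measT_comp _ mtr); case: qF.
have -> : dirint (rows (Us beta)) (fun y : 'rV[R]_K => (weight V (x + (y - xJ) *m Pm K m))%:E) xJ =
  (c%:E * dirint (rows (Us beta)) (fun y : 'rV[R]_K => (weight V y)%:E) xJ)%E.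
 have mwE : measT (fun y : 'rV[R]_K => (weight V y)%:E) by exact/measT_EFin.
 have w0E (y : 'rV[R]_K) : (0 <= (weight V y)%:E)%E by rewrite lee_fin.
 rewrite -(dintZl _ _ (expR_ge0 _) mwE w0E).
 by congr dirint; apply: funext => y; rewrite wE EFinM.
have mFw : measT (fun y : 'rV[R]_K => (Ff beta (fam l) y * weight V y)%:E).
 exact/measT_EFin/measTM.
have Fw0 (y : 'rV[R]_K) : (0 <= (Ff beta (fam l) y * weight V y)%:E)%E.
 by rewrite lee_fin mulr_ge0 ?Ff_ge0.
rewrite (dintZl _ _ (expR_ge0 _) mFw Fw0) muleCA lee_wpmul2l ?lee_fin ?expR_ge0//.
apply: (one_block (frame_C1 fr) (frame_ub fr) (frame_lb fr) D0 (mf l) (fD l) (fL l) (f0 l)).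
 exact: submxMl.
exact: lamJ_eq.
Qed.

(** The spline part of the force. The complement [dH - Lam] points along the fiber, where
    integration by parts controls it; the expectation of [Lam] is the expected force [gvec]. *)
Definition Lam x := proj (dH x).

Lemma lgr_Lam i : lgr (fun x => Lam x 0 i).
by rewrite /Lam /proj; apply: lgr_mul => j; apply: lgr_mul => l; exact: lgr_psi1vec.
Qed.

Lemma Lam_fluct e : E (fun x => dot (dH x - Lam x) e ^+ 2) <= (1 + B) * sqn e.
have [u uE] := proj_sub e.
rewrite (_ : (fun x => _) = fun x => dot (dH x) (u *m A) ^+ 2); last first.
 by apply: funext => x; rewrite -uE dotBl dotBr proj_sym.
apply: le_trans (Ef_psi1_sqr V A_free d0 x0 u) _.
by rewrite -uE; apply: ler_wpM2l; [rewrite addr_ge0// bnd_ge0|exact: proj_contr].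
Qed.

Lemma dot_blk_beta (m : 'I_M) y i : (blk m y *m beta^T) 0 i = dot y (row i beta *m Pm K m).
rewrite dotC dot_mul -/(blk m y) /dot mxE; apply: eq_bigr => k _.
by rewrite !mxE mulrC.
Qed.

Lemma sqn_row_Pm i (m : 'I_M) : sqn (row i beta *m Pm K m) <= C1.
by rewrite sqn_emb; exact: (sqn_row_Bm (frame_ub fr)). Qed.

Definition hcst : R := block_cst V r C1 C2 (2 * B).
Definition CA : R := C2 * (2 * hcst + 2 * (r%:R * ((1 + B) * C1))).

Lemma measurable_Ex (w : R -> R) (s : 'rV[R]_N -> R) : growth w -> measT s ->
 measT (fun x => Ex V (s x) w).
move=> gw ms; apply: (measT_comp (f := fun u => Ex V u w)) ms.
apply: cts_measT.
by apply: der_cts => z; exact: der_Ex.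
Qed.

Lemma measurable_lamJ m k : measT (fun x => lamJ m x 0 k).
by have [] := lgr_lamJ m k. Qed.

Lemma measurable_blk m k : measT (fun x => blk m x 0 k).
by under eq_fun do rewrite blkE; exact: meas_coor. Qed.

Lemma meas_fam (w : R -> R) m k : continuous w -> growth w ->
 measT (fun x => w (blk m x 0 k) - Ex V (lamJ m x 0 k) w).
move=> cw gw; apply: measTB.
 apply: (measT_comp (f := w)); last exact: measurable_blk.
 exact: cts_measT.
by apply: measurable_Ex => //; exact: measurable_lamJ.
Qed.

Lemma blk_Lam_lamJ m x : exists s, blk m (Lam x) - lamJ m x = s *m beta.
exists (dH x *m Bm_inv Bs *m Sm sigma m - tiltc V beta (blk m x)).
by rewrite mulmxBl /Lam /proj blk_bsp.
Qed.

Lemma lgr_Lam_lamJ m k : lgr (fun x => (blk m (Lam x) - lamJ m x) 0 k).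
apply: lgr_vecB => i; last exact: lgr_lamJ.
by apply: lgr_blk => j; exact: lgr_Lam.
Qed.

Definition hvecJ m x : 'rV[R]_K := \row_k hs V (lamJ m x 0 k) (blk m x 0 k).

(** Both fields lie in the block span, so their difference is measured by its averages. There the
    spins cancel, because [x] and the means at [lamJ] have equal averages; the force defect and the
    fluctuation of [dH - Lam] remain. *)
Lemma Lam_lamJ_ub m x : sqn (blk m (Lam x) - lamJ m x) <=
 C2 * (2 * sqn (hvecJ m x *m beta^T) +
    2 * \sum_i dot (dH x - Lam x) (row i beta *m Pm K m) ^+ 2).
have [s sE] := blk_Lam_lamJ m x.
rewrite sE; apply: le_trans (span_beta_lb (frame_C2 fr) (frame_lb fr) s) _.
apply: ler_wpM2l; first exact: ltW (frame_C2 fr).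
rewrite -sE.
have -> : (blk m (Lam x) - lamJ m x) *m beta^T =
  hvecJ m x *m beta^T + - (blk m (dH x - Lam x) *m beta^T).
 have e := dHE V (lamJ m x) (blk m x).
 have -> : hvecJ m x = (dH (blk m x) - lamJ m x) - (blk m x - mvec V (lamJ m x)).
  by rewrite e addrC addKr.
 have -> : dH (blk m x) = blk m (dH x).
  by apply/rowP => k; rewrite blkE mxE [in RHS]mxE blkE.
 rewrite blkB !mulmxBl (lamJ_eq m x) subrr subr0 opprB.
 by rewrite [RHS]addrC addrA subrK.
apply: le_trans (sqnD _ _) _; rewrite sqnN lerD2l.
apply: ler_wpM2l => //.
by rewrite sqnE; apply: ler_sum => i _; rewrite dot_blk_beta.
Qed.

Lemma qgr_fluct e : qgr (fun x => dot (dH x - Lam x) e ^+ 2).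
have h : lgr (fun x => dot (dH x - Lam x) e).
 apply: lgr_dot; apply: lgr_vecB => i; [exact: lgr_psi1vec|exact: lgr_Lam].
by under eq_fun do rewrite expr2; exact: lgrM.
Qed.

Lemma Ef_hvecJ m : E (fun x => sqn (hvecJ m x *m beta^T)) <= hcst.
apply: (block_expect (m := m) (fam := fun l k => hs V (l 0 k))).
- by rewrite mulr_ge0// bnd_ge0.
- by move=> l k; have [] := gr_hs V (l 0 k).
- by move=> l k t; exact: hs_ub.
- move=> l k t u; rewrite /hs opprB addrA subrK.
 have [c _ ->] := MVT_any u t (is_derive_pert1 V).
 rewrite normrM; apply: ler_wpM2r => //; apply: le_trans (pert2_ub V c) _.
 by rewrite mulr_natl mulr2n lerDl bnd_ge0.
- by move=> l k; exact: Ex_hs.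
- by move=> k; apply: meas_fam; [exact: cf1|exact: gr_f1].
Qed.

Lemma lgrowth_hvecJ m k : lgr (fun x => hvecJ m x 0 k).
under eq_fun do rewrite mxE.
apply: (lgr_bounded (C := 2 * B)); last by move=> x; exact: hs_ub.
by apply: meas_fam; [exact: cf1|exact: gr_f1].
Qed.

Lemma Ef_Lam_lamJ m : E (fun x => sqn (blk m (Lam x) - lamJ m x)) <= CA.
have q1 : qgr (fun x => sqn (hvecJ m x *m beta^T)).
 by apply: qgr_sqn => i; apply: lgr_mul => k; exact: lgrowth_hvecJ.
have q2 : qgr (fun x => \sum_i dot (dH x - Lam x) (row i beta *m Pm K m) ^+ 2).
 by apply: qgr_sum => i; exact: qgr_fluct.
have q3 : qgr (fun x => sqn (blk m (Lam x) - lamJ m x)).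
 by apply: qgr_sqn => k; exact: lgr_Lam_lamJ.
have q12 : qgr (fun x => 2 * sqn (hvecJ m x *m beta^T) +
    2 * \sum_i dot (dH x - Lam x) (row i beta *m Pm K m) ^+ 2).
 by apply: qgrD; exact: qgrZ.
apply: le_trans (le_Ef V A_free d0 x0 q3 (qgrZ C2 q12) (Lam_lamJ_ub m)) _.
rewrite (EfZ _ q12); apply: ler_wpM2l; first exact: ltW (frame_C2 fr).
rewrite (EfD (qgrZ 2 q1) (qgrZ 2 q2)) (EfZ _ q1) (EfZ _ q2).
apply: lerD; (apply: ler_wpM2l; first by []); first exact: Ef_hvecJ.
rewrite (Ef_sum V A_free d0 x0); last by move=> i; exact: qgr_fluct.
rewrite mulr_natl -[X in _ *+ X](card_ord r) -sumr_const; apply: ler_sum => i _.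
apply: le_trans (Lam_fluct _) _.
by apply: ler_wpM2l; [rewrite addr_ge0// bnd_ge0|exact: sqn_row_Pm].
Qed.

(** Deterministic tilt with the spline moments of [x0], an intermediate point between [Lam] and its
    expectation. *)
Definition lam0 : 'rV[R]_N := tiltc V Bs x0 *m Bs.
Definition tiltJ x : 'rV[R]_N := \sum_m lamJ m x *m Pm K m.

Lemma blk_tiltJ m x : blk m (tiltJ x) = lamJ m x.
rewrite /tiltJ blk_sum (bigD1 m)//= blk_emb eqxx scale1r big1 ?addr0// => i im.
by rewrite blk_emb eq_sym (negbTE im) scale0r.
Qed.

Lemma fiber_eq x : rowsp A (x - x0) -> x *m Bs^T = x0 *m Bs^T.
by move=> [c cE]; rewrite -[x](subrK x0) cE mulmxDl -mulmxA Us_orth mulmx0 add0r.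
Qed.

(** Equal averages on every block add up to equal spline moments, and these are common to [x] and
    [x0] on the fiber. *)
Lemma tiltJ_eq x : rowsp A (x - x0) -> mvec V (tiltJ x) *m Bs^T = mvec V lam0 *m Bs^T.
move=> /fiber_eq xE; rewrite /lam0 (tiltcP V C2r_gt0 frame_bsp_lb) -xE !mul_bspT.
by apply: eq_bigr => m _; rewrite mvec_blk blk_tiltJ lamJ_eq.
Qed.

Definition CB : R := (4 * lip V / mono V) ^+ 2 * (Ck * CA).

(** [weighted_inversion], with the weight peaked at block [m], compares [Lam] and [lam0] through the
    local tilts. Every block contributes at most [CA] and the weights sum to at most [Ck], so the
    bound does not grow with the number of blocks. *)
Lemma Ef_Lam_lam0 m : E (fun x => sqn (blk m (Lam x - lam0))) <= CB.
have [kap [k0 kslow k1 kC]] := frame_kap fr m.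
have qL : forall i, qgr (fun x => kap i * sqn (blk i (Lam x) - lamJ i x)).
 by move=> i; apply: qgrZ; apply: qgr_sqn => k; exact: lgr_Lam_lamJ.
have qS : qgr (fun x => \sum_i kap i * sqn (blk i (Lam x) - lamJ i x)) by exact: qgr_sum.
have q0 : qgr (fun x => sqn (blk m (Lam x - lam0))).
 apply: qgr_sqn => k; apply: lgr_blk; apply: lgr_vecB => i; first exact: lgr_Lam.
 exact: lgr_cst.
have pt x : rowsp A (x - x0) -> sqn (blk m (Lam x - lam0)) <=
  (4 * lip V / mono V) ^+ 2 * \sum_i kap i * sqn (blk i (Lam x) - lamJ i x).
 move=> /tiltJ_eq te.
 have := weighted_inversion (frame_C1 fr) (frame_C2 fr) (frame_ub fr) (frame_lb fr) k0 kslow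
  (frame_eta fr) (dH x *m Bm_inv Bs) te.
 rewrite -/(proj (dH x)) -/(Lam x) -/lam0 => h.
 apply: le_trans (le_trans _ h) _; last first.
  apply: ler_wpM2l; first exact: sqr_ge0.
  by apply: ler_sum => i _; rewrite blkB blk_tiltJ.
 rewrite (bigD1 m isT) /=; apply: ler_wpDr.
  by apply: sumr_ge0 => i _; apply: mulr_ge0; [exact: ltW|exact: sqn_ge0].
 exact: ler_peMl (sqn_ge0 _) k1.
apply: le_trans (le_Ef_fiber V A_free d0 q0 (qgrZ _ qS) pt) _.
rewrite (EfZ _ qS); apply: ler_wpM2l; first exact: sqr_ge0.
rewrite (Ef_sum V A_free d0 x0 _ qL).
have CA0 : 0 <= CA.
 apply: mulr_ge0; first exact: ltW (frame_C2 fr).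
 apply: addr_ge0; apply: mulr_ge0 => //; first by apply: block_cst_ge0; exact: ltW (frame_C1 fr).
 apply: mulr_ge0 => //; apply: mulr_ge0; last exact: ltW (frame_C1 fr).
 by rewrite addr_ge0// bnd_ge0.
apply: le_trans (_ : \sum_i kap i * CA <= _).
 apply: ler_sum => i _; rewrite (EfZ).
  by apply: ler_wpM2l; [exact: ltW|exact: Ef_Lam_lamJ].
 by apply: qgr_sqn => k; exact: lgr_Lam_lamJ.
by rewrite -mulr_suml; apply: ler_wpM2r.
Qed.

Definition gvec : 'rV[R]_N := \row_j E (fun x => dH x 0 j).

Lemma lgr_qgr (F : 'rV[R]_N -> R) : lgr F -> qgr F.
move=> lF; rewrite (_ : F = fun x => F x * 1); last by apply: funext => x; rewrite mulr1.
by apply: lgrM => //; exact: lgr_cst.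
Qed.

Lemma Ef_dot (u : 'rV[R]_N -> 'rV[R]_N) (v : 'rV[R]_N) : (forall i, lgr (fun x => u x 0 i)) ->
 E (fun x => dot (u x) v) = dot (\row_j E (fun x => u x 0 j)) v.
move=> lu; rewrite /dot (Ef_sum V A_free d0 x0); last first.
 move=> i; under eq_fun do rewrite mulrC.
 by apply: qgrZ; exact: lgr_qgr.
apply: eq_bigr => i _; rewrite mxE [RHS]mulrC -(EfZ); last exact: lgr_qgr.
by congr Ef; apply: funext => x; rewrite mulrC.
Qed.

Lemma gvec_dot u : E (fun x => dot (dH x) u) = dot gvec u.
by rewrite Ef_dot// => i; exact: lgr_psi1vec. Qed.

(** The part of [gvec] along the fiber is the expectation of a force along the fiber, which is zero
    by integration by parts. *)
Lemma proj_gvec : proj gvec = gvec.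
have [u uE] := proj_sub gvec; apply/esym/eqP; rewrite -subr_eq0 -sqn_eq0 uE.
rewrite /sqn -[in X in dot X _]uE dotBl -gvec_dot (Ef_psi1 V A_free d0 x0).
by rewrite {1}/proj span_orth subrr.
Qed.

Lemma gvec_span : gvec = gvec *m Bm_inv Bs *m Bs.
by rewrite -{1}proj_gvec. Qed.

Lemma Ef_Lam_dot u : E (fun x => dot (Lam x) u) = dot gvec u.
under eq_fun do rewrite /Lam proj_sym.
by rewrite gvec_dot -proj_sym proj_gvec.
Qed.

Lemma lgr_Lam_sub i (g : 'rV[R]_N) : lgr (fun x => (Lam x - g) 0 i).
by apply: lgr_vecB => j; [exact: lgr_Lam|exact: lgr_cst]. Qed.

Lemma qgr_Lam_blk m (g : 'rV[R]_N) : qgr (fun x => sqn (blk m (Lam x - g))).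
by apply: qgr_sqn => k; apply: lgr_blk => i; exact: lgr_Lam_sub. Qed.

Lemma Ef_Lam_sub0 u : E (fun x => dot (Lam x - gvec) u) = 0.
under eq_fun do rewrite dotBl.
rewrite (EfB).
- by rewrite Ef_Lam_dot Ef_cst ?subrr.
- by apply: lgr_qgr; apply: lgr_dot => i; exact: lgr_Lam.
- exact: qgr_cst.
Qed.

(** A second moment is least about the mean, so [lam0] may be traded for [gvec]. *)
Lemma Ef_Lam_gvec m : E (fun x => sqn (blk m (Lam x - gvec))) <= CB.
set u := 2 *: (blk m (gvec - lam0) *m Pm K m); set c := sqn (blk m (gvec - lam0)).
have qd : qgr (fun x => dot (Lam x - gvec) u).
 by apply: lgr_qgr; apply: lgr_dot => i; exact: lgr_Lam_sub.
have e : (fun x => sqn (blk m (Lam x - lam0))) =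
 (fun x => sqn (blk m (Lam x - gvec)) + (dot (Lam x - gvec) u + c)).
 apply: funext => x.
 rewrite (_ : Lam x - lam0 = (Lam x - gvec) + (gvec - lam0)); last by rewrite addrA subrK.
 by rewrite blkD sqnDE /u dotZr [dot (Lam x - gvec) _]dotC dot_mul -/(blk m _) dotC addrA.
have := Ef_Lam_lam0 m; rewrite e.
have qc : qgr (fun x => dot (Lam x - gvec) u + c).
 by apply: qgrD => //; exact: qgr_cst.
rewrite (EfD (qgr_Lam_blk _ _) qc).
rewrite (EfD qd (qgr_cst _ c)) Ef_Lam_sub0 add0r Ef_cst //.
by apply: le_trans; rewrite lerDl sqn_ge0.
Qed.

Lemma eq_Ef_fiber F G : qgr F -> qgr G ->
 (forall x, rowsp A (x - x0) -> F x = G x) -> E F = E G.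
move=> qF qG FG; apply/eqP; rewrite eq_le.
by apply/andP; split; apply: (le_Ef_fiber V A_free d0) => // x /FG ->.
Qed.

Lemma dot_fiber (z : 'rV[R]_M) x : rowsp A (x - x0) -> dot (z *m Bs) x = dot (z *m Bs) x0.
by move=> [c cE]; rewrite -[x](subrK x0) cE dotDr span_orth add0r. Qed.

Definition hvecg x : 'rV[R]_N := \row_j hs V (gvec 0 j) (x 0 j).

Lemma lgr_hvecg j : lgr (fun x => hvecg x 0 j).
under eq_fun do rewrite mxE.
apply: (lgr_bounded (C := 2 * B)); last by move=> x; exact: hs_ub.
apply: (measT_comp (f := hs V (gvec 0 j))); last exact: meas_coor.
by have [] := gr_hs V (gvec 0 j).
Qed.

(** At the tilt [gvec] the centred force is the centred spin plus the defect. Tested with a spline,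
    the spin is deterministic on the fiber and the centred force averages to zero. *)
Lemma bias_eq (z : 'rV[R]_M) :
 dot (z *m Bs) (x0 - mvec V gvec) = - E (fun x => dot (z *m Bs) (hvecg x)).
set th := z *m Bs.
have qh : qgr (fun x => dot th (hvecg x)).
 under eq_fun do rewrite dotC.
 by apply: lgr_qgr; apply: lgr_dot => i; exact: lgr_hvecg.
have qp : qgr (fun x => dot (dH x) th).
 by apply: lgr_qgr; apply: lgr_dot => i; exact: lgr_psi1vec.
have : E (fun x => dot (dH x) th - dot gvec th) =
   E (fun x => dot th (x0 - mvec V gvec) + dot th (hvecg x)).
 apply: eq_Ef_fiber.
 - by apply: qgrB => //; exact: qgr_cst.
 - by apply: qgrD => //; exact: qgr_cst.
 move=> x /(dot_fiber z) xE; rewrite -dotBl (dHE V gvec x) dotDl dotBr.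
 by rewrite dotBl ![dot _ th]dotC xE.
rewrite (EfB qp (qgr_cst _ _)) gvec_dot Ef_cst // subrr.
rewrite (EfD (qgr_cst _ _) qh) Ef_cst // => /esym/eqP.
by rewrite addr_eq0 => /eqP.
Qed.

Let w j := stein V (gvec 0 j).
Let dw j z := hs V (gvec 0 j) z + w j z * (psi1 V z - gvec 0 j).
Let wbar j := Ex V (gvec 0 j) (w j).

Lemma der_w j (z : R) : is_derive z 1 (w j) (dw j z).
exact: der_stein. Qed.

Lemma cts_w j : continuous (w j).
exact: der_cts (der_w j). Qed.

Lemma gr_w j : growth (w j).
apply: (gr_cts (C := stein_cst V)); first exact: cts_w.
by move=> z; exact: stein_ub.
Qed.

Lemma lgr_coor_fun (f : R -> R) (D : R) j : continuous f -> (forall z, `|f z| <= D) ->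
 lgr (fun x => f (x 0 j)).
move=> cf fD; apply: (lgr_bounded (C := D)) => // .
apply: (measT_comp (f := f)); last exact: meas_coor.
exact: cts_measT.
Qed.

Lemma lgr_w j : lgr (fun x => w j (x 0 j)).
exact: (@lgr_coor_fun (w j) (stein_cst V) j (@cts_w j) (stein_ub V _)). Qed.

Lemma lgr_dw j : lgr (fun x => dw j (x 0 j)).
exact: (@lgr_coor_fun (dw j) (stein_cst V) j (@cts_dstein _ V _) (dstein_ub V _)). Qed.

(** Stein's equation writes the defect as [dw - w * (psi1 - gvec)], and the last factor splits into
    [dH - Lam] and [Lam - gvec]. The former is the force along the fiber part of the unit vector;
    integrated by parts, it cancels [dw] up to the diagonal entry of the projection. In the latter
    [w] may be centred at [wbar], because [Lam - gvec] has mean zero. *)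
Lemma Ef_hs j : E (fun x => hs V (gvec 0 j) (x 0 j)) =
 proj (delta_mx 0 j) 0 j * E (fun x => dw j (x 0 j)) -
 E (fun x => (w j (x 0 j) - wbar j) * (Lam x - gvec) 0 j).
have [u uE] := proj_sub (delta_mx 0 j); set p := proj _ 0 j.
have vj : (u *m A) 0 j = 1 - p by rewrite -uE mxE [X in X + _]mxE [X in _ + X]mxE !eqxx.
have lW := lgr_w j; have lD := lgr_dw j.
have qD := lgr_qgr lD.
have ibp : (1 - p) * E (fun x => dw j (x 0 j)) =
  E (fun x => w j (x 0 j) * dot (dH x) (u *m A)).
 rewrite -(EfZ _ qD).
 have ib := fiber_ibp V A_free x0 (c := u) (G := fun x => w j (x 0 j))
  (dG := fun x => dw j (x 0 j) * (u *m A) 0 j) lW.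
 refine (etrans _ (ib _ _ _)).
 - by congr Ef; apply: funext => x; rewrite vj mulrC.
 - by under eq_fun do rewrite mulrC; exact: qgrZ.
 - by move=> x t; exact: der_coor_line (der_w j).
 - move=> x; set c := (u *m A) 0 j.
  have cl : continuous (fun t : R => (x + t *: (u *m A)) 0 j).
   rewrite (_ : (fun t : R => _) = fun t => x 0 j + t * c); last first.
    by apply: funext => s; rewrite mxE [X in _ + X]mxE.
   by move=> t; apply: cvgD; [exact: cvg_cst|apply: cvgM; [exact: cvg_id|exact: cvg_cst]].
  move=> t; apply: cvgM; last exact: cvg_cst.
  apply: (@continuous_comp _ _ _ (fun t : R => (x + t *: (u *m A)) 0 j) (dw j)); first exact: cl.
  exact: cts_dstein.
have ue x : dot (dH x) (u *m A) = (dH x - Lam x) 0 j.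
 by rewrite -uE dotBr -proj_sym -/(Lam x) !dot_delta [RHS]mxE [X in _ = _ + X]mxE.
have L1 : lgr (fun x => (dH x - Lam x) 0 j).
 by apply: lgr_vecB => i; [exact: lgr_psi1vec|exact: lgr_Lam].
have L2 := lgr_Lam_sub j gvec.
rewrite (_ : (fun x => hs V _ _) = fun x => dw j (x 0 j) -
 (w j (x 0 j) * (dH x - Lam x) 0 j + w j (x 0 j) * (Lam x - gvec) 0 j)); last first.
 apply: funext => x; rewrite -mulrDr -(stein_equation V (gvec 0 j) (x 0 j)) -/(w j) -/(dw j _).
 by congr (_ - _ * _); rewrite !mxE addrA subrK.
have q1 := lgrM lW L1; have q2 := lgrM lW L2.
rewrite (EfB qD (qgrD q1 q2)) (EfD q1 q2).
rewrite (_ : E (fun x => w j (x 0 j) * (dH x - Lam x) 0 j) = (1 - p) * E (fun x => dw j (x 0 j))); last first.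
 by rewrite ibp; congr Ef; apply: funext => x; rewrite ue.
rewrite (_ : E (fun x => (w j (x 0 j) - wbar j) * (Lam x - gvec) 0 j) =
 E (fun x => w j (x 0 j) * (Lam x - gvec) 0 j)).
 by move: (E _) (E _) => s t; ring.
under eq_fun do rewrite mulrBl.
rewrite (EfB q2 (qgrZ _ (lgr_qgr L2))) (EfZ _ (lgr_qgr L2)).
under [X in _ - _ * Ef _ _ _ X]eq_fun do rewrite -dot_delta.
by rewrite Ef_Lam_sub0 mulr0 subr0.
Qed.

Let sc := stein_cst V.
Let Lw := sc * (3 + 4 * B ^+ 2).

Lemma sc_ge0 : 0 <= sc.
exact: le_trans (normr_ge0 _) (stein_ub V 0 0). Qed.

(** The centred Stein solution is split at the local tilt: [bJ] is centred for the product law at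
    [lamJ], and [cJ] is the change of mean from [lamJ] to [gvec]. *)
Definition bJ (th : 'rV[R]_N) m x : 'rV[R]_K :=
 \row_k (th 0 (idx m k) * (w (idx m k) (blk m x 0 k) - Ex V (lamJ m x 0 k) (w (idx m k)))).
Definition cJ (th : 'rV[R]_N) m x : 'rV[R]_K :=
 \row_k (th 0 (idx m k) * (Ex V (lamJ m x 0 k) (w (idx m k)) - wbar (idx m k))).

Lemma lgrowth_bJ th m k : lgr (fun x => bJ th m x 0 k).
under eq_fun do rewrite mxE.
apply: lgrZ; apply: (lgr_bounded (C := 2 * sc)).
 by apply: meas_fam; [exact: cts_w|exact: gr_w].
move=> x; apply: le_trans (ler_normB _ _) _; rewrite mulr_natl mulr2n.
by apply: lerD; [exact: stein_ub|apply: Ex_ub; [exact: gr_w|exact: stein_ub]].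
Qed.

Lemma bsp_coef_sup (z : 'rV[R]_M) m k :
 (z *m Bs) 0 (idx m k) ^+ 2 <= supc * sqn (blk m (z *m Bs)).
by have := bsp_sup z m k; rewrite blkE. Qed.

(** The test spline enters the one-site functions through its largest entry on the block. As
    [block_cst] scales quadratically, that entry comes out squared, as [supc] times the squared
    norm. *)
Lemma Ef_bJ (z : 'rV[R]_M) m : E (fun x => sqn (bJ (z *m Bs) m x *m beta^T)) <=
 supc * sqn (blk m (z *m Bs)) * block_cst V r C1 C2 (2 * sc).
set th := z *m Bs; set q := supc * _.
have q0 : 0 <= q by apply: mulr_ge0; [exact: supc_ge0|exact: sqn_ge0].
have thq k : `|th 0 (idx m k)| <= Num.sqrt q.
 by rewrite -sqrtr_sqr ler_wsqrtr// bsp_coef_sup.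
rewrite -[X in X * _](sqr_sqrtr q0) -block_cst_scale.
pose fam (l : 'rV[R]_K) (k : 'I_K) (t : R) : R :=
 th 0 (idx m k) * (w (idx m k) t - Ex V (l 0 k) (w (idx m k))).
have gw := gr_w; have s0 := sc_ge0.
apply: (block_expect (m := m) (fam := fam)).
- by apply: mulr_ge0; [exact: sqrtr_ge0|rewrite mulr_ge0].
- move=> l k; apply: measTM; first exact: measurable_cst.
 by apply: measTB; [by have [] := gw (idx m k)|exact: measurable_cst].
- move=> l k t; rewrite normrM; apply: ler_pM => //.
 apply: le_trans (ler_normB _ _) _; rewrite mulr_natl mulr2n.
 by apply: lerD; [exact: stein_ub|apply: Ex_ub; [exact: gw|exact: stein_ub]].
- move=> l k t u; rewrite -mulrBr opprB addrA subrK normrM -mulrA; apply: ler_pM => //.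
 have [c _ ->] := MVT_any u t (der_w (idx m k)).
 rewrite normrM; apply: ler_wpM2r => //; apply: le_trans (dstein_ub V _ c) _.
 by rewrite mulr_natl mulr2n lerDl.
- move=> l k; rewrite /fam ExZ; last by apply: grB => //; exact: gr_cst.
 by rewrite ExB ?Ex_cst ?subrr ?mulr0//; exact: gr_cst.
- move=> k; apply: measTM; first exact: measurable_cst.
 by apply: meas_fam; [exact: cts_w|exact: gw].
Qed.

Lemma sqr_le_norm (x y : R) : `|x| <= `|y| -> x ^+ 2 <= y ^+ 2.
by move=> h; rewrite -(real_normK (num_real x)) -(real_normK (num_real y)) lerXn2r ?nnegrE. Qed.

Lemma sqn_cJ (z : 'rV[R]_M) m x : sqn (cJ (z *m Bs) m x) <=
 supc * sqn (blk m (z *m Bs)) * (Lw ^+ 2 * sqn (lamJ m x - blk m gvec)).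
rewrite {1}sqnE [sqn (lamJ m x - _)]sqnE; set q := supc * _; rewrite !mulr_sumr; apply: ler_sum => k _.
rewrite mxE exprMn; apply: ler_pM; [exact: sqr_ge0|exact: sqr_ge0|exact: bsp_coef_sup|].
rewrite -exprMn; apply: sqr_le_norm.
have mw : measT (w (idx m k)) by have [] := gr_w (idx m k).
apply: le_trans (Ex_lipschitz V _ _ mw (stein_ub V _)) _.
have Lw0 : 0 <= Lw.
 by apply: mulr_ge0; [exact: sc_ge0|rewrite addr_ge0// mulr_ge0// sqr_ge0].
have -> : (lamJ m x - blk m gvec) 0 k = lamJ m x 0 k - gvec 0 (idx m k).
 by rewrite mxE [X in _ + X]mxE blkE.
by rewrite [leRHS]normrM (ger0_norm Lw0).
Qed.

Lemma cross_blk (th : 'rV[R]_N) m x : blk m (\row_j (th 0 j * (w j (x 0 j) - wbar j))) = bJ th m x + cJ th m x.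
apply/rowP => k; rewrite blkE [LHS]mxE [RHS]mxE [X in _ = X + _]mxE [X in _ = _ + X]mxE -mulrDr.
by rewrite blkE addrA subrK.
Qed.

(** [Lam - gvec] lies in the block span, so [bJ] is felt only through its averages, which the
    one-block estimate controls; estimating [bJ] by its full norm would lose a factor [K]. *)
Lemma cross_ub (th : 'rV[R]_N) m x t : 0 < t ->
 `|2 * dot (bJ th m x + cJ th m x) (blk m (Lam x - gvec))| <=
 t * (C2 * sqn (bJ th m x *m beta^T) + sqn (cJ th m x)) + t^-1 * (2 * sqn (blk m (Lam x - gvec))).
move=> t0; rewrite dotDl mulrDr; apply: le_trans (ler_normD _ _) _.
have C20 := frame_C2 fr.
have h2 := dot_young_scaled (cJ th m x) (blk m (Lam x - gvec)) t0.
have h1 : `|2 * dot (bJ th m x) (blk m (Lam x - gvec))| <=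
  t * (C2 * sqn (bJ th m x *m beta^T)) + t^-1 * sqn (blk m (Lam x - gvec)).
 have [s ->] : exists s, blk m (Lam x - gvec) = s *m beta.
  by rewrite gvec_span /Lam /proj -!mulmxBl blk_bsp; eexists.
 rewrite dotC dot_mul dotC.
 apply: le_trans (dot_young_scaled _ s (mulr_gt0 t0 C20)) _.
 rewrite -mulrA lerD2l invfM -mulrA; apply: ler_wpM2l; first by rewrite invr_ge0 ltW.
 by rewrite ler_pdivrMl// (frame_lb fr).
apply: le_trans (lerD h1 h2) _; apply: le_of_eq; ring.
Qed.

Lemma qgr_lamJ_gvec m : qgr (fun x => sqn (lamJ m x - blk m gvec)).
apply: qgr_sqn => k; apply: lgr_vecB => i; first exact: lgr_lamJ.
exact: lgr_cst.
Qed.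

Lemma Ef_lamJ_gvec m : E (fun x => sqn (lamJ m x - blk m gvec)) <= 2 * CA + 2 * CB.
have q1 : qgr (fun x => sqn (blk m (Lam x) - lamJ m x)).
 by apply: qgr_sqn => k; exact: lgr_Lam_lamJ.
have q2 := qgr_Lam_blk m gvec.
apply: le_trans (le_Ef V A_free d0 x0 (qgr_lamJ_gvec m)
 (qgrD (qgrZ 2 q1) (qgrZ 2 q2)) _) _.
 move=> x; rewrite (_ : _ - _ = - (blk m (Lam x) - lamJ m x) + blk m (Lam x - gvec)).
  by apply: le_trans (sqnD _ _) _; rewrite sqnN.
 by rewrite blkB opprB addrA subrK.
rewrite (EfD (qgrZ 2 q1) (qgrZ 2 q2)) (EfZ _ q1) (EfZ _ q2).
by apply: lerD; apply: ler_wpM2l => //; [exact: Ef_Lam_lamJ|exact: Ef_Lam_gvec].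
Qed.

Definition CD : R := C2 * block_cst V r C1 C2 (2 * sc) + Lw ^+ 2 * (2 * CA + 2 * CB).

(** The vanishing term merely names a block and a base point, from whose second moment the sign is
    read off. *)
Lemma CB_ge0 m : 0 <= CB + 0 * sqn (blk m x0).
rewrite mul0r addr0; apply: le_trans (Ef_Lam_gvec m).
rewrite -(Ef_cst V A_free d0 x0 0); apply: (le_Ef V A_free d0) => //.
- exact: qgr_cst.
- exact: qgr_Lam_blk.
- by move=> x; exact: sqn_ge0.
Qed.

(** The parameter [t] stays free, so that a single use of [optimize] after the sum over all blocks
    yields the product bound. *)
Lemma Ef_cross (z : 'rV[R]_M) t : 0 < t ->
 `|2 * E (fun x => dot (\row_j ((z *m Bs) 0 j * (w j (x 0 j) - wbar j))) (Lam x - gvec))| <=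
 t * (supc * sqn (z *m Bs) * CD) + t^-1 * (M%:R * (2 * CB)).
move=> t0; set th := z *m Bs.
pose Y x := dot (\row_j (th 0 j * (w j (x 0 j) - wbar j))) (Lam x - gvec).
pose G m x := t * (C2 * sqn (bJ th m x *m beta^T) +
 supc * sqn (blk m th) * (Lw ^+ 2 * sqn (lamJ m x - blk m gvec))) +
 t^-1 * (2 * sqn (blk m (Lam x - gvec))).
have qY : qgr Y.
 rewrite /Y /dot; apply: (@qgr_sum _ _ _ _ (fun j x => (\row_j (th 0 j * (w j (x 0 j) - wbar j))) 0 j * (Lam x - gvec) 0 j)) => j.
 under eq_fun do rewrite mxE.
 apply: lgrM; last exact: lgr_Lam_sub.
 by apply: lgrZ; apply: lgrB; [exact: lgr_w|exact: lgr_cst].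
have qb m : qgr (fun x => sqn (bJ th m x *m beta^T)).
 by apply: qgr_sqn => i; apply: lgr_mul => k; exact: lgrowth_bJ.
have ql := qgr_lamJ_gvec; have qL m := qgr_Lam_blk m gvec.
have qG m : qgr (G m).
 by apply: qgrD; apply: qgrZ; [apply: qgrD; apply: qgrZ => //; exact: qgrZ|exact: qgrZ].
have pt x : `|2 * Y x| <= \sum_m G m x.
 rewrite /Y dot_blk mulr_sumr; apply: le_trans (ler_norm_sum _ _ _) _; apply: ler_sum => m _.
 rewrite cross_blk; apply: le_trans (cross_ub _ _ _ t0) _; rewrite lerD2r.
 apply: ler_wpM2l; first exact: ltW.
 by rewrite lerD2l; exact: sqn_cJ.
have EG : E (fun x => \sum_m G m x) <= t * (supc * sqn th * CD) + t^-1 * (M%:R * (2 * CB)).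
 rewrite (Ef_sum V A_free d0 x0 _ qG).
 have -> : t * (supc * sqn th * CD) + t^-1 * (M%:R * (2 * CB)) =
   \sum_(m < M) (t * (supc * sqn (blk m th) * CD) + t^-1 * (2 * CB)).
  rewrite big_split/= sumr_const card_ord -!mulr_sumr -mulr_suml -mulr_sumr -sqn_blk.
  by congr (_ + _); rewrite -mulr_natl; ring.
 apply: ler_sum => m _.
 have q1 := qgrZ C2 (qb m); have q2 := qgrZ (supc * sqn (blk m th)) (qgrZ (Lw ^+ 2) (ql m)).
 rewrite (EfD (qgrZ t (qgrD q1 q2)) (qgrZ t^-1 (qgrZ 2 (qL m)))).
 rewrite (EfZ _ (qgrD q1 q2)) (EfD q1 q2).
 rewrite (EfZ _ (qb m)) (EfZ _ (qgrZ (Lw ^+ 2) (ql m))).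
 rewrite (EfZ _ (ql m)) (EfZ _ (qgrZ 2 (qL m))).
 rewrite (EfZ _ (qL m)).
 apply: lerD; last first.
  apply: ler_wpM2l; first by rewrite invr_ge0 ltW.
  by apply: ler_wpM2l => //; exact: Ef_Lam_gvec.
 apply: ler_wpM2l; first exact: ltW.
 rewrite /CD mulrDr; apply: lerD.
  rewrite [leRHS]mulrCA; apply: ler_wpM2l; [exact: ltW (frame_C2 fr)|exact: Ef_bJ].
 apply: ler_wpM2l; first by apply: mulr_ge0; [exact: supc_ge0|exact: sqn_ge0].
 by apply: ler_wpM2l; [exact: sqr_ge0|exact: Ef_lamJ_gvec].
have qS := @qgr_sum _ _ _ (index_enum 'I_M) G qG.
rewrite ler_norml -(EfZ _ qY) lerNl -(EfN V A_free x0 (qgrZ 2 qY)).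
apply/andP; split; apply: le_trans EG; apply: (le_Ef V A_free d0 x0) => //.
- by apply: qgrN; exact: qgrZ.
- by move=> x; have := pt x; rewrite ler_norml lerNl => /andP[].
- exact: qgrZ.
- by move=> x; have := pt x; rewrite ler_norml => /andP[].
Qed.

Definition Cmain : R := 2 * (C2 * C3 * sc) ^+ 2 + 2 * (C2 * C3 * CD * (2 * CB)).

Lemma Ef_dw_ub j : `|E (fun x => dw j (x 0 j))| <= sc.
have qD := lgr_qgr (lgr_dw j).
have h x : - sc <= dw j (x 0 j) <= sc by rewrite -ler_norml dstein_ub.
rewrite ler_norml -{1}(Ef_cst V A_free d0 x0 (- sc)) -[X in _ <= _ <= X](Ef_cst V A_free d0 x0 sc).
apply/andP; split; apply: (le_Ef V A_free d0).
- exact: qgr_cst.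
- exact: qD.
- by move=> x; case/andP: (h x).
- exact: qD.
- exact: qgr_cst.
- by move=> x; case/andP: (h x).
Qed.

(** There are [N = K * M] diagonal terms of size [O(1 / K)], with square sum of order [M / K]. *)
Lemma diag_term (z : 'rV[R]_M) :
 (\sum_j (z *m Bs) 0 j * (proj (delta_mx 0 j) 0 j * E (fun x => dw j (x 0 j)))) ^+ 2 <=
 (C2 * C3 * sc) ^+ 2 * (M%:R / K%:R) * sqn (z *m Bs).
set q : 'rV[R]_N := \row_j (proj (delta_mx 0 j) 0 j * E (fun x => dw j (x 0 j))).
have -> : \sum_j (z *m Bs) 0 j * (proj (delta_mx 0 j) 0 j * E (fun x => dw j (x 0 j))) =
  dot (z *m Bs) q by apply: eq_bigr => j _; rewrite [q 0 j]mxE.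
apply: le_trans (dot_cs _ _) _; rewrite [leRHS]mulrC.
apply: ler_wpM2l; first exact: sqn_ge0.
have K0 : K%:R != 0 :> R by rewrite pnatr_eq0 -lt0n (frame_K fr).
rewrite sqnE; apply: le_trans (_ : \sum_(j < N) (supc * sc) ^+ 2 <= _).
 apply: ler_sum => j _; rewrite mxE; apply: sqr_le_norm.
 have [p0 pS] := andP (proj_diag j).
 rewrite [leLHS]normrM [leRHS]normrM (ger0_norm p0) (ger0_norm supc_ge0) (ger0_norm sc_ge0).
 by apply: ler_pM => //; exact: Ef_dw_ub.
rewrite sumr_const card_ord -[leLHS]mulr_natl natrM /supc le_eqVlt; apply/orP; left; apply/eqP.
by field.
Qed.

Lemma CD_ge0 (m : 'I_M) : 0 <= CD.
rewrite /CD; apply: addr_ge0.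
 apply: mulr_ge0; first exact: ltW (frame_C2 fr).
 by apply: block_cst_ge0; exact: ltW (frame_C1 fr).
apply: mulr_ge0; first exact: sqr_ge0.
apply: le_trans (Ef_lamJ_gvec m); rewrite -(Ef_cst V A_free d0 x0 0).
apply: (le_Ef V A_free d0) => //.
- exact: qgr_cst.
- exact: qgr_lamJ_gvec.
- by move=> x; exact: sqn_ge0.
Qed.

(** Diagonal and cross terms both have square of order [M / K] relative to the test spline. The
    normalisation by [sqrt K / N] in [grad_bias] turns this into [1 / K ^ 2]. *)
Theorem main_estimate (z : 'rV[R]_M) : (0 < M)%N ->
 dot (z *m Bs) (x0 - mvec V gvec) ^+ 2 <= Cmain * (M%:R / K%:R) * sqn (z *m Bs).
move=> M0; set th := z *m Bs; pose m0 := Ordinal M0.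
set S2 := E (fun x => dot (\row_j (th 0 j * (w j (x 0 j) - wbar j))) (Lam x - gvec)).
set S1 := \sum_j th 0 j * (proj (delta_mx 0 j) 0 j * E (fun x => dw j (x 0 j))).
have -> : dot th (x0 - mvec V gvec) = - (S1 - S2).
 rewrite bias_eq /dot (Ef_sum V A_free d0 x0); last first.
  by move=> j; apply: qgrZ; apply: lgr_qgr; exact: lgr_hvecg.
 congr (- _); rewrite /S1 /S2 /dot (Ef_sum V A_free d0 x0); last first.
  move=> j; under eq_fun do rewrite mxE.
  apply: lgrM; last exact: lgr_Lam_sub.
  by apply: lgrZ; apply: lgrB; [exact: lgr_w|exact: lgr_cst].
 rewrite -sumrB; apply: eq_bigr => j _.
 rewrite (EfZ); last by apply: lgr_qgr; exact: lgr_hvecg.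
 under eq_fun do rewrite mxE.
 rewrite Ef_hs mulrBr; congr (_ - _).
 rewrite -(EfZ); last first.
  apply: lgrM; last exact: lgr_Lam_sub.
  by apply: lgrB; [exact: lgr_w|exact: lgr_cst].
 by congr Ef; apply: funext => x; rewrite [in RHS]mxE mulrA.
have h1 : S1 ^+ 2 <= _ := diag_term z.
have h2 : S2 ^+ 2 <= (supc * sqn th * CD) * (M%:R * (2 * CB)).
 apply: optimize.
 - by apply: mulr_ge0; [apply: mulr_ge0; [exact: supc_ge0|exact: sqn_ge0]|exact: (CD_ge0 m0)].
 - apply: mulr_ge0 => //; apply: mulr_ge0 => //.
  by have := CB_ge0 m0; rewrite mul0r addr0.
 - by move=> t t0; exact: Ef_cross.
rewrite sqrrN; apply: le_trans (_ : 2 * S1 ^+ 2 + 2 * S2 ^+ 2 <= _).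
 by rewrite -subr_ge0 (_ : _ - _ = (S1 + S2) ^+ 2) ?sqr_ge0//; ring.
have -> : Cmain * (M%:R / K%:R) * sqn th = 2 * ((C2 * C3 * sc) ^+ 2 * (M%:R / K%:R) * sqn th) +
 2 * ((supc * sqn th * CD) * (M%:R * (2 * CB))).
 rewrite /Cmain /supc; move: (sqn th) K%:R^-1 M%:R CD CB => ? ? ? ? ?; ring.
by apply: lerD; apply: ler_wpM2l.
Qed.
End main.

#[local] Transparent block_cst stein_cst lip mono.

(** * Differentiability of the logarithmic partition function *)

Lemma expR_quadratic (R : realType) (b : R) : `|b| <= 2^-1 -> 1 - b <= expR (- b) <= 1 - b + 2 * b ^+ 2.
rewrite ler_norml => /andP[b1 b2]; apply/andP; split; first exact: expR_ge1Dx.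
have p : 0 < 1 + b by lra.
rewrite -[leLHS]mulr1 expRN -ler_pdivlMl ?invr_gt0 ?expR_gt0// invrK.
apply: (@le_trans _ _ ((1 + b) * (1 - b + 2 * b ^+ 2))).
 rewrite -subr_ge0 (_ : _ - _ = b ^+ 2 * (1 + 2 * b)); last by ring.
 by apply: mulr_ge0; [exact: sqr_ge0|lra].
apply: ler_wpM2r; last exact: expR_ge1Dx.
by have := sqr_ge0 b; move: (b ^+ 2) => c; lra.
Qed.

Lemma ln_near1 (R : realType) (rho s : R) : 0 <= s -> s <= 2^-1 -> 1 - s <= rho -> - (2 * s) <= ln rho.
move=> s0 s1 h; have r2 : 2^-1 <= rho by lra.
have rp : 0 < rho by lra.
have ri : rho^-1 <= 2 by rewrite -[leRHS]invrK lef_pV2 ?posrE.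
have hp : -1 < rho^-1 - 1 by rewrite ltrBrDl subrr invr_gt0.
have : - ln rho <= rho^-1 - 1 by have := le_ln1Dx hp; rewrite addrCA subrr addr0 lnV ?posrE.
have : rho^-1 - 1 <= 2 * s.
 have -> : rho^-1 - 1 = rho^-1 * (1 - rho) by rewrite mulrBr mulr1 mulVf// gt_eqF.
 have [r1|r1] := leP rho 1; first by apply: ler_pM; [rewrite invr_ge0 ltW|lra|exact: ri|lra].
 apply: (@le_trans _ _ 0); last by lra.
 by rewrite nmulr_lle0 ?invr_ge0 ?(ltW rp)// subr_lt0.
by move: (ln rho) (rho^-1) => u v; lra.
Qed.

Lemma qgr_bounded (R : realType) n (F : 'rV[R]_n -> R) C : measT F ->
 (forall x, `|F x| <= C) -> qgr F.
move=> mF FC; have := lgrM (lgr_bounded mF FC) (lgr_cst n 1).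
by under eq_fun do rewrite mulr1; exact.
Qed.

Section expansion.
Context {R : realType} (V : perturbation R) (n d : nat) (A : 'M[R]_(d, n)).
Hypothesis A_free : row_free A.
Hypothesis d_gt0 : (0 < d)%N.
Variables x0 g : 'rV[R]_n.
Notation psi := (pot V).
Notation B := (bnd V).
Notation E := (Ef V A x0).
Notation dH := (dH V).
Implicit Types x w : 'rV[R]_n.
Hypothesis g_dot : forall u, E (fun x => dot (dH x) u) = dot g u.

(** Energy increment along [w] beyond its expected value [dot g w]. The term [dot (x - x0) w], zero
    on the fiber for admissible [w], removes the unbounded part of the force, so that [tbias] is
    bounded on the whole space. *)
Definition tbias w x : R := hamiltonian psi (x + w) - hamiltonian psi x - dot (x - x0) w - dot g w.

Definition qvec x : 'rV[R]_n := \row_i (slope V + pert1 V (x 0 i)) + (x0 - g).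

Lemma tbias_lin w x : `|tbias w x - dot (qvec x) w| <= curv V * sqn w.
have := sum_taylor V x w; congr (`|_| <= _); rewrite /tbias /qvec.
have -> : dH x = x + \row_i (slope V + pert1 V (x 0 i)).
 by apply/rowP => i; rewrite !mxE addrA.
rewrite !dotDl !dotNl; move: (hamiltonian _ _) (hamiltonian _ _) (dot _ _) (dot _ _) (dot _ _) => *; ring.
Qed.

Definition qcst : R := 2 * (n%:R * (`|slope V| + B) ^+ 2) + 2 * sqn (x0 - g).

Lemma sqn_qvec x : sqn (qvec x) <= qcst.
apply: le_trans (sqnD _ _) _; rewrite lerD2r; apply: ler_wpM2l => //.
rewrite sqnE -[X in _ <= X%:R * _](card_ord n) mulr_natl -sumr_const; apply: ler_sum => i _.
rewrite mxE -[leLHS](real_normK (num_real _)) lerXn2r ?nnegrE ?addr_ge0 ?bnd_ge0//.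
by apply: le_trans (ler_normD _ _) _; rewrite lerD2l pert1_ub.
Qed.

Definition tcst : R := 2 * qcst + 2 * curv V ^+ 2.

Lemma tbias_sqr w x : sqn w <= 1 -> tbias w x ^+ 2 <= tcst * sqn w.
move=> w1; have s0 := sqn_ge0 w.
have h1 : dot (qvec x) w ^+ 2 <= qcst * sqn w.
 by apply: le_trans (dot_cs _ _) _; apply: ler_wpM2r => //; exact: sqn_qvec.
have h2 : (tbias w x - dot (qvec x) w) ^+ 2 <= curv V ^+ 2 * sqn w.
 apply: (@le_trans _ _ ((curv V * sqn w) ^+ 2)).
  rewrite -[leLHS](real_normK (num_real _)) lerXn2r ?nnegrE ?tbias_lin//.
  by rewrite mulr_ge0// curv_ge0.
 rewrite exprMn; apply: ler_wpM2l; first exact: sqr_ge0.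
 by rewrite expr2 ler_piMr.
rewrite /tcst; move: (tbias w x) (dot _ _) h1 h2 => b q h1 h2.
have : b ^+ 2 <= 2 * (b - q) ^+ 2 + 2 * q ^+ 2.
 by rewrite -subr_ge0 (_ : _ - _ = (b - 2 * q) ^+ 2) ?sqr_ge0//; ring.
rewrite (_ : (_ + _) * sqn w = 2 * (qcst * sqn w) + 2 * (curv V ^+ 2 * sqn w)); last by ring.
by move: (b ^+ 2) ((b - q) ^+ 2) (q ^+ 2) (qcst * _) (curv V ^+ 2 * _) h1 h2 => *; lra.
Qed.

(** Bound on [sqn w] below which [tbias] is at most 1/2 in modulus and the expansions of [expR] and
    [ln] apply. *)
Definition rcst : R := (4 * (1 + tcst + curv V))^-1.

Lemma tcst_ge0 : 0 <= tcst.
rewrite /tcst /qcst addr_ge0//; last by rewrite mulr_ge0 ?sqr_ge0.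
by rewrite mulr_ge0// addr_ge0// mulr_ge0 ?sqn_ge0// mulr_ge0 ?sqr_ge0.
Qed.

Lemma rcst_gt0 : 0 < rcst.
have := tcst_ge0; have := curv_ge0 V; rewrite invr_gt0.
by move: tcst (curv V) => s t; lra.
Qed.

Lemma rcst_small s : 0 <= s -> s <= rcst -> [/\ s <= 1, tcst * s <= 4^-1 & curv V * s <= 2^-1].
have t0 := tcst_ge0; have k0 := curv_ge0 V => s0.
rewrite /rcst -[_^-1]div1r ler_pdivlMr; last by move: tcst (curv V) t0 k0 => ? ? *; lra.
have : 0 <= tcst * s by rewrite mulr_ge0.
have : 0 <= curv V * s by rewrite mulr_ge0.
rewrite (_ : s * (4 * (1 + tcst + curv V)) = 4 * s + 4 * (tcst * s) + 4 * (curv V * s)); last by ring.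
by move: (tcst * s) (curv V * s) => *; split; lra.
Qed.

Lemma meas_tbias w : measT (tbias w).
have mH (v : 'rV[R]_n) : measT (fun x => hamiltonian psi (x + v)).
 apply: measurable_sum => i; apply: (measT_comp (f := psi)).
  by apply: cts_measT; exact: cpsi.
 by under eq_fun do rewrite mxE; apply: measTD => //; exact: meas_coor.
apply: measTB => //; apply: measTB.
 apply: measTB; first exact: mH.
 by have := mH 0; under eq_fun do rewrite addr0.
by under eq_fun do rewrite dotBl; apply: measTB => //; exact: measurable_dot.
Qed.

Lemma tbias_ub w x : sqn w <= rcst -> `|tbias w x| <= 2^-1.
move=> wr; have [w1 h _] := rcst_small (sqn_ge0 w) wr.
have := le_trans (tbias_sqr x w1) h.
rewrite -[_ ^+ 2](real_normK (num_real _)) => h2.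
have : `|tbias w x| ^+ 2 <= (2^-1) ^+ 2 by apply: (le_trans h2); lra.
by apply: ler_of_sqr; rewrite invr_ge0.
Qed.

Lemma weight_shift w x : weight V (x + w) =
 expR (- dot g w) * expR (- tbias w x) * weight V x * expR (- dot (x - x0) w).
rewrite /weight -!expRD /tbias; congr expR.
by move: (hamiltonian _ _) (hamiltonian _ _) (dot _ _) (dot _ _) => *; ring.
Qed.

Lemma qgr_tbias w : sqn w <= rcst -> qgr (fun x => tbias w x).
move=> wr; apply: (qgr_bounded (meas_tbias w) (fun x => tbias_ub x wr)).
Qed.

Lemma qgr_exp_tbias w : sqn w <= rcst -> qgr (fun x => expR (- tbias w x)).
move=> wr; apply: (@qgr_bounded _ _ _ (expR 1)).
 apply: (measT_comp (f := expR)) => //.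
 by apply: measT_comp => //; exact: meas_tbias.
move=> x; rewrite ger0_norm ?expR_ge0// ler_expR.
by have := tbias_ub x wr; rewrite ler_norml; move: (tbias w x) => t; lra.
Qed.

(** Translation of the fiber: for [w] orthogonal to the row space, the factor
    [expR (- dot (x - x0) w)] of [weight_shift] equals 1 on the fiber. *)
Lemma Zf_shift w : (forall c, dot (c *m A) w = 0) -> sqn w <= rcst ->
 Zf V A (x0 + w) = expR (- dot g w) * (Zf V A x0 * E (fun x => expR (- tbias w x))).
move=> wA wr; set G := fun x => expR (- tbias w x).
have qG : qgr G := qgr_exp_tbias wr.
have Z0 := Zf_gt0 V A_free d_gt0 x0.
have -> : Zf V A x0 * E G = gibbs_int V A x0 G by rewrite /Ef mulrC divfK// gt_eqF.
apply: EFin_inj; rewrite -(int_weightE V A_free).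
have iG := intble_gibbs V A_free x0 (qgrZ (expR (- dot g w)) qG).
have -> : expR (- dot g w) * gibbs_int V A x0 G = gibbs_int V A x0 (fun x => expR (- dot g w) * G x).
 rewrite /gibbs_int -RintegralZl//; last exact: intble_gibbs.
 by apply: eq_Rintegral => x _; rewrite mulrA.
rewrite /gibbs_int /Rintegral fineK; last exact: integrable_fin_num iG.
have mw : measT (fun x => (weight V (x0 + w + x))%:E).
 apply/measT_EFin; apply: (measT_comp (meas_weight V (n := n))).
 by exact: meas_transll.
apply: eq_int_fiberm => //.
- by move=> x; rewrite lee_fin; exact: expR_ge0.
- by case/integrableP: iG.
- by move=> x; rewrite lee_fin !mulr_ge0 ?expR_ge0.
move=> x [c ->]; rewrite addrAC (weight_shift w).
have -> : x0 + c *m A - x0 = c *m A by rewrite addrC addKr.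
rewrite wA oppr0 expR0 mulr1.
by [].
Qed.

(** On the fiber the first-order part of [tbias] is the centred force along [w], so only the Taylor
    remainder survives in the mean. *)
Lemma Ef_tbias w : (forall c, dot (c *m A) w = 0) -> sqn w <= rcst ->
 `|E (fun x => tbias w x)| <= curv V * sqn w.
move=> wA wr; have qb := qgr_tbias wr.
have qp : qgr (fun x => dot (dH x) w).
 have lp : lgr (fun x => dot (dH x) w).
  by apply: lgr_dot => i; exact: lgr_psi1vec.
 have := lgrM lp (lgr_cst n 1); under eq_fun do rewrite mulr1; exact.
have h x : rowsp A (x - x0) -> `|tbias w x - (dot (dH x) w - dot g w)| <= curv V * sqn w.
 move=> [u xu]; apply: le_trans (tbias_lin w x); rewrite le_eqVlt; apply/orP; left; apply/eqP.
 congr (`|_ - _|); rewrite /qvec.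
 have -> : dH x = x + \row_i (slope V + pert1 V (x 0 i)).
  by apply/rowP => i; rewrite !mxE addrA.
 have xE : dot x w = dot x0 w by rewrite -[x](subrK x0) xu dotDl wA add0r.
 rewrite !dotDl xE dotNl.
 by move: (dot _ _) (dot _ _) (dot _ _) => *; ring.
have q1 c : qgr (fun x => dot (dH x) w + c).
 by apply: qgrD => //; exact: qgr_cst.
have e c : E (fun x => dot (dH x) w + c) = dot g w + c.
 by rewrite (EfD V A_free x0 qp (qgr_cst _ c)) g_dot (Ef_cst V A_free d_gt0).
have ub : E (fun x => tbias w x) <= curv V * sqn w.
 apply: le_trans (le_Ef_fiber V A_free d_gt0 qb (q1 (- dot g w + curv V * sqn w)) _) _.
  move=> x /h; rewrite ler_norml => /andP[_].
  by move: (tbias _ _) (dot _ _) (dot _ _) (_ * _) => *; lra.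
 by rewrite e addrA subrr add0r.
have lb : - (curv V * sqn w) <= E (fun x => tbias w x).
 apply: le_trans (le_Ef_fiber V A_free d_gt0 (q1 (- dot g w - curv V * sqn w)) qb _).
  by rewrite e addrA subrr add0r.
 move=> x /h; rewrite ler_norml => /andP[].
 by move: (tbias _ _) (dot _ _) (dot _ _) (_ * _) => *; lra.
by rewrite ler_norml lb ub.
Qed.

(** The mean of [tbias] and its square are both of second order in [w]; so is then the logarithm of
    the mean of [expR (- tbias)]. *)
Theorem ln_Zf_expansion w : (forall c, dot (c *m A) w = 0) -> sqn w <= rcst ->
 `|ln (Zf V A (x0 + w)) - ln (Zf V A x0) + dot g w| <= (2 * tcst + 2 * curv V) * sqn w.
move=> wA wr; have qb := qgr_tbias wr; have qe := qgr_exp_tbias wr.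
have [w1 h4 h2] := rcst_small (sqn_ge0 w) wr.
have Z0 := Zf_gt0 V A_free d_gt0 x0.
set rho := E (fun x => expR (- tbias w x)).
have Eb := Ef_tbias wA wr; have := Eb; rewrite ler_norml => /andP[Eb1 Eb2].
have q1 c : qgr (fun x => c - tbias w x) by apply: qgrB => //; exact: qgr_cst.
have e c : E (fun x => c - tbias w x) = c - E (fun x => tbias w x).
 by rewrite (EfB V A_free x0 (qgr_cst _ c) qb) (Ef_cst V A_free d_gt0).
have k0 := curv_ge0 V; have t0 := tcst_ge0; have s0 := sqn_ge0 w.
have lb : 1 - curv V * sqn w <= rho.
 apply: (@le_trans _ _ (E (fun x => 1 - tbias w x))).
  by rewrite e; move: (E _) (_ * _) Eb2 => *; lra.
 apply: (le_Ef V A_free d_gt0) => // x.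
 by case/andP: (expR_quadratic (tbias_ub x wr)).
have ub : rho <= 1 + (curv V * sqn w + 2 * (tcst * sqn w)).
 apply: (@le_trans _ _ (E (fun x => (1 + 2 * (tcst * sqn w)) - tbias w x))); last first.
  by rewrite e; move: (E _) (_ * _) (2 * _) Eb1 => *; lra.
 apply: (le_Ef V A_free d_gt0) => // x.
 case/andP: (expR_quadratic (tbias_ub x wr)) => _ h; apply: (le_trans h).
 have := tbias_sqr x w1; move: (tbias w x) (tcst * sqn w) => u v; lra.
have rp : 0 < rho by move: (curv V * sqn w) h2 lb => *; lra.
rewrite (Zf_shift wA wr) -/rho.
have -> : ln (expR (- dot g w) * (Zf V A x0 * rho)) = - dot g w + (ln (Zf V A x0) + ln rho).
 rewrite lnM ?posrE ?expR_gt0//; last exact: mulr_gt0.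
 by rewrite expRK lnM ?posrE.
rewrite (_ : _ + _ = ln rho); last by move: (dot _ _) (ln _) (ln _) => *; ring.
rewrite ler_norml; apply/andP; split.
 have cs0 : 0 <= curv V * sqn w by rewrite mulr_ge0.
 have := ln_near1 cs0 h2 lb; have : 0 <= tcst * sqn w by rewrite mulr_ge0.
 rewrite (_ : (_ + _) * sqn w = 2 * (tcst * sqn w) + 2 * (curv V * sqn w)); last by ring.
 by move: (ln rho) (curv V * sqn w) (tcst * sqn w) => *; lra.
have : -1 < rho - 1 by move: (rho) rp => *; lra.
move=> /le_ln1Dx; rewrite addrC subrK => h; apply: (le_trans h).
have : 0 <= curv V * sqn w by rewrite mulr_ge0.
rewrite (_ : (_ + _) * sqn w = 2 * (tcst * sqn w) + 2 * (curv V * sqn w)); last by ring.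
by move: ub; move: (curv V * sqn w) (tcst * sqn w) => k t; lra.
Qed.
End expansion.

(** * Polynomials on the unit interval *)

Section polynomial.
Context {R : realType}.
Implicit Types (p q : {poly R}) (t : R).

Lemma der_horner p t : is_derive t 1 (horner p) (p^`().[t]).
elim/poly_ind: p => [|p c IH].
 rewrite deriv0 horner0 (_ : horner 0 = cst 0); first exact: is_derive_cst.
 by apply: funext => s; rewrite horner0.
rewrite (_ : horner (p * 'X + c%:P) = (fun s => p.[s] * s + c)); last first.
 by apply: funext => s; rewrite !hornerE.
apply: is_derive_eq; rewrite derivD derivM derivX derivC !hornerE.
by rewrite /GRing.scale/= addrC; ring.
Qed.

Lemma poly_ub01 p : exists2 C, 0 <= C & forall t, 0 <= t <= 1 -> `|p.[t]| <= C.
exists (\sum_(i < size p) `|p`_i|); first by rewrite sumr_ge0.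
move=> t /andP[t0 t1]; rewrite horner_coef; apply: le_trans (ler_norm_sum _ _ _) _.
apply: ler_sum => i _; rewrite normrM ler_piMr// normrX exprn_ile1//.
by rewrite ger0_norm.
Qed.

Lemma poly01_eq0 p : (forall t, 0 <= t <= 1 -> p.[t] = 0) -> p = 0.
move=> p0; pose rs := [seq i.+1%:R^-1 | i <- iota 0 (size p)] : seq R.
apply: (@roots_geq_poly_eq0 _ p rs); last by rewrite size_map size_iota.
 apply/allP => _ /mapP[i _ ->]; apply/eqP/p0.
 by rewrite invr_ge0 ler0n/= invf_le1 ?ler1n// ltr0n.
rewrite map_inj_uniq ?iota_uniq// => i j /invr_inj /eqP.
by rewrite eqr_nat eqSS => /eqP.
Qed.

Definition antid p : {poly R} := \poly_(i < (size p).+1) (p`_i.-1 / i%:R).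

Lemma coef_antid p i : (antid p)`_i = p`_i.-1 / i%:R.
rewrite coef_poly ltnS; case: leqP => // pi.
by case: i pi => //= i; rewrite ltnS => pi; rewrite nth_default ?mul0r.
Qed.

Lemma deriv_antid p : (antid p)^`() = p.
apply/polyP => i; rewrite coef_deriv coef_antid/= -[LHS]mulr_natr divfK//.
Qed.

Definition int01 p : R := (antid p).[1] - (antid p).[0].

Lemma int01D p q : int01 (p + q) = int01 p + int01 q.
have -> : int01 (p + q) = (antid p + antid q).[1] - (antid p + antid q).[0].
 by rewrite /int01; congr (_.[_] - _.[_]); apply/polyP => i;
  rewrite coefD !coef_antid coefD mulrDl.
by rewrite /int01 !hornerD; ring.
Qed.

Lemma int01Z c p : int01 (c *: p) = c * int01 p.
have -> : int01 (c *: p) = (c *: antid p).[1] - (c *: antid p).[0].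
 by rewrite /int01; congr (_.[_] - _.[_]); apply/polyP => i;
  rewrite coefZ !coef_antid coefZ mulrA.
by rewrite /int01 !hornerZ mulrBr.
Qed.

Lemma int01_0 : int01 0 = 0.
by rewrite -(scale0r (0 : {poly R})) int01Z mul0r. Qed.

Lemma int01_sum (I : Type) (s : seq I) (F : I -> {poly R}) :
 int01 (\sum_(i <- s) F i) = \sum_(i <- s) int01 (F i).
by apply: (big_morph int01 int01D int01_0). Qed.

Lemma poly_mvt p (a b : R) : a <= b ->
 exists2 c, a <= c <= b & p.[b] - p.[a] = p^`().[c] * (b - a).
move=> ab; have [->|anb] := eqVneq a b.
 by exists b; rewrite ?lexx// !subrr mulr0.
have altb : a < b by rewrite lt_def eq_sym anb.
have [|c cab ->] := @MVT R (horner p) (fun t => p^`().[t]) a b altb (fun t _ => der_horner p t).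
 by apply: continuous_subspaceT => t; apply/differentiable_continuous/derivable1_diffP.
by exists c => //; case/andP: cab => /ltW -> /ltW ->.
Qed.

(** The antiderivative of a square is monotone, and equal end values make it constant. *)
Lemma int01_sqr_eq0 p : int01 (p * p) = 0 -> p = 0.
move=> /eqP; rewrite subr_eq0 => /eqP e; set Q := antid (p * p) in e.
have mono a b : a <= b -> Q.[a] <= Q.[b].
 move=> ab; have [c _] := poly_mvt Q ab; rewrite deriv_antid hornerM => h.
 by rewrite -subr_ge0 h mulr_ge0 ?subr_ge0// -expr2 sqr_ge0.
have : Q - (Q.[0])%:P = 0.
 apply: poly01_eq0 => t /andP[t0 t1]; rewrite !hornerE; apply/eqP; rewrite subr_eq0 eq_le.
 by apply/andP; split; [rewrite -e|]; exact: mono.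
move=> /(congr1 deriv); rewrite derivB derivC subr0 deriv_antid deriv0.
by move=> /eqP; rewrite mulf_eq0 orbb => /eqP.
Qed.
End polynomial.

(** * Cardinal B-splines *)

Section bspline.
Context {R : realType}.
(** Index shift with value 0 at [i = 0], where the left neighbour is outside the support. *)
Definition Bpr (B : nat -> {poly R}) (i : nat) : {poly R} := if i is j.+1 then B j else 0.

(* The restriction of the cardinal B-spline of degree L to [i, i + 1], as a
 polynomial in the local coordinate s = x - i (Cox-de Boor recursion). *)
Fixpoint Bp (L : nat) : nat -> {poly R} :=
 if L is l.+1 then fun i =>
  l.+1%:R^-1 *: (('X + i%:R%:P) * Bp l i + ((l.+2%:R - i%:R)%:P - 'X) * Bpr (Bp l) i)
 else fun i => (i == 0)%N%:R%:P.

Arguments Bp : simpl never.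

Lemma Bp0 i : Bp 0 i = (i == 0)%N%:R%:P. by []. Qed.

Lemma BpS l i : Bp l.+1 i =
 l.+1%:R^-1 *: (('X + i%:R%:P) * Bp l i + ((l.+2%:R - i%:R)%:P - 'X) * Bpr (Bp l) i).
by []. Qed.

Lemma BpE l i : l.+1%:R%:P * Bp l.+1 i =
 ('X + i%:R%:P) * Bp l i + ((l.+2%:R - i%:R)%:P - 'X) * Bpr (Bp l) i.
by rewrite BpS -mul_polyC mulrA -polyCM mulfV ?pnatr_eq0// mul1r.
Qed.

Lemma natC_inj l (p q : {poly R}) : l.+1%:R%:P * p = l.+1%:R%:P * q -> p = q.
by apply: mulfI; rewrite polyC_eq0 pnatr_eq0. Qed.

Lemma Bp_gt L i : (L < i)%N -> Bp L i = 0.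
elim: L i => [|l IH] [|i]//; rewrite ltnS => li; apply: (@natC_inj l).
rewrite BpE/= mulr0 IH ?mulr0 ?add0r; last exact: ltnW.
have [->|il] := eqVneq i l.+1.
 by rewrite subrr polyC0 sub0r IH ?mulr0.
by rewrite IH ?mulr0// ltn_neqAle eq_sym; case: ltngtP li il.
Qed.

Lemma size_Bp L i : (size (Bp L i) <= L.+1)%N.
elim: L i => [|l IH] i; first by rewrite Bp0 size_polyC; case: eqP => _; rewrite ?oner_eq0 ?eqxx.
rewrite BpS; apply: leq_trans (size_scale_leq _ _) _; apply: leq_trans (size_polyD _ _) _.
have sX (c : R) : (size ('X + c%:P)%R <= 2)%N.
 by rewrite -[c]opprK polyCN size_XsubC.
rewrite geq_max; apply/andP; split.
 apply: leq_trans (size_polyMleq _ _) _; rewrite -subn1 leq_subLR.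
 by apply: leq_trans (leq_add (sX _) (IH i)) _.
apply: leq_trans (size_polyMleq _ _) _; rewrite -subn1 leq_subLR.
have sB : (size (Bpr (Bp l) i) <= l.+1)%N by case: i => [|j]//=; rewrite size_poly0.
have s2 : (size ((l.+2%:R - i%:R)%:P - 'X : {poly R})%R <= 2)%N.
 by rewrite -size_polyN opprB size_XsubC.
exact: leq_trans (leq_add s2 sB) _.
Qed.

Lemma natCS n : (n.+1%:R%:P : {poly R}) = n%:R%:P + 1.
by rewrite -polyC1 -polyCD natr1. Qed.

Lemma deriv_natM n (p : {poly R}) : n%:R%:P * p^`() = (n%:R%:P * p)^`().
by rewrite derivM derivC mul0r add0r. Qed.

Lemma deriv_Bp L i : (Bp L.+1 i)^`() = Bp L i - Bpr (Bp L) i.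
elim: L i => [|l IH] i.
 apply: (@natC_inj 0); rewrite deriv_natM BpE.
 by case: i => [|[|i]] /=; rewrite !Bp0 !(derivD, derivM, derivX, derivC, derivB, derivN)
  ?polyCB ?polyC0 ?polyC1 ?natCS ?polyC0; ring.
apply: (@natC_inj l.+1); rewrite deriv_natM BpE.
rewrite derivD !derivM derivD derivB !derivX !derivC.
case: i => [|[|i]] /=; rewrite ?IH ?deriv0 /=.
- have := BpE l 0; rewrite /= polyC0 (natCS l.+1).
 move: ((l.+1%:R)%:P : {poly R}) (Bp l.+1 0%N) => n1 b h.
 by transitivity (b + n1 * b); [rewrite h; ring|ring].
- have := BpE l 0; have := BpE l 1; rewrite /= !polyCB (natCS l.+2) (natCS l.+1) polyC0.
 move: ((l.+1%:R)%:P : {poly R}) (Bp l.+1 0%N) (Bp l.+1 1%N) => n1 b b1 h1 h0.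
 by transitivity (b1 - b + n1 * b1 - n1 * b); [rewrite h1 h0; ring|ring].
have := BpE l i.+1; have := BpE l i.+2; rewrite /= !polyCB (natCS l.+2) (natCS l.+1).
rewrite (natCS i.+1) (natCS i).
move: ((l.+1%:R)%:P : {poly R}) (Bp l.+1 i.+1) (Bp l.+1 i.+2) => n1 b1 b2 h2 h1.
by transitivity (b2 - b1 + n1 * b2 - n1 * b1); [rewrite h1 h2; ring|ring].
Qed.

Lemma sum_Bpr (c : nat -> {poly R}) (B : nat -> {poly R}) n :
 \sum_(i < n.+1) c i * Bpr B i = \sum_(i < n) c i.+1 * B i.
by rewrite big_ord_recl/= mulr0 add0r; apply: eq_bigr => i _. Qed.

Lemma sum_Bp L : \sum_(i < L.+1) Bp L i = 1.
elim: L => [|l IH]; first by rewrite big_ord1 Bp0 polyC1.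
apply: (@natC_inj l); rewrite mulr_sumr.
under eq_bigr do rewrite BpE.
rewrite big_split/= big_ord_recr/= Bp_gt// mulr0 addr0.
rewrite (sum_Bpr (fun i => (l.+2%:R - i%:R)%:P - 'X)) -big_split/= -IH mulr_sumr.
apply: eq_bigr => i _; rewrite -mulrDl; congr (_ * _).
rewrite !polyCB -[i.+1%:R]natr1 -[l.+2%:R]natr1 !polyCD; ring.
Qed.

Lemma Bp_match l i : (Bp l.+1 i).[1] = (Bp l.+1 i.+1).[0] /\ (Bp l.+1 0).[0] = 0.
have E n j t : n.+1%:R * (Bp n.+1 j).[t] = (t + j%:R) * (Bp n j).[t] + (n.+2%:R - j%:R - t) * (Bpr (Bp n) j).[t].
 by have := congr1 (horner^~ t) (BpE n j); rewrite !hornerE.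
have n0 n : n.+1%:R != 0 :> R by rewrite pnatr_eq0.
elim: l i => [|l IH] i.
 split; apply: (mulfI (n0 0)); rewrite !E ?Bp0.
  by case: i => [|[|i]] /=; rewrite !Bp0 !hornerE -?natr1; ring.
 by rewrite /= !hornerE; ring.
split; apply: (mulfI (n0 l.+1)); rewrite !E; last by rewrite /= (IH 0).2 !hornerE; ring.
have -> : (Bpr (Bp l.+1) i).[1] = (Bp l.+1 i).[0].
 by case: i => [|j] /=; [rewrite horner0 (IH 0).2|rewrite (IH j).1].
by rewrite (IH i).1 /= -!natr1; ring.
Qed.

Lemma Bp_smooth r L i : (r < L)%N ->
 (Bp L i)^`(r).[1] = (Bp L i.+1)^`(r).[0] /\ (Bp L 0)^`(r).[0] = 0.
elim: r L i => [|r IH] [|L] i// rL; first exact: Bp_match.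
rewrite !derivSn !deriv_Bp !derivnB !hornerE /= linear0 horner0 subr0; split; last exact: (IH L 0 rL).2.
rewrite (IH L i rL).1; congr (_ - _).
by case: i => [|j] /=; [rewrite linear0 horner0 (IH L 0 rL).2|rewrite (IH L j rL).1].
Qed.

(** Differentiation lowers the degree and turns the coefficients into their differences, so by
    induction they are all equal; the partition of unity then makes the common value 0. *)
Lemma Bp_free L (c : nat -> R) : \sum_(i < L.+1) c i *: Bp L i = 0 ->
 forall i, (i <= L)%N -> c i = 0.
elim: L c => [|L IH] c.
 rewrite big_ord1 Bp0 /= polyC1 => /eqP; rewrite scaler_eq0 oner_eq0 orbF => /eqP c0 i.
 by rewrite leqn0 => /eqP ->.
move=> s0; have c_eq i : (i <= L)%N -> c i = c i.+1.
 move=> iL; apply/eqP; rewrite -subr_eq0; apply/eqP.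
 apply: (IH (fun i => c i - c i.+1)) => //.
 have := congr1 deriv s0; rewrite deriv0 raddf_sum/= => e; rewrite -[RHS]e.
 under [RHS]eq_bigr do rewrite derivZ deriv_Bp scalerBr.
 rewrite sumrB [X in X - _]big_ord_recr/= (Bp_gt (ltnSn L)) scaler0 addr0 [X in _ - X]big_ord_recl/= scaler0 add0r -sumrB.
 by apply: eq_bigr => j _; rewrite scalerBl.
have call i : (i <= L.+1)%N -> c i = c 0%N.
 by elim: i => // i IHi iL; rewrite -c_eq// IHi// ltnW.
move: s0; rewrite (eq_bigr (fun i : 'I_L.+2 => c 0%N *: Bp L.+1 i)); last first.
 by move=> i _; rewrite call// -ltnS.
rewrite -scaler_sumr sum_Bp => /eqP; rewrite scaler_eq0 oner_eq0 orbF => /eqP c0 i iL.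
by rewrite call.
Qed.

(** A primitive of [Bp L i]: its derivative telescopes by [deriv_Bp]. *)
Definition Pp L i : {poly R} := \sum_(l < i.+1) Bp L.+1 l.

Lemma deriv_Pp L i : (Pp L i)^`() = Bp L i.
elim: i => [|i IH]; first by rewrite /Pp big_ord1 deriv_Bp subr0.
by rewrite /Pp big_ord_recr/= derivD -/(Pp L i) IH deriv_Bp/= addrC subrK.
Qed.

Section fixed_degree.
Variable L : nat.
Implicit Types s : 'rV[R]_L.+1.

Definition psp s : {poly R} := \sum_(i < L.+1) s 0 i *: Bp L i.
Definition Psp s : {poly R} := \sum_(i < L.+1) s 0 i *: Pp L i.

Lemma deriv_Psp s : (Psp s)^`() = psp s.
by rewrite raddf_sum/=; apply: eq_bigr => i _; rewrite derivZ deriv_Pp. Qed.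

Lemma psp_eq0 s : psp s = 0 -> s = 0.
move=> s0; apply/rowP => i; rewrite mxE -(inord_val i).
apply: (@Bp_free L (fun j => s 0 (inord j))); last by rewrite -ltnS.
by rewrite -[RHS]s0; apply: eq_bigr => j _; rewrite inord_val.
Qed.

Lemma size_psp s : (size (psp s) <= L.+1)%N.
apply: leq_trans (size_sum _ _ _) _; apply/bigmax_leqP => i _.
by apply: leq_trans (size_scale_leq _ _) _; exact: size_Bp.
Qed.

Lemma psp_full (q : {poly R}) : (size q <= L.+1)%N -> exists s, q = psp s.
move=> sq; pose A : 'M[R]_L.+1 := \matrix_(i, j) (Bp L i)`_j.
have pA s : poly_rV (psp s) = s *m A.
 apply/rowP => j; rewrite !mxE coef_sum; apply: eq_bigr => i _.
 by rewrite coefZ mxE.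
have Au : A \in unitmx.
 rewrite -row_free_unit; apply/row_freeP; exists (pinvmx A).
 apply/row_matrixP => i; apply/eqP; rewrite -subr_eq0 -linearB/=.
 have : psp (row i (A *m pinvmx A - 1%:M)) = 0.
  rewrite -[psp _](poly_rV_K (size_psp _)) pA -row_mul mulmxBl mulmxKpV ?submx_refl// mul1mx subrr.
  by rewrite linear0 linear0.
 by move=> /psp_eq0 ->.
exists (poly_rV q *m invmx A).
by rewrite -[LHS](poly_rV_K sq) -[RHS](poly_rV_K (size_psp _)) pA mulmxKV.
Qed.

Lemma sqr_sum_coef s (b : 'I_L.+1 -> R) C : (forall i, `|b i| <= C) ->
 (\sum_i s 0 i * b i) ^+ 2 <= L.+1%:R * C ^+ 2 * sqn s.
move=> bC; have C0 : 0 <= C by apply: le_trans (bC ord0).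
have -> : \sum_i s 0 i * b i = dot s (\row_i b i) by apply: eq_bigr => i _; rewrite mxE.
apply: le_trans (dot_cs _ _) _; rewrite mulrC ler_wpM2r ?sqn_ge0//.
rewrite sqnE -[X in _ <= X%:R * _](card_ord L.+1) mulr_natl -sumr_const; apply: ler_sum => i _.
by rewrite mxE -[leLHS](real_normK (num_real _)) lerXn2r ?nnegrE.
Qed.

Lemma psp_ub : exists2 C, 0 < C & forall s t, 0 <= t <= 1 ->
 [/\ (psp s).[t] ^+ 2 <= C * sqn s, ((psp s)^`().[t]) ^+ 2 <= C * sqn s &
   forall i : 'I_L.+1, (Bp L i).[t] ^+ 2 <= C].
have [D D0 DB] : exists2 D, 0 <= D & forall (i : 'I_L.+1) t, 0 <= t <= 1 ->
  `|(Bp L i).[t]| <= D /\ `|((Bp L i)^`()).[t]| <= D.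
 have h (i : 'I_L.+1) : exists D, 0 <= D /\ forall t, 0 <= t <= 1 ->
   `|(Bp L i).[t]| <= D /\ `|((Bp L i)^`()).[t]| <= D.
  have [C1 C10 h1] := poly_ub01 (Bp L i); have [C2 C20 h2] := poly_ub01 (Bp L i)^`().
  exists (C1 + C2); split; first exact: addr_ge0.
  by move=> t t01; split; [apply: le_trans (h1 _ t01) _|apply: le_trans (h2 _ t01) _];
   rewrite ?lerDl ?lerDr.
 have [f fP] := choice h; exists (\sum_i f i); first by apply: sumr_ge0 => i _; case: (fP i).
 move=> i t t01; have le : f i <= \sum_i f i.
  by rewrite (bigD1 i)//= lerDl sumr_ge0// => j _; case: (fP j).
 by have [_ /(_ t t01)[u v]] := fP i; split; apply: le_trans le.
exists (L.+1%:R * D ^+ 2 + D ^+ 2 + 1).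
 by rewrite ltr_wpDl// addr_ge0 ?sqr_ge0// mulr_ge0 ?sqr_ge0.
move=> s t t01; have le X : X <= L.+1%:R * D ^+ 2 * sqn s -> X <= (L.+1%:R * D ^+ 2 + D ^+ 2 + 1) * sqn s.
 move=> h; apply: le_trans h _; apply: ler_wpM2r; first exact: sqn_ge0.
 by rewrite -addrA lerDl addr_ge0 ?sqr_ge0.
split.
- apply: le; rewrite horner_sum; under eq_bigr do rewrite hornerZ.
 by apply: sqr_sum_coef => i; case: (DB i t t01).
- apply: le; rewrite raddf_sum/= horner_sum; under eq_bigr do rewrite derivZ hornerZ.
 by apply: sqr_sum_coef => i; case: (DB i t t01).
move=> i; apply: (@le_trans _ _ (D ^+ 2)).
 by rewrite -[leLHS](real_normK (num_real _)) lerXn2r ?nnegrE//; case: (DB i t t01).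
by rewrite addrAC lerDr addr_ge0// mulr_ge0 ?sqr_ge0.
Qed.
End fixed_degree.
End bspline.

(** * Cell averages of B-splines *)

Section averages.
Context {R : realType} (L : nat).
Implicit Types s : 'rV[R]_L.+1.

(** Exact average of the spline piece over the [k]-th of [K] subcells, as a difference of
    primitives. *)
Definition avg (K : nat) s (k : nat) : R :=
 K%:R * ((Psp s).[k.+1%:R / K%:R] - (Psp s).[k%:R / K%:R]).

(** The factor [sqrt K] makes [bavg K *m (bavg K)^T] a Riemann sum for the Gram matrix [gram01], so
    that its frame bounds do not depend on [K]. *)
Definition bavg (K : nat) : 'M[R]_(L.+1, K) := \matrix_(i, k)
 (Num.sqrt K%:R * ((Pp L i).[k.+1%:R / K%:R] - (Pp L i).[k%:R / K%:R])).

Lemma mul_bavg K s k : Num.sqrt K%:R * (s *m bavg K) 0 k = avg K s k.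
have -> : avg K s k = Num.sqrt K%:R * (Num.sqrt K%:R * ((Psp s).[k.+1%:R / K%:R] - (Psp s).[k%:R / K%:R])).
 by rewrite mulrA -expr2 sqr_sqrtr.
congr (_ * _); rewrite mxE !horner_sum -sumrB mulr_sumr.
by apply: eq_bigr => i _; rewrite mxE !hornerZ -mulrBr mulrCA.
Qed.

Lemma sqn_bavg K s : (0 < K)%N -> sqn (s *m bavg K) = \sum_(k < K) avg K s k ^+ 2 / K%:R.
move=> K0; rewrite sqnE; apply: eq_bigr => k _; rewrite -mul_bavg exprMn sqr_sqrtr// mulrC mulKf//.
by rewrite pnatr_eq0 -lt0n.
Qed.

Lemma node01 K (k : 'I_K) (t : R) : k%:R / K%:R <= t <= k.+1%:R / K%:R -> 0 <= t <= 1.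
move=> /andP[h1 h2]; have K0 : (0 < K)%N by case: k h1 h2 => k; case: K.
rewrite (le_trans _ h1) ?divr_ge0//= (le_trans h2)//.
by rewrite ler_pdivrMr ?ltr0n// mul1r ler_nat.
Qed.

Lemma node_le K (k : nat) : k%:R / K%:R <= k.+1%:R / K%:R :> R.
by rewrite ler_wpM2r ?invr_ge0// ler_nat. Qed.

Lemma node_width K (k : nat) : k.+1%:R / K%:R - k%:R / K%:R = K%:R^-1 :> R.
by rewrite -mulrBl -natr1 addrAC subrr add0r mul1r. Qed.

Lemma avg_mvt K s k : (0 < K)%N ->
 exists2 c, k%:R / K%:R <= c <= k.+1%:R / K%:R & avg K s k = (psp s).[c].
move=> K0; have [c h e] := poly_mvt (Psp s) (node_le K k).
exists c => //; rewrite /avg e node_width deriv_Psp mulrC mulfVK//.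
by rewrite pnatr_eq0 -lt0n.
Qed.

Lemma poly_close (p : {poly R}) (C : R) K (k : 'I_K) (b c : R) :
 (forall t : R, 0 <= t <= 1 -> (p^`().[t]) ^+ 2 <= C) ->
 k%:R / K%:R <= b <= k.+1%:R / K%:R -> k%:R / K%:R <= c <= k.+1%:R / K%:R ->
 (p.[b] - p.[c]) ^+ 2 <= C / K%:R ^+ 2.
move=> pC.
wlog bc : b c / c <= b.
 move=> H hb hc; have [|/ltW] := leP c b => h; first exact: H.
 by rewrite -sqrrN opprB; apply: H.
move=> hb hc; have [u /andP[u1 u2] ->] := poly_mvt p bc.
have u01 : 0 <= u <= 1.
 apply: (@node01 K k); case/andP: hb => _ h; case/andP: hc => h' _.
 by rewrite (le_trans h' u1) (le_trans u2 h).
rewrite exprMn -exprVn; apply: ler_pM; rewrite ?sqr_ge0//; first exact: pC.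
rewrite lerXn2r ?nnegrE ?subr_ge0 ?invr_ge0//.
rewrite -(node_width K k); case/andP: hb => _ h; case/andP: hc => h' _.
by apply: lerB.
Qed.

Lemma sum_cst_div K (x : R) : (0 < K)%N -> \sum_(k < K) x / K%:R = x.
move=> K0; rewrite sumr_const card_ord -[LHS]mulr_natr mulfVK//.
by rewrite pnatr_eq0 -lt0n.
Qed.

Lemma telescope_nodes (q : {poly R}) K : (0 < K)%N ->
 q.[1] - q.[0] = \sum_(k < K) (q.[k.+1%:R / K%:R] - q.[k%:R / K%:R]).
move=> K0; rewrite -(big_mkord xpredT (fun k => q.[k.+1%:R / K%:R] - q.[k%:R / K%:R])).
rewrite (@telescope_sumr _ 0 K (fun k => q.[k%:R / K%:R]) (leq0n K)).
by rewrite mul0r divff// pnatr_eq0 -lt0n.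
Qed.

Lemma sqr_sum_div K (x : 'I_K -> R) : (0 < K)%N ->
 (\sum_k x k / K%:R) ^+ 2 <= \sum_k x k ^+ 2 / K%:R.
move=> K0; have -> : \sum_k x k / K%:R = dot (\row_k x k) (\row_k K%:R^-1).
 by apply: eq_bigr => k _; rewrite !mxE.
apply: le_trans (dot_cs _ _) _; rewrite -mulr_suml !sqnE.
under eq_bigr do rewrite mxE; rewrite ler_wpM2l//.
 by rewrite sumr_ge0// => k _; exact: sqr_ge0.
under eq_bigr do rewrite mxE; rewrite sumr_const card_ord expr2 -[leLHS]mulr_natl mulVKf//.
by rewrite pnatr_eq0 -lt0n.
Qed.

Definition gram01 : 'M[R]_L.+1 := \matrix_(i, j) int01 (Bp L i * Bp L j).

Lemma mul_gram01 s j : (s *m gram01) 0 j = int01 (psp s * Bp L j).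
rewrite mxE /psp mulr_suml int01_sum; apply: eq_bigr => i _.
by rewrite mxE -scalerAl int01Z.
Qed.

Lemma gram01_unit : gram01 \in unitmx.
rewrite -row_free_unit; apply/row_freeP; exists (pinvmx gram01).
apply/row_matrixP => i; apply/eqP; rewrite -subr_eq0 -linearB/=.
set s := row i _; have s0 : s *m gram01 = 0.
 by rewrite /s -row_mul mulmxBl mulmxKpV ?submx_refl// mul1mx subrr linear0.
apply/eqP; apply: psp_eq0; apply: int01_sqr_eq0.
rewrite {2}/psp mulr_sumr int01_sum big1// => j _.
have -> : psp s * (s 0 j *: Bp L j) = s 0 j *: (psp s * Bp L j) by rewrite scalerAr.
by rewrite int01Z -mul_gram01 s0 [X in _ * X]mxE mulr0.
Qed.

(** The lower bound rests on the invertibility of [gram01]: moments of a piece are computed from its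
    averages with an error that decreases with [K], and this error is absorbed for large [K]. *)
Theorem bavg_bounds : exists C : R, exists K1 : nat, [/\ 0 < C, (0 < K1)%N &
 forall K, (K1 <= K)%N -> [/\ forall s, sqn (s *m bavg K) <= C * sqn s,
  forall s, sqn s <= C * sqn (s *m bavg K),
  forall k, \sum_i bavg K i k ^+ 2 <= C / K%:R &
  forall s (k : 'I_K) t, k%:R / K%:R <= t <= k.+1%:R / K%:R ->
   (avg K s k - (psp s).[t]) ^+ 2 <= C * sqn s / K%:R ^+ 2]].
have [C C0 HC] := @psp_ub R L; have [D D0 HD] := mulmx_ub (invmx gram01).
pose F := D * (L.+1%:R * C); have F0 : 0 < F by rewrite !mulr_gt0.
(* Makes the relative discretisation error [2 F C / K ^ 2] at most 1/2. *)
pose K1 := (Num.trunc (4 * F * C)).+1.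
pose T := C + 4 * F + L.+1%:R * C.
have T0 : 0 < T by rewrite /T !addr_gt0// !mulr_gt0.
exists T, K1; split=> // K K1K; have K0 : (0 < K)%N by exact: leq_trans K1K.
have KR : 0 < K%:R :> R by rewrite ltr0n.
have CT X Y : 0 <= Y -> X <= C * Y -> X <= T * Y.
 move=> Y0 h; apply: le_trans h _; apply: ler_wpM2r => //.
 by rewrite /T -addrA lerDl addr_ge0// ltW// !mulr_gt0.
have close s (k : 'I_K) t : k%:R / K%:R <= t <= k.+1%:R / K%:R ->
  (avg K s k - (psp s).[t]) ^+ 2 <= C * sqn s / K%:R ^+ 2.
 move=> ht; have [c hc ->] := avg_mvt s k K0.
 by apply: (@poly_close _ _ K k) => // u u01; case: (HC s u u01).
split.
- move=> s; apply: CT; first exact: sqn_ge0.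
 rewrite sqn_bavg// -[leRHS](@sum_cst_div K)//; apply: ler_sum => k _.
 rewrite ler_wpM2r ?invr_ge0//; have [c /node01 hc ->] := avg_mvt s k K0.
 by case: (HC s c hc).
- move=> s; have F1 : sqn s <= 2 * F * sqn (s *m bavg K) + 2 * F * C / K%:R ^+ 2 * sqn s.
  rewrite -[in leLHS](mulmxK gram01_unit s); apply: le_trans (HD _) _.
  have h j : (s *m gram01) 0 j ^+ 2 <= C * (2 * sqn (s *m bavg K) + 2 * (C * sqn s / K%:R ^+ 2)).
   rewrite mul_gram01 /int01 (telescope_nodes _ K0).
   (* One mean value point per subcell, chosen as a function so that it may occur under the sum. *)
   pose f (k : 'I_K) : R := xget 0 [set c | k%:R / K%:R <= c <= k.+1%:R / K%:R /\
    (antid (psp s * Bp L j)).[k.+1%:R / K%:R] - (antid (psp s * Bp L j)).[k%:R / K%:R] =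
    (psp s * Bp L j).[c] * K%:R^-1].
   have fP (k : 'I_K) : k%:R / K%:R <= f k <= k.+1%:R / K%:R /\
    (antid (psp s * Bp L j)).[k.+1%:R / K%:R] - (antid (psp s * Bp L j)).[k%:R / K%:R] =
    (psp s * Bp L j).[f k] * K%:R^-1.
    have [c hc e] := poly_mvt (antid (psp s * Bp L j)) (node_le K k).
    rewrite /f; case: xgetP => [x -> //|/(_ c)]; case; split=> //.
    by rewrite e deriv_antid node_width.
   under eq_bigr do rewrite (fP _).2.
   apply: le_trans (sqr_sum_div _ K0) _.
   rewrite sqn_bavg// mulr_sumr -[X in 2 * X](@sum_cst_div K)// mulr_sumr -big_split/= mulr_sumr.
   apply: ler_sum => k _; rewrite hornerM exprMn.
   have [hf _] := fP k; have f01 := node01 hf; have [_ _ hB] := HC s _ f01.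
   have hc := close s k _ hf.
   have : (psp s).[f k] ^+ 2 <= 2 * avg K s k ^+ 2 + 2 * (C * sqn s / K%:R ^+ 2).
    move: hc; move: (avg K s k) ((psp s).[f k]) (_ / _) => u v w hw.
    have : v ^+ 2 <= 2 * u ^+ 2 + 2 * (u - v) ^+ 2.
     by rewrite -subr_ge0 (_ : _ - _ = (2 * u - v) ^+ 2) ?sqr_ge0//; ring.
    by move: (v ^+ 2) (u ^+ 2) ((u - v) ^+ 2) hw => *; lra.
   have -> : C * (2 * (avg K s k ^+ 2 / K%:R) + 2 * (C * sqn s / K%:R ^+ 2 / K%:R)) =
    (2 * avg K s k ^+ 2 + 2 * (C * sqn s / K%:R ^+ 2)) * C / K%:R by ring.
   move=> hp; rewrite ler_wpM2r ?invr_ge0//; by apply: ler_pM; rewrite ?sqr_ge0.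
  rewrite sqnE; apply: le_trans (_ : D * \sum_(j < L.+1) (C * (2 * sqn (s *m bavg K) + 2 * (C * sqn s / K%:R ^+ 2))) <= _).
   by rewrite ler_wpM2l ?(ltW D0)//; apply: ler_sum => j _; exact: h.
  rewrite sumr_const card_ord -[X in D * X]mulr_natl le_eqVlt /F; apply/orP; left; apply/eqP.
  by field; rewrite gt_eqF.
 have h2 : 2 * F * C / K%:R ^+ 2 <= 2^-1.
  have k1 : 4 * F * C <= K%:R.
   apply: le_trans (_ : K1%:R <= _); last by rewrite ler_nat.
   by rewrite ltW// truncnS_gt.
  rewrite ler_pdivrMr ?exprn_gt0//.
  have : K%:R <= K%:R ^+ 2 :> R by rewrite expr2 ler_peMr ?ler1n// ltW.
  by move: k1; rewrite -[2 * F * C]/(2 * F * C) -!mulrA; move: (F * C) (K%:R ^+ 2) => *; lra.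
 have s0 := sqn_ge0 s; have b0 := sqn_ge0 (s *m bavg K).
 have h3 : 2 * F * C / K%:R ^+ 2 * sqn s <= 2^-1 * sqn s by rewrite ler_wpM2r.
 apply: (@le_trans _ _ (4 * F * sqn (s *m bavg K))).
  move: F1 h3; set u := 2 * F * C / K%:R ^+ 2 * sqn s; rewrite -(mulrA 2 F) -(mulrA 4 F).
  by move: (F * _) u (sqn s) => *; lra.
 by rewrite ler_wpM2r// /T addrAC lerDr addr_ge0// ltW// !mulr_gt0.
- move=> k; apply: (@le_trans _ _ (L.+1%:R * C / K%:R)); last first.
  by rewrite ler_wpM2r ?invr_ge0// /T lerDr addr_ge0 ?(ltW C0)// mulr_ge0// ltW.
 rewrite -mulrA mulr_natl -[X in _ *+ X](card_ord L.+1) -sumr_const; apply: ler_sum => i _.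
 rewrite mxE exprMn sqr_sqrtr//; have [c hc ->] := poly_mvt (Pp L i) (node_le K k).
 rewrite deriv_Pp node_width exprMn.
 have [_ _ hB] := HC 0 _ (node01 hc).
 have -> : K%:R * ((Bp L i).[c] ^+ 2 * K%:R^-1 ^+ 2) = (Bp L i).[c] ^+ 2 / K%:R by field; rewrite gt_eqF.
 by rewrite ler_wpM2r ?invr_ge0.
- move=> s k t ht; apply: le_trans (close s k t ht) _.
 by rewrite ler_wpM2r ?invr_ge0 ?sqr_ge0//; apply: CT; [exact: sqn_ge0|].
Qed.
End averages.

(** * Exponentially decaying cyclic weights *)

Section weights.
Context {R : realType} (L M' : nat).
Notation M := M'.+1.

(** The B-splines active on block [m] are those starting at [m], [m - 1], ..., [m - L],
    cyclically. *)
Definition sigma (m : 'I_M) (i : 'I_L.+1) : 'I_M := (m - inZp i)%R.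

Lemma sigma_inj i : injective (sigma ^~ i).
by move=> m m' /addIr. Qed.

Variable rho : R.
Hypothesis rho_gt0 : 0 < rho.
Hypothesis rho_lt1 : rho < 1.

(** Comparable to [rho] raised to the cyclic distance. A sum over both directions instead of a
    minimum keeps the one-step ratio easy to bound across the wrap-around. *)
Definition kapf (i : nat) : R := rho ^+ i + rho ^+ (M - i).
Definition kap (m0 m : 'I_M) : R := kapf (m - m0)%R.

Lemma kapf_step (x : 'I_M) : rho * kapf x <= kapf (x - inZp 1)%R /\ rho * kapf (x - inZp 1)%R <= kapf x.
have mono a b : (b <= a)%N -> rho ^+ a <= rho ^+ b by move=> ab; rewrite ler_wiXn2l// ltW.
have E i (iM : (i < M)%N) : rho * kapf i = rho ^+ i.+1 + rho ^+ (M - i).+1.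
 by rewrite /kapf mulrDr -!exprS.
have vE : (x - inZp 1)%R = (if (x : nat) is i.+1 then i else M') :> nat.
 case: (M') x => [|n] x; first by rewrite !ord1.
 transitivity ((x + (n.+2 - 1 %% n.+2) %% n.+2) %% n.+2)%N; first by [].
 rewrite (@modn_small 1)// modnDmr subSS subn0.
 case: x => [[|i] xM] /=; first by rewrite add0n modn_small.
 by rewrite addSnnS modnDr modn_small// ltnW.
rewrite {}vE; case: x => [[|i] xM] /=.
 rewrite !E// /kapf subn0 subSnn expr0 expr1 [X in _ <= X /\ _]addrC.
 split; first by rewrite lerD2l; apply: mono; rewrite -addn2 leq_addr.
 by rewrite addrC lerD2r -[leRHS](expr0 rho); exact: mono.
have iM : (i < M)%N by exact: ltnW.
rewrite !E// /kapf; have -> : (M - i)%N = (M - i.+1).+1 by rewrite subnSK.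
by split; apply: lerD => //; apply: mono; rewrite ?leqnSn// ltnW.
Qed.

Lemma kapf_steps (x : 'I_M) i :
 rho ^+ i * kapf x <= kapf (x - inZp i)%R /\ rho ^+ i * kapf (x - inZp i)%R <= kapf x.
elim: i => [|i [IH1 IH2]].
 by rewrite !expr0 !mul1r (_ : inZp 0 = 0 :> 'I_M) ?subr0//; apply/val_inj; rewrite /= mod0n.
have -> : (x - inZp i.+1)%R = (x - inZp i - inZp 1)%R.
 rewrite -addrA -opprD; congr (_ - _).
 by apply/val_inj; rewrite /= modnDm addn1.
have [h1 h2] := kapf_step (x - inZp i)%R.
rewrite !exprS; split.
 by rewrite -mulrA; apply: le_trans h1; rewrite ler_wpM2l// ltW.
rewrite [_ * rho ^+ i]mulrC -mulrA; apply: le_trans IH2; rewrite ler_wpM2l//.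
by rewrite exprn_ge0// ltW.
Qed.

Lemma kapf_gt0 i : 0 < kapf i.
by rewrite /kapf addr_gt0// exprn_gt0. Qed.

(** Ratios of at least [1 - q] in both directions give a relative variation of at most
    [q / (1 - q)]. *)
Lemma kap_slow (q : R) m0 m i : 0 <= q -> q < 1 -> 1 - q <= rho ^+ L ->
 `|kap m0 (sigma m i) - kap m0 m| <= q / (1 - q) * kap m0 m.
move=> q0 q1 hq; have q1' : 0 < 1 - q by rewrite subr_gt0.
have hi : 1 - q <= rho ^+ i.
 apply: (le_trans hq); rewrite ler_wiXn2l//; [exact: ltW|exact: ltW|by rewrite -ltnS].
have [h1 h2] := kapf_steps (m - m0)%R i.
have e : (sigma m i - m0 = m - m0 - inZp i)%R by rewrite /sigma addrAC.
rewrite /kap e; move: h1 h2 (kapf_gt0 (m - m0)%R) (kapf_gt0 (m - m0 - inZp i)%R).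
move: (kapf _) (kapf _) => b a h1 h2 a0 b0.
have g1 : (1 - q) * a <= b by apply: le_trans h1; rewrite ler_wpM2r// ltW.
have g2 : (1 - q) * b <= a by apply: le_trans h2; rewrite ler_wpM2r// ltW.
rewrite mulrAC ler_pdivlMr// -[X in _ * X](gtr0_norm q1') -normrM ler_norml.
have qq : 0 <= q * a * q by rewrite !mulr_ge0// ltW.
have e1 : (b - a) * (1 - q) = (1 - q) * b - a + q * a by ring.
have e2 : (1 - q) * ((1 - q) * a) - a + q * a = - (q * a) + q * a * q by ring.
have g3 : (1 - q) * ((1 - q) * a) <= (1 - q) * b by rewrite ler_wpM2l// ltW.
rewrite e1; apply/andP; split; last by move: (_ * b) (q * a) g2 => *; lra.
by move: e2 g3 qq; move: (_ * (_ * a)) (_ * b) (q * a * q) (q * a) => *; lra.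
Qed.

Lemma geometric_ub n : \sum_(i < n) rho ^+ i <= (1 - rho)^-1.
have r1 : 0 < 1 - rho by rewrite subr_gt0.
rewrite -[_^-1]div1r ler_pdivlMr// mulrC.
have := subrX1 rho n; rewrite -[rho ^+ n - 1]opprB -[rho - 1]opprB mulNr => /oppr_inj <-.
by rewrite gerBl exprn_ge0// ltW.
Qed.

Lemma sum_kap m0 : \sum_m kap m0 m <= 2 / (1 - rho).
rewrite /kap -(reindex_inj (P := xpredT) (F := fun m : 'I_M => kapf m) (addIr (- m0)%R)) /kapf big_split/=.
rewrite mulr_natl mulr2n; apply: lerD; first exact: geometric_ub.
apply: le_trans (geometric_ub M); rewrite (reindex_inj rev_ord_inj)/=.
apply: ler_sum => i _; rewrite ler_wiXn2l//; [exact: ltW|exact: ltW|].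
by rewrite subKn// ltnW.
Qed.
End weights.

Lemma bernoulli (R : realType) (d : R) n : 0 <= d -> d <= 1 -> 1 - n%:R * d <= (1 - d) ^+ n.
move=> d0 d1; elim: n => [|n IH]; first by rewrite mul0r subr0 expr0.
rewrite exprS; apply: (@le_trans _ _ ((1 - d) * (1 - n%:R * d))); last first.
 by rewrite ler_wpM2l// subr_ge0.
rewrite -subr_ge0 -natr1 (_ : _ - _ = n%:R * d ^+ 2); last by ring.
by rewrite mulr_ge0// sqr_ge0.
Qed.

Theorem frame_exists (R : realType) (V : perturbation R) (L : nat) :
 exists C Ck eta : R, exists K1 : nat, [/\ (1 < K1)%N, 0 < C & forall K M', (K1 <= K)%N ->
  frame V (bavg L K) (@sigma L M') C C C Ck eta /\
  forall s (k : 'I_K) t, k%:R / K%:R <= t <= k.+1%:R / K%:R ->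
   (avg K s k - (@psp R L s).[t]) ^+ 2 <= C * sqn s / K%:R ^+ 2].
have [C [K1 [C0 K10 HC]]] := @bavg_bounds R L.
pose c := mono V / (2 * lip V).
have lip0 : 0 < lip V by apply: lt_le_trans (lip_ge2 V).
have c0 : 0 < c by rewrite divr_gt0 ?mono_gt0// mulr_gt0.
(* This [eta] satisfies [frame_eta]; [q] solves [q / (1 - q) = eta], and [d] is chosen by
   Bernoulli's inequality so that [rho ^ L >= 1 - q]. None of them involves [K] or [M]. *)
pose eta := c / (1 + C); have C1 : 0 < 1 + C by rewrite addr_gt0.
have eta0 : 0 < eta by rewrite divr_gt0.
pose q := eta / (1 + eta); have e1 : 0 < 1 + eta by rewrite addr_gt0.
have q0 : 0 < q by rewrite divr_gt0.
have q1 : q < 1 by rewrite ltr_pdivrMr// mul1r ltrDr.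
have qe1 : 1 - q = (1 + eta)^-1 by rewrite /q; field; rewrite gt_eqF.
have qe : q / (1 - q) = eta by rewrite qe1 invrK /q mulfVK ?gt_eqF.
pose d := q / L.+1%:R.
have d0 : 0 < d by rewrite divr_gt0.
have d1 : d < 1 by apply: le_lt_trans q1; rewrite ler_pdivrMr// ler_peMr ?ler1n// ltW.
pose rho := 1 - d.
have rho0 : 0 < rho by rewrite subr_gt0.
have rho1 : rho < 1 by rewrite ltrBlDr ltrDl.
have hq : 1 - q <= rho ^+ L.
 apply: le_trans (bernoulli L (ltW d0) (ltW d1)); rewrite lerB// /d mulrCA.
 by rewrite ler_piMr ?(ltW q0)// ler_pdivrMr// mul1r ler_nat.
(* [K >= 2] gives the fibers positive dimension, the last condition of [frame]. *)
exists C, (2 / (1 - rho)), eta, (maxn 2 K1); split; [by rewrite leq_max|by []|]; move=> K M'; rewrite geq_max => /andP[K2 K1K].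
have [h1 h2 h3 h4] := HC K K1K; split=> //.
have K0 : (0 < K)%N by exact: ltnW.
split=> //; try exact: ltW; rewrite ?sigma_inj//.
- by rewrite divr_ge0// subr_ge0 ltW.
- exact: sigma_inj.
- rewrite -/c /eta expr_div_n mulrCA ler_piMr ?sqr_ge0// mulrC.
 rewrite ler_pdivrMl ?exprn_gt0// mulr1.
 by rewrite -expr2 lerXn2r ?nnegrE ?(ltW C0) ?(ltW C1)// lerDr.
- move=> m0; exists (kap rho m0); split.
 + by move=> m; exact: kapf_gt0.
 + by move=> m i; rewrite -qe; apply: kap_slow => //; exact: ltW.
 + by rewrite /kap subrr /kapf expr0 lerDl exprn_ge0// ltW.
 + exact: sum_kap.
rewrite mxrank_ker subn_gt0; apply: leq_ltn_trans (rank_leq_col _) _.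
by rewrite -[X in (X < _)%N]mul1n ltn_mul2r.
Qed.

(** * Square-integrable functions on the circle *)

Section circle.
Context {R : realType}.
Notation cm := (circle_measure R).
Notation T := (measurableTypeR R).
Implicit Types (f g h : R -> R).

Definition dom01 : set T := `[0, 1[%classic.

Lemma meas_dom01 : measurable dom01.
exact: measurable_itv. Qed.

Lemma cm_setT : cm setT = 1%E.
by rewrite /circle_measure /= /mrestr setTI lebesgue_measure_itv/= lte_fin ltr01 sube0.
Qed.

Lemma cm_out : cm (~` dom01) = 0%E.
by rewrite /circle_measure /= /mrestr setICl measure0. Qed.

Lemma cm_ae (P : R -> Prop) : (forall t, 0 <= t < 1 -> P t) -> {ae cm, forall t, P t}.
move=> H; exists (~` dom01); split; [by apply: measurableC; exact: meas_dom01|exact: cm_out|].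
by move=> t nP dt; apply: nP; apply: H; move: dt; rewrite /dom01 /= in_itv.
Qed.

Lemma cm_ae_imp (P Q : R -> Prop) : (forall t, P t -> Q t) ->
 {ae cm, forall t, P t} -> {ae cm, forall t, Q t}.
by move=> PQ [N [mN N0 sN]]; exists N; split=> // t nQ; apply: sN => /PQ. Qed.

Lemma cm_ae_and (P Q : R -> Prop) : {ae cm, forall t, P t} -> {ae cm, forall t, Q t} ->
 {ae cm, forall t, P t /\ Q t}.
move=> [N [mN N0 sN]] [N' [mN' N0' sN']]; exists (N `|` N'); split.
- exact: measurableU.
- by rewrite measureU0.
move=> t /= nPQ; have [Pt|nPt] := pselect (P t); last by left; exact: sN.
by right; apply: sN' => Qt; exact: nPQ.
Qed.

Definition cint f : R := \int[cm]_t f t.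
Definition cintble f := cm.-integrable setT (EFin \o (f : T -> R)).

Lemma cintble_meas f : cintble f -> measT (f : T -> R).
by move=> /integrableP[/measT_EFin]. Qed.

Lemma eq_cint_ae f g : measT (f : T -> R) -> measT (g : T -> R) ->
 {ae cm, forall t, f t = g t} -> cint f = cint g.
move=> mf mg fg; congr fine; apply: ae_eq_integral => //.
- exact/measT_EFin.
- exact/measT_EFin.
by apply: cm_ae_imp fg => t /= ->.
Qed.

Lemma cint_dom f : cintble f -> cint f = \int[cm]_(t in dom01) f t.
move=> cf; congr fine; rewrite (negligible_integral _ _ cf cm_out)//.
 by rewrite setTD setCK.
apply: measurableC; exact: meas_dom01.
Qed.

Lemma cint_lebesgue f : cintble f -> cint f = \int[lebesgue_measure]_(t in `[0, 1[) f t.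
move=> /cint_dom ->; congr fine; apply: eq_measure_integral => A mA sA.
by rewrite /circle_measure /= /mrestr setIidl.
Qed.

Lemma le_cint f g : cintble f -> cintble g -> (forall t, 0 <= t < 1 -> f t <= g t) ->
 cint f <= cint g.
move=> cf cg fg; rewrite !cint_dom//; apply: le_Rintegral => //.
- exact: meas_dom01.
- exact: (integrableS measurableT meas_dom01 (@subsetT _ _) cf).
- exact: (integrableS measurableT meas_dom01 (@subsetT _ _) cg).
Qed.

Lemma cintble_bounded f C : measT (f : T -> R) -> (forall t, `|f t| <= C) -> cintble f.
move=> mf fC; apply: measurable_bounded_integrable => //.
 by rewrite [X in (X < _)%E]cm_setT ltry.
by exists C; split=> [|x Cx t _]; [exact: num_real|apply: le_trans (fC t) (ltW Cx)].
Qed.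

Lemma le_cintble f g : measT (f : T -> R) -> (forall t, `|f t| <= g t) ->
 cintble g -> cintble f.
move=> mf fg; apply: le_integrable => //; first exact/measT_EFin.
by move=> t _; rewrite /= lee_fin (le_trans (fg t))// ler_norm.
Qed.

Lemma cintbleD f g : cintble f -> cintble g -> cintble (fun t => f t + g t).
exact: integrableD. Qed.

Lemma cintbleZ c f : cintble f -> cintble (fun t => c * f t).
exact: integrableZl. Qed.

Lemma cintD f g : cintble f -> cintble g -> cint (fun t => f t + g t) = cint f + cint g.
exact: RintegralD. Qed.

Lemma cintZ c f : cintble f -> cint (fun t => c * f t) = c * cint f.
exact: RintegralZl. Qed.

Lemma cint_cst c : cint (fun=> c) = c.
rewrite /cint /Rintegral integral_cst//.
by rewrite [X in (_ * X)%E]cm_setT mule1.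
Qed.

Lemma cintegrable_sum (I : Type) (s : seq I) (F : I -> R -> R) : (forall i, cintble (F i)) ->
 cintble (fun t => \sum_(i <- s) F i t).
move=> cF; elim: s => [|i s IH].
 under eq_fun do rewrite big_nil.
 by apply: (@cintble_bounded _ 0) => // t; rewrite normr0.
under eq_fun do rewrite big_cons; exact: cintbleD.
Qed.

Lemma cint_sum (I : Type) (s : seq I) (F : I -> R -> R) : (forall i, cintble (F i)) ->
 cint (fun t => \sum_(i <- s) F i t) = \sum_(i <- s) cint (F i).
move=> cF; elim: s => [|i s IH].
 by rewrite big_nil; under [X in cint X]eq_fun do rewrite big_nil; rewrite cint_cst.
rewrite big_cons -IH -cintD//; last exact: cintegrable_sum.
by congr cint; apply: funext => t; rewrite big_cons.
Qed.

(** Working form of membership in [L^2] ([Lfun2P]), without the periodicity that [L2circle] adds. *)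
Definition sq2 f := measT (f : T -> R) /\ cintble (fun t => f t ^+ 2).

Lemma sq2_meas f : sq2 f -> measT (f : T -> R).
by case. Qed.

Lemma sq2_mul f g : sq2 f -> sq2 g -> cintble (fun t => f t * g t).
move=> [mf f2] [mg g2]; apply: (@le_cintble _ (fun t => f t ^+ 2 + g t ^+ 2)).
- exact: measTM.
- move=> t; rewrite ler_norml; move: (f t) (g t) => x y.
 have h1 := sqr_ge0 (x + y); have h2 := sqr_ge0 (x - y).
 have h3 := sqr_ge0 x; have h4 := sqr_ge0 y.
 have e1 : (x + y) ^+ 2 = x ^+ 2 + y ^+ 2 + 2 * (x * y) by ring.
 have e2 : (x - y) ^+ 2 = x ^+ 2 + y ^+ 2 - 2 * (x * y) by ring.
 rewrite e1 in h1; rewrite e2 in h2; move: (x * y) (x ^+ 2) (y ^+ 2) h1 h2 h3 h4 => *.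
 by apply/andP; split; lra.
exact: cintbleD.
Qed.

Lemma sq2D f g : sq2 f -> sq2 g -> sq2 (fun t => f t + g t).
move=> sf sg; have [mf f2] := sf; have [mg g2] := sg; split; first exact: measTD.
rewrite (_ : (fun t => _) = fun t => f t ^+ 2 + (g t ^+ 2 + 2 * (f t * g t))).
 by apply: cintbleD => //; apply: cintbleD => //; apply: cintbleZ; exact: sq2_mul.
by apply: funext => t; ring.
Qed.

Lemma sq2Z c f : sq2 f -> sq2 (fun t => c * f t).
move=> [mf f2]; split; first exact: measTM.
by under eq_fun do rewrite exprMn; exact: cintbleZ.
Qed.

Lemma sq2B f g : sq2 f -> sq2 g -> sq2 (fun t => f t - g t).
move=> sf sg; under eq_fun do rewrite -mulN1r.
by apply: sq2D => //; exact: sq2Z.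
Qed.

Lemma sq2_bounded f C : measT (f : T -> R) -> (forall t, `|f t| <= C) -> sq2 f.
move=> mf fC; split=> //; apply: (@cintble_bounded _ (C ^+ 2)); first exact: measurable_funX.
move=> t; rewrite normrX lerXn2r ?nnegrE//.
by apply: le_trans (fC t).
Qed.

Lemma sq2_le f g : measT (f : T -> R) -> (forall t, `|f t| <= `|g t|) -> sq2 g -> sq2 f.
move=> mf fg [mg g2]; split=> //; apply: le_cintble g2; first exact: measurable_funX.
by move=> t; rewrite normrX -[leRHS]real_normK ?num_real// lerXn2r ?nnegrE.
Qed.

Lemma sq2_intble f : sq2 f -> cintble f.
move=> sf; have := sq2_mul sf (@sq2_bounded (fun=> 1) 1 (measurable_cst _) _).
by under eq_fun do rewrite mulr1; apply => t; rewrite normr1.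
Qed.

Lemma sq2_ae f g : measT (f : T -> R) -> {ae cm, forall t, f t = g t} -> sq2 g -> sq2 f.
move=> mf fg [mg /integrableP[mg2 ig]]; split=> //; apply/integrableP; split.
 by apply/measT_EFin; exact: measurable_funX.
apply: le_lt_trans ig; rewrite le_eqVlt; apply/orP; left; apply/eqP.
apply: ae_eq_integral => //.
- by apply: measT_comp => //; apply/measT_EFin; exact: measurable_funX.
- exact: measT_comp.
by apply: cm_ae_imp fg => t /= ->.
Qed.

Lemma sq2_sum (I : Type) (s : seq I) (F : I -> R -> R) : (forall i, sq2 (F i)) ->
 sq2 (fun t => \sum_(i <- s) F i t).
move=> cF; elim: s => [|i s IH].
 under eq_fun do rewrite big_nil.
 by apply: (@sq2_bounded _ 0) => // t; rewrite normr0.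
by under eq_fun do rewrite big_cons; exact: sq2D.
Qed.

Lemma L2dotE f g : L2dot f g = cint (fun t => f t * g t).
by []. Qed.

Lemma L2dotC f g : L2dot f g = L2dot g f.
by rewrite !L2dotE; congr cint; apply: funext => t; rewrite mulrC. Qed.

Lemma L2dotDl f g h : sq2 f -> sq2 g -> sq2 h ->
 L2dot (fun t => f t + g t) h = L2dot f h + L2dot g h.
move=> sf sg sh; rewrite !L2dotE -cintD; [|exact: sq2_mul..].
by congr cint; apply: funext => t; rewrite mulrDl.
Qed.

Lemma L2dotZl c f h : sq2 f -> sq2 h -> L2dot (fun t => c * f t) h = c * L2dot f h.
move=> sf sh; rewrite !L2dotE -cintZ; last exact: sq2_mul.
by congr cint; apply: funext => t; rewrite mulrA.
Qed.

Lemma L2dotBl f g h : sq2 f -> sq2 g -> sq2 h ->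
 L2dot (fun t => f t - g t) h = L2dot f h - L2dot g h.
move=> sf sg sh; rewrite -[- L2dot g h]mulN1r -L2dotZl// -L2dotDl//; last exact: sq2Z.
by congr L2dot; apply: funext => t; rewrite mulN1r.
Qed.

Lemma L2dot_suml (I : Type) (s : seq I) (F : I -> R -> R) h : (forall i, sq2 (F i)) -> sq2 h ->
 L2dot (fun t => \sum_(i <- s) F i t) h = \sum_(i <- s) L2dot (F i) h.
move=> sF sh; under [RHS]eq_bigr do rewrite L2dotE.
rewrite -cint_sum; last by move=> i; exact: sq2_mul.
by rewrite L2dotE; congr cint; apply: funext => t; rewrite mulr_suml.
Qed.

Lemma L2dot_ge0 f : 0 <= L2dot f f.
by rewrite /L2dot /Rintegral fine_ge0// integral_ge0// => t _; rewrite lee_fin -expr2 sqr_ge0.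
Qed.

Lemma L2dot_sqr f : L2dot f f = cint (fun t => f t ^+ 2).
by rewrite L2dotE; congr cint; apply: funext => t; rewrite expr2. Qed.

Lemma L2dot_expand f g : sq2 f -> sq2 g -> forall a b,
 L2dot (fun t => a * f t + b * g t) (fun t => a * f t + b * g t) =
 a ^+ 2 * L2dot f f + 2 * a * b * L2dot f g + b ^+ 2 * L2dot g g.
move=> sf sg a b; have saf := sq2Z a sf; have sbg := sq2Z b sg.
have sS := sq2D saf sbg.
have e h : sq2 h -> L2dot h (fun t => a * f t + b * g t) = a * L2dot f h + b * L2dot g h.
 by move=> sh; rewrite L2dotC L2dotDl// !L2dotZl.
by rewrite L2dotDl// !L2dotZl// !e// [L2dot g f]L2dotC; ring.
Qed.

Lemma L2dot_cs f g : sq2 f -> sq2 g -> L2dot f g ^+ 2 <= L2dot f f * L2dot g g.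
move=> sf sg; have f0 := L2dot_ge0 f; have g0 := L2dot_ge0 g.
apply: optimize => // t t0; have tn : t != 0 by rewrite gt_eqF.
have h b : b ^+ 2 = 1 -> - (b * (2 * L2dot f g)) <= t * L2dot f f + t^-1 * L2dot g g.
 move=> b1; have := L2dot_ge0 (fun s => t * f s + b * g s).
 rewrite L2dot_expand// b1 => h; rewrite -subr_ge0.
 have -> : t * L2dot f f + t^-1 * L2dot g g - - (b * (2 * L2dot f g)) =
  t^-1 * (t ^+ 2 * L2dot f f + 2 * t * b * L2dot f g + 1 * L2dot g g) by field.
 by rewrite mulr_ge0// invr_ge0 ltW.
rewrite ler_norml; have := h 1 (expr1n _ 2); have := h (-1) (sqrr_sign _ 1).
by rewrite mulN1r mul1r opprK; move: (2 * _) (_ + _) => u v; lra.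
Qed.

Lemma sqr_add_le (x y : R) : (x + y) ^+ 2 <= 2 * x ^+ 2 + 2 * y ^+ 2.
by rewrite -subr_ge0 (_ : _ - _ = (x - y) ^+ 2) ?sqr_ge0//; ring. Qed.

Lemma le_L2dot f g : sq2 f -> sq2 g -> (forall t, 0 <= t < 1 -> f t ^+ 2 <= g t ^+ 2) ->
 L2dot f f <= L2dot g g.
by move=> [mf f2] [mg g2] fg; rewrite !L2dot_sqr; exact: le_cint. Qed.

Lemma L2dot_ae f g h : measT (f : T -> R) -> measT (g : T -> R) ->
 measT (h : T -> R) -> {ae cm, forall t, f t = g t} -> L2dot f h = L2dot g h.
move=> mf mg mh fg; apply: eq_cint_ae; [exact: measTM|exact: measTM|].
by apply: cm_ae_imp fg => t ->.
Qed.

Lemma L2normE f : sq2 f -> L2norm f = (Num.sqrt (L2dot f f))%:E.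
move=> [mf f2]; rewrite /L2norm unlock.
have -> : (\int[cm]_x (`|(EFin \o f) x| `^ 2) = (L2dot f f)%:E)%E.
 rewrite L2dot_sqr /cint /Rintegral fineK; last exact: integrable_fin_num f2.
 by apply: eq_integral => t _; rewrite [(EFin \o f) t]/= abse_EFin poweR_EFin powR_mulrn// real_normK ?num_real.
by rewrite poweR_EFin powR12_sqrt// L2dot_ge0.
Qed.

Lemma Lfun2P f : f \in Lfun cm 2%:E <-> sq2 f.
split=> [h|sf].
 split; last exact: Lfun2_integrable_sqr.
 by move: h; rewrite inE => /andP[]; rewrite inE.
rewrite inE; apply/andP; split; rewrite inE/=; first by case: sf.
by rewrite /finite_norm [X in (X < _)%E](L2normE sf) ltry.
Qed.

Lemma L2circleP f : L2circle f <-> periodic f 1 /\ sq2 f.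
by split=> [[p h]|[p h]]; split=> //; exact/Lfun2P. Qed.
End circle.

(** * Cells, step functions and cell averages *)

Section cells.
Context {R : realType}.
Notation T := (measurableTypeR R).
Implicit Types (t u : R).

Definition frac t : R := t - (Num.floor t)%:~R.

Lemma frac01 t : 0 <= frac t < 1.
rewrite /frac subr_ge0 ltrBlDl floor_le_tmp /=.
by have := floorD1_gt t; rewrite intrD.
Qed.

Lemma frac_id t : 0 <= t < 1 -> frac t = t.
move=> t01; rewrite /frac (@floor_def _ t 0) ?subr0//.
Qed.

Lemma frac_periodic : periodic frac 1.
by move=> t; rewrite /frac floorDrz ?floor1 ?intrD ?int_num1//; ring. Qed.

Lemma meas_frac : measT (frac : T -> R).
apply: measTB; first exact: measurable_id.
apply: nondecreasing_measurable => // s t st.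
by rewrite ler_int; exact: le_floor.
Qed.

Definition cellI (N n : nat) t : R := \1_(`[n%:R / N%:R, n.+1%:R / N%:R[) (frac t).

Definition in_cell (N n : nat) u : Prop := n%:R / N%:R <= u < n.+1%:R / N%:R.

Lemma cellI1 N n t : in_cell N n (frac t) -> cellI N n t = 1.
by move=> h; rewrite /cellI indicE mem_set//= in_itv. Qed.

Lemma cellI0 N n t : ~ in_cell N n (frac t) -> cellI N n t = 0.
by move=> h; rewrite /cellI indicE memNset//= in_itv. Qed.

Lemma meas_cellI N n : measT (cellI N n : T -> R).
apply: (measT_comp (f := \1_(`[n%:R / N%:R, n.+1%:R / N%:R[) : R -> R)); last exact: meas_frac.
by apply: measurable_indic; exact: measurable_itv.
Qed.

Lemma in_cell_exists N u : (0 < N)%N -> 0 <= u < 1 -> exists n : 'I_N, in_cell N n u.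
move=> N0 /andP[u0 u1]; have NR : 0 < N%:R :> R by rewrite ltr0n.
have uN : 0 <= u * N%:R by rewrite mulr_ge0.
have := trunc_itv uN; set n := Num.trunc _ => /andP[h1 h2].
have nN : (n < N)%N.
 by rewrite -(ltr_nat R); apply: le_lt_trans h1 _; rewrite -[ltRHS]mul1r ltr_pM2r.
by exists (Ordinal nN); rewrite /in_cell ler_pdivrMr// ltr_pdivlMr// h1.
Qed.

Lemma in_cell_uniq N n n' u : (0 < N)%N -> in_cell N n u -> in_cell N n' u -> n = n'.
move=> N0; have NR : 0 < N%:R :> R by rewrite ltr0n.
rewrite /in_cell !ler_pdivrMr// !ltr_pdivlMr// => /andP[a b] /andP[c d].
have h1 : (n < n'.+1)%N by rewrite -(ltr_nat R) (le_lt_trans a).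
have h2 : (n' < n.+1)%N by rewrite -(ltr_nat R) (le_lt_trans c).
by apply/eqP; rewrite eqn_leq -ltnS h1.
Qed.

(** Periodic because it factors through [frac]; step functions and splines are both instances. *)
Definition pw N (p : 'I_N -> {poly R}) t : R := \sum_(n < N) cellI N n t * (p n).[frac t].

Lemma pwE N (p : 'I_N -> {poly R}) t (n : 'I_N) : in_cell N n (frac t) -> pw p t = (p n).[frac t].
move=> h; have N0 : (0 < N)%N by case: (N) n {h p} => [[]|].
rewrite /pw (bigD1 n)//= cellI1// mul1r big1 ?addr0// => i ni.
rewrite cellI0 ?mul0r// => h'; move/eqP: ni; apply; apply/val_inj.
exact: in_cell_uniq h' h.
Qed.

Lemma measurable_horner_frac (p : {poly R}) : measT ((fun t => p.[frac t]) : T -> R).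
apply: (measT_comp (f := horner p)); last exact: meas_frac.
apply: cts_measT => t.
by apply: der_cts => z; exact: der_horner.
Qed.

Lemma sq2_cell_poly N n (p : {poly R}) : sq2 (fun t => cellI N n t * p.[frac t]).
have [C C0 h] := poly_ub01 p; apply: (@sq2_bounded _ _ C).
 by apply: measTM; [exact: meas_cellI|exact: measurable_horner_frac].
move=> t; have /andP[f0 f1] := frac01 t; rewrite /cellI indicE; case: (_ \in _).
 by rewrite mul1r h// f0 ltW.
by rewrite mul0r normr0.
Qed.

Lemma sq2_cellI N n : sq2 (cellI N n).
have := sq2_cell_poly N n 1; rewrite (_ : (fun t => _) = cellI N n)//.
by apply: funext => t; rewrite hornerC mulr1.
Qed.

Lemma sq2_pw N (p : 'I_N -> {poly R}) : sq2 (pw p).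
by apply: sq2_sum => n; exact: sq2_cell_poly. Qed.

Lemma pw_periodic N (p : 'I_N -> {poly R}) : periodic (pw p) 1.
by move=> t; apply: eq_bigr => n _; rewrite /cellI frac_periodic.
Qed.

Lemma cint_cell N (n : 'I_N) (p Q : {poly R}) : Q^`() = p ->
 cint (fun t => cellI N n t * p.[frac t]) = Q.[n.+1%:R / N%:R] - Q.[n%:R / N%:R].
move=> Qp; have N0 : (0 < N)%N by case: (N) n => [[]|].
have NR : 0 < N%:R :> R by rewrite ltr0n.
rewrite cint_lebesgue; last exact/sq2_intble/sq2_cell_poly.
set a := n%:R / _; set b := n.+1%:R / _.
have ab : a < b by rewrite ltr_pM2r ?invr_gt0// ltr_nat.
have sub : `[a, b[%classic `<=` `[0%R, 1%R[%classic.
 move=> t /=; rewrite !in_itv/= => /andP[h1 h2]; rewrite (le_trans _ h1) ?divr_ge0//=.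
 by rewrite (lt_le_trans h2)// ler_pdivrMr// mul1r ler_nat.
have -> : \int[lebesgue_measure]_(t in `[0, 1[) (cellI N n t * p.[frac t]) =
  \int[lebesgue_measure]_(t in `[a, b[) p.[t].
 congr fine; rewrite -[in RHS](setIidr sub) integral_mkcondr.
 apply: eq_integral => t; rewrite inE/= in_itv/= => t01.
 by rewrite /cellI frac_id// indicE patchE; case: (_ \in _); rewrite ?mul1r ?mul0r.
have cp : continuous (horner p) by apply: der_cts => z; exact: der_horner.
have ic : lebesgue_measure.-integrable `[a, b] (EFin \o horner p).
 by apply: continuous_compact_integrable; [exact: segment_compact|exact: continuous_subspaceT].
rewrite Rintegral_itv_bndo_bndc; last first.
 apply: integrableS ic; [exact: measurable_itv|exact: measurable_itv|].
 by move=> t /=; rewrite !in_itv/= => /andP[-> /ltW].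
rewrite /Rintegral (continuous_FTC2 ab (F := horner Q)) ?fineB//.
- exact: continuous_subspaceT.
- have cQ : continuous (horner Q) by apply: der_cts => z; exact: der_horner.
 split.
 + by move=> t _; have [] := der_horner Q t.
 + by apply: cvg_at_right_filter; exact: cQ.
 + by apply: cvg_at_left_filter; exact: cQ.
- by move=> t _; rewrite derive1E; have [_ ->] := der_horner Q t; rewrite Qp.
Qed.

Lemma stepE N (x : 'rV[R]_N) t (n : 'I_N) : in_cell N n (frac t) -> step x t = x 0 n.
move=> h; have := pwE (fun n => (x 0 n)%:P) h; rewrite hornerC => <-.
by apply: eq_bigr => i _; rewrite hornerC mulrC.
Qed.

Lemma step_pw N (x : 'rV[R]_N) : step x = pw (fun n => (x 0 n)%:P).
by apply: funext => t; apply: eq_bigr => i _; rewrite hornerC mulrC. Qed.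

Lemma sq2_step N (x : 'rV[R]_N) : sq2 (step x).
by rewrite step_pw; exact: sq2_pw. Qed.

Lemma cint_step N (x : 'rV[R]_N) : cint (step x) = \sum_n x 0 n / N%:R.
rewrite step_pw cint_sum; last by move=> n; exact/sq2_intble/sq2_cell_poly.
apply: eq_bigr => n _; rewrite (@cint_cell N n _ (x 0 n *: 'X)); last by rewrite derivZ derivX alg_polyC.
by rewrite !hornerZ !hornerX -mulrBr node_width.
Qed.

Definition avgvec N (v : R -> R) : 'rV[R]_N := \row_n (N%:R * L2dot (cellI N n) v).

Lemma L2dot_step N (x : 'rV[R]_N) v : (0 < N)%N -> sq2 v -> L2dot (step x) v = dot x (avgvec N v) / N%:R.
move=> N0 sv; rewrite (_ : step x = fun t => \sum_n x 0 n * cellI N n t)//.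
rewrite L2dot_suml//; last by move=> n; apply: sq2Z; exact: sq2_cellI.
rewrite /dot mulr_suml; apply: eq_bigr => n _; rewrite L2dotZl//; last exact: sq2_cellI.
by rewrite mxE; field; rewrite pnatr_eq0 -lt0n.
Qed.

Lemma L2dot_step2 N (x y : 'rV[R]_N) : (0 < N)%N -> L2dot (step x) (step y) = dot x y / N%:R.
move=> N0; have -> : L2dot (step x) (step y) = cint (step (\row_n (x 0 n * y 0 n))).
 congr cint; apply: funext => t; have [n h] := in_cell_exists N0 (frac01 t).
 by rewrite !(stepE _ h) mxE.
by rewrite cint_step /dot mulr_suml; apply: eq_bigr => n _; rewrite mxE.
Qed.

Lemma bessel N v : (0 < N)%N -> sq2 v -> sqn (avgvec N v) / N%:R <= L2dot v v.
move=> N0 sv; set x := avgvec N v.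
have := L2dot_ge0 (fun t => 1 * v t + (-1) * step x t).
rewrite L2dot_expand//; last exact: sq2_step.
rewrite [L2dot v (step x)]L2dotC L2dot_step// L2dot_step2// -/x -/(sqn x).
by move: (L2dot v v) (_ / _) => u w; lra.
Qed.
End cells.

(** * Periodic splines in B-spline coordinates *)

Section spl.
Context {R : realType} (L M' : nat).
Notation M := M'.+1.
Notation sg := (@sigma L M').
Implicit Types (z : 'rV[R]_M) (t u : R).

Definition locoef z (m : 'I_M) : 'rV[R]_L.+1 := z *m Sm sg m.

Definition lin (m : nat) : {poly R} := M%:R *: 'X - m%:R%:P.

Lemma horner_lin m u : (lin m).[u] = M%:R * u - m%:R.
by rewrite /lin !hornerE. Qed.

Definition spl z : R -> R := pw (fun m : 'I_M => psp (locoef z m) \Po lin m).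

Lemma splE z t (m : 'I_M) : in_cell M m (frac t) ->
 spl z t = (psp (locoef z m)).[M%:R * frac t - m%:R].
by move=> h; rewrite /spl (pwE _ h) horner_comp horner_lin. Qed.

Lemma sq2_spl z : sq2 (spl z).
exact: sq2_pw. Qed.

Lemma spl_periodic z : periodic (spl z) 1.
exact: pw_periodic. Qed.

Lemma pspD (s s' : 'rV[R]_L.+1) : psp (s + s') = psp s + psp s'.
by rewrite /psp -big_split/=; apply: eq_bigr => i _; rewrite mxE scalerDl. Qed.

Lemma pspZ c (s : 'rV[R]_L.+1) : psp (c *: s) = c *: psp s.
by rewrite /psp scaler_sumr; apply: eq_bigr => i _; rewrite mxE scalerA. Qed.

Lemma splD z z' t : spl (z + z') t = spl z t + spl z' t.
have [m h] := in_cell_exists (ltn0Sn M') (frac01 t).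
by rewrite !(splE _ h) /locoef mulmxDl pspD hornerD.
Qed.

Lemma splZ c z t : spl (c *: z) t = c * spl z t.
have [m h] := in_cell_exists (ltn0Sn M') (frac01 t).
by rewrite !(splE _ h) /locoef -scalemxAl pspZ hornerZ.
Qed.

Lemma splB z z' t : spl (z - z') t = spl z t - spl z' t.
by rewrite -scaleN1r splD splZ mulN1r. Qed.

Variable K : nat.
Hypothesis K_gt0 : (0 < K)%N.
Notation N := (K * M)%N.
Notation Bs := (bsp (bavg L K) sg).

Let KR : K%:R != 0 :> R. by rewrite pnatr_eq0 -lt0n. Qed.
Let MR : M%:R != 0 :> R. by rewrite pnatr_eq0. Qed.
Lemma N_gt0 : (0 < N)%N. by rewrite muln_gt0 K_gt0. Qed.

Lemma local_coor (m : 'I_M) (k : nat) : M%:R * ((m * K + k)%:R / N%:R) - m%:R = k%:R / K%:R :> R.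
by rewrite natrD !natrM; field; rewrite KR addrC natr1 MR. Qed.

Lemma in_cell_idx (m : 'I_M) (k : 'I_K) u : in_cell N (idx m k) u ->
 in_cell M m u /\ in_cell K k (M%:R * u - m%:R).
have K0 : 0 < K%:R :> R by rewrite ltr0n.
have M0 : 0 < M%:R :> R by rewrite ltr0n.
have N0 : 0 < N%:R :> R by rewrite ltr0n N_gt0.
move=> h; have h2 : in_cell K k (M%:R * u - m%:R).
 rewrite /in_cell -!(local_coor m) lerD2r ltrD2r ler_pM2l// ltr_pM2l//.
 by rewrite addnS; exact: h.
split=> //; move: h2; rewrite /in_cell ler_pdivrMr// ltr_pdivlMr// mulrC => /andP[a b].
have a1 : 0 <= M%:R * u - m%:R by rewrite -(pmulr_rge0 _ K0) (le_trans _ a).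
have b1 : M%:R * u - m%:R < 1 by rewrite -(ltr_pM2l K0) mulr1 (lt_le_trans b)// ler_nat.
rewrite -[m.+1%:R]natr1 ler_pdivrMr// ltr_pdivlMr// mulrC; move: (M%:R * u) a1 b1 => w a1 b1.
by apply/andP; split; lra.
Qed.

Lemma cell_int_spl z (m : 'I_M) (k : 'I_K) :
 N%:R * L2dot (cellI N (idx m k)) (spl z) = avg K (locoef z m) k.
set s := locoef z m; pose p := psp s \Po lin m.
have dl : (lin m)^`() = M%:R%:P by rewrite derivB derivZ derivX derivC subr0 alg_polyC.
have -> : L2dot (cellI N (idx m k)) (spl z) = cint (fun t => cellI N (idx m k) t * p.[frac t]).
 congr cint; apply: funext => t; have [h|h] := pselect (in_cell N (idx m k) (frac t)).
  by have [h1 _] := in_cell_idx h; rewrite (splE _ h1) /p horner_comp horner_lin.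
 by rewrite cellI0 ?mul0r.
rewrite (@cint_cell _ N (idx m k) p (M%:R^-1 *: (Psp s \Po lin m))); last first.
 by rewrite derivZ deriv_comp deriv_Psp dl -mul_polyC mulrCA -polyCM mulVf ?mulr1// polyC1.
rewrite !hornerZ !horner_comp !horner_lin -[X in X%:R / N%:R]addnS !local_coor /avg natrM.
by field; rewrite addrC natr1 MR.
Qed.

Lemma avgvec_spl z : avgvec N (spl z) = Num.sqrt K%:R *: (z *m Bs).
apply/rowP => j; have [m [k ->]] := idx_surj j.
rewrite [LHS]mxE [RHS]mxE cell_int_spl -blkE blk_bsp -mul_bavg.
by [].
Qed.

Lemma sqn_bsp_spl z : sqn (z *m Bs) <= M%:R * L2dot (spl z) (spl z).
have := bessel N_gt0 (sq2_spl z); rewrite avgvec_spl sqnZ sqr_sqrtr// natrM invfM mulrAC mulrA divff// mul1r.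
by rewrite mulrC ler_pdivrMr ?ltr0n// mulrC.
Qed.
End spl.

(** * Regularity of glued polynomial pieces *)

Section glue.
Context {R : realType}.
Implicit Types (f g : R -> R) (P Q S : {poly R}) (t : R).

Lemma poly_ub_near P (t0 : R) : exists2 C, 0 <= C & forall t, `|t - t0| <= 1 -> `|P.[t]| <= C.
have [C C0 h] := poly_ub01 (P \Po (2 *: 'X + (t0 - 1)%:P)); exists C => // t.
rewrite ler_norml => /andP[t1 t2]; have := h ((t - t0 + 1) / 2).
rewrite horner_comp hornerD hornerZ hornerX hornerC.
have -> : 2 * ((t - t0 + 1) / 2) + (t0 - 1) = t by field.
by apply; apply/andP; split; lra.
Qed.

Lemma cts_at_linear g (C d t0 : R) : 0 <= C -> 0 < d ->
 (forall t, `|t - t0| < d -> `|g t| <= C * `|t - t0|) -> {for t0, continuous g}.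
move=> C0 d0 h; have g0 : g t0 = 0.
 by have := h t0; rewrite subrr normr0 mulr0 normr_le0 => /(_ d0)/eqP.
rewrite /prop_for /continuous_at g0; apply/cvgrPdist_le => e e0.
have d1 : 0 < Num.min d (e / (C + 1)) by rewrite lt_min d0 divr_gt0// ltr_wpDl.
exists (Num.min d (e / (C + 1))) => // t; rewrite /ball_/= distrC lt_min => /andP[td te].
rewrite sub0r normrN; apply: le_trans (h t td) _.
apply: (@le_trans _ _ (C * (e / (C + 1)))); first by rewrite ler_wpM2l// ltW.
rewrite mulrCA ler_piMr ?(ltW e0)// ler_pdivrMr ?ltr_wpDl// mul1r.
by rewrite lerDl.
Qed.

Lemma is_derive_quadratic g (C d t0 : R) : 0 <= C -> 0 < d ->
 (forall t, `|t - t0| < d -> `|g t| <= C * `|t - t0| ^+ 2) -> is_derive t0 1 g 0.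
move=> C0 d0 h; have g0 : g t0 = 0.
 by have := h t0; rewrite subrr normr0 expr0n mulr0 normr_le0 => /(_ d0)/eqP.
have key : (fun k : R => k^-1 *: ((g \o shift t0) (k *: (1 : R)) - g t0)) @ 0^' --> (0 : R).
 apply/cvgrPdist_le => e e0.
 have d1 : 0 < Num.min d (e / (C + 1)) by rewrite lt_min d0 divr_gt0// ltr_wpDl.
 near=> k; rewrite sub0r normrN /= g0 subr0 normrM normfV.
 have k0 : k != 0 by near: k; exact: nbhs_dnbhs_neq.
 have : `|k| < Num.min d (e / (C + 1)) by near: k; exact: dnbhs0_lt.
 rewrite lt_min => /andP[kd ke].
 have := h (k *: 1 + t0); rewrite addrK [k *: 1]mulr1 => /(_ kd) hk.
 have kp : 0 < `|k| by rewrite normr_gt0.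
 rewrite mulrC ler_pdivrMr//; apply: (le_trans hk); rewrite expr2 mulrA ler_wpM2r//.
 apply: (@le_trans _ _ (C * (e / (C + 1)))); first by rewrite ler_wpM2l// ltW.
 rewrite mulrCA ler_piMr ?(ltW e0)// ler_pdivrMr ?ltr_wpDl// mul1r.
 by rewrite lerDl.
by split; [exact: cvgP key|exact: cvg_lim key].
Unshelve. all: by end_near. Qed.

Lemma root_factor P t0 : P.[t0] = 0 -> exists S, P = S * ('X - t0%:P).
by move=> h; apply/factor_theorem/eqP. Qed.

Section gluing.
Variables (f : R -> R) (P Q : {poly R}) (t0 d : R).
Hypothesis d_gt0 : 0 < d.
Hypothesis f_left : forall t, t0 - d < t < t0 -> f t = P.[t].
Hypothesis f_right : forall t, t0 <= t < t0 + d -> f t = Q.[t].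
Hypothesis PQ : P.[t0] = Q.[t0].

(** The right-hand polynomial is the reference on both sides; on the left, the defect is divisible
    by the [k]-th power of the distance to [t0]. *)
Lemma glue_err S (k : nat) : P - Q = S * ('X - t0%:P) ^+ k -> exists2 C, 0 <= C &
 forall t, `|t - t0| < Num.min d 1 -> `|f t - Q.[t]| <= C * `|t - t0| ^+ k.
move=> e; have [C C0 hC] := poly_ub_near S t0; exists C => // t.
rewrite lt_min => /andP[]; rewrite ltr_norml => /andP[h1 h2] h3.
have [tt|tt] := leP t0 t.
 rewrite f_right ?subrr ?normr0 ?mulr_ge0 ?exprn_ge0// tt/=.
 by move: h2; rewrite ltrBlDl.
rewrite f_left ?tt ?andbT; last by rewrite ltrBlDr -ltrBlDl; move: h1; lra.
rewrite -hornerN -hornerD e hornerM horner_exp !hornerE normrM normrX.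
by rewrite ler_wpM2r ?exprn_ge0// hC// ltW.
Qed.

Lemma glue_continuous : {for t0, continuous f}.
have : (P - Q).[t0] = 0 by rewrite !hornerE PQ subrr.
move=> /root_factor[S e]; have [|C C0 h] := @glue_err S 1; first by rewrite expr1.
have cg : {for t0, continuous (fun t => f t - Q.[t])}.
 by apply: (@cts_at_linear _ C (Num.min d 1)) => //; rewrite lt_min d_gt0 ltr01.
have -> : f = (fun t => (f t - Q.[t]) + Q.[t]) by apply: funext => t; rewrite subrK.
apply: cvgD; first exact: cg.
by apply: der_cts => z; exact: der_horner.
Qed.

Hypothesis PQ' : P^`().[t0] = Q^`().[t0].

Lemma glue_derive : is_derive t0 1 f (Q^`().[t0]).
have : (P - Q).[t0] = 0 by rewrite !hornerE PQ subrr.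
move=> /root_factor[S1 e1]; have : S1.[t0] = 0.
 have : ((P - Q)^`()).[t0] = 0 by rewrite derivB !hornerE PQ' subrr.
 by rewrite e1 derivM derivB derivX derivC subr0 mulr1 hornerD hornerM hornerXsubC subrr mulr0 add0r.
move=> /root_factor[S e2]; have [|C C0 h] := @glue_err S 2; first by rewrite e1 e2 expr2 mulrA.
have dg : is_derive t0 1 (fun t => f t - Q.[t]) 0.
 by apply: (@is_derive_quadratic _ C (Num.min d 1)) => //; rewrite lt_min d_gt0 ltr01.
have -> : f = (fun t => (f t - Q.[t]) + Q.[t]) by apply: funext => t; rewrite subrK.
have dQ := der_horner Q t0.
by apply: is_derive_eq; rewrite add0r.
Qed.
End gluing.

Lemma continuous_endpoints f P (a b : R) : continuous f -> a < b ->
 (forall t, a < t < b -> f t = P.[t]) -> f a = P.[a] /\ f b = P.[b].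
move=> cf ab fP; have cP : continuous (horner P).
 by apply: der_cts => z; exact: der_horner.
split.
- have h1 : f t @[t --> a^'+] --> f a by apply: cvg_at_right_filter; exact: cf.
 have h2 : f t @[t --> a^'+] --> P.[a].
  apply: cvg_trans (_ : P.[t] @[t --> a^'+] --> P.[a]); last by apply: cvg_at_right_filter; exact: cP.
  apply: near_eq_cvg; near=> t; apply/esym/fP; apply/andP; split; near: t.
   exact: nbhs_right_gt.
  exact: nbhs_right_lt.
 exact: cvg_unique h1 h2.
- have h1 : f t @[t --> b^'-] --> f b by apply: cvg_at_left_filter; exact: cf.
 have h2 : f t @[t --> b^'-] --> P.[b].
  apply: cvg_trans (_ : P.[t] @[t --> b^'-] --> P.[b]); last by apply: cvg_at_left_filter; exact: cP.
  apply: near_eq_cvg; near=> t; apply/esym/fP; apply/andP; split; near: t.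
   exact: nbhs_left_gt.
  exact: nbhs_left_lt.
 exact: cvg_unique h1 h2.
Unshelve. all: by end_near. Qed.

Lemma derive1n_poly f P (a b : R) r : (forall t, a < t < b -> f t = P.[t]) ->
 forall t, a < t < b -> derive1n r f t = P^`(r).[t].
move=> fP; elim: r => [|r IH] t tab; first by rewrite derivn0; exact: fP.
rewrite derive1nS derive1E derivnS.
have [_ <-] := der_horner (P^`(r)) t.
apply: near_eq_derive; have : t \in `]a, b[ by rewrite in_itv.
move=> /near_in_itvoo; apply: filterS => s; rewrite in_itv/=.
exact: IH.
Qed.

Lemma derive1_periodic f : periodic f 1 -> periodic (derive1 f) 1.
move=> pf t; rewrite /derive1.
have -> : (fun h : R => h^-1 *: (f (h + (t + 1)) - f (t + 1))) = fun h : R => h^-1 *: (f (h + t) - f t).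
 by apply: funext => h; rewrite addrA !pf.
by [].
Qed.

Lemma derive1n_periodic f r : periodic f 1 -> periodic (derive1n r f) 1.
by move=> pf; elim: r => [//|r IH]; rewrite derive1nS; exact: derive1_periodic. Qed.

Lemma CkS k f : (forall t, derivable f t 1) -> Ck k (derive1 f) -> Ck k.+1 f.
move=> df [h1 h2]; split; last by rewrite derive1Sn.
by case=> [|j] jk t; [exact: df|rewrite derive1Sn; exact: h1].
Qed.

Lemma Ck_cts k f r : Ck k f -> (r <= k)%N -> continuous (derive1n r f).
move=> [h1 h2]; rewrite leq_eqVlt => /orP[/eqP -> //|rk].
by apply: derivable_cts => z; exact: h1.
Qed.

Lemma monomial_of_derivn P (n : nat) : (size P <= n.+1)%N ->
 (forall r, (r < n)%N -> P^`(r).[0] = 0) -> P = P`_n *: 'X^n.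
move=> sP h; apply/polyP => i; rewrite coefZ coefXn.
have [ni|ni|->] := ltngtP n i; last by rewrite mulr1.
 by rewrite mulr0 nth_default// (leq_trans sP).
have := h i ni; rewrite horner_coef0 coef_derivn addn0 ffactnn mulr0 -mulr_natr => /eqP.
by rewrite mulf_eq0 pnatr_eq0 eqn0Ngt fact_gt0 orbF => /eqP.
Qed.
End glue.

#[local] Arguments Bp : simpl never.

(** * The spline space as the span of B-splines *)

Section dictionary.
Context {R : realType} (M' : nat).
Notation M := M'.+1.
Notation T := (measurableTypeR R).
Notation cm := (circle_measure R).
Implicit Types (t u : R).

Definition prv (m : 'I_M) : 'I_M := (m - inZp 1)%R.

Lemma prv_val m : prv m = (if (m : nat) is i.+1 then i else M') :> nat.
rewrite /prv; case: (M') m => [|n] x; first by rewrite !ord1.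
transitivity ((x + (n.+2 - 1 %% n.+2) %% n.+2) %% n.+2)%N; first by [].
rewrite (@modn_small 1)// modnDmr subSS subn0.
case: x => [[|i] xM] /=; first by rewrite add0n modn_small.
by rewrite addSnnS modnDr modn_small// ltnW.
Qed.

Lemma sigma0 L m : @sigma L M' m ord0 = m.
by rewrite /sigma (_ : inZp 0 = 0 :> 'I_M) ?subr0//; apply/val_inj; rewrite /= mod0n. Qed.

Lemma sigmaS L m (i : nat) (i1 : (i < L.+1)%N) (i2 : (i.+1 < L.+1)%N) :
 @sigma L M' m (Ordinal i2) = @sigma L M' (prv m) (Ordinal i1).
rewrite /sigma /prv -addrA -opprD; congr (_ - _).
by apply/val_inj; rewrite /= modnDm add1n.
Qed.

Section matching.
Variable l : nat.
Notation L := l.+1.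
Implicit Type z : 'rV[R]_M.

Lemma locoefE z m (i : 'I_L.+1) : locoef L z m 0 i = z 0 (@sigma L M' m i).
exact: mul_Sm. Qed.

Lemma psp_derivn (s : 'rV[R]_L.+1) r t : (psp s)^`(r).[t] = \sum_(i < L.+1) s 0 i * (Bp L i)^`(r).[t].
rewrite /psp linear_sum horner_sum; apply: eq_bigr => i _.
by rewrite linearZ hornerZ.
Qed.

Lemma psp_derivn1 (s : 'rV[R]_L.+1) r : (r < L)%N ->
 (psp s)^`(r).[1] = \sum_(i < L) s 0 (widen_ord (leqnSn L) i) * (Bp L i.+1)^`(r).[0].
move=> rL; rewrite psp_derivn big_ord_recr/= (Bp_smooth L rL).1 (Bp_gt (ltnSn L)) linear0 horner0 mulr0 addr0.
by apply: eq_bigr => i _; rewrite (Bp_smooth i rL).1.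
Qed.

Lemma psp_derivn0 (s : 'rV[R]_L.+1) r : (r < L)%N ->
 (psp s)^`(r).[0] = \sum_(i < L) s 0 (lift ord0 i) * (Bp L i.+1)^`(r).[0].
by move=> rL; rewrite psp_derivn big_ord_recl/= (Bp_smooth 0 rL).2 mulr0 add0r.
Qed.

Lemma locoef_match z m r : (r < L)%N ->
 (psp (locoef L z (prv m)))^`(r).[1] = (psp (locoef L z m))^`(r).[0].
move=> rL; rewrite psp_derivn1// psp_derivn0//; apply: eq_bigr => i _; congr (_ * _).
rewrite !locoefE; congr (z 0 _).
have i1 : (i < L.+1)%N by exact: ltnW (ltn_ord i).
have i2 : (i.+1 < L.+1)%N by exact: ltn_ord i.
transitivity (@sigma L M' (prv m) (Ordinal i1)); first by congr sigma; exact/val_inj.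
by rewrite -(sigmaS m i1 i2); congr sigma; exact/val_inj.
Qed.

(** The mismatch of the shared coefficients defines a combination [e] of the pieces of index at
    least 1 whose derivatives of order below [L] vanish at 0. So [e] is a multiple of [X ^ L], as is
    the piece [Bp L 0], and freeness of the pieces leaves no mismatch. *)
Lemma coef_of_match (c d : 'rV[R]_L.+1) :
 (forall r, (r < L)%N -> (psp c)^`(r).[1] = (psp d)^`(r).[0]) ->
 forall i : 'I_L, c 0 (widen_ord (leqnSn L) i) = d 0 (lift ord0 i).
move=> h; pose df (i : nat) : R := if i is j.+1 then
 (d 0 (inord j.+1) - c 0 (inord j)) else 0.
have inW (i : 'I_L) : inord i = widen_ord (leqnSn L) i :> 'I_L.+1.
 by apply/val_inj; rewrite /= inordK// (leq_trans (ltn_ord i)).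
have inL (i : 'I_L) : inord i.+1 = lift ord0 i :> 'I_L.+1.
 by apply/val_inj; rewrite /= inordK// ltnS.
pose e := \sum_(i < L.+1) df i *: Bp L i.
have eS : (size e <= L.+1)%N.
 apply: leq_trans (size_sum _ _ _) _; apply/bigmax_leqP => i _.
 by apply: leq_trans (size_scale_leq _ _) _; exact: size_Bp.
have e0 r : (r < L)%N -> e^`(r).[0] = 0.
 move=> rL; rewrite /e linear_sum horner_sum big_ord_recl/= scale0r linear0 horner0 add0r.
 have := h r rL; rewrite psp_derivn1// psp_derivn0// => /esym/eqP; rewrite -subr_eq0 -sumrB => /eqP h'.
 rewrite -[RHS]h'; apply: eq_bigr => i _.
 by rewrite linearZ hornerZ /= inL inW mulrBl.
have eX := monomial_of_derivn eS e0.
have bX := monomial_of_derivn (size_Bp L 0) (fun r rL => (@Bp_smooth R r L 0 rL).2).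
set be := (Bp L 0)`_L in bX; set ee := e`_L in eX.
have f0 := @Bp_free R L.
have be0 : be != 0.
 apply/eqP => b0; have := f0 (fun i => (i == 0%N)%:R) _ 0%N (leq0n _).
 move=> /(_ _)/eqP; rewrite oner_eq0 => H; suff : false by []; apply: H.
 rewrite (bigD1 ord0)//= scale1r bX b0 scale0r add0r big1// => i i0.
 by rewrite (_ : (i : nat) == 0%N = false) ?scale0r//; exact/negbTE.
have all0 := f0 (fun i => df i - ee / be * (i == 0%N)%:R) _.
have z0 : \sum_(i < L.+1) (df i - ee / be * ((i : nat) == 0%N)%:R) *: Bp L i = 0.
 under eq_bigr do rewrite scalerBl; rewrite sumrB -/e eX.
 rewrite big_ord_recl/= mulr1 bX scalerA divfK// big1 ?addr0 ?subrr// => i _.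
 by rewrite mulr0 scale0r.
move=> i; have := all0 z0 i.+1 (ltn_ord i).
by rewrite /= mulr0 subr0 inL inW => /eqP; rewrite subr_eq0 => /eqP.
Qed.

(** Coefficients of the derivative, up to the factor [M] from rescaling. *)
Definition dz z : 'rV[R]_M := \row_m (z 0 m - z 0 (prv m)).
End matching.

Lemma locoef_deriv l z m : (psp (locoef l.+2 z m))^`() = psp (locoef l.+1 (dz z) m).
have e (i : 'I_l.+2) : widen_ord (leqnSn l.+2) i = Ordinal (ltnW (ltn_ord i) : (i < l.+3)%N) :> 'I_l.+3 by exact/val_inj.
rewrite /psp raddf_sum/=; under eq_bigr do rewrite derivZ deriv_Bp scalerBr.
rewrite sumrB big_ord_recr/= (Bp_gt (ltnSn l.+1)) scaler0 addr0.
rewrite [X in _ - X]big_ord_recl/= scaler0 add0r -sumrB; apply: eq_bigr => i _.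
rewrite -scalerBl; congr (_ *: _); rewrite !locoefE mxE; congr (z 0 _ - z 0 _).
have i1 : (i < l.+3)%N by exact: ltnW (ltn_ord i).
have i2 : (i.+1 < l.+3)%N by exact: ltn_ord i.
transitivity (@sigma l.+2 M' m (Ordinal i2)); first by congr sigma; exact/val_inj.
rewrite (sigmaS m i1 i2) /prv /sigma /=.
by rewrite addrAC.
Qed.

(** [w] is the coordinate relative to block [m] in the period starting at [n]. Negative values fall
    into the preceding block, which for [m = 0] belongs to the previous period. *)
Lemma spl_local L (z : 'rV[R]_M) (n : int) (m : 'I_M) t :
 let w := M%:R * (t - n%:~R) - m%:R in
 (0 <= w < 1 -> spl L z t = (psp (locoef L z m)).[w]) /\
 (-1 <= w < 0 -> spl L z t = (psp (locoef L z (prv m))).[w + 1]).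
move=> w; have M0 : 0 < M%:R :> R by rewrite ltr0n.
have mM : (m : nat)%:R + 1 <= M%:R :> R by rewrite natr1 ler_nat.
have key (k : int) (m' : 'I_M) : 0 <= M%:R * (t - k%:~R) - m'%:R < 1 ->
  spl L z t = (psp (locoef L z m')).[M%:R * (t - k%:~R) - m'%:R].
 move=> /andP[h1 h2]; have mM' : (m' : nat)%:R + 1 <= M%:R :> R by rewrite natr1 ler_nat.
 have m0 : 0 <= (m' : nat)%:R :> R by [].
 have fk : Num.floor t = k.
  apply: floor_def; rewrite intrD -(ler_pM2l M0) -(ltr_pM2l M0) mulrDr.
  have e : M%:R * (t - k%:~R) = M%:R * t - M%:R * k%:~R by rewrite mulrBr.
  rewrite e in h1 h2; rewrite mulr1z mulr1.
  by move: (M%:R * t) (M%:R * k%:~R) h1 h2 => *; apply/andP; split; lra.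
 have fE : frac t = t - k%:~R by rewrite /frac fk.
 rewrite -fE; apply: splE; rewrite fE /in_cell ler_pdivrMr// ltr_pdivlMr// mulrC -[m'.+1%:R]natr1.
 by move: (M%:R * _) h1 h2 => *; apply/andP; split; lra.
split; first exact: key.
move=> /andP[w1 w2]; have := prv_val m; case: (m : nat) @w w1 w2 mM => [|i] w w1 w2 mM pE.
 have e : w + 1 = M%:R * (t - (n - 1)%:~R) - (prv m)%:R.
  rewrite /w pE intrB -natr1 mulr1z; ring.
 rewrite e; apply: key; rewrite -e; apply/andP; split; lra.
have e : w + 1 = M%:R * (t - n%:~R) - (prv m)%:R.
 by rewrite /w pE -[i.+1%:R]natr1; ring.
by rewrite e; apply: key; rewrite -e; apply/andP; split; lra.
Qed.

Lemma knot_coor t : exists (n : int) (m : 'I_M), 0 <= M%:R * (t - n%:~R) - m%:R < 1.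
have M0 : 0 < M%:R :> R by rewrite ltr0n.
have [m] := in_cell_exists (ltn0Sn M') (frac01 t).
rewrite /in_cell ler_pdivrMr// ltr_pdivlMr// mulrC -natr1 => /andP[h1 h2].
by exists (Num.floor t), m; rewrite -/(frac t); move: (_ * frac t) h1 h2 => *; apply/andP; split; lra.
Qed.

Definition linn (n : int) (m : nat) : {poly R} := M%:R *: ('X - (n%:~R)%:P) - m%:R%:P.

Lemma horner_linn n m t : (linn n m).[t] = M%:R * (t - n%:~R) - m%:R.
by rewrite /linn !hornerE. Qed.

Lemma deriv_linn n m : (linn n m)^`() = M%:R%:P.
by rewrite /linn derivB derivZ derivB derivX !derivC !subr0 alg_polyC. Qed.

(** Inside a block the same polynomial holds on both sides; at local coordinate 0, a knot, the left
    one belongs to the preceding block. *)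
Lemma spl_glue L (z : 'rV[R]_M) (t0 : R) : exists (P Q : {poly R}) (d : R),
 [/\ 0 < d, forall t, t0 - d < t < t0 -> spl L z t = P.[t],
  forall t, t0 <= t < t0 + d -> spl L z t = Q.[t] &
  exists n (m : 'I_M), [/\ Q = psp (locoef L z m) \Po linn n m,
   0 <= (linn n m).[t0] < 1 &
   P = Q \/ (linn n m).[t0] = 0 /\ P = psp (locoef L z (prv m)) \Po (linn n m + 1)]].
have M0 : 0 < M%:R :> R by rewrite ltr0n.
have [n [m h]] := knot_coor t0; set q := psp (locoef L z m).
rewrite -horner_linn in h; have /andP[h1 h2] := h.
set w0 := (linn n m).[t0] in h h1 h2.
have lw t : (linn n m).[t] = w0 + M%:R * (t - t0) by rewrite /w0 !horner_linn; ring.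
have right d : M%:R * d <= 1 - w0 -> forall t, t0 <= t < t0 + d -> spl L z t = (q \Po linn n m).[t].
 move=> hd t /andP[t1 t2]; rewrite horner_comp horner_linn; apply: (spl_local L z n m t).1.
 rewrite -horner_linn lw.
 have : M%:R * (t - t0) < M%:R * d by rewrite ltr_pM2l// ltrBlDl.
 have : 0 <= M%:R * (t - t0) by rewrite mulr_ge0 ?subr_ge0.
 by move: (M%:R * (t - t0)) (M%:R * d) hd => *; apply/andP; split; lra.
have [w00|w0n] := eqVneq w0 0.
 exists (psp (locoef L z (prv m)) \Po (linn n m + 1)), (q \Po linn n m), M%:R^-1.
 split; first by rewrite invr_gt0.
 - move=> t /andP[t1 t2]; rewrite horner_comp hornerD hornerC horner_linn.
  apply: (spl_local L z n m t).2; rewrite -horner_linn lw w00 add0r.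
  have : M%:R * - M%:R^-1 < M%:R * (t - t0) by rewrite ltr_pM2l// ltrBrDl.
  rewrite mulrN mulfV ?lt0r_neq0//.
  have : M%:R * (t - t0) < 0 by rewrite pmulr_rlt0// subr_lt0.
  by move: (M%:R * _) => *; apply/andP; split; lra.
 - by apply: right; rewrite mulfV ?lt0r_neq0// w00 subr0.
 by exists n, m; split=> //; right.
have w0p : 0 < w0 by rewrite lt_def w0n.
exists (q \Po linn n m), (q \Po linn n m), (Num.min w0 (1 - w0) / M%:R); split.
- by rewrite divr_gt0// lt_min w0p subr_gt0.
- move=> t /andP[t1 t2]; rewrite horner_comp horner_linn; apply: (spl_local L z n m t).1.
 rewrite -horner_linn lw.
 have : - w0 < M%:R * (t - t0).
  apply: (@le_lt_trans _ _ (M%:R * - (Num.min w0 (1 - w0) / M%:R))); last first.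
   by rewrite ltr_pM2l// ltrBrDl.
  by rewrite mulrN lerN2 mulrC divfK ?lt0r_neq0// ge_min lexx.
 have : M%:R * (t - t0) < 0 by rewrite pmulr_rlt0// subr_lt0.
 by move: (M%:R * _) => *; apply/andP; split; lra.
- by apply: right; rewrite mulrC divfK ?lt0r_neq0// ge_min lexx orbT.
by exists n, m; split=> //; left.
Qed.

Lemma spl_glue_match l (z : 'rV[R]_M) (m : 'I_M) n (t0 : R) r : (r <= l)%N -> (linn n m).[t0] = 0 ->
 (psp (locoef l.+1 z (prv m)))^`(r).[(linn n m + 1).[t0]] =
 (psp (locoef l.+1 z m))^`(r).[(linn n m).[t0]].
by move=> rl w0; rewrite hornerD hornerC w0 add0r locoef_match. Qed.

Lemma spl_continuous l (z : 'rV[R]_M) : continuous (spl l.+1 z).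
move=> t0; have [P [Q [d [d0 hl hr [n [m [QE _ PQ]]]]]]] := spl_glue l.+1 z t0.
apply: (glue_continuous d0 hl hr); case: PQ => [-> //|[w0 ->]].
rewrite QE !horner_comp; exact: (spl_glue_match z (leq0n l) w0).
Qed.

Lemma der_spl l (z : 'rV[R]_M) (t0 : R) :
 is_derive t0 1 (spl l.+2 z) (spl l.+1 (M%:R *: dz z) t0).
have [P [Q [d [d0 hl hr [n [m [QE w01 PQ]]]]]]] := spl_glue l.+2 z t0.
have dQ : Q^`().[t0] = spl l.+1 (M%:R *: dz z) t0.
 rewrite QE deriv_comp deriv_linn hornerM hornerC horner_comp locoef_deriv splZ mulrC.
 congr (_ * _); rewrite horner_linn in w01 *; apply/esym.
 exact: (spl_local l.+1 (dz z) n m t0).1.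
rewrite -dQ; apply: (glue_derive d0 hl hr); case: PQ => [-> //|[w0 ->]].
 rewrite QE !horner_comp; exact: (spl_glue_match z (leq0n l.+1) w0).
rewrite QE !deriv_comp derivD derivC addr0 !hornerM !horner_comp; congr (_ * _).
exact: (spl_glue_match (r := 1) z (ltn0Sn l) w0).
Qed.

Lemma Ck_spl l (z : 'rV[R]_M) : Ck l (spl l.+1 z).
elim: l z => [|l IH] z; first by split=> //; exact: spl_continuous.
apply: CkS; first by move=> t; have [] := der_spl l z t.
rewrite (_ : derive1 _ = spl l.+1 (M%:R *: dz z)); first exact: IH.
by apply: funext => t; rewrite derive1E; have [] := der_spl l z t.
Qed.

Lemma size_comp_lin (p q : {poly R}) n : (size p <= n)%N -> (size q <= 2)%N -> (size (p \Po q) <= n)%N.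
move=> sp sq; have [->|p0] := eqVneq p 0; first by rewrite comp_poly0 size_poly0.
apply: leq_trans (size_comp_poly_leq _ _) _.
apply: (@leq_trans ((size p).-1 * 1).+1); first by rewrite ltnS leq_mul2l; case: (size q) sq => [|[|[|]]]//; rewrite orbT.
by rewrite muln1 prednK// size_poly_gt0.
Qed.

Lemma size_lin m : (size (lin M' m : {poly R}) <= 2)%N.
rewrite /lin; apply: leq_trans (size_polyD _ _) _; rewrite geq_max size_polyN.
by rewrite (leq_trans (size_scale_leq _ _)) ?size_polyX// (leq_trans (size_polyC_leq1 _)).
Qed.

Theorem spline_spl L (z : 'rV[R]_M) : spline L M (spl L z).
split; first exact: spl_periodic.
 move=> m mM; exists (psp (locoef L z (Ordinal mM)) \Po lin M' m).
  by apply: size_comp_lin; [exact: size_psp|exact: size_lin].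
 move=> t; rewrite in_itv/= => /andP[t1 t2]; have M0 : 0 < M%:R :> R by rewrite ltr0n.
 have t01 : 0 <= t < 1.
  rewrite ltW ?(le_lt_trans _ t1) ?divr_ge0//= (lt_le_trans t2)// ler_pdivrMr// mul1r ler_nat.
  by [].
 rewrite (@splE _ _ _ z t (Ordinal mM)); first by rewrite horner_comp horner_lin frac_id.
 by rewrite frac_id// /in_cell/= t2 ltW.
case: L => [|l]; last exact: Ck_spl.
by apply/L2circleP; split; [exact: spl_periodic|exact: sq2_spl].
Qed.

(** On each block the polynomial has local coefficients; smoothness at the knots makes neighbouring
    blocks share them ([coef_of_match]), so those of index 0 determine all. Equality is claimed
    inside the blocks only, since for [L = 0] the values at the knots are free. *)
Theorem spline_eq_spl L y : spline L M y -> exists z : 'rV[R]_M,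
 forall m : 'I_M, forall t, m%:R / M%:R < t < m.+1%:R / M%:R -> y t = spl L z t.
move=> [py pw_y reg]; have M0 : 0 < M%:R :> R by rewrite ltr0n.
have M1 : M%:R != 0 :> R by rewrite gt_eqF.
have /choice[p pP] : forall m : 'I_M, exists p : {poly R}, (size p <= L.+1)%N /\
  forall t, m%:R / M%:R < t < m.+1%:R / M%:R -> y t = p.[t].
 move=> m; have [p sp h] := pw_y m (ltn_ord m); exists p; split=> // t ht.
pose il (m : 'I_M) : {poly R} := M%:R^-1 *: ('X + (m%:R)%:P).
have sil m : (size (il m) <= 2)%N.
 apply: leq_trans (size_scale_leq _ _) _; rewrite -[m%:R]opprK polyCN size_XsubC.
 by [].
have /choice[c cP] : forall m : 'I_M, exists s : 'rV[R]_L.+1, p m \Po il m = psp s.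
 by move=> m; apply: psp_full; apply: size_comp_lin; [case: (pP m)|exact: sil].
have ilE (m : 'I_M) u : (il m).[u] = (u + m%:R) / M%:R by rewrite /il !hornerE mulrC.
exists (\row_m c m 0 ord0) => m t ht.
suff cE (i : nat) (iL : (i < L.+1)%N) (m' : 'I_M) :
  c m' 0 (Ordinal iL) = c (@sigma L M' m' (Ordinal iL)) 0 ord0.
 have t01 : 0 <= t < 1.
  case/andP: ht => t1 t2; rewrite ltW ?(le_lt_trans _ t1) ?divr_ge0//= (lt_le_trans t2)//.
  by rewrite ler_pdivrMr// mul1r ler_nat.
 rewrite (@splE _ _ _ _ t m); last by rewrite frac_id// /in_cell; case/andP: ht => /ltW -> ->.
 have -> : locoef L (\row_m c m 0 ord0) m = c m.
  apply/rowP => i; rewrite mul_Sm mxE; case: i => i iL.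
  by rewrite -(cE i iL).
 rewrite -cP horner_comp ilE frac_id// (proj2 (pP m) t ht); congr (_.[_]).
 by rewrite subrK mulrC mulKf.
elim: i iL m' => [|i IH] iL m'.
 by rewrite (_ : Ordinal iL = ord0) ?sigma0//; exact/val_inj.
have i1 : (i < L.+1)%N by exact: ltnW.
rewrite (sigmaS m' i1 iL) -IH.
case: L reg p pP c cP IH iL i1 pw_y => [|l] reg p pP c cP IH iL i1 _ //.
have iL' : (i < l.+1)%N by [].
have cm' := @coef_of_match l (c (prv m')) (c m') _ (Ordinal iL').
rewrite (_ : Ordinal iL = lift ord0 (Ordinal iL')); last exact/val_inj.
rewrite -cm'; first by congr (c _ 0 _); exact/val_inj.
move=> r rL; rewrite -!cP.
have dn (q : {poly R}) mm k u : (q \Po il mm)^`(k).[u] = M%:R^-1 ^+ k * (q^`(k)).[(il mm).[u]].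
 elim: k q => [|k IHk] q; first by rewrite !derivn0 horner_comp expr0 mul1r.
 have dil : (il mm)^`() = (M%:R^-1)%:P by rewrite derivZ derivD derivX derivC addr0 alg_polyC.
 rewrite derivSn deriv_comp dil mulrC mul_polyC linearZ hornerZ IHk -derivSn.
 by rewrite mulrA -exprS.
rewrite !dn; congr (_ * _); rewrite !ilE add0r addrC natr1.
pose D := derive1n r y.
have cD : continuous D by apply: Ck_cts reg _; rewrite -ltnS.
have pD : periodic D 1 by exact: derive1n_periodic.
have ends (mm : 'I_M) : D (mm%:R / M%:R) = (p mm)^`(r).[mm%:R / M%:R] /\
  D (mm.+1%:R / M%:R) = (p mm)^`(r).[mm.+1%:R / M%:R].
 apply: continuous_endpoints => //; first by rewrite ltr_pM2r ?invr_gt0// ltr_nat.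
 exact: derive1n_poly (proj2 (pP mm)).
rewrite -(ends m').1 -(ends (prv m')).2 prv_val; case: (m' : nat) => [//|]; last by [].
by rewrite mul0r mulfV// -[in LHS](add0r 1) pD.
Qed.

Lemma spline_measurable L y : spline L M y -> measT (y : T -> R).
case: L => [|l] [py _ reg]; first by have [_ []] := (L2circleP y).1 reg.
by apply: cts_measT; exact: (Ck_cts reg (leq0n l)).
Qed.

Theorem spline_ae L y : spline L M y -> exists z : 'rV[R]_M,
 [/\ sq2 y, {ae cm, forall t, y t = spl L z t} & y = spl L z %[ae cm]].
move=> sy; have my := spline_measurable sy; have [z zE] := spline_eq_spl sy.
have M0 : 0 < M%:R :> R by rewrite ltr0n.
have cN : countable (range (fun m : nat => m%:R / M%:R : R)) by exact: card_image_le.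
have mN : measurable (range (fun m : nat => m%:R / M%:R : R) : set T).
 by apply: countable_measurable cN => t; exact: measurable_set1.
have mC : measurable (~` `[0, 1[%classic : set T) by apply: measurableC; exact: measurable_itv.
have ae : {ae cm, forall t, y t = spl L z t}.
 exists (~` `[0, 1[%classic `|` range (fun m : nat => m%:R / M%:R : R)); split.
 - exact: measurableU.
 - rewrite measureU0//; first exact: cm_out.
  rewrite /circle_measure/= /mrestr; apply: countable_lebesgue_measure0.
  by apply: sub_countable cN; apply: subset_card_le; exact: subIsetl.
 move=> t nE; apply: contrapT => /not_orP[/contrapT/=]; rewrite in_itv/= => t01 nr.
 apply: nE; have [m] := in_cell_exists (ltn0Sn M') t01.
 rewrite /in_cell le_eqVlt => /andP[/orP[/eqP e|h1] h2]; first by exfalso; apply: nr; exists m.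
 by apply: (zE m); rewrite h1.
by exists z; split=> //; [exact: sq2_ae my ae (sq2_spl L z)|apply: cm_ae_imp ae => t ->].
Qed.
End dictionary.

(** * Projection, fibers and the coarse-grained Hamiltonian *)

Section projection.
Context {R : realType} (V : perturbation R) (L K M' : nat) (C Ck eta : R).
Notation M := M'.+1.
Notation N := (K * M)%N.
Notation T := (measurableTypeR R).
Notation cm := (circle_measure R).
Notation sg := (@sigma L M').
Notation Bs := (bsp (bavg L K) sg).
Notation A := (Us Bs).
Notation psi := (pot V).
Notation rK := (Num.sqrt K%:R : R).
Hypothesis fr : frame V (bavg L K) sg C C C Ck eta.
Hypothesis avg_close : forall s (k : 'I_K) t, k%:R / K%:R <= t <= k.+1%:R / K%:R ->
 (avg K s k - (@psp R L s).[t]) ^+ 2 <= C * sqn s / K%:R ^+ 2.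
Implicit Types (z : 'rV[R]_M) (x : 'rV[R]_N).

Let K0 : (0 < K)%N := frame_K fr.
Let KR : 0 < K%:R :> R. by rewrite ltr0n. Qed.
Let MR : 0 < M%:R :> R. by rewrite ltr0n. Qed.
Let NR : 0 < N%:R :> R. by rewrite ltr0n muln_gt0 K0. Qed.
Let rK0 : 0 < rK. by rewrite sqrtr_gt0. Qed.
Let rK2 : rK * rK = K%:R. by rewrite -expr2 sqr_sqrtr. Qed.
Let N0 : (0 < N)%N. by rewrite muln_gt0 K0. Qed.

Lemma sqn_le_spl z : sqn z <= C / L.+1%:R * (M%:R * L2dot (spl L z) (spl L z)).
apply: le_trans (frame_bsp_lb fr z) _; apply: ler_wpM2l.
 by rewrite divr_ge0// ltW// (frame_C1 fr).
exact: sqn_bsp_spl.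
Qed.

(** B-spline moments. They determine the projection of [f], and a fiber is a level set of
    [mom (step x)] ([spline_fiberE]). *)
Definition mom (f : R -> R) : 'rV[R]_M := \row_j L2dot f (spl L (delta_mx 0 j)).

Lemma spl_sum z t : spl L z t = \sum_j z 0 j * spl L (delta_mx 0 j) t.
rewrite {1}(row_sum_delta z); elim/big_rec2: _ => [|j y u _ <-].
 by rewrite -(scale0r 0) splZ mul0r.
by rewrite splD splZ.
Qed.

Lemma dot_mom z f : sq2 f -> L2dot f (spl L z) = dot z (mom f).
move=> sf; rewrite L2dotC (_ : spl L z = fun t => \sum_j z 0 j * spl L (delta_mx 0 j) t).
 rewrite L2dot_suml//; last by move=> j; apply: sq2Z; exact: sq2_spl.
 apply: eq_bigr => j _; rewrite L2dotZl//; last exact: sq2_spl.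
 by rewrite mxE L2dotC.
by apply: funext => t; exact: spl_sum.
Qed.

Definition Gm : 'M[R]_M := \matrix_(i, j) L2dot (spl L (delta_mx 0 i)) (spl L (delta_mx 0 j)).

Lemma mom_spl z : mom (spl L z) = z *m Gm.
apply/rowP => j; rewrite !mxE L2dotC dot_mom; last exact: sq2_spl.
by apply: eq_bigr => i _; rewrite !mxE L2dotC.
Qed.

Lemma mom_spl_inj z z' : mom (spl L z) = mom (spl L z') -> z = z'.
rewrite !mom_spl => /eqP; rewrite -subr_eq0 -mulmxBl => /eqP e.
apply/eqP; rewrite -subr_eq0 -sqn_eq0; set u := z - z' in e *.
have := sqn_le_spl u; rewrite dot_mom ?mom_spl ?e; last exact: sq2_spl.
rewrite (dotC u) dot0l !mulr0 => h.
by rewrite eq_le h sqn_ge0.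
Qed.

Lemma Gm_unit : Gm \in unitmx.
rewrite -row_free_unit; apply/row_freeP; exists (pinvmx Gm).
apply/row_matrixP => i; apply/eqP; rewrite -subr_eq0 -linearB/=.
set s := row i _; have s0 : s *m Gm = 0.
 by rewrite /s -row_mul mulmxBl mulmxKpV ?submx_refl// mul1mx subrr linear0.
by apply/eqP; apply: mom_spl_inj; rewrite !mom_spl s0 mul0mx.
Qed.

Lemma mom_ae f g : sq2 f -> sq2 g -> {ae cm, forall t, f t = g t} -> mom f = mom g.
move=> sf sg' fg; apply/rowP => j; rewrite !mxE.
apply: L2dot_ae; [exact: sq2_meas|exact: sq2_meas|exact: (sq2_meas (sq2_spl _ _))|exact: fg].
Qed.

(** The Gram matrix is invertible, so a spline with the prescribed moments exists and [xget] does
    not fall back on its default. *)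
Lemma spline_projP f : sq2 f -> spline L M (spline_proj L M f) /\ mom (spline_proj L M f) = mom f.
move=> sf; pose z := mom f *m invmx Gm.
have e : mom (spl L z) = mom f by rewrite mom_spl /z mulmxKV// Gm_unit.
have : spline L M (spline_proj L M f) /\
  forall v, spline L M v -> L2dot (f \- spline_proj L M f) v = 0.
 apply: (@xgetPex _ (cst 0) [set y | spline L M y /\
  forall v, spline L M v -> L2dot (f \- y) v = 0]).
 exists (spl L z); split; first exact: spline_spl.
 move=> v /spline_ae[zv [sv vE _]].
 have sz := sq2_spl L z; have szv := sq2_spl L zv.
 have sd : sq2 (f \- spl L z) by exact: sq2B.
 rewrite L2dotC (L2dot_ae (sq2_meas sv) (sq2_meas szv) (sq2_meas sd) vE).
 by rewrite L2dotC L2dotBl// !dot_mom// e subrr.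
move=> [sy h]; split=> //; apply/rowP => j; rewrite !mxE; have [zy [sqy _ _]] := spline_ae sy.
have := h _ (spline_spl L (delta_mx 0 j)); rewrite L2dotBl//; last exact: sq2_spl.
by move=> /eqP; rewrite subr_eq0 => /eqP.
Qed.

Lemma mom_step x : mom (step x) = (rK / N%:R) *: (x *m Bs^T).
apply/rowP => j; rewrite mxE L2dot_step//; last exact: sq2_spl.
rewrite avgvec_spl// dotZr mxE -rowE mulrAC; congr (_ * _).
by rewrite mxE; apply: eq_bigr => i _; rewrite !mxE.
Qed.

(** Moments determine the coefficients of a spline, so equality of two splines almost everywhere
    amounts to equality of moments. *)
Lemma spline_fiberE y z x : sq2 y -> {ae cm, forall t, y t = spl L z t} ->
 spline_fiber L M y x <-> mom (step x) = mom y.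
move=> sy yE; have [ssx mx] := spline_projP (sq2_step x).
have [z' [sy' y'E _]] := spline_ae ssx; split.
 move=> h; rewrite -mx; apply: mom_ae => //.
 by apply: cm_ae_imp h => t; apply.
move=> h; have zz : z' = z.
 apply: mom_spl_inj; rewrite -(mom_ae sy' (sq2_spl L z') y'E) mx h.
 exact: mom_ae (sq2_spl L z) yE.
apply: cm_ae_imp (cm_ae_and y'E yE) => t [-> ->] _.
by rewrite zz.
Qed.

Lemma rank_fiber : \rank (kermx (Bs : 'M[R]_(M, N))^T) = (N - M)%N.
rewrite mxrank_ker mxrank_tr; congr (_ - _)%N.
apply/eqP; rewrite -/(row_free Bs); apply/row_freeP.
by exists (Bm_inv Bs); exact: mul_Bm_inv (frame_bsp_lb fr).
Qed.

(** The fiber is the coset through [x0] of the row space of [A], and the dimension [N - M] of the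
    Hausdorff measure is the number of rows of [A]. *)
Lemma coarse_hamiltonianE y z x0 : sq2 y -> {ae cm, forall t, y t = spl L z t} ->
 mom (step x0) = mom y ->
 coarse_hamiltonian psi L K M y = - (ln (Zf V A x0) / N%:R).
move=> sy yE x0E; rewrite /coarse_hamiltonian.
have -> : (spline_fiber L M y : set 'rV[R]_N) = [set x | rowsp A (x - x0)].
 apply/seteqP; split => x /=; rewrite (spline_fiberE x sy yE) -x0E !mom_step.
  move=> /(scalerI _) h; have [|u ->] := @Us_full _ _ _ Bs (x - x0); last by exists u.
  by rewrite mulmxBl h ?subrr// gt_eqF// divr_gt0.
 by move=> /(fiber_eq) ->.
rewrite -rank_fiber (integral_hausdorff A x0 (f := fun x => (weight V x)%:E)); first last.
- by move=> x; rewrite lee_fin expR_ge0.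
- by apply/measT_EFin; exact: meas_weight.
by rewrite (int_weightE V (Us_free Bs)).
Qed.

Let opp_div_sub (n a b c : R) : n != 0 -> - (a / n) - - (b / n) - c = - n^-1 * (a - b + n * c).
by move=> n0; field. Qed.

Section gradient.
Variables (y0 : R -> R) (x0 : 'rV[R]_N).
Hypothesis spline_y0 : spline L M y0.
Hypothesis fiber_x0 : mom (step x0) = mom y0.
Notation g := (gvec V (bavg L K) sg x0).

(** [gvec] lies in the span of the rows of [Bs]. The factor [rK^-1] undoes the one in [avgvec_spl],
    so that the cell averages of [grad] are exactly [gvec]. *)
Definition gcoef : 'rV[R]_M := rK^-1 *: (g *m Bm_inv Bs).

Definition grad : R -> R := spl L gcoef.

Lemma gvec_gcoef : g = rK *: (gcoef *m Bs).
by rewrite /gcoef -scalemxAl scalerA divff ?gt_eqF// scale1r -(gvec_span fr). Qed.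

Lemma avgvec_grad : avgvec N grad = g.
by rewrite /grad avgvec_spl// -gvec_gcoef. Qed.

(** Lifts an increment of the moments to a displacement of [x0] orthogonal to the fiber, as
    [ln_Zf_expansion] requires. *)
Definition lift_mx : 'M[R]_(M, N) := (N%:R / rK) *: (invmx (Bs *m Bs^T) *m Bs).

Lemma lift_mxE z : z *m lift_mx *m Bs^T = (N%:R / rK) *: z.
rewrite /lift_mx -scalemxAr -scalemxAl; congr (_ *: _).
by rewrite -!mulmxA mulVmx ?mulmx1// (Bm_gram_unit (frame_bsp_lb fr)).
Qed.

Lemma dot_lift z u : dot (u *m Bs) (z *m lift_mx) = N%:R / rK * dot u z.
by rewrite dot_mul lift_mxE dotZr. Qed.

Lemma sqn_mom : exists2 D, 0 < D & forall v, sq2 v -> sqn (mom v) <= D * L2dot v v.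
pose e j := spl L (delta_mx 0 j : 'rV[R]_M).
exists (\sum_j L2dot (e j) (e j) + 1).
 by rewrite ltr_wpDl// sumr_ge0// => j _; exact: L2dot_ge0.
move=> v sv; rewrite sqnE mulrDl mul1r mulr_suml; apply: ler_wpDr; first exact: L2dot_ge0.
apply: ler_sum => j _; rewrite mxE mulrC; apply: L2dot_cs => //; exact: sq2_spl.
Qed.

Theorem grad_is_gradient : is_gradient L M (coarse_hamiltonian psi L K M) y0 grad.
split; first exact: spline_spl.
move=> e e0; have [D D0 hD] := sqn_mom; have [D' D'0 hD'] := mulmx_ub lift_mx.
have [z0 [sy0 y0E _]] := spline_ae spline_y0.
set Q := 2 * tcst V x0 g + 2 * curv V.
have Q0 : 0 <= Q by rewrite /Q addr_ge0// mulr_ge0 ?tcst_ge0 ?curv_ge0.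
pose F := D' * D; have F0 : 0 < F by rewrite mulr_gt0.
have rc := rcst_gt0 V x0 g.
(* The first bound keeps the displacement within [rcst]; the second makes the quadratic remainder at
   most [e] times the norm. *)
pose r := Num.min (Num.sqrt (rcst V x0 g / F)) (e / (Q * F / N%:R + 1)).
have QF : 0 <= Q * F / N%:R by rewrite divr_ge0// mulr_ge0// ltW.
have r0 : 0 < r by rewrite lt_min sqrtr_gt0 !divr_gt0//= ltr_wpDl.
exists r => // v sv; have [zv [sqv vE _]] := spline_ae sv.
rewrite L2normE// lee_fin /=; set nv := Num.sqrt _ => nvr.
have nv0 : 0 <= nv by exact: sqrtr_ge0.
have nv2 : nv ^+ 2 = L2dot v v by rewrite sqr_sqrtr// L2dot_ge0.
pose w := mom v *m lift_mx.
have wF : sqn w <= F * nv ^+ 2.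
 rewrite nv2 -mulrA; apply: le_trans (hD' _) _; apply: ler_wpM2l; [exact: ltW|exact: hD].
have wr : sqn w <= rcst V x0 g.
 apply: (le_trans wF); rewrite mulrC -ler_pdivlMr//.
 have rr : 0 <= rcst V x0 g / F by rewrite divr_ge0// ltW.
 rewrite -(sqr_sqrtr rr) lerXn2r ?nnegrE ?sqrtr_ge0//.
 by apply: (le_trans nvr); rewrite ge_min lexx.
have wA c : dot (c *m A) w = 0.
 by rewrite dotC /w /lift_mx -scalemxAr mulmxA dotZl span_orth mulr0.
have sqyv : sq2 (y0 \+ v) by exact: sq2D.
have yvE : {ae cm, forall t, (y0 \+ v) t = spl L (z0 + zv) t}.
 by apply: cm_ae_imp (cm_ae_and y0E vE) => t [/= -> ->]; rewrite splD.
have fw : mom (step (x0 + w)) = mom (y0 \+ v).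
 have -> : mom (y0 \+ v) = mom y0 + mom v.
  by apply/rowP => j; rewrite !mxE L2dotDl//; exact: sq2_spl.
 rewrite -fiber_x0 !mom_step mulmxDl scalerDr; congr (_ + _).
 by rewrite lift_mxE scalerA mulrA divfK ?divff ?scale1r// gt_eqF.
rewrite (coarse_hamiltonianE sqyv yvE fw) (coarse_hamiltonianE sy0 y0E fiber_x0).
have := ln_Zf_expansion (Us_free Bs) (frame_rank fr) (gvec_dot fr x0) wA wr.
have -> : dot g w = N%:R * L2dot grad v.
 rewrite gvec_gcoef dotZl dot_lift L2dotC /grad dot_mom// mulrA; congr (_ * _).
 by field; rewrite gt_eqF.
rewrite -/Q => h.
rewrite (opp_div_sub _ _ _ (lt0r_neq0 NR)).
rewrite normrM normrN normfV (ger0_norm (ler0n _ _)) ler_pdivrMl//.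
apply: (le_trans h); apply: (@le_trans _ _ (Q * (F * nv ^+ 2))); first by rewrite ler_wpM2l.
rewrite mulrA expr2 mulrA [leRHS]mulrA ler_wpM2r//.
have : nv * (Q * F / N%:R + 1) <= e.
 rewrite -ler_pdivlMr; last by rewrite ltr_wpDl.
 by apply: (le_trans nvr); rewrite ge_min lexx orbT.
rewrite mulrDr mulr1 => h2; rewrite -ler_pdivrMl// mulrC.
have -> : Q * F * nv / N%:R = nv * (Q * F / N%:R) by ring.
by apply: le_trans h2; rewrite lerDl.
Qed.

Lemma step_mean x t : mean V (step x t) = step (mvec V x) t.
have [n h] := in_cell_exists N0 (frac01 t).
by rewrite !(stepE _ h) mxE.
Qed.

(** Against splines, [zeta] may be replaced by [step x0], which has the same moments; the pairing
    then becomes the one of [main_estimate]. *)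
Theorem grad_bias (zeta : R -> R) z : sq2 zeta -> mom zeta = mom y0 ->
 L2dot (fun t => zeta t - mean V (step g t)) (spl L z) ^+ 2 <=
 Cmain V L.+1 C C C Ck / K%:R ^+ 2 * L2dot (spl L z) (spl L z).
move=> sz me; have ss := sq2_spl L z.
have -> : (fun t => zeta t - mean V (step g t)) = fun t => zeta t - step (mvec V g) t.
 by apply: funext => t; rewrite step_mean.
rewrite L2dotBl//; last exact: sq2_step.
rewrite dot_mom// me -fiber_x0 mom_step L2dot_step// avgvec_spl// !dotZr -dot_mul.
rewrite [dot (mvec V g) _]dotC.
rewrite (_ : _ - _ = rK / N%:R * dot (z *m Bs) (x0 - mvec V g)); last by rewrite dotBr; ring.
rewrite exprMn; apply: le_trans (ler_wpM2l (sqr_ge0 _) (main_estimate fr x0 z (ltn0Sn M'))) _.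
have Cm0 : 0 <= Cmain V L.+1 C C C Ck.
 rewrite /Cmain; apply: addr_ge0; first by rewrite mulr_ge0// sqr_ge0.
 have C0 : 0 <= C by exact: ltW (frame_C1 fr).
 apply: mulr_ge0 => //; apply: mulr_ge0; first apply: mulr_ge0.
 - exact: mulr_ge0.
 - exact: (CD_ge0 fr x0 ord0).
 - apply: mulr_ge0 => //; have := CB_ge0 fr x0 ord0.
  by rewrite mul0r addr0.
apply: (@le_trans _ _ ((rK / N%:R) ^+ 2 * (Cmain V L.+1 C C C Ck * (M%:R / K%:R) * (M%:R * L2dot (spl L z) (spl L z))))).
 apply: ler_wpM2l; first exact: sqr_ge0.
 apply: ler_wpM2l; first by rewrite mulr_ge0// divr_ge0.
 exact: sqn_bsp_spl.
rewrite le_eqVlt; apply/orP; left; apply/eqP.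
rewrite exprMn expr2 rK2 natrM; move: (Cmain _ _ _ _ _ _) (L2dot _ _) => c l.
by field; rewrite addrC natr1 !gt_eqF.
Qed.

(** [step g] takes the cell averages of [grad], so the error is that of averaging a polynomial piece
    over a subcell. *)
Theorem grad_average : L2dot (fun t => step g t - grad t) (fun t => step g t - grad t) <=
 C ^+ 2 / K%:R ^+ 2 * L2dot grad grad.
have C0 : 0 <= C by exact: ltW (frame_C1 fr).
have sd : sq2 (fun t => step g t - grad t) by apply: sq2B; [exact: sq2_step|exact: sq2_spl].
pose b : 'rV[R]_M := \row_m (C ^+ 2 / K%:R ^+ 2 * sqn (blk m (gcoef *m Bs))).
rewrite L2dot_sqr; apply: le_trans (_ : cint (step b) <= _).
 apply: le_cint; [by case: sd|exact/sq2_intble/sq2_step|].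
 move=> t _; have [n h] := in_cell_exists N0 (frac01 t).
 have [m [k nE]] := idx_surj n; subst n; have [hm hk] := in_cell_idx K0 h.
 have gE : g 0 (idx m k) = avg K (locoef L gcoef m) k.
  by rewrite -avgvec_grad mxE cell_int_spl.
 rewrite (stepE _ h) (stepE _ hm) gE [b _ _]mxE /grad (@splE _ _ _ _ _ m hm).
 have /andP[k1 /ltW k2] := hk.
 apply: (le_trans (avg_close _ _)); first by rewrite k1 k2.
 rewrite blk_bsp -/(locoef L gcoef m).
 rewrite (_ : C ^+ 2 / K%:R ^+ 2 * _ = C * (C * sqn (locoef L gcoef m *m bavg L K)) / K%:R ^+ 2); last by ring.
 rewrite ler_wpM2r ?invr_ge0 ?sqr_ge0//; apply: ler_wpM2l => //.
 exact: frame_lb fr _.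
rewrite cint_step; under eq_bigr do rewrite mxE -mulrA.
rewrite -mulr_sumr; apply: ler_wpM2l; first by rewrite divr_ge0 ?sqr_ge0.
rewrite -mulr_suml -sqn_blk ler_pdivrMr// mulrC.
exact: sqn_bsp_spl.
Qed.
End gradient.
End projection.

Local Notation dif f g := (fun t => f t - g t).
Local Notation ico a b := (fun t => (a <= t < b)%R%:R).
Local Notation ilt a := (fun t => (t < a)%R%:R).
Local Notation oball a l := (fun t => (`|t - a| < l)%R%:R).
Local Notation cball a l := (fun t => (`|t - a| <= l)%R%:R).

(** * Smooth test functions and primitives *)

Section test_functions.
Context {R : realType}.
Implicit Types (f g F : R -> R).

(* Closed under differentiation, hence consisting of smooth functions. *)
Inductive elementary : (R -> R) -> Prop :=
| elementary_cst c : elementary (cst c)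
| elementary_cos w : elementary (fun t => cos (w * t))
| elementary_sin w : elementary (fun t => sin (w * t))
| elementaryD f g : elementary f -> elementary g -> elementary (fun t => f t + g t)
| elementaryM f g : elementary f -> elementary g -> elementary (fun t => f t * g t)
| elementary_exp f : elementary f -> elementary (fun t => expR (f t))
| elementary_shift f c : elementary f -> elementary (fun t => f (t - c))
| elementary_primitive f F : elementary f -> (forall t : R, is_derive t 1 F (f t)) -> elementary F.

Let der_lin w (t : R) : is_derive t 1 ( *%R w) w.
by have := is_deriveZ w (is_derive_id t (1 : R)); rewrite /GRing.scale/= mulr1. Qed.

Lemma der_addr f (df c t : R) : is_derive (t + c) 1 f df -> is_derive t 1 (fun s => f (s + c)) df.
move=> Df; have Ds : is_derive t 1 (fun s : R => s + c) 1.
 by have := is_deriveD (is_derive_id t (1 : R)) (is_derive_cst c t 1); rewrite addr0.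
by have := @is_derive1_comp _ f (fun s => s + c) t _ _ Df Ds; rewrite mulr1.
Qed.

Lemma elem_derive f : elementary f ->
 exists2 f', elementary f' & forall t : R, is_derive t 1 f (f' t).
elim=> {f}.
- by move=> c; exists (cst 0); [exact: elementary_cst|move=> t; exact: is_derive_cst].
- move=> w; exists (fun t => (- w) * sin (w * t)).
  by apply: (elementaryM (elementary_cst _)); exact: elementary_sin.
 move=> t; have := is_derive1_comp (is_derive_cos (w * t)) (der_lin w t).
 by rewrite mulrC mulrN mulNr.
- move=> w; exists (fun t => w * cos (w * t)).
  by apply: (elementaryM (elementary_cst _)); exact: elementary_cos.
 move=> t; have := is_derive1_comp (is_derive_sin (w * t)) (der_lin w t).
 by rewrite mulrC.
- move=> f g _ [f' ef' Df] _ [g' eg' Dg]; exists (fun t => f' t + g' t); first exact: elementaryD.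
 by move=> t; exact: is_deriveD.
- move=> f g ef [f' ef' Df] eg [g' eg' Dg]; exists (fun t => f t * g' t + g t * f' t).
  by apply: elementaryD; apply: elementaryM.
 by move=> t; exact: is_deriveM.
- move=> f ef [f' ef' Df]; exists (fun t => f' t * expR (f t)).
  by apply: elementaryM => //; exact: elementary_exp.
 move=> t; have := is_derive1_comp (is_derive_expR (f t)) (Df t).
 by rewrite mulrC.
- move=> f c ef [f' ef' Df]; exists (fun t => f' (t - c)); first exact: elementary_shift.
 by move=> t; exact: der_addr.
- by move=> f F ef _ DF; exists f.
Qed.

Lemma elem_cts f : elementary f -> continuous f.
by move=> /elem_derive[f' _ Df]; apply: der_cts. Qed.

Lemma elem_Ck f k : elementary f -> Ck k f.
move=> ef.
have e j : elementary (derive1n j f).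
 elim: j => [//|j /elem_derive[f' ef' Df]].
 suff -> : derive1n j.+1 f = f' by [].
 by apply: funext => t; rewrite derive1nS derive1E; have [_ ->] := Df t.
split; last exact: elem_cts.
by move=> j _ t; have [f' _ Df] := elem_derive (e j); have [] := Df t.
Qed.

Notation mu := (@lebesgue_measure R).

Lemma cts_intble_itv f (x y : R) : continuous f -> mu.-integrable `[x, y] (EFin \o f).
move=> cf; apply: continuous_compact_integrable; first exact: segment_compact.
exact: continuous_subspaceT.
Qed.

(** Signed integrals from 0 give one formula on the whole line; near [x] it is compared with the
    integral from a point [A] to the left of both 0 and [x]. *)
Lemma primitive_exists f : continuous f -> exists F, forall t : R, is_derive t 1 F (f t).
move=> cf; pose F y := \int[mu]_(t in `[0, y]) f t - \int[mu]_(t in `[y, 0]) f t.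
exists F => x; pose A := - `|x| - 1; pose B := `|x| + 1.
pose G y := \int[mu]_(t in `[A, y]) f t.
have /andP[xl xu] : - `|x| <= x <= `|x| by rewrite -ler_norml.
have x0 := normr_ge0 x.
have Ax : A < x by rewrite /A; lra.
have xB : x < B by rewrite /B; lra.
have A0 : A <= 0 by rewrite /A; lra.
have GB y z : A <= y -> y <= z -> G z - G y = \int[mu]_(t in `[y, z]) f t.
 move=> Ay yz; rewrite (Rintegral_itvB (b := BRight z)) ?bnd_simp//; last exact: cts_intble_itv.
 rewrite Rintegral_itv_obnd_cbnd//.
 by apply: integrableS (cts_intble_itv y z cf) => // t /=; rewrite !in_itv/= => /andP[/ltW -> ->].
have FG y : A <= y -> F y = G y - G 0.
 move=> Ay; rewrite /F; have [y0|y0|<-] := ltgtP 0 y.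
 - by rewrite (set_itv_ge (b2 := BRight 0)) ?bnd_simp -?ltNge// Rintegral_set0 subr0 GB// ltW.
 - by rewrite (set_itv_ge (b1 := BLeft 0)) ?bnd_simp -?ltNge// Rintegral_set0 sub0r -GB ?opprB// ltW.
 - by rewrite !subrr.
have [dG Gx] := continuous_FTC1_closed xB (cts_intble_itv A B cf) Ax (cf x).
have DG : is_derive x 1 (fun y => G y - G 0) (f x).
 have := is_deriveB (DeriveDef dG (erefl _)) (is_derive_cst (G 0) x 1).
 by rewrite -derive1E Gx subr0.
have nx : \forall y \near x, G y - G 0 = F y.
 near=> y; apply/esym/FG; apply/ltW; near: y; exact: nbhs_right_gt || exact: lt_nbhsr.
exact: near_eq_is_derive nx DG.
Unshelve. all: by end_near. Qed.

Lemma primitive_diff f F (x y : R) : continuous f -> (forall t : R, is_derive t 1 F (f t)) -> x <= y ->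
 F y - F x = \int[mu]_(t in `[x, y]) f t.
move=> cf DF; rewrite le_eqVlt => /predU1P[->|xy].
 by rewrite subrr set_itv1 Rintegral_set1.
have cF : continuous F by exact: der_cts DF.
rewrite /Rintegral (continuous_FTC2 xy (F := F)) ?fineB//.
- exact: continuous_subspaceT.
- split.
 + by move=> t _; have [] := DF t.
 + by apply: cvg_at_right_filter; exact: cF.
 + by apply: cvg_at_left_filter; exact: cF.
- by move=> t _; rewrite derive1E; have [_ ->] := DF t.
Qed.

(** [F (s + 1) - F s] is constant because [f] is periodic, and the constant drops out of the
    difference. *)
Lemma primitive_periodic f F (a b : R) : (forall t : R, is_derive t 1 F (f t)) -> periodic f 1 ->
 periodic (fun t => F (t - a) - F (t - b)) 1.
move=> DF pf t; pose G (s : R) := F (s + 1) - F s.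
have DG (s : R) : is_derive s 1 G 0.
 by have := is_deriveB (der_addr (DF (s + 1))) (DF s); rewrite pf subrr.
have := is_derive_0_is_cst (t - a) (t - b) DG.
rewrite /G ![t + 1 - _]addrAC; move: (F _) (F _) (F _) (F _) => *; lra.
Qed.
End test_functions.

Lemma cvg_Rint d (T : measurableType d) (R : realType) (mu : {measure set T -> \bar R})
  (D : set T) (f_ : nat -> T -> R) (f g : T -> R) : measurable D ->
 (forall n, measurable_fun D (f_ n)) -> measurable_fun D f ->
 {ae mu, forall x, D x -> f_ ^~ x @ \oo --> f x} ->
 mu.-integrable D (EFin \o g) -> {ae mu, forall x, forall n, D x -> `|f_ n x| <= g x} ->
 (fun n => \int[mu]_(x in D) f_ n x) @ \oo --> \int[mu]_(x in D) f x.
move=> mD mf_ mf cf ig fg.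
have [||||if_ _ h] := @dominated_convergence _ _ _ mu D mD (fun n => EFin \o f_ n) (EFin \o f) (EFin \o g) _ _ _ ig _.
- by move=> n; exact/measT_EFin.
- exact/measT_EFin.
- by apply: filterS cf => x + Dx => /(_ Dx) h; apply/cvg_EFin; [exact: nearW|exact: h].
- by apply: filterS fg => x h n Dx; rewrite lee_fin; exact: h.
by apply: fine_cvg; rewrite fineK//; exact: integrable_fin_num if_.
Qed.

(** * Smooth approximation of arc indicators *)

Section bump.
Context {R : realType} (l : R).
Hypotheses (l0 : 0 < l) (l1 : l < 1 / 2).
Notation mu := (@lebesgue_measure R).
Notation T := (measurableTypeR R).

Let x (s : R) := cos (2 * pi * s) - cos (2 * pi * l).

(* The second factor vanishes where x does, so that the limit is the indicator
 of [0 < x] at every point. *)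
Definition bump (n : nat) (s : R) : R :=
 expR (- expR (- n%:R * x s)) * (1 - expR (- n%:R * x s ^+ 2)).

Definition arc_ind (s : R) : R := (0 < x s)%R%:R.

Lemma bump_elem n : elementary (bump n).
have ex : elementary x by apply: elementaryD; [exact: elementary_cos|exact: elementary_cst].
apply: elementaryM.
 apply: elementary_exp; apply: (@eq_ind _ _ elementary) (funext (fun t => mulN1r _)).
 apply: elementaryM; first exact: elementary_cst.
 by apply: elementary_exp; apply: elementaryM => //; exact: elementary_cst.
apply: elementaryD; first exact: elementary_cst.
apply: (@eq_ind _ _ elementary) (funext (fun t => mulN1r _)).
apply: elementaryM; first exact: elementary_cst.
apply: elementary_exp; apply: elementaryM; first exact: elementary_cst.
by apply: (@eq_ind _ _ elementary) (funext (fun t => esym (expr2 _))); exact: elementaryM.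
Qed.

Lemma bump_periodic n : periodic (bump n) 1.
move=> s; rewrite /bump /x (_ : 2 * pi * (s + 1) = 2 * pi * s + pi *+ 2) ?cosD2pi//.
by rewrite mulr2n; ring.
Qed.

Lemma bump01 n s : 0 <= bump n s <= 1.
have a1 := expR_ge0 (- expR (- n%:R * x s)).
have a2 : expR (- expR (- n%:R * x s)) <= 1 by rewrite -expR0 ler_expR oppr_le0 expR_ge0.
have b1 := expR_ge0 (- n%:R * x s ^+ 2).
have b2 : expR (- n%:R * x s ^+ 2) <= 1.
 by rewrite -expR0 ler_expR mulNr oppr_le0 mulr_ge0// sqr_ge0.
by rewrite /bump; apply/andP; split; nra.
Qed.

Lemma cvg_expR_nat (c : R) : 0 < c -> (fun n : nat => expR (- n%:R * c)) @ \oo --> (0 : R).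
move=> c0; under eq_fun do rewrite mulNr -mulrN expRM_natl.
apply: cvg_expr; rewrite ger0_norm ?expR_ge0//.
by rewrite -expR0 ltr_expR oppr_lt0.
Qed.

Lemma cvg_bump s : bump ^~ s @ \oo --> arc_ind s.
rewrite /arc_ind /bump; have [x0|x0|x0] := ltgtP 0 (x s) => /=.
- rewrite -[X in _ --> X](mulr1 1).
 apply: cvgM.
  rewrite -[X in _ --> X](@expR0 R) -oppr0.
  apply: (@cvg_comp _ _ _ (fun n : nat => - expR (- n%:R * x s)) expR _ _ _ _ (@continuous_expR R (- 0))).
  by apply: cvgN; exact: cvg_expR_nat.
 rewrite -[X in _ --> X]subr0; apply: cvgB; first exact: cvg_cst.
 by apply: cvg_expR_nat; rewrite exprn_gt0.
- apply: (@squeeze_cvgr _ _ _ _ (cst 0) (fun n => expR (- n%:R * - x s))).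
 + apply: nearW => n; have /andP[h _] := bump01 n s; rewrite h /=.
  have b1 := expR_ge0 (- n%:R * x s ^+ 2).
  have b2 : expR (- n%:R * x s ^+ 2) <= 1.
   by rewrite -expR0 ler_expR mulNr oppr_le0 mulr_ge0// sqr_ge0.
  have := expR_ge0 (- expR (- n%:R * x s)).
  have : expR (- expR (- n%:R * x s)) <= expR (- n%:R * - x s).
   rewrite ler_expR mulrN lerN2; apply: le_trans (expR_ge1Dx _).
   by rewrite lerDr.
  move: (expR _) (expR (- n%:R * x s ^+ 2)) (expR _) b1 b2 => *; nra.
 + exact: cvg_cst.
 + by apply: cvg_expR_nat; rewrite oppr_gt0.
- under eq_fun do rewrite -x0 expr0n/= mulr0 expR0 subrr mulr0.
 exact: cvg_cst.
Qed.

(** The angle is folded into [[0, pi]], where the cosine decreases; [|s| < 1 - l] keeps [s] away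
    from the neighbouring copies of the arc. *)
Lemma arc_indE s : `|s| < 1 - l -> arc_ind s = (`|s| < l)%R%:R.
move=> sl; rewrite /arc_ind /x; congr (nat_of_bool _)%:R.
have pi0 := @pi_gt0 R; have n0 := normr_ge0 s.
have -> : cos (2 * pi * s) = cos (2 * pi * `|s|).
 by have [s0|s0] := ger0P s; rewrite ?mulrN ?cosN.
have half (h : R) : 0 <= h -> h <= 1 / 2 -> 2 * pi * h \in `[0, pi].
 move=> h0 h1; rewrite in_itv /=; have := mulr_ge0 (ltW pi0) h0.
 have : 0 <= pi * (1 - 2 * h) by apply: mulr_ge0; [exact: ltW|lra].
 by move=> *; apply/andP; split; lra.
have lp : 2 * pi * l \in `[0, pi] by apply: half; exact: ltW.
rewrite subr_gt0; have [h|h] := leP `|s| (1 / 2).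
 rewrite ltr_cos//; last by apply: half => //; lra.
 by rewrite ltr_pM2l// mulr_gt0.
have -> : cos (2 * pi * `|s|) = cos (2 * pi * (1 - `|s|)).
 rewrite -[RHS]cosN -[RHS]cosD2pi; congr cos; rewrite mulr2n; ring.
rewrite ltr_cos//; last by apply: half; move: l0 l1 sl h; move: `|s| => u *; lra.
rewrite ltr_pM2l ?mulr_gt0//; have -> : (`|s| < l) = false by apply/negbTE; rewrite -leNgt; lra.
by apply/negbTE; rewrite -leNgt; lra.
Qed.

Lemma meas_bump n (D : set T) : measurable_fun D (bump n : T -> R).
apply: measurable_funTS; apply: cts_measT.
exact: elem_cts (bump_elem n).
Qed.

Lemma measurable_arc (D : set T) : measurable_fun D (arc_ind : T -> R).
apply: measurable_funTS.
by apply: (measurable_fun_cvg (h := bump)) => // [m|s _]; [exact: meas_bump|exact: cvg_bump].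
Qed.

(** Limit of differences of primitives of bumps. Near one period it is [2 * l] times the indicator
    of [[b, a[], smeared over width [l] at both ends. *)
Definition sweep (a b t : R) : R := \int[mu]_(s in `[t - a, t - b]) arc_ind s.

Lemma cvg_sweep a b t : (fun n => \int[mu]_(s in `[t - a, t - b]) bump n s) @ \oo --> sweep a b t.
apply: (@cvg_Rint _ _ _ mu _ _ _ (cst 1)) => //.
- by move=> n; exact: meas_bump.
- exact: measurable_arc.
- by apply: aeW => s _; exact: cvg_bump.
- by apply: cts_intble_itv => s; exact: cvg_cst.
- by apply: aeW => s n _; have /andP[h1 h2] := bump01 n s; rewrite ger0_norm.
Qed.

Lemma sweep_bounds a b t : l < b -> b <= a -> a + l < 1 -> 0 <= t < 1 ->
 `|sweep a b t - 2 * l * (b <= t < a)%R%:R| <= 2 * l * ((`|t - a| <= l)%R%:R + (`|t - b| <= l)%R%:R).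
move=> lb ba al /andP[t0 t1]; pose I := `]-l, l[%classic : set T.
pose J := `[t - a, t - b]%classic : set T; pose X := I `&` J.
have mmI : measurable I by exact: measurable_itv.
have mJ : measurable J by exact: measurable_itv.
have mX : measurable X by exact: measurableI.
have -> : sweep a b t = fine (mu X).
 congr fine; rewrite -integral_indic//.
 apply: eq_integral => s; rewrite inE/= in_itv/= => /andP[s1 s2]; congr EFin.
 rewrite arc_indE ?indicE; last by rewrite ltr_norml; apply/andP; split; lra.
 by rewrite ltr_norml; congr (_ %:R); congr nat_of_bool; apply/idP/idP; rewrite inE /I/= in_itv.
have mI : mu I = (2 * l)%:E.
 rewrite lebesgue_measure_itv/= lte_fin gtrN// -EFinB; congr EFin; lra.
have le2l : 0 <= fine (mu X) <= 2 * l.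
 rewrite fine_ge0//= -lee_fin fineK.
  rewrite -mI; apply: le_measure; [exact/mem_set|exact/mem_set|exact: subIsetl].
 rewrite ge0_fin_numE//; apply: (@le_lt_trans _ _ (2 * l)%:E); last exact: ltry.
 rewrite -mI; apply: le_measure; [exact/mem_set|exact/mem_set|exact: subIsetl].
have [ta|ta] := leP `|t - a| l; have [tb|tb] := leP `|t - b| l; case: (boolP (b <= t < a)) => bta.
all: try by rewrite /= ?mulr1n ?mulr0n ler_norml; apply/andP; split; lra.
- have -> : X = I.
  apply/seteqP; split => s; first by case.
  rewrite /X/I/J/= !in_itv/= => /andP[s1 s2]; split; first by rewrite s1.
  move: bta ta tb => /andP[bt tt]; rewrite ler0_norm ?ger0_norm; [move=> ta tb|lra|lra].
  by apply/andP; split; lra.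
 by rewrite mI /= ler_norml; apply/andP; split; lra.
- have -> : X = set0.
  apply/seteqP; split => s//; rewrite /X/I/J/= !in_itv/= => -[/andP[s1 s2] /andP[s3 s4]].
  move: bta; rewrite negb_and -ltNge -leNgt => /orP[h|h].
   by move: tb; rewrite ler0_norm; lra.
  by move: ta; rewrite ger0_norm; lra.
 by rewrite measure0 /= ler_norml; apply/andP; split; lra.
Qed.
End bump.

(** * Representation by a primitive of the weak derivative *)

Section weak_derivative.
Context {R : realType} (zeta xi : R -> R).
Hypotheses (sq_zeta : sq2 zeta) (weak_xi : weak_derivative zeta xi).
Notation mu := (@lebesgue_measure R).
Notation T := (measurableTypeR R).
Notation cm := (circle_measure R).

Lemma sq2_weak : sq2 xi.
by have [/L2circleP[]] := weak_xi. Qed.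

Lemma weak_mean0 : L2dot xi (cst 1) = 0.
have [_ /(_ (cst 1))] := weak_xi.
rewrite (_ : derive1 (cst 1 : R -> R) = cst 0); last by apply: funext => t; rewrite derive1_cst.
move=> h; apply/eqP; rewrite -oppr_eq0 -h//; last by move=> k; apply: elem_Ck; exact: elementary_cst.
by rewrite L2dotE; under [X in cint X]eq_fun do rewrite mulr0; rewrite cint_cst.
Qed.

Lemma meas_bool (P : R -> bool) : measurable [set t : T | P t] ->
 measT (fun t : T => (P t)%:R : R).
move=> mP; have -> : (fun t : T => (P t)%:R : R) = \1_[set t : T | P t].
 by apply: funext => t; rewrite indicE; congr (nat_of_bool _)%:R; apply/idP/idP; rewrite inE.
exact: measurable_indic.
Qed.

Lemma norm_bool_le1 (b : bool) : `|b%:R : R| <= 1.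
by case: b => /=; rewrite ?normr1 ?normr0. Qed.

Lemma cint_bool (P : R -> bool) : measurable [set t : T | P t] ->
 (forall t, P t -> 0 <= t < 1) -> cint (fun t => (P t)%:R) = fine (mu [set t : T | P t]).
move=> mP P01; rewrite cint_lebesgue.
 have e : [set t : T | P t] = [set t | P t] `&` `[0, 1[.
  by apply/seteqP; split => t /= [] // h; rewrite ?in_itv/= ?P01.
 congr fine; rewrite [in RHS]e -integral_indic//.
 by apply: eq_integral => t _; congr EFin; rewrite indicE; congr (nat_of_bool _)%:R; apply/idP/idP; rewrite inE.
apply: (@cintble_bounded _ _ 1); first exact: meas_bool.
by move=> t; exact: norm_bool_le1.
Qed.

Let ballE (a l : R) : [set t : T | `|t - a| < l] = `]a - l, a + l[%classic.
by apply/seteqP; split => t /=; rewrite in_itv/= ltr_norml => /andP[? ?]; apply/andP; split; lra.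
Qed.

Let cballE (a l : R) : [set t : T | `|t - a| <= l] = `[a - l, a + l]%classic.
by apply/seteqP; split => t /=; rewrite in_itv/= ler_norml => /andP[? ?]; apply/andP; split; lra.
Qed.

Let mball (a l : R) : measurable [set t : T | `|t - a| < l].
by rewrite ballE; exact: measurable_itv. Qed.

Let mcball (a l : R) : measurable [set t : T | `|t - a| <= l].
by rewrite cballE; exact: measurable_itv. Qed.

Lemma cint_ball (a l : R) : 0 < l -> l < a -> a + l < 1 -> cint (oball a l) = 2 * l.
move=> l0 la al; rewrite cint_bool//; last first.
 by move=> t; rewrite ltr_norml => /andP[h1 h2]; apply/andP; split; lra.
by rewrite ballE lebesgue_measure_itv/= lte_fin ifT -?EFinB/=; [ring|lra].
Qed.

Lemma cint_cball (a l : R) : 0 < l -> l < a -> a + l < 1 -> cint (cball a l) = 2 * l.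
move=> l0 la al; rewrite cint_bool//; last first.
 by move=> t; rewrite ler_norml => /andP[h1 h2]; apply/andP; split; lra.
by rewrite cballE lebesgue_measure_itv/= lte_fin ifT -?EFinB/=; [ring|lra].
Qed.

Lemma cvg_cint (f_ : nat -> R -> R) f g : (forall n, measT (f_ n : T -> R)) ->
 measT (f : T -> R) -> (forall t, 0 <= t < 1 -> f_ ^~ t @ \oo --> f t) ->
 cintble g -> (forall n t, `|f_ n t| <= g t) -> (fun n => cint (f_ n)) @ \oo --> cint f.
move=> mf_ mf cf ig fg; apply: (cvg_Rint measurableT mf_ mf _ ig).
 by apply: cm_ae => t t01 _; exact: cf.
by apply: cm_ae => t _ n _; exact: fg.
Qed.

Section window.
Variables (l a b : R).
Hypotheses (l0 : 0 < l) (lb : l < b) (ba : b <= a) (al : a + l < 1).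

Let l1 : l < 1 / 2. move: l0 lb ba al => *; lra. Qed.

Let sq_xi := sq2_weak.

Let E n : R -> R := sval (cid (primitive_exists (elem_cts (bump_elem l n)))).
Let DE n (t : R) : is_derive t 1 (E n) (bump l n t).
by rewrite /E; case: cid. Qed.
Let eta n (t : R) := E n (t - b) - E n (t - a).

Lemma etaE n t : eta n t = \int[mu]_(s in `[t - a, t - b]) bump l n s.
apply: primitive_diff => //; last by (move: l0 lb ba al => *; lra).
exact: elem_cts (bump_elem l n).
Qed.

Lemma elem_eta n : elementary (eta n).
have eE : elementary (E n) by apply: elementary_primitive (bump_elem l n) (DE n).
apply: elementaryD; first exact: elementary_shift.
apply: (@eq_ind _ _ elementary) (funext (fun t => mulN1r _)).
by apply: elementaryM; [exact: elementary_cst|exact: elementary_shift].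
Qed.

Lemma meas_eta n : measT (eta n : T -> R).
by apply: cts_measT; apply: elem_cts; exact: elem_eta. Qed.

Lemma eta_ub n t : `|eta n t| <= 1.
rewrite /eta; have [->|tt] := eqVneq (t - b) (t - a); first by rewrite subrr normr0.
have tba : t - a < t - b by move: tt; rewrite neq_lt => /orP[|//]; (move: l0 lb ba al => *; lra).
have cE : continuous (E n) by exact: der_cts (DE n).
have [c _ ->] := @MVT R (E n) (bump l n) (t - a) (t - b) tba (fun x _ => DE n x) (continuous_subspaceT cE).
have /andP[c0 c1] := bump01 l n c.
have d0 : 0 <= t - b - (t - a) by move: ba => *; lra.
have d1 : t - b - (t - a) <= 1 by move: l0 lb ba al => *; lra.
by rewrite ger0_norm; [rewrite mulr_ile1|rewrite mulr_ge0].
Qed.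

Lemma derive_eta n : derive1 (eta n) = fun t => bump l n (t - b) - bump l n (t - a).
apply: funext => t; rewrite derive1E.
by have [_ ->] := is_deriveB (der_addr (DE n (t - b))) (der_addr (DE n (t - a))).
Qed.

Lemma cvg_eta t : (fun n => eta n t) @ \oo --> sweep l a b t.
by rewrite (funext (fun n => etaE n t)); exact: cvg_sweep. Qed.

Lemma meas_sweep : measT (sweep l a b : T -> R).
apply: (measurable_fun_cvg (h := eta)); [exact: meas_eta|by move=> t _; exact: cvg_eta].
Qed.

Lemma sweep_ub t : `|sweep l a b t| <= 1.
have h : (fun n => `|eta n t|) @ \oo --> `|sweep l a b t|.
 by apply: cvg_norm; exact: cvg_eta.
by apply: (ler_cvg_to h (cvg_cst (1 : R))); apply: nearW => n; exact: eta_ub.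
Qed.

(** The weak identity for the smooth [eta n], whose derivative is the difference of the bumps at [b]
    and at [a], passed to the limit by dominated convergence. *)
Lemma weak_window :
 L2dot zeta (fun t => (`|t - a| < l)%R%:R - (`|t - b| < l)%R%:R) = L2dot xi (sweep l a b).
pose ind (c t : R) : R := (`|t - c| < l)%R%:R.
have mind c : measT (ind c : T -> R) by exact: meas_bool.
have mb n c : measT (fun t : T => bump l n (t - c)).
 apply: cts_measT; apply: elem_cts.
 by apply: elementary_shift; exact: bump_elem.
have c1 : (fun n => L2dot zeta (derive1 (eta n))) @ \oo --> L2dot zeta (fun t => ind b t - ind a t).
 under eq_fun do rewrite derive_eta L2dotE.
 rewrite L2dotE; apply: (@cvg_cint _ _ (fun t => `|zeta t|)).
 - move=> n; apply: measTM; [exact: sq2_meas|exact: measTB].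
 - apply: measTM; [exact: sq2_meas|exact: measTB].
 - move=> t /andP[t0 t1].
  have ib c : l < c -> c + l < 1 -> (fun n => bump l n (t - c)) @ \oo --> ind c t.
   move=> lc cl; rewrite /ind -(arc_indE l0 l1); first exact: cvg_bump.
   by rewrite ltr_norml; move: l0 lb ba al => *; apply/andP; split; lra.
  apply: cvgM; first exact: cvg_cst.
  by apply: cvgB; apply: ib; (move: l0 lb ba al => *; lra).
 - exact: integrable_norm (sq2_intble sq_zeta).
 - move=> n t; rewrite normrM ler_piMr//.
  have := bump01 l n (t - b); have := bump01 l n (t - a).
  by move=> /andP[? ?] /andP[? ?]; rewrite ler_norml; move: l0 lb ba al => *; apply/andP; split; lra.
have c2 : (fun n => - L2dot xi (eta n)) @ \oo --> - L2dot xi (sweep l a b).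
 apply: cvgN; under eq_fun do rewrite L2dotE.
 rewrite L2dotE; apply: (@cvg_cint _ _ (fun t => `|xi t|)).
 - move=> n; apply: measTM; [exact: sq2_meas|exact: meas_eta].
 - apply: measTM; [exact: sq2_meas|exact: meas_sweep].
 - move=> t _; apply: cvgM; first exact: cvg_cst.
  exact: cvg_eta.
 - exact: integrable_norm (sq2_intble sq2_weak).
 - by move=> n t; rewrite normrM ler_piMr// eta_ub.
have e : (fun n => L2dot zeta (derive1 (eta n))) = fun n => - L2dot xi (eta n).
 apply: funext => n; have [_ h] := weak_xi; apply: h; last by move=> k; apply: elem_Ck; exact: elem_eta.
 by apply: primitive_periodic (DE n) _; exact: bump_periodic.
rewrite e in c1.
have h : L2dot zeta (fun t => ind b t - ind a t) = - L2dot xi (sweep l a b).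
 by rewrite -(cvg_lim (@Rhausdorff R) c1) (cvg_lim (@Rhausdorff R) c2).
have sind c : sq2 (ind c) by apply: (@sq2_bounded _ _ 1) => // t; exact: norm_bool_le1.
move: h; rewrite L2dotC L2dotBl// [in X in _ -> X]L2dotC L2dotBl; [|exact: (sind a)|exact: (sind b)|by []].
rewrite -!/(ind _).
by move=> h; rewrite -opprB h opprK.
Qed.
End window.

(** Cut to one period, which makes it integrable on the line, so that Lebesgue's differentiation
    theorem applies. *)
Let f : R -> R := zeta \_ `[0, 1[.

Lemma cintble_lebesgue g : cintble g -> mu.-integrable `[0, 1[ (EFin \o g).
move=> /integrableP[mg fg]; apply/integrableP; split; first exact: measurable_funS mg.
apply: le_lt_trans fg; rewrite (_ : integral mu _ _ = \int[cm]_(t in `[0%R, 1%R[) `|(g t)%:E|)%E.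
 by apply: ge0_subset_integral => //; exact: measT_comp.
by apply: eq_measure_integral => B mB sB; rewrite /circle_measure /= /mrestr setIidl.
Qed.

Lemma locally_integrable_restriction : locally_integrable setT f.
apply: open_integrable_locally; first exact: openT.
have h := (integrable_mkcond _ (@meas_dom01 R)).1 (cintble_lebesgue (sq2_intble sq_zeta)).
by rewrite /f -restrict_EFin.
Qed.

Lemma lebesgue_pt_ball (a e : R) : lebesgue_pt f a -> 0 < a < 1 -> 0 < e ->
 \forall l \near 0^'+, `|L2dot zeta (oball a l) - 2 * l * zeta a| <= 2 * l * e.
move=> fa /andP[a0 a1] e0.
have /fine_cvgP[finE /cvgrPdist_lt/(_ e e0) ne] := fa.
near=> l; have l0 : 0 < l by near: l; exact: nbhs_right_gt.
have la : l < a by near: l; exact: nbhs_right_lt.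
have al : a + l < 1.
 suff : l < 1 - a by lra.
 by near: l; apply: nbhs_right_lt; lra.
have fin : davg f a l \is a fin_num by near: l.
have dl : `|0 - fine (davg f a l)| < e by near: l.
have sind : sq2 (oball a l).
 by apply: (@sq2_bounded _ _ 1); [exact: meas_bool|move=> t; exact: norm_bool_le1].
pose h t := (zeta t - zeta a) * (`|t - a| < l)%R%:R.
have sc : sq2 (fun t => zeta t - zeta a).
 by apply: sq2B => //; apply: (@sq2_bounded _ _ `|zeta a|).
have ih : cintble h by exact: sq2_mul.
have -> : L2dot zeta (oball a l) - 2 * l * zeta a = cint h.
 have <- : L2dot (fun t => zeta t - zeta a) (oball a l) = cint h by rewrite L2dotE.
 rewrite L2dotBl//; last by apply: (@sq2_bounded _ _ `|zeta a|).
 congr (_ - _); rewrite [RHS]L2dotE cintZ; last exact: sq2_intble.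
 by rewrite cint_ball// mulrC.
apply: (@le_trans _ _ (cint (fun t => `|h t|))).
 exact: le_normr_Rintegral.
have ih' : cintble (fun t => `|h t|) by exact: integrable_norm.
have hE : (cint (fun t => `|h t|))%:E = (\int[mu]_(y in ball a l) `|(center (f a) \o f) y|%:E)%E.
 rewrite cint_lebesgue// /Rintegral fineK; last first.
  exact: integrable_fin_num (cintble_lebesgue ih').
 rewrite (_ : ball a l = `[0, 1[ `&` ball a l); last first.
  rewrite setIidr// => y; rewrite /ball/= in_itv/= distrC ltr_norml => /andP[h1 h2].
  by apply/andP; split; lra.
 rewrite integral_mkcondr; apply: eq_integral => y; rewrite inE/= in_itv/= => y01.
 rewrite patchE /h; case: ifPn => yB.
  have -> : (`|y - a| < l)%R by move: yB; rewrite inE /ball/= distrC.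
  by rewrite mulr1 /= /f !patchE !mem_set// /= in_itv/= ltW.
 have -> : (`|y - a| < l)%R = false by apply: contraNF yB; rewrite inE /ball/= distrC.
 by rewrite mulr0 normr0.
move: dl; rewrite /davg /iavg -hE lebesgue_measure_ball; last exact: ltW.
rewrite inver ifF; last by apply/negbTE; rewrite mulrn_eq0 negb_or /= gt_eqF.
rewrite -EFinM /= sub0r normrN ger0_norm.
 by rewrite ltr_pdivrMl ?pmulrn_lgt0// => /ltW; rewrite -[l *+ 2]mulr_natl.
by rewrite mulr_ge0 ?Rintegral_ge0// invr_ge0 mulrn_wge0// ltW.
Unshelve. all: by end_near. Qed.

Lemma sq2_bool (P : R -> bool) : measurable [set t : T | P t] -> sq2 (fun t => (P t)%:R).
by move=> mP; apply: (@sq2_bounded _ _ 1); [exact: meas_bool|move=> t; exact: norm_bool_le1].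
Qed.

Let measurable_ico (a b : R) : measurable [set t : T | b <= t < a].
have -> : [set t : T | b <= t < a] = `[b, a[%classic by apply/seteqP; split => t /=; rewrite in_itv.
exact: measurable_itv.
Qed.

Lemma sq2_ico (b a : R) : sq2 (ico b a).
exact: sq2_bool. Qed.

Lemma sq2_lt (t : R) : sq2 (ilt t).
apply: sq2_bool; have -> : [set s : T | s < t] = `]-oo, t[%classic.
 by apply/seteqP; split => s /=; rewrite in_itv.
exact: measurable_itv.
Qed.

Lemma L2dot_ico (b a : R) : b <= a -> L2dot xi (ilt a) - L2dot xi (ilt b) =
 L2dot xi (ico b a).
move=> ba; have sxi := sq2_weak.
rewrite ![L2dot xi _]L2dotC -L2dotBl//; [|exact: sq2_lt|exact: sq2_lt].
congr L2dot; apply: funext => t; case: (ltP t b) => tb /=.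
 by rewrite (lt_le_trans tb ba) subrr.
by rewrite subr0.
Qed.

(** The defect is at most of order [l] on two windows of length [2 * l], so Cauchy-Schwarz gains a
    factor of order [sqrt l] over the main term. *)
Lemma sweep_error (l a b : R) : 0 < l -> l < b -> b <= a -> a + l < 1 ->
 (L2dot xi (sweep l a b) - 2 * l * L2dot xi (ico b a)) ^+ 2 <=
 (2 * l) ^+ 2 * (8 * l * L2dot xi xi).
move=> l0 lb ba al; have sxi := sq2_weak.
pose I t : R := (b <= t < a)%R%:R; have sI : sq2 I by exact: sq2_ico.
have ss : sq2 (sweep l a b).
 by apply: (@sq2_bounded _ _ 1); [exact: meas_sweep|move=> t; exact: sweep_ub].
have sc c : sq2 (cball c l) by exact: sq2_bool.
have -> : L2dot xi (sweep l a b) - 2 * l * L2dot xi I = L2dot xi (fun t => sweep l a b t - 2 * l * I t).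
 by rewrite ![L2dot xi _]L2dotC L2dotBl ?L2dotZl//; exact: sq2Z.
have su : sq2 (fun t => sweep l a b t - 2 * l * I t) by apply: sq2B => //; exact: sq2Z.
apply: le_trans (L2dot_cs sxi su) _; rewrite [leRHS]mulrA [leRHS]mulrC; apply: ler_wpM2l.
 exact: L2dot_ge0.
pose w t : R := 2 * l * ((`|t - a| <= l)%R%:R + (`|t - b| <= l)%R%:R).
have sw : sq2 w by apply: sq2Z; exact: sq2D.
apply: le_trans (le_L2dot su sw _) _.
 move=> t t01; rewrite -real_normK ?num_real// lerXn2r ?nnegrE//; first by rewrite mulr_ge0 ?addr_ge0// mulr_ge0// ltW.
 by apply: sweep_bounds => //; move: l0 lb ba al => *; lra.
rewrite L2dot_sqr.
have bound (c : R) : l < c -> c + l < 1 -> cint (cball c l) = 2 * l by exact: cint_cball.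
pose w2 t : R := 8 * l ^+ 2 * ((`|t - a| <= l)%R%:R + (`|t - b| <= l)%R%:R).
have i2 : cintble (fun t : R => (`|t - a| <= l)%R%:R + (`|t - b| <= l)%R%:R).
 by apply: cintbleD; apply: sq2_intble.
apply: le_trans (_ : cint w2 <= _).
 apply: le_cint; [by case: sw|exact: cintbleZ|].
 move=> t _; rewrite /w /w2; have := sqr_ge0 l.
 by case: (`|t - a| <= l); case: (`|t - b| <= l) => /=; move=> *; nra.
rewrite /w2 cintZ// cintD; [|exact: sq2_intble|exact: sq2_intble].
rewrite !bound; [|lra|lra|lra|lra].
by apply: le_of_eq; ring.
Qed.

(** [weak_window] divided by [2 * l], as [l] tends to 0: at Lebesgue points the window averages tend
    to the values of [zeta]. *)
Lemma weak_pair (a b : R) : lebesgue_pt f a -> lebesgue_pt f b -> 0 < b -> b <= a -> a < 1 ->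
 zeta a - zeta b = L2dot xi (ico b a).
move=> fa fb b0 ba a1; set X := L2dot xi _.
have sxi := sq2_weak; have nx := L2dot_ge0 xi.
apply/eqP; rewrite -subr_eq0 -normr_le0; apply/ler_addgt0Pr => e e0; rewrite add0r.
pose d := e / 3; have d0 : 0 < d by rewrite divr_gt0.
have a01 : 0 < a < 1 by apply/andP; split; lra.
have b01 : 0 < b < 1 by apply/andP; split; lra.
have q0 : 0 < d ^+ 2 / (8 * (L2dot xi xi + 1)).
 by rewrite divr_gt0 ?exprn_gt0// mulr_gt0// ltr_wpDl.
near (0 : R)^'+ => l.
have l0 : 0 < l by near: l; exact: nbhs_right_gt.
have lb : l < b by near: l; exact: nbhs_right_lt.
have al : a + l < 1.
 suff : l < 1 - a by lra.
 by near: l; apply: nbhs_right_lt; lra.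
have lq : l < d ^+ 2 / (8 * (L2dot xi xi + 1)) by near: l; exact: nbhs_right_lt.
have Ha : `|L2dot zeta (oball a l) - 2 * l * zeta a| <= 2 * l * d.
 by near: l; exact: lebesgue_pt_ball.
have Hb : `|L2dot zeta (oball b l) - 2 * l * zeta b| <= 2 * l * d.
 by near: l; exact: lebesgue_pt_ball.
have S1 := weak_window l0 lb ba al; have S2 := sweep_error l0 lb ba al.
rewrite -/X in S2.
have ln : 8 * l * L2dot xi xi <= d ^+ 2.
 move: lq; rewrite ltr_pdivlMr ?mulr_gt0// ?ltr_wpDl// => lq.
 apply: le_trans (ltW lq); rewrite (_ : l * (8 * _) = 8 * l * L2dot xi xi + 8 * l); last by ring.
 by rewrite lerDl mulr_ge0// ltW.
have {}S2 : `|L2dot xi (sweep l a b) - 2 * l * X| <= 2 * l * d.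
 have ld : 0 <= 2 * l * d by rewrite !mulr_ge0// ltW.
 rewrite -(ger0_norm ld) -ler_sqr ?nnegrE// !real_normK ?num_real//.
 by apply: (le_trans S2); rewrite [leRHS]exprMn ler_wpM2l// sqr_ge0.
move: S1; rewrite L2dotC L2dotBl; [|exact: sq2_bool|exact: sq2_bool|by []].
rewrite ![L2dot _ zeta]L2dotC => S1.
have l2 : 0 < 2 * l by rewrite mulr_gt0.
rewrite -(ler_pM2l l2) -{1}(gtr0_norm l2) -normrM.
have -> : 2 * l * (zeta a - zeta b - X) = (L2dot xi (sweep l a b) - 2 * l * X)
 - (L2dot zeta (oball a l) - 2 * l * zeta a)
 + (L2dot zeta (oball b l) - 2 * l * zeta b) by rewrite -S1; ring.
apply: le_trans (ler_normD _ _) _; apply: le_trans (lerD (ler_normB _ _) Hb) _.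
apply: le_trans (lerD (lerD S2 Ha) (lexx _)) _.
by rewrite /d le_eqVlt; apply/orP; left; apply/eqP; field.
Unshelve. all: by end_near. Qed.

(** Almost every point is a Lebesgue point; one of them, [t0], fixes the constant, and [weak_pair]
    compares the others with it. *)
Theorem weak_derivative_ae : exists c, {ae cm, forall t, zeta t = c + L2dot xi (ilt t)}.
have sxi := sq2_weak.
have [N [mN N0 sN]] := lebesgue_differentiation locally_integrable_restriction.
have ge0 : exists2 t0, 0 < t0 < 1 & ~ N t0.
 apply/not_exists2P => H.
 have : (mu `]0%R, 1%R[ <= mu N)%E.
  by apply: le_measure; rewrite ?inE// => t /=; rewrite in_itv/= => t01; have [//|/contrapT] := H t.
 by rewrite N0 lebesgue_measure_itv/= lte_fin ltr01 sube0 lee_fin ler10.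
have [t0 t001 Nt0] := ge0.
have lp t : ~ N t -> lebesgue_pt f t by move=> Nt; apply: contrapT => h; exact/Nt/sN.
exists (zeta t0 - L2dot xi (ilt t0)).
exists (N `|` [set 0] `|` ~` dom01); split.
- apply: measurableU; first exact: measurableU.
 by apply: measurableC; exact: meas_dom01.
- have h (B : set T) : measurable B -> mu B = 0%E -> cm B = 0%E.
  move=> mB B0; apply/eqP; rewrite eq_le measure_ge0 andbT -[leRHS]B0.
  by rewrite /circle_measure /= /mrestr; apply: le_measure; rewrite ?inE//; exact: measurableI.
 rewrite measureU0//; [|exact: measurableU|by apply: measurableC; exact: meas_dom01|exact: cm_out].
 by rewrite measureU0//; apply: h => //; rewrite lebesgue_measure_set1.
move=> t /= H; apply: contrapT => /not_orP[/not_orP[Nt t0'] /contrapT].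
rewrite /dom01/= in_itv/= => /andP[tge tlt]; apply: H.
have t01 : 0 < t < 1 by rewrite tlt andbT lt_neqAle tge andbT; apply/eqP => e; apply: t0'.
move/andP: t001 => [t00 t01']; move/andP: t01 => [tg _].
have [tt|/ltW tt] := leP t0 t.
 have := weak_pair (lp _ Nt) (lp _ Nt0) t00 tt tlt.
 by rewrite -L2dot_ico//; move: (L2dot _ _) (L2dot _ _) => *; lra.
have := weak_pair (lp _ Nt0) (lp _ Nt) tg tt t01'.
by rewrite -L2dot_ico//; move: (L2dot _ _) (L2dot _ _) => *; lra.
Qed.
End weak_derivative.

(** * Spline approximation of the macroscopic gradient *)

Section approximation.
Context {R : realType} (V : perturbation R) (L M' : nat).
Notation M := M'.+1.
Notation sg := (@sigma L M').
Notation T := (measurableTypeR R).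
Notation cm := (circle_measure R).
Notation psi := (pot V).
Notation kap := (3 + 4 * bnd V ^+ 2).

Let lam (m : R) : R := derive1 (cramer psi) m.

Let kap0 : 0 < kap. by rewrite ltr_wpDr// mulr_ge0// sqr_ge0. Qed.

Lemma mean_derive1_cramer (m : R) : mean V (derive1 (cramer psi) m) = m.
by have [s <-] := mean_surj V m; rewrite derive1_cramer. Qed.

Lemma derive1_cramer_lip (m m' : R) : `|lam m - lam m'| <= kap * `|m - m'|.
have := mean_mono V (lam m) (lam m'); rewrite /lam !mean_derive1_cramer -/(lam _) -/(lam _).
rewrite ler_pdivrMl//; move: (lam m - lam m') (m - m') => x y h.
have [->|x0] := eqVneq x 0; first by rewrite normr0 mulr_ge0// ltW.
have xp : 0 < `|x| by rewrite normr_gt0.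
rewrite -(ler_pM2l xp); apply: (@le_trans _ _ (x ^+ 2)); first by rewrite -expr2 real_normK ?num_real.
apply: (le_trans h); rewrite [leRHS]mulrCA ler_pM2l// -normrM; exact: ler_norm.
Qed.

Lemma derive1_cramer_ub (m : R) : `|lam m| <= `|m| + (`|slope V| + bnd V).
have := mean_close V (lam m); rewrite /lam mean_derive1_cramer -/(lam _) => h.
have -> : lam m = m + slope V - (m - (lam m - slope V)) by ring.
apply: le_trans (ler_normB _ _) _; rewrite addrA lerD//; exact: ler_normD.
Qed.

Lemma continuous_derive1_cramer : continuous lam.
move=> m; have c : {for m, continuous (fun t => lam t - lam m)}.
 by apply: (@cts_at_linear _ _ kap 1 m) => [| |t _]; [exact: ltW|exact: ltr01|exact: derive1_cramer_lip].
have -> : lam = (fun t => (lam t - lam m) + lam m) by apply: funext => t; rewrite subrK.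
by apply: (cvgD c); exact: cvg_cst.
Qed.

Lemma sq2_sublinear (g f : R -> R) (c : R) : continuous g -> 0 <= c ->
 (forall m, `|g m| <= `|m| + c) -> sq2 f -> sq2 (fun t => g (f t)).
move=> cg c0 gc sf; apply: (@sq2_le _ _ (fun t => `|f t| + c)).
- by apply: (measT_comp (f := g)); [exact: cts_measT|exact: sq2_meas].
- by move=> t; rewrite [leRHS]ger0_norm ?addr_ge0.
apply: sq2D; last by apply: (@sq2_bounded _ _ c) => // t; rewrite ger0_norm.
by apply: (sq2_le _ _ sf) => [|t]; [exact: cintble_meas (integrable_norm (sq2_intble sf))|rewrite normr_id].
Qed.

Lemma sq2_macro_gradient (f : R -> R) : sq2 f -> sq2 (macro_gradient psi f).
exact: sq2_sublinear continuous_derive1_cramer (addr_ge0 (normr_ge0 _) (bnd_ge0 V)) derive1_cramer_ub.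
Qed.

Variables (zeta xi : R -> R).
Hypotheses (sq_zeta : sq2 zeta) (weak_xi : weak_derivative zeta xi).
Let sq_xi : sq2 xi := sq2_weak weak_xi.

(** Primitive of the weak derivative, which is [zeta] up to a constant almost everywhere; [cellw m]
    is the share of the energy of [xi] in cell [m]. *)
Let F (t : R) : R := L2dot xi (ilt t).
Let cellw (m : nat) : R := cint (fun s => xi s ^+ 2 * cellI M m s).

Let MR : 0 < M%:R :> R. by rewrite ltr0n. Qed.

Let cell_sqr m t : cellI M m t ^+ 2 = cellI M m t :> R.
by rewrite /cellI indicE; case: (_ \in _); rewrite ?expr1n ?expr0n. Qed.

Let cell_abs m t : `|cellI M m t : R| <= 1.
by rewrite /cellI indicE; case: (_ \in _); rewrite ?normr1 ?normr0. Qed.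

Let sq_cell m : sq2 (fun s => xi s * cellI M m s).
apply: sq2_le sq_xi; last by move=> t; rewrite normrM ler_piMr.
by apply: measTM; [exact: sq2_meas|exact: meas_cellI].
Qed.

Let cellwE m : cellw m = L2dot (fun s => xi s * cellI M m s) (fun s => xi s * cellI M m s).
by rewrite L2dot_sqr; congr cint; apply: funext => s; rewrite exprMn cell_sqr. Qed.

Let cellw_ge0 m : 0 <= cellw m. by rewrite cellwE L2dot_ge0. Qed.

Lemma sum_cellw : \sum_(m < M) cellw m = L2dot xi xi.
rewrite L2dot_sqr -cint_sum; last first.
 move=> m; have [_] := sq_cell m; rewrite (_ : (fun _ => _ ^+ 2) = (fun s => xi s ^+ 2 * cellI M m s))//.
 by apply: funext => s; rewrite exprMn cell_sqr.
congr cint; apply: funext => s; have [m h] := in_cell_exists (ltn0Sn M') (frac01 s).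
rewrite (bigD1 m)//= cellI1// mulr1 big1 ?addr0// => i im.
rewrite cellI0 ?mulr0// => h'; move/eqP: im; apply; apply/val_inj.
exact: in_cell_uniq h' h.
Qed.

Let sq_ico := @sq2_ico R.
Let sq_lt := @sq2_lt R.

Let FB (u t : R) : u <= t -> F t - F u = L2dot xi (ico u t).
exact: (L2dot_ico weak_xi). Qed.

(** The weak derivative has mean zero, so its primitive closes up across the period. *)
Let F01 : F 0 = F 1.
apply/eqP; rewrite eq_sym -subr_eq0 FB ?ler01// -[X in _ == X](weak_mean0 weak_xi); apply/eqP.
rewrite !L2dotE; apply: eq_cint_ae.
- by apply: measTM; apply: sq2_meas.
- by apply: measTM; [exact: sq2_meas|exact: measurable_cst].
by apply: cm_ae => s ->.
Qed.

(** Cauchy-Schwarz on an interval of length at most [1 / M], with only the energy inside the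
    cell. *)
Lemma primitive_cell (m : nat) (u t : R) : (m < M)%N -> m%:R / M%:R <= u -> u <= t -> t <= m.+1%:R / M%:R ->
 (F t - F u) ^+ 2 <= cellw m / M%:R.
move=> mM mu' ut tm.
have u0 : 0 <= u by apply: le_trans mu'; rewrite divr_ge0// ltW.
have t1 : t <= 1 by apply: (le_trans tm); rewrite ler_pdivrMr// mul1r ler_nat.
rewrite FB//.
have -> : L2dot xi (ico u t) = L2dot (fun s => xi s * cellI M m s) (ico u t).
 rewrite !L2dotE; apply: eq_cint_ae.
 - by apply: measTM; apply: sq2_meas.
 - by apply: measTM; apply: sq2_meas.
 apply: cm_ae => s s01; case: (boolP (u <= s < t)) => [/andP[us st]|_]; last by rewrite !mulr0.
 by rewrite cellI1 ?mulr1// frac_id// /in_cell (le_trans mu' us) (lt_le_trans st tm).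
apply: le_trans (L2dot_cs (sq_cell m) (sq_ico u t)) _; rewrite -cellwE; apply: ler_wpM2l => //.
have -> : L2dot (ico u t) (ico u t) = cint (ico u t).
 by rewrite L2dot_sqr; congr cint; apply: funext => s; case: (_ <= _ < _); rewrite ?expr1n ?expr0n.
have mI : [set s : T | u <= s < t] = `[u, t[%classic by apply/seteqP; split => s /=; rewrite in_itv.
rewrite cint_bool.
- rewrite mI lebesgue_measure_itv/=; case: ifP => _ /=; last by rewrite invr_ge0 ltW.
 move: tm mu'; rewrite -natr1 mulrDl mul1r; move: (m%:R / M%:R : R) (M%:R^-1 : R) => *; lra.
- by rewrite mI; exact: measurable_itv.
by move=> s /andP[us st]; rewrite (le_trans u0 us) (lt_le_trans st t1).
Qed.

Let Y (m : 'I_M) : R := F (m%:R / M%:R).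

Let prv_inj : injective (@prv M').
by move=> m m' /addIr. Qed.

Lemma primitive_prv (m : 'I_M) : (Y m - Y (prv m)) ^+ 2 <= cellw (prv m) / M%:R.
have -> : Y m = F ((prv m).+1%:R / M%:R).
 rewrite /Y; have := prv_val m; case: m => -[|i] iM /= ->; last by [].
 by rewrite mul0r divff ?gt_eqF.
apply: primitive_cell => //; rewrite ler_pM2r ?invr_gt0// ler_nat//.
Qed.

(** Back knot by knot: the factor comes from [(u + v) ^ 2 <= 2 u ^ 2 + 2 v ^ 2] and
    [2 + 2 * 4 ^ i <= 4 ^ (i + 1)]. *)
Lemma sum_primitive_sigma (i : 'I_L.+1) :
 \sum_m (Y m - Y (sg m i)) ^+ 2 <= 4 ^+ i * (L2dot xi xi / M%:R).
case: i => i; elim: i => [|i IH] iL.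
 rewrite big1; first by rewrite mulr_ge0// divr_ge0 ?L2dot_ge0// ltW.
 by move=> m _; rewrite (_ : Ordinal iL = ord0) ?sigma0 ?subrr ?expr0n//; exact: val_inj.
have iL' := ltnW iL.
apply: (@le_trans _ _ (\sum_m (2 * (Y m - Y (prv m)) ^+ 2 + 2 * (Y (prv m) - Y (sg (prv m) (Ordinal iL'))) ^+ 2))).
 apply: ler_sum => m _; rewrite (sigmaS _ iL'); apply: le_trans (sqr_add_le _ _).
 by rewrite addrA subrK.
rewrite big_split/= -!mulr_sumr.
have h1 : \sum_m (Y m - Y (prv m)) ^+ 2 <= L2dot xi xi / M%:R.
 apply: le_trans (ler_sum _ (fun m _ => primitive_prv m)) _.
 rewrite -mulr_suml -sum_cellw [X in _ <= X / _](reindex_inj prv_inj)/=.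
 by [].
have h2 := IH iL'.
rewrite (reindex_inj prv_inj)/= in h2.
have X0 : 0 <= L2dot xi xi / M%:R by rewrite divr_ge0 ?L2dot_ge0// ltW.
rewrite exprS -mulrA; have e1 : 1 <= 4 ^+ i :> R by rewrite exprn_ege1// ler1n.
move: h1 h2 X0 e1; move: (\sum_m _) (\sum_m _) (L2dot xi xi / _) (4 ^+ i) => a b x e h1 h2 X0 e1.
have : x <= e * x by rewrite ler_peMl.
by move: h1 h2; move: (e * x) => ex h1 h2 h3; lra.
Qed.

Lemma le_cint_ae (f g : R -> R) : cintble f -> cintble g ->
 {ae cm, forall t, f t <= g t} -> cint f <= cint g.
move=> cf cg [N [mN N0 sN]].
have mI : measT (\1_(~` N) : T -> R) by apply: measurable_indic; exact: measurableC.
have I1 t : `|\1_(~` N) t : R| <= 1 by rewrite indicE; exact: norm_bool_le1.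
have cI h : cintble h -> cintble (fun t => h t * \1_(~` N) t).
 move=> ch; apply: le_cintble (integrable_norm ch); last by move=> t; rewrite normrM ler_piMr.
 by apply: measTM => //; exact: cintble_meas.
have eI h : cintble h -> cint h = cint (fun t => h t * \1_(~` N) t).
 move=> ch; apply: eq_cint_ae; [exact: cintble_meas|exact: (cintble_meas (cI _ ch))|].
 exists N; split=> // t /= Ht; apply: contrapT => Nt; apply: Ht; rewrite indicE mem_set ?mulr1//.
rewrite (eI f)// (eI g)//; apply: le_cint; [exact: cI|exact: cI|].
move=> t _; rewrite indicE; case: (boolP (t \in ~` N)) => [|_]; last by rewrite !mulr0.
by rewrite inE => Nt; rewrite !mulr1; apply: contrapT => h; exact/Nt/sN.
Qed.

Lemma psp_const (a : R) : psp (const_mx a : 'rV[R]_L.+1) = a%:P.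
rewrite /psp; under eq_bigr do rewrite mxE.
by rewrite -scaler_sumr sum_Bp alg_polyC.
Qed.

Let locoefE (z : 'rV[R]_M) m (i : 'I_L.+1) : locoef L z m 0 i = z 0 (sg m i).
exact: mul_Sm. Qed.

Section control.
Variables (C c : R).
Hypothesis C0 : 0 <= C.
Hypothesis psp_bound : forall (s : 'rV[R]_L.+1) t, 0 <= t <= 1 -> (psp s).[t] ^+ 2 <= C * sqn s.
Hypothesis zetaE : {ae cm, forall t, zeta t = c + F t}.

(** Quasi-interpolant: the B-spline coefficients are the values of the macroscopic gradient at the
    knots, read off the continuous representative [c + F]. *)
Definition knots : 'rV[R]_M := \row_m lam (c + Y m).
Let D : R := C * kap ^+ 2 * (2 * \sum_(i < L.+1) 4 ^+ i + 2 * L.+1%:R).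
Let p := macro_gradient psi zeta.

(** The pieces sum to 1, so on a cell the error is a spline piece whose coefficients are differences
    of the derivative of [cramer] between a knot and the point. Its Lipschitz bound and the energies
    of the nearby cells control them. *)
Theorem spline_approximation :
 L2dot (fun t => spl L knots t - p t) (fun t => spl L knots t - p t) <= D / M%:R ^+ 2 * L2dot xi xi.
pose b : 'rV[R]_M := \row_m (C * (kap ^+ 2 *
 (2 * (\sum_i (Y m - Y (sg m i)) ^+ 2) + 2 * L.+1%:R * (cellw m / M%:R)))).
have sp : sq2 p by exact: sq2_macro_gradient.
have ss := sq2_spl L knots.
have sd : sq2 (fun t => spl L knots t - p t) by exact: sq2B.
rewrite L2dot_sqr; apply: le_trans (_ : cint (step b) <= _).
 apply: le_cint_ae; [by case: sd|exact/sq2_intble/sq2_step|].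
 have t01ae : {ae cm, forall t : R, 0 <= t < 1} by apply: cm_ae.
 apply: cm_ae_imp (cm_ae_and t01ae zetaE) => t [t01 zE].
 have [m h] := in_cell_exists (ltn0Sn M') (frac01 t).
 rewrite (stepE _ h) mxE (@splE _ _ _ _ _ m h) /p /macro_gradient /= zE -/(lam _).
 move: h; rewrite (frac_id t01) => h.
 set tau := M%:R * t - m%:R; have tau01 : 0 <= tau <= 1.
  move: h; rewrite /in_cell ler_pdivrMr// ltr_pdivlMr// -[m.+1%:R]natr1 /tau mulrC => /andP[h1 h2].
  by apply/andP; split; lra.
 pose e := locoef L knots m + const_mx (- lam (c + F t)).
 have -> : (psp (locoef L knots m)).[tau] - lam (c + F t) = (psp e).[tau].
  by rewrite /e pspD psp_const hornerD hornerC.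
 apply: le_trans (psp_bound _ tau01) _; apply: ler_wpM2l => //.
 rewrite sqnE; have Ft : (Y m - F t) ^+ 2 <= cellw m / M%:R.
  rewrite -sqrrN opprB; move/andP: h => [h1 /ltW h2].
  exact: primitive_cell.
 apply: (@le_trans _ _ (\sum_(i < L.+1) kap ^+ 2 * (2 * (Y m - Y (sg m i)) ^+ 2 + 2 * (cellw m / M%:R)))).
  apply: ler_sum => i _; rewrite /e [_ 0 i]mxE locoefE !mxE.
  have l1 := derive1_cramer_lip (c + Y (sg m i)) (c + F t).
  have -> : (lam (c + Y (sg m i)) - lam (c + F t)) ^+ 2 = `|lam (c + Y (sg m i)) - lam (c + F t)| ^+ 2.
   by rewrite real_normK ?num_real.
  apply: (@le_trans _ _ ((kap * `|c + Y (sg m i) - (c + F t)|) ^+ 2)).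
   by rewrite lerXn2r ?nnegrE// mulr_ge0// ltW.
  rewrite exprMn real_normK ?num_real//; apply: ler_wpM2l; first exact: sqr_ge0.
  have -> : c + Y (sg m i) - (c + F t) = - (Y m - Y (sg m i)) + (Y m - F t) by ring.
  by apply: le_trans (sqr_add_le _ _) _; rewrite sqrrN lerD2l ler_wpM2l.
 rewrite -mulr_sumr; apply: ler_wpM2l; first exact: sqr_ge0.
 rewrite big_split/= -mulr_sumr sumr_const card_ord lerD2l -mulr_natr.
 by apply: le_of_eq; ring.
rewrite cint_step; under eq_bigr do rewrite mxE.
rewrite -mulr_suml -!mulr_sumr big_split/= -!mulr_sumr exchange_big/= -mulr_suml sum_cellw.
have h : \sum_(i < L.+1) \sum_m (Y m - Y (sg m i)) ^+ 2 <= \sum_(i < L.+1) 4 ^+ i * (L2dot xi xi / M%:R).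
 by apply: ler_sum => i _; exact: sum_primitive_sigma.
rewrite -mulr_suml in h.
apply: (@le_trans _ _ (C * (kap ^+ 2 * (2 * ((\sum_(i < L.+1) 4 ^+ i) * (L2dot xi xi / M%:R)) +
 2 * L.+1%:R * (L2dot xi xi / M%:R))) / M%:R)).
 rewrite ler_pM2r ?invr_gt0//; apply: ler_wpM2l => //; apply: ler_wpM2l; first exact: sqr_ge0.
 by rewrite lerD2r ler_wpM2l.
apply: le_of_eq; rewrite /D.
have := gt_eqF MR; move: (L2dot xi xi) (\sum_(i < L.+1) _) (M%:R : R) => x y n n0.
by field; rewrite n0.
Qed.
End control.
End approximation.

(** * Energy estimate and conclusion *)

Section energy.
Context {R : realType} (V : perturbation R).
Notation B := (bnd V).
Implicit Types f g : R -> R.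

Definition nrm f : R := Num.sqrt (L2dot f f).

Lemma nrm_ge0 f : 0 <= nrm f. exact: sqrtr_ge0. Qed.

Lemma nrm_sqr f : nrm f ^+ 2 = L2dot f f. by rewrite sqr_sqrtr// L2dot_ge0. Qed.

Lemma nrm_cs f g : sq2 f -> sq2 g -> `|L2dot f g| <= nrm f * nrm g.
move=> sf sg; rewrite -ler_sqr ?nnegrE ?mulr_ge0 ?nrm_ge0// real_normK ?num_real//.
by rewrite exprMn !nrm_sqr; exact: L2dot_cs.
Qed.

Lemma nrm_triangle f g h : sq2 f -> sq2 g -> sq2 h ->
 nrm (dif f h) <= nrm (dif f g) + nrm (dif g h).
move=> sf sg sh; set u := fun t => f t - g t; set v := fun t => g t - h t.
have su : sq2 u by exact: sq2B. have sv : sq2 v by exact: sq2B.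
have -> : (dif f h) = fun t => 1 * u t + 1 * v t.
 by apply: funext => t; rewrite !mul1r /u /v addrA subrK.
rewrite -ler_sqr ?nnegrE ?addr_ge0 ?nrm_ge0// nrm_sqr L2dot_expand// sqrrD !nrm_sqr.
have := ler_norm (L2dot u v); have := nrm_cs su sv.
by move: (L2dot u v) (L2dot u u) (L2dot v v) (nrm u * nrm v) => *; lra.
Qed.

Lemma nrm_le f g (c : R) : sq2 f -> sq2 g -> 0 <= c -> (forall t, `|f t| <= c * `|g t|) -> nrm f <= c * nrm g.
move=> sf sg c0 fg; rewrite -ler_sqr ?nnegrE ?mulr_ge0 ?nrm_ge0// exprMn !nrm_sqr.
rewrite (_ : c ^+ 2 * _ = L2dot (fun t => c * g t) (fun t => c * g t)); last first.
 rewrite [RHS]L2dotZl//; last exact: sq2Z.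
 by rewrite [X in _ = _ * X]L2dotC L2dotZl// mulrA expr2.
apply: le_L2dot => //; first exact: sq2Z.
move=> t _; rewrite -[_ ^+ 2]real_normK ?num_real// -[leRHS]real_normK ?num_real//.
by rewrite lerXn2r ?nnegrE// normrM (ger0_norm c0).
Qed.

Lemma sq2_mean f : sq2 f -> sq2 (fun t => mean V (f t)).
apply: (sq2_sublinear (@cts_mean _ V) (addr_ge0 (normr_ge0 (slope V)) (bnd_ge0 V))) => m.
rewrite -[mean V m](subrK (m - slope V)) addrC; apply: le_trans (ler_normD _ _) _.
by rewrite addrA; apply: lerD (ler_normB _ _) (mean_close V m).
Qed.

Variables (G S s p zeta : R -> R) (e1 e2 : R).
Hypotheses (sG : sq2 G) (sS : sq2 S) (ss : sq2 s) (sp : sq2 p) (sz : sq2 zeta).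
Hypothesis mean_p : forall t, mean V (p t) = zeta t.
Hypothesis G_close : nrm (dif S G) <= e1 * nrm G.
Hypothesis G_bias : `|L2dot (fun t => zeta t - mean V (S t)) (dif G s)| <= e2 * nrm (dif G s).

Notation x := (nrm (dif G p)).
Notation q := (nrm (dif s p)).
Notation lipm := (2 + 4 * B ^+ 2).

(** Strong monotonicity of [mean] bounds [G - p] by its pairing with [mean G - zeta], which is split
    through the comparison spline [s]. On [G - s], itself a spline in the application, the bias
    bound applies once [G] is replaced by its step averages [S]; [s - p] is treated by
    Cauchy-Schwarz. *)
Lemma energy_estimate : (3 + 4 * B ^+ 2)^-1 * x ^+ 2 <=
 lipm * q * x + nrm (dif G s) * (lipm * e1 * nrm G + e2).
have B2 : 0 <= B ^+ 2 by exact: sqr_ge0.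
have L0 : 0 <= lipm by rewrite addr_ge0// mulr_ge0.
have sGp : sq2 (dif G p) by exact: sq2B.
have sGs : sq2 (dif G s) by exact: sq2B.
have ssp : sq2 (dif s p) by exact: sq2B.
have smG := sq2_mean sG; have smS := sq2_mean sS.
have smGz : sq2 (fun t => mean V (G t) - zeta t) by exact: sq2B.
have smGS : sq2 (fun t => mean V (G t) - mean V (S t)) by exact: sq2B.
have szS : sq2 (fun t => zeta t - mean V (S t)) by exact: sq2B.
apply: (@le_trans _ _ (L2dot (dif G p) (fun t => mean V (G t) - zeta t))).
 rewrite nrm_sqr L2dot_sqr L2dotE -cintZ; last by case: sGp.
 apply: le_cint; [by apply: cintbleZ; case: sGp|exact: sq2_mul|].
 by move=> t _; rewrite -mean_p; exact: mean_mono.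
have -> : L2dot (dif G p) (fun t => mean V (G t) - zeta t) =
  L2dot (dif s p) (fun t => mean V (G t) - zeta t) +
  (L2dot (fun t => mean V (G t) - mean V (S t)) (dif G s) -
  L2dot (fun t => zeta t - mean V (S t)) (dif G s)).
 rewrite -L2dotBl// [X in _ + X]L2dotC.
 rewrite (_ : (fun t => mean V (G t) - mean V (S t) - _) = fun t => mean V (G t) - zeta t); last first.
  by apply: funext => t; rewrite opprB addrA subrK.
 rewrite -L2dotDl//; congr L2dot; apply: funext => t; ring.
apply: lerD.
 apply: le_trans (ler_norm _) _; apply: le_trans (nrm_cs ssp smGz) _.
 rewrite mulrAC [leRHS]mulrC; apply: ler_wpM2l; first exact: nrm_ge0.
 apply: nrm_le => // t; rewrite -mean_p; exact: mean_lip.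
apply: le_trans (ler_norm _) _; apply: le_trans (ler_normB _ _) _.
rewrite mulrDr; apply: lerD; last by rewrite mulrC.
apply: le_trans (nrm_cs smGS sGs) _; rewrite mulrC; apply: ler_wpM2l; first exact: nrm_ge0.
rewrite -mulrA; apply: (@le_trans _ _ (lipm * nrm (dif S G))); last exact: ler_wpM2l.
apply: nrm_le => //; first exact: sq2B.
by move=> t; rewrite [X in _ <= _ * X]distrC; exact: mean_lip.
Qed.
End energy.

(** The occurrence of [x] on the right through [g] is absorbed by the smallness of [l * e1], which
    is of order [1 / K]; what remains is a quadratic inequality in [x] to be solved. *)
Lemma quadratic_bound (R : realFieldType) (k l x q v g np e1 e2 : R) :
 0 < k -> k <= 1 -> 1 <= l -> 0 <= x -> 0 <= q -> 0 <= v -> 0 <= g -> 0 <= np -> 0 <= e1 -> 0 <= e2 ->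
 v <= x + q -> g <= x + np -> l * e1 <= k / 4 ->
 k * x ^+ 2 <= l * q * x + v * (l * e1 * g + e2) ->
 x <= 4 / k * (2 * l * q + (l * e1 * np + e2)).
move=> k0 k1 l1 x0 q0 v0 g0 np0 e10 e20 vx gx le1 h.
rewrite -[2 * l * q]mulrA; set d := l * e1 * np + e2; set b := 2 * (l * q) + d.
have c0 : 0 <= l * e1 by rewrite mulr_ge0//; lra.
have d0 : 0 <= d by rewrite /d addr_ge0// mulr_ge0.
have lq : q <= l * q by rewrite ler_peMl.
have b0 : 0 <= b by rewrite /b; move: (l * q) lq => *; lra.
have h1 : l * e1 * g + e2 <= k / 4 * x + d.
 have : l * e1 * g <= l * e1 * (x + np) by exact: ler_wpM2l.
 have : l * e1 * x <= k / 4 * x by exact: ler_wpM2r.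
 by rewrite /d mulrDr; move: (l * e1 * g) (l * e1 * x) (l * e1 * np) => *; lra.
have kx0 : 0 <= k / 4 * x by rewrite mulr_ge0// divr_ge0// ltW.
have h2 : v * (l * e1 * g + e2) <= (x + q) * (k / 4 * x + d).
 by apply: ler_pM => //; rewrite addr_ge0// mulr_ge0.
have kq : k / 4 * q <= l * q by apply: ler_wpM2r => //; lra.
have h3 : 3 / 4 * (k * x ^+ 2) <= x * b + b ^+ 2.
 have : x * (l * q + k / 4 * q + d) <= x * b.
  by apply: ler_wpM2l => //; rewrite /b; move: (l * q) (k / 4 * q) kq => *; lra.
 have : q * d <= b ^+ 2.
  by rewrite expr2; apply: ler_pM => //; rewrite /b; move: (l * q) lq => *; lra.
 have -> : x * (l * q + k / 4 * q + d) = l * q * x + (x + q) * (k / 4 * x + d) - q * d - k * x ^+ 2 / 4 by field.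
 by move: (x * b) (b ^+ 2) (q * d) (k * x ^+ 2) (l * q * x) (_ * (k / 4 * x + d)) (v * _) h h2 => *; lra.
rewrite mulrAC -[_ / k]/(_ * _) ler_pdivlMr// leNgt; apply/negP => h4.
have [b00|bn] := eqVneq b 0.
 move: h4; rewrite b00 mulr0 => h4; move: h3; rewrite b00 mulr0 expr0n addr0.
 have xp : 0 < x by move: h4; rewrite pmulr_lgt0.
 by have := mulr_gt0 h4 xp; rewrite (_ : x * k * x = k * x ^+ 2); [lra|ring].
have bp : 0 < b by rewrite lt_def bn.
have xk : b < x * k by lra.
have xb : 4 * b < x by apply: lt_le_trans h4 _; rewrite ler_piMr.
have xp : 0 < x by lra.
have u1 : 4 * (x * b) < k * x ^+ 2.
 by rewrite (_ : k * x ^+ 2 = x * (x * k)); [rewrite mulrCA ltr_pM2l|ring].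
have u2 : 4 * b ^+ 2 <= x * b by rewrite expr2 mulrA ler_pM2r// ltW.
have u3 : 0 < x * b by exact: mulr_gt0.
by move: (x * b) (b ^+ 2) (k * x ^+ 2) h3 u1 u2 u3 => *; lra.
Qed.

Lemma nrm_macro_gradient (R : realType) (V : perturbation R) (zeta : R -> R) : sq2 zeta ->
 nrm (macro_gradient (pot V) zeta) <= 2 * (nrm zeta + (`|slope V| + bnd V)).
move=> sz; set p := macro_gradient _ _; set c := _ + bnd V.
have c0 : 0 <= c by rewrite addr_ge0.
have n0 := nrm_ge0 zeta; have sp : sq2 p by exact: sq2_macro_gradient.
rewrite -ler_sqr ?nnegrE ?nrm_ge0 ?mulr_ge0 ?addr_ge0// nrm_sqr L2dot_sqr.
have i2 : cintble (fun t => 2 * zeta t ^+ 2) by apply: cintbleZ; case: sz.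
have ic : cintble (fun _ : R => 2 * c ^+ 2).
 by apply: (@cintble_bounded _ _ `|2 * c ^+ 2|) => //; exact: measurable_cst.
apply: le_trans (_ : cint (fun t => 2 * zeta t ^+ 2 + 2 * c ^+ 2) <= _).
 apply: le_cint; [by case: sp|exact: cintbleD|].
 move=> t _; have h : `|p t| <= `|zeta t| + c by exact: derive1_cramer_ub.
 rewrite -[_ ^+ 2]real_normK ?num_real//.
 apply: (@le_trans _ _ ((`|zeta t| + c) ^+ 2)); first by rewrite lerXn2r ?nnegrE ?addr_ge0.
 by apply: le_trans (sqr_add_le _ _) _; rewrite real_normK ?num_real.
rewrite cintD// cintZ; last by case: sz.
rewrite cint_cst -L2dot_sqr -nrm_sqr; move: (nrm zeta) n0 => n n0; nra.
Qed.

Theorem gradient_estimate (R : realType) (V : perturbation R) (L : nat) :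
 exists (K0 : nat) (C : R), [/\ (0 < K0)%N, 0 < C & forall K M' : nat, (K0 <= K)%N ->
  (forall y : R -> R, spline L M'.+1 y -> spline_fiber L M'.+1 (N := (K * M'.+1)%N) y !=set0) ->
  forall zeta : R -> R, sq2 zeta -> exists g, [/\
   is_gradient L M'.+1 (coarse_hamiltonian (pot V) L K M'.+1)
    (spline_proj L M'.+1 zeta) g, sq2 g & forall xi, weak_derivative zeta xi ->
   nrm (fun t => g t - macro_gradient (pot V) zeta t) <=
    C * ((K%:R^-1 + M'.+1%:R^-1) * (nrm zeta + nrm xi) + K%:R^-1)]].
have rescale (u k n : R) : 0 < k -> 4 * u / k < n -> u <= k / 4 * n.
 by move=> k0; rewrite ltr_pdivrMr// => h; lra.
have terms_le (i j n h : R) : 0 <= i -> 0 <= j -> 0 <= n -> 0 <= h ->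
  [/\ j * h <= (i + j) * (n + h) + i, i * n <= (i + j) * (n + h) + i & i <= (i + j) * (n + h) + i].
 move=> i0 j0 n0 h0; have e : (i + j) * (n + h) = i * n + i * h + (j * n + j * h) by ring.
 have := mulr_ge0 i0 n0; have := mulr_ge0 i0 h0; have := mulr_ge0 j0 n0; have := mulr_ge0 j0 h0.
 by rewrite e; move: (i * n) (i * h) (j * n) (j * h) => *; split; lra.
have [C [Ck [eta [K1 [K10 C0 HK]]]]] := frame_exists V L.
have [Cp Cp0 HCp] := @psp_ub R L.
set kap := 3 + 4 * bnd V ^+ 2; set l := 2 + 4 * bnd V ^+ 2; set c := `|slope V| + bnd V.
have B2 : 0 <= bnd V ^+ 2 by exact: sqr_ge0.
have kap1 : 1 <= kap by rewrite /kap; lra.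
have kap0 : 0 < kap by apply: lt_le_trans kap1.
have l1 : 1 <= l by rewrite /l; lra.
have c0 : 0 <= c by rewrite addr_ge0.
pose k := kap^-1; have k0 : 0 < k by rewrite invr_gt0.
have k1 : k <= 1 by rewrite invf_le1.
pose D := Cp * kap ^+ 2 * (2 * \sum_(i < L.+1) 4 ^+ i + 2 * L.+1%:R).
have D0 : 0 <= D.
 apply: mulr_ge0; first by rewrite mulr_ge0 ?sqr_ge0// ltW.
 by rewrite addr_ge0// mulr_ge0// sumr_ge0// => i _; rewrite exprn_ge0.
pose d := Num.sqrt D; have d0 : 0 <= d by exact: sqrtr_ge0.
pose cm := Num.sqrt `|Cmain V L.+1 C C C Ck|; have cm0 : 0 <= cm by exact: sqrtr_ge0.
pose a1 := 4 / k * (2 * l * d); pose a2 := 4 / k * (2 * l * C); pose a3 := 4 / k * (2 * l * C * c + cm).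
have k4 : 0 <= 4 / k by rewrite divr_ge0// ltW.
have l0 : 0 <= l by apply: le_trans l1.
have C0' := ltW C0.
have a10 : 0 <= a1 by rewrite !mulr_ge0// invr_ge0 ltW.
have a20 : 0 <= a2 by rewrite !mulr_ge0// invr_ge0 ltW.
have a30 : 0 <= a3 by rewrite mulr_ge0// addr_ge0// !mulr_ge0.
(* The second threshold yields [l * (C / K) <= k / 4] for [quadratic_bound]. The constants [a1],
   [a2] and [a3] go with the derivative over [M], the norm over [K] and the bare [1 / K]. *)
exists (maxn K1 (Num.trunc (4 * l * C / k)).+1), (a1 + a2 + a3 + 1); split.
- by rewrite leq_max (ltnW K10).
- by rewrite ltr_wpDl// !addr_ge0.
move=> K M'; rewrite geq_max => /andP[KK1 KT] surj zeta sz.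
have [fr avg_close] := HK K M' KK1.
have KR : 0 < K%:R :> R by rewrite ltr0n (leq_trans _ KT).
have MR : 0 < M'.+1%:R :> R by rewrite ltr0n.
have [sy0 my0] := spline_projP fr sz; set y0 := spline_proj _ _ _ in sy0 my0 *.
have [z0 [sqy0 y0E _]] := spline_ae sy0.
(* Surjectivity of the projection enters here: it provides a step function in the fiber over the
   projection of [zeta]. *)
have [x0 /(spline_fiberE fr x0 sqy0 y0E) mx0] := surj _ sy0.
set G := grad V L x0; set p := macro_gradient _ _.
have sG : sq2 G by exact: sq2_spl.
have gG := grad_is_gradient fr sy0 mx0.
exists G; split=> [//|//|xi wxi].
have sp : sq2 p by exact: sq2_macro_gradient.
have [cz zE] := weak_derivative_ae sz wxi.
set s := spl L (knots V M' xi cz); have ss : sq2 s by exact: sq2_spl.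
set S := step (gvec V (bavg L K) (@sigma L M') x0); have sS : sq2 S by exact: sq2_step.
have n0 := nrm_ge0 zeta; have h0 := nrm_ge0 xi.
have q1 : nrm (dif s p) <= d / M'.+1%:R * nrm xi.
 have dM : 0 <= d / M'.+1%:R * nrm xi by rewrite !mulr_ge0// invr_ge0 ltW.
 rewrite -ler_sqr ?nnegrE ?nrm_ge0// 2!exprMn !nrm_sqr exprVn sqr_sqrtr//.
 have HB (v : 'rV[R]_L.+1) (t : R) : 0 <= t <= 1 -> (psp v).[t] ^+ 2 <= Cp * sqn v by move=> /(HCp v)[].
 exact: (@spline_approximation R V L M' zeta xi sz wxi Cp cz (ltW Cp0) HB zE).
have G_close : nrm (dif S G) <= C / K%:R * nrm G.
 have CK : 0 <= C / K%:R * nrm G by rewrite !mulr_ge0 ?nrm_ge0// invr_ge0 ltW.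
 rewrite -ler_sqr ?nnegrE ?nrm_ge0// 2!exprMn !nrm_sqr exprVn.
 exact: grad_average fr avg_close x0.
have G_bias : `|L2dot (fun t => zeta t - mean V (S t)) (dif G s)| <=
  cm / K%:R * nrm (dif G s).
 have CK : 0 <= cm / K%:R * nrm (dif G s) by rewrite !mulr_ge0 ?nrm_ge0// invr_ge0 ltW.
 rewrite -ler_sqr ?nnegrE// real_normK ?num_real// 2!exprMn nrm_sqr exprVn sqr_sqrtr//.
 have -> : (dif G s) = spl L (gcoef V L x0 - knots V M' xi cz).
  by apply: funext => t; rewrite splB.
 apply: le_trans (grad_bias fr mx0 _ sz (esym my0)) _.
 by rewrite ler_wpM2r ?L2dot_ge0// ler_wpM2r ?invr_ge0 ?sqr_ge0// ler_norm.
have est := energy_estimate sG sS ss sp sz (fun t => mean_derive1_cramer V (zeta t)) G_close G_bias.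
have np := nrm_macro_gradient V sz; rewrite -/p -/c in np.
have vx : nrm (dif G s) <= nrm (dif G p) + nrm (dif s p).
 apply: le_trans (nrm_triangle sG sp ss) _; rewrite lerD2l.
 by apply: le_trans (nrm_le (c := 1) _ _ _ _) _; [| | | |rewrite mul1r]; rewrite ?ler01//;
  [exact: sq2B|exact: sq2B|move=> t; rewrite mul1r distrC].
have gx : nrm G <= nrm (dif G p) + nrm p.
 have s0 : sq2 (cst 0 : R -> R) by apply: (@sq2_bounded _ _ 0) => // t; rewrite normr0.
 have := nrm_triangle sG sp s0.
 rewrite (_ : (fun t => G t - _) = G); last by apply: funext => t; rewrite subr0.
 by rewrite (_ : (fun t => p t - _) = p)//; apply: funext => t; rewrite subr0.
have lk : l * (C / K%:R) <= k / 4.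
 rewrite mulrA ler_pdivrMr//.
 have : 4 * l * C / k < K%:R.
  apply: lt_le_trans (_ : (Num.trunc (4 * l * C / k)).+1%:R <= _); last by rewrite ler_nat.
  by have /andP[] := trunc_itv (ltac:(by rewrite !mulr_ge0// invr_ge0 ltW) : 0 <= 4 * l * C / k).
 by rewrite -[4 * l * C]mulrA; exact: rescale.
have CK0 : 0 <= C / K%:R by rewrite divr_ge0// ltW.
have cmK0 : 0 <= cm / K%:R by rewrite divr_ge0// ltW.
have x1 := quadratic_bound k0 k1 l1 (nrm_ge0 _) (nrm_ge0 _) (nrm_ge0 _) (nrm_ge0 _) (nrm_ge0 p) CK0 cmK0 vx gx lk est.
apply: (le_trans x1).
set W := (_ + _) * _ + _.
have iK : 0 <= K%:R^-1 :> R by rewrite invr_ge0 ltW.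
have iM : 0 <= M'.+1%:R^-1 :> R by rewrite invr_ge0 ltW.
have [W1 W2 W3] : [/\ M'.+1%:R^-1 * nrm xi <= W, K%:R^-1 * nrm zeta <= W & K%:R^-1 <= W] by exact: terms_le.
have W0 : 0 <= W by apply: le_trans W3.
apply: (@le_trans _ _ (a1 * (M'.+1%:R^-1 * nrm xi) + a2 * (K%:R^-1 * nrm zeta) + a3 * K%:R^-1)).
 rewrite [leRHS](_ : _ = 4 / k * (2 * l * (d / M'.+1%:R * nrm xi) + (l * (C / K%:R) * (2 * (nrm zeta + c)) + cm / K%:R))).
  apply: ler_wpM2l => //; apply: lerD; first by apply: ler_wpM2l => //; rewrite mulr_ge0.
  by rewrite lerD2r; apply: ler_wpM2l => //; rewrite mulr_ge0.
 by rewrite /a1 /a2 /a3; ring.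
rewrite !mulrDl mul1r; apply: ler_wpDr => //.
by apply: lerD; [apply: lerD|]; apply: ler_wpM2l.
Qed.

Theorem theorem1p9 (R : realType) (L : nat) (a : R) (dpsi : R -> R)
    (dpsi_C2 : Ck 2 dpsi)
    (dpsi_bounded : bounded_fun dpsi)
    (dpsi2_bounded : bounded_fun (derive1n 2 dpsi))
    (mean0 : \int[lebesgue_measure]_z (z * expR (- potential a dpsi z)) = 0) :
  exists (K0 : nat) (C : R), forall K M : nat, (K0 <= K)%N -> (1 <= M)%N ->
    (forall y : R -> R, spline L M y -> spline_fiber L M (N := (K * M)%N) y !=set0) ->
    forall zeta : R -> R, L2circle zeta ->
    exists2 g : R -> R,
      is_gradient L M (coarse_hamiltonian (potential a dpsi) L K M)
        (spline_proj L M zeta) g &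
      (L2norm (g \- macro_gradient (potential a dpsi) zeta)%R <=
        C%:E * ((K%:R^-1 + M%:R^-1)%:E * (L2norm zeta + H1norm zeta)
                + (K%:R^-1)%:E))%E.
Proof.
have solve_for (c d y i n : R) : c != 0 -> d != 0 -> y = c * (d * (n + ((y / c - i) / d - n)) + i).
 by move=> c0 d0; field; rewrite c0 d0.
have [B [B0 b0 b1 b2]] := Ck2_bounds dpsi_C2 dpsi_bounded dpsi2_bounded.
have [dg c2] := dpsi_C2.
have D0 (z : R) : is_derive z 1 dpsi (derive1 dpsi z).
 by apply: DeriveDef; [exact: (dg 0%N)|rewrite derive1E].
have D1 (z : R) : is_derive z 1 (derive1 dpsi) (derive1n 2 dpsi z).
 apply: DeriveDef; first by have := dg 1%N isT z; rewrite derive1n1.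
 by rewrite [RHS]derive1E -derive1n1.
pose V := Perturbation a D0 D1 c2 B0 b0 b1 b2.
have [K0 [C [K00 C0 H]]] := gradient_estimate V L.
exists K0, C => K [//|M'] KK _ surj zeta /L2circleP[_ sz].
have [g [gg sg est]] := H K M' KK surj zeta sz; exists g => //.
have KR : 0 < K%:R :> R by rewrite ltr0n (leq_trans K00).
have sp : sq2 (macro_gradient (potential a dpsi) zeta) by exact: (sq2_macro_gradient V).
rewrite (L2normE sz) (L2normE (sq2B sg sp)) -/(nrm _) -/(nrm _).
set x := nrm _; pose e : R := K%:R^-1 + M'.+1%:R^-1.
have e0 : 0 < e by rewrite addr_gt0 ?invr_gt0// ltr0n.
(* The right-hand side increases with [H1norm], so the claim is solved for it: [v] is a lower bound
   of the set whose infimum, possibly over the empty set, is [H1norm zeta]. The infinite case is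
   thereby covered without a case distinction. *)
have h : (((x / C - K%:R^-1) / e - nrm zeta)%:E <= H1norm zeta)%E.
 apply: le_ereal_inf_tmp => _ [xi wxi <-].
 rewrite (L2normE (sq2_weak wxi)) lee_fin -/(nrm xi) lerBlDl ler_pdivrMr// lerBlDr ler_pdivrMr//.
 by rewrite mulrC [_ * e]mulrC; exact: est.
set v := _ / e - _ in h.
have xE : x = C * (e * (nrm zeta + v) + K%:R^-1).
 exact: solve_for (lt0r_neq0 C0) (lt0r_neq0 e0).
rewrite {1}xE (_ : (_ * _)%:E = (C%:E * (e%:E * ((nrm zeta)%:E + v%:E) + (K%:R^-1)%:E))%E)//.
rewrite lee_pmul2l ?lte_fin//; apply: leeD => //.
by rewrite lee_pmul2l ?lte_fin//; exact: leeD.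
Qed.
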